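(* Let $N<0$, $\lambda_\sharp<\lambda_\flat$, let $\bullet\in\{\rightarrow,\leftarrow,\uparrow,\downarrow\}$, with contour realised by rays from an abscissa $\sigma_0\in(\lambda_\sharp,\lambda_\flat)$. Assume throughout that the enlarged parameter set (that of the right-hand side) still satisfies $\lambda_\sharp<\lambda_\flat$. Then: (i) (Euler transform; $\bullet=\leftarrow$.) If $\operatorname{Re}\beta>\sigma_0$ and $\operatorname{Re}\gamma>0$, then $$\int_0^1t^{\beta-1}(1-t)^{\gamma-1}K^{\leftarrow}\!\left(\begin{matrix}\mathbf a\\ \mathbf b\end{matrix}\middle|zt;\tau,\alpha\right)dt=\Gamma(\gamma)\tau^{-\gamma}K^{\leftarrow\;m+2,n}_{\;\;\;p+2,q+2}\!\left(\begin{matrix}\mathbf a,\ \beta,\ \beta+\gamma+\tau\\ \beta+\tau,\ \beta+\gamma,\ \mathbf b\end{matrix}\middle|z;\tau,\alpha\right),$$ the new $b$'s being numerator-type and the new $a$'s denominator-type. The mirror identity for $K^{\rightarrow}$, obtained from the inversion law $K^{\rightarrow}\big({\mathbf a\atop\mathbf b}\big|z\big)_{(m,n,p,q)}=K^{\leftarrow}\big({1+\tau-\mathbf b\atop1+\tau-\mathbf a}\big|z^{-1}\big)_{(n,m,q,p)}$, also holds: if, for the reflected data (orders $(n,m,q,p)$, parameters $1+\tau-\mathbf b$, $1+\tau-\mathbf a$, for which the quantities playing the roles of $\lambda_\sharp$ and $\lambda_\flat$ are $-\lambda_\flat$ and $-\lambda_\sharp$), there is an abscissa $\sigma_0'\in(-\lambda_\flat,-\lambda_\sharp)$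 with $\operatorname{Re}\beta>\sigma_0'$, if $\operatorname{Re}\gamma>0$, and if the enlarged parameter set on the right-hand side of the following identity satisfies the inequality $\lambda_\sharp<\lambda_\flat$ computed for that set, then $$\int_0^1t^{\beta-1}(1-t)^{\gamma-1}K^{\rightarrow}\!\left(\begin{matrix}\mathbf a\\ \mathbf b\end{matrix}\middle|\frac zt;\tau,\alpha\right)dt=\Gamma(\gamma)\tau^{-\gamma}K^{\leftarrow\;n+2,m}_{\;\;\;q+2,p+2}\!\left(\begin{matrix}1+\tau-\mathbf b,\ \beta,\ \beta+\gamma+\tau\\ \beta+\tau,\ \beta+\gamma,\ 1+\tau-\mathbf a\end{matrix}\middle|z^{-1};\tau,\alpha\right).$$ (ii) (Erdélyi–Kober; $\bullet=\leftarrow$.) If $\operatorname{Re}(\gamma+1)>\sigma_0$ and $\operatorname{Re}\delta>0$, then, with $I^{\gamma,\delta}_1f(z)=\frac{1}{\Gamma(\delta)}\int_0^1(1-\sigma)^{\delta-1}\sigma^{\gamma}f(z\sigma)\,d\sigma$, $$I^{\gamma,\delta}_1K^{\leftarrow}(z)=\tau^{-\delta}K^{\leftarrow\;m+2,n}_{\;\;\;p+2,q+2}\!\left(\begin{matrix}\mathbf a,\ \gamma+1,\ \gamma+\delta+1+\tau\\ \gamma+1+\tau,\ \gamma+\delta+1,\ \mathbf b\end{matrix}\middle|z\right).$$ The Riemann–Liouville integral is $I^{\delta}_{0+}=z^{\delta}I^{0,\delta}_1$, so the family is closed under it by this formula (with $\gamma=0$) together with the shift law $K^{\bullet}\big({c+\mathbf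 a\atop c+\mathbf b}\big|z\big)=e^{\pi\alpha c^2/\tau}z^{-c}K^{\bullet}\big({\mathbf a\atop\mathbf b}\big|e^{-2\pi\alpha c/\tau}z\big)$. (iii) (Differentiation; all four classes.) For every integer $k\ge1$, $$\frac{d^k}{dz^k}K^{\bullet}\!\left(\begin{matrix}\mathbf a\\ \mathbf b\end{matrix}\middle|z\right)=\frac{(-\tau)^k}{z^k}K^{\bullet\;m,n+2}_{\;\;\;p+2,q+2}\!\left(\begin{matrix}1+\tau,\ 1-k,\ \mathbf a\\ \mathbf b,\ 1+\tau-k,\ 1\end{matrix}\middle|z\right),$$ the new $a$'s being numerator-type and the new $b$'s denominator-type. For $k=1$ this reads $\frac{d}{dz}K^{\bullet}\big({\mathbf a\atop\mathbf b}\big|z\big)=-\frac{\tau}{z}K^{\bullet\;m,n+2}_{\;\;\;p+2,q+2}\big({0,\,1+\tau,\,\mathbf a\atop\mathbf b,\,\tau,\,1}\big|z\big)$. (iv) (Laplace transform and Mellin convolution, kernel level only.) The Laplace multiplier $\Gamma(s)$ combined with the reflection $s\mapsto1-s$, and the Mellin-convolution multiplier (a second kernel $\phi_2$ with the same $\tau$), keep one inside the family of kernels, up to a factor $C\lambda^{-s}$: in the Laplace case, if the reflected kernel $\phi(1-s)$ has order $(m_*,n_*,p_*,q_* )$, then $\Gamma(s)\phi(1-s)$ has order $(m_*,n_*+1,p_*+1,q_*+1)$; in the convolution case $\phi_1\phi_2$ has order $(m_1+m_2,n_1+n_2,p_1+p_2,q_1+q_2)$ and $\alpha=\alpha_1+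\alpha_2$.
   Context: For $\tau>0$, $G(z;\tau)$ is the Barnes double gamma function: the entire function $G(z;\tau)=\frac{z}{\tau}e^{c_1 z/\tau+c_2 z^2/(2\tau^2)}\prod_{(k,l)\in\mathbb{Z}_{\ge0}^2\setminus\{(0,0)\}}\big(1+\frac{z}{k\tau+l}\big)e^{-\frac{z}{k\tau+l}+\frac{z^2}{2(k\tau+l)^2}}$, with real constants $c_1,c_2$ (depending on $\tau$) uniquely determined by $G(z+1;\tau)=\Gamma(z/\tau)G(z;\tau)$ and $G(z+\tau;\tau)=(2\pi)^{(\tau-1)/2}\tau^{1/2-z}\Gamma(z)G(z;\tau)$. Let $\tau>0$, $0\le m\le q$, $0\le n\le p$ integers, $\mathbf a\in\mathbb{C}^p$, $\mathbf b\in\mathbb{C}^q$, $\alpha\in\mathbb{C}$. The kernel of order $(m,n,p,q)$ is $$\phi(s)=\frac{\prod_{j=1}^{m}G(b_j-s;\tau)\prod_{j=1}^{n}G(1+\tau-a_j+s;\tau)}{\prod_{j=m+1}^{q}G(1+\tau-b_j+s;\tau)\prod_{j=n+1}^{p}G(a_j-s;\tau)}\,e^{\pi\alpha s^2/\tau},\quad N=2(m+n)-p-q.$$ Numerator-type parameters are $a_1,\dots,a_n$, $b_1,\dots,b_m$; the others are denominator-type. $\Lambda^+=\{a_j+l\tau+k: n<j\le p,\ l,k\in\mathbb{Z}_{\ge0}\}$, $\Lambda^-=\{b_j-l\tau-k: m<j\le q,\ l,k\in\mathbb{Z}_{\ge1}\}$, $\lambda_\sharp=\max_{m<j\le q}\operatorname{Re}b_j-\tau-1$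 ($-\infty$ if $m=q$), $\lambda_\flat=\min_{n<j\le p}\operatorname{Re}a_j$ ($+\infty$ if $n=p$). $z$ is on the Riemann surface of the logarithm, $z^{-s}=e^{-s\log z}$, $\log(zt)=\log z+\ln t$ for $t>0$, $\log(z^{-1})=-\log z$. $L_{\theta^-,\theta^+}$ denotes a simple, piecewise smooth, proper curve in $\mathbb{C}\setminus(\Lambda^+\cup\Lambda^-)$ that outside some disc coincides with two straight rays of angles $\theta^-\in(-\pi,0)$, $\theta^+\in(0,\pi)$, is traversed from the $\theta^-$ end to the $\theta^+$ end, and has $\Lambda^+$ in the component of its complement containing the large positive reals and $\Lambda^-$ in the other. For $\varepsilon\in(0,\pi/4)$, $K^{\bullet}=K^{\bullet\,m,n}_{\;\,p,q}\big({\mathbf a\atop\mathbf b}\big|z;\tau,\alpha\big)$ is $\frac{1}{2\pi i}\int_\gamma\phi(s)z^{-s}ds$ with $\gamma=L_{-\varepsilon,\varepsilon}$ ($\rightarrow$), $L_{-\pi+\varepsilon,\pi-\varepsilon}$ ($\leftarrow$), $L_{-\varepsilon,\pi-\varepsilon}$ ($\uparrow$), $L_{-\pi+\varepsilon,\varepsilon}$ ($\downarrow$); for $N<0$ these converge absolutely and are independent of the choices. Realisation with abscissa $\sigma_0$: $\gamma$ consists of two straight rays issuing from $\sigma_0$ at the two indicated angles (so for $\leftarrow$ one has $\operatorname{Re}s\le\sigma_0$ on $\gamma$). *)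

(* Defs.v *)
From Stdlib Require Import Reals List ZArith.
From Coquelicot Require Import Coquelicot.
Import ListNotations.
Open Scope R_scope.
Open Scope C_scope.

Definition Cexp (z : C) : C := RtoC (exp (Re z)) * (cos (Im z), sin (Im z)).

(* x^c for a positive real base x, principal value. *)
Definition Rcpow (x : R) (c : C) : C := Cexp (c * RtoC (ln x)).

Definition Cprod (l : list C) : C := fold_right Cmult (RtoC 1) l.

Definition Clim_seq (u : nat -> C) : C :=
  (real (Lim_seq (fun n => Re (u n))), real (Lim_seq (fun n => Im (u n)))).

(* Euler-Gauss limit; the value at the poles 0, -1, -2, ... is meaningless. *)
Definition CGamma (z : C) : C :=
  Clim_seq (fun n =>
    RtoC (INR (fact n)) * Rcpow (INR n) z
      / Cprod (map (fun k => z + RtoC (INR k)) (seq 0 (S n)))).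

Definition not_Gamma_pole (z : C) : Prop :=
  forall k : nat, z <> RtoC (- INR k).

Definition barnes_factor (tau : R) (z : C) (kl : nat * nat) : C :=
  match kl with
  | (O, O) => RtoC 1
  | (k, l) =>
      let om := RtoC (INR k * tau + INR l) in
      (RtoC 1 + z / om) * Cexp (- (z / om) + z ^ 2 / (RtoC 2 * om ^ 2))
  end.

(* The double product converges absolutely, so its value is the limit along
   the squares 0 <= k, l <= n. *)
Definition barnes_partial (tau c1 c2 : R) (z : C) (n : nat) : C :=
  z / RtoC tau
    * Cexp (RtoC c1 * z / RtoC tau + RtoC c2 * z ^ 2 / RtoC (2 * tau ^ 2))
    * Cprod (map (barnes_factor tau z) (list_prod (seq 0 (S n)) (seq 0 (S n)))).

(* G is G(. ; tau): the functional equations pin down the constants c1, c2.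
   They are identities of entire functions once the poles of Gamma are
   cancelled by the zeros of G, hence are required off these poles. *)
Definition is_barnes_G (tau : R) (G : C -> C) : Prop :=
  exists c1 c2 : R,
    (forall z : C,
       filterlim (barnes_partial tau c1 c2 z) eventually (locally (G z)))
    /\ (forall z : C, not_Gamma_pole (z / RtoC tau) ->
          G (z + RtoC 1) = CGamma (z / RtoC tau) * G z)
    /\ (forall z : C, not_Gamma_pole z ->
          G (z + RtoC tau)
          = RtoC (Rpower (2 * PI) ((tau - 1) / 2))
            * Rcpow tau (RtoC (1 / 2) - z) * CGamma z * G z).

(* Parameters a in C^p and b in C^q are lists, p = length a, q = length b;
   the first n entries of a and the first m entries of b are numerator-type. *)
Definition kernel (G : C -> C) (tau : R) (m n : nat) (a b : list C) (alpha s : C)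
  : C :=
  Cprod (map (fun bj => G (bj - s)) (firstn m b))
  * Cprod (map (fun aj => G (RtoC (1 + tau) - aj + s)) (firstn n a))
  / (Cprod (map (fun bj => G (RtoC (1 + tau) - bj + s)) (skipn m b))
     * Cprod (map (fun aj => G (aj - s)) (skipn n a)))
  * Cexp (RtoC PI * alpha * s ^ 2 / RtoC tau).

Definition order_N (m n p q : nat) : Z :=
  (2 * (Z.of_nat m + Z.of_nat n) - Z.of_nat p - Z.of_nat q)%Z.

Definition Lambda_plus (tau : R) (n : nat) (a : list C) (s : C) : Prop :=
  exists (aj : C) (l k : nat), In aj (skipn n a) /\
    s = aj + RtoC (INR l * tau + INR k).

Definition Lambda_minus (tau : R) (m : nat) (b : list C) (s : C) : Prop :=
  exists (bj : C) (l k : nat), In bj (skipn m b) /\ (1 <= l)%nat /\ (1 <= k)%nat /\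
    s = bj - RtoC (INR l * tau + INR k).

Definition Rbar_max (x y : Rbar) : Rbar := if Rbar_le_dec x y then y else x.

Definition lambda_sharp (tau : R) (m : nat) (b : list C) : Rbar :=
  fold_right Rbar_max m_infty
    (map (fun bj => Finite (Re bj - tau - 1)%R) (skipn m b)).

Definition lambda_flat (n : nat) (a : list C) : Rbar :=
  fold_right Rbar_min p_infty (map (fun aj => Finite (Re aj)) (skipn n a)).

(* gamma'(t); only meaningful where gamma is differentiable. *)
Definition velocity (gamma : R -> C) (t : R) : C :=
  (Derive (fun u => Re (gamma u)) t, Derive (fun u => Im (gamma u)) t).

Definition piecewise_smooth (gamma : R -> C) : Prop :=
  (forall t : R, continuous gamma t) /\
  exists corners : list R,
    (forall t : R, ~ In t corners ->
       ex_derive (fun u => Re (gamma u)) t /\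
       ex_derive (fun u => Im (gamma u)) t /\
       continuous (velocity gamma) t /\ velocity gamma t <> RtoC 0) /\
    (forall t : R, In t corners ->
       exists vl vr : C, vl <> RtoC 0 /\ vr <> RtoC 0 /\
         filterlim (velocity gamma) (at_left t) (locally vl) /\
         filterlim (velocity gamma) (at_right t) (locally vr)).

(* s and s' lie in the same component of the complement of the curve (which is
   open, so that components are path components). *)
Definition same_side (gamma : R -> C) (s s' : C) : Prop :=
  exists path : R -> C,
    (forall u : R, continuous path u) /\ path 0%R = s /\ path 1%R = s' /\
    (forall u t : R, (0 <= u <= 1)%R -> path u <> gamma t).

(* The curves L_{theta-, theta+} separating Lp (= Lambda^+) from
   Lm (= Lambda^-).  The two ends are parametrised by arc length; properness
   follows.  By the Jordan curve theorem the complement has two components,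
   distinguished by their containing the large positive, resp. the large
   negative, reals. *)
Record is_contour (theta_m theta_p : R) (Lp Lm : C -> Prop) (gamma : R -> C)
  : Prop := {
  contour_simple : forall t t' : R, gamma t = gamma t' -> t = t';
  contour_smooth : piecewise_smooth gamma;
  contour_ends : exists (T : R) (sm sp : C),
    (forall t : R, (t <= - T)%R ->
       gamma t = sm + RtoC (- t) * Cexp (Ci * RtoC theta_m)) /\
    (forall t : R, (T <= t)%R ->
       gamma t = sp + RtoC t * Cexp (Ci * RtoC theta_p));
  contour_avoids : forall t : R, ~ Lp (gamma t) /\ ~ Lm (gamma t);
  contour_right : forall s : C, Lp s ->
    exists M : R, forall x : R, (M <= x)%R -> same_side gamma s (RtoC x);
  contour_left : forall s : C, Lm s ->
    exists M : R, forall x : R, (M <= x)%R -> same_side gamma s (RtoC (- x))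
}.

Definition is_contour_integral (f : C -> C) (gamma : R -> C) (v : C) : Prop :=
  is_RInt_gen (V := C_R_NormedModule)
    (fun t => f (gamma t) * velocity gamma t)
    (Rbar_locally m_infty) (Rbar_locally p_infty) v.

Inductive contour_class : Set := K_right | K_left | K_up | K_down.

Definition theta_minus (cls : contour_class) (eps : R) : R :=
  match cls with
  | K_right | K_up => (- eps)%R
  | K_left | K_down => (- PI + eps)%R
  end.

Definition theta_plus (cls : contour_class) (eps : R) : R :=
  match cls with
  | K_right | K_down => eps
  | K_left | K_up => (PI - eps)%R
  end.

(* The argument w stands for log z: a point z of the Riemann surface of the
   logarithm is identified with log z in C, so z^{-s} = exp (- s w), zt is
   w + ln t and z^{-1} is - w. *)
Definition is_K_value (G : C -> C) (tau : R) (cls : contour_class) (m n : nat)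
    (a b : list C) (alpha w v : C) : Prop :=
  forall (eps : R) (gamma : R -> C), (0 < eps < PI / 4)%R ->
    is_contour (theta_minus cls eps) (theta_plus cls eps)
      (Lambda_plus tau n a) (Lambda_minus tau m b) gamma ->
    is_contour_integral
      (fun s => kernel G tau m n a b alpha s * Cexp (- s * w)
                  / (RtoC (2 * PI) * Ci))
      gamma v.

(* The common value of the integral over all admissible contours. *)
Definition K (G : C -> C) (tau : R) (cls : contour_class) (m n : nat)
    (a b : list C) (alpha w : C) : C :=
  @iota C_R_CompleteNormedModule (is_K_value G tau cls m n a b alpha w).

(* int_0^1 t^(be-1) (1-t)^(ga-1) g(t) dt = v *)
Definition is_beta_integral (be ga : C) (g : R -> C) (v : C) : Prop :=
  is_RInt_gen (V := C_R_NormedModule)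
    (fun t => Rcpow t (be - RtoC 1) * Rcpow (1 - t) (ga - RtoC 1) * g t)
    (at_right 0) (at_left 1) v.

(* I_1^{ga,de} f (z) = v, where w = log z *)
Definition is_Erdelyi_Kober (ga de : C) (f : C -> C) (w v : C) : Prop :=
  exists I : C,
    is_RInt_gen (V := C_R_NormedModule)
      (fun t => Rcpow (1 - t) (de - RtoC 1) * Rcpow t ga * f (w + RtoC (ln t)))
      (at_right 0) (at_left 1) I
    /\ v = RtoC 1 / CGamma de * I.

(* I_{0+}^{de} f (z) = (1/Gamma(de)) int_0^z (z-u)^(de-1) f(u) du along the
   segment u = r e^{i theta}, 0 < r < |z|, where log z = ln |z| + i theta. *)
Definition is_Riemann_Liouville (de : C) (f : C -> C) (w v : C) : Prop :=
  let theta := Im w in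
  let rz := exp (Re w) in
  exists I : C,
    is_RInt_gen (V := C_R_NormedModule)
      (fun r => Cexp ((de - RtoC 1) * (ln (rz - r), theta)) * f (ln r, theta)
                  * Cexp (Ci * RtoC theta))
      (at_right 0) (at_left rz) I
    /\ v = RtoC 1 / CGamma de * I.

(* d/dz of f at the point with log z = w, in the local coordinate z = e^w. *)
Definition is_ddz (f : C -> C) (w l : C) : Prop :=
  filterlim (fun w' : C => (f w' - f w) / (Cexp w' - Cexp w))
    (locally' w) (locally l).

Fixpoint is_ddz_n (k : nat) (f g : C -> C) : Prop :=
  match k with
  | O => forall w, f w = g w
  | S k' => exists h : C -> C, is_ddz_n k' f h /\ forall w, is_ddz h w (g w)
  end.

(* psi = C lambda^{-s} phi as meromorphic functions, for some C <> 0, some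
   lambda (with logarithm loglam) and some kernel phi of order (m,n,p,q) with
   coefficient alpha. *)
Definition has_kernel_order (G : C -> C) (tau : R) (psi : C -> C)
    (m n p q : nat) (alpha : C) : Prop :=
  (m <= q)%nat /\ (n <= p)%nat /\
  exists (a b : list C) (C0 loglam : C),
    length a = p /\ length b = q /\ C0 <> RtoC 0 /\
    forall s0 : C, locally' s0 (fun s : C =>
      psi s = C0 * Cexp (- s * loglam) * kernel G tau m n a b alpha s).

(* Main.v *)
Require Import Defs.
From Stdlib Require Import Reals List ZArith Lra Lia Psatz Permutation Classical ClassicalEpsilon.
From Coquelicot Require Import Coquelicot.
Import ListNotations.
Open Scope C_scope.
Open Scope R_scope.

(* Each factor [G] contributes [Re (s^2) ln |s| / (2 tau)] to the logarithm of
   the modulus of the kernel, with signs adding up to [N]; so for [N < 0] the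
   kernel decays faster than every Gaussian along rays making an angle less
   than [PI / 4] with the real axis. Two contours of the same class can
   therefore be closed up far away. The poles lie in a horizontal strip, and on
   a bounded set the kernel is a holomorphic function over a product of linear
   factors: by partial fractions, its integral over the closed chain vanishes
   as soon as the chain does not wind around the poles. Hence [K] can be
   computed on a standard contour, a vertical segment prolonged by two rays.

   On that contour, all identities reduce to identities of integrands. By the
   functional equations of [G], the four new factors of the Euler transform
   collapse to [Gamma (be - s) / Gamma (be + ga - s)], and Euler's beta integral
   shows that this is the multiplier of the transform; the exchange of integrals
   is done on [[a, b]] inside [(0, 1)], followed by a uniform limit. For the
   derivatives they collapse to the polynomial [s (s + 1) ... (s + k - 1)]. The
   inversion law is the substitution [s -> - s], and the shift law translates
   the contour by [c]. *)

(* Contours are arbitrary curves, and a pole is tied to its side only by a path that avoids the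
   curve. Its winding number is therefore found by moving it along that path: over a long piece of
   curve the increment of [arg (z - p)] changes by less than [PI / 2]. A closed chain has four
   pieces, two curves and two segments, so the total change is less than [2 PI], and integrality
   makes it 0. Partial fractions reduce Cauchy's theorem to the functions [1 / (z - p)] treated in
   this way.

   For the growth of [G], the product is cut at an index proportional to [Cmod z]. The tail costs
   [O (Cmod z ^ 2)], and the head contributes [Re (z * z) / 2] times the sum of [1 / (k tau + l)^2]
   up to the cutoff. That sum is left as it stands: it is the same for every factor of the kernel,
   and its logarithmic divergence absorbs all quadratic errors.

   Integrals over the contour are read as a linear functional of a multiplier, with one bound for
   all multipliers of a given exponential growth; differentiation, exchange of integrals and limits
   all go through that bound. *)
Tactic Notation "le_via" uconstr(H) := eapply Rle_trans; [ apply H | ].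
Tactic Notation "lt_via" uconstr(H) := eapply Rle_lt_trans; [ apply H | ].

Ltac pos := intros; match goal with
  | |- _ /\ _ => split; pos
  | |- _ => lra
  | |- 0 <= Cmod _ => apply Cmod_ge_0
  | |- 0 <= Rabs _ => apply Rabs_pos
  | |- 0 <= INR _ => apply pos_INR
  | |- 0 <= _ * _ => apply Rmult_le_pos; pos
  | |- 0 <= _ / _ => apply Rmult_le_pos; pos
  | |- 0 <= _ ^ _ => apply pow_le; pos
  | |- 0 <= _ => left; pos
  | |- 0 < exp _ => apply exp_pos
  | |- 0 < Rpower _ _ => apply exp_pos
  | |- 0 < _ / _ => apply Rdiv_lt_0_compat; pos
  | |- 0 < / _ => apply Rinv_0_lt_compat; pos
  | |- 0 < _ * _ => apply Rmult_lt_0_compat; pos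
  | |- 0 < _ ^ _ => apply pow_lt; pos
  | |- 0 < Rmin _ _ => apply Rmin_pos; pos
  | |- 0 < ?x => is_var x; unfold x; pos
  | |- _ => nra
  end.

(** * Complex arithmetic and the exponential *)

Lemma C_ext (z w : C) : Re z = Re w -> Im z = Im w -> z = w.
Proof. destruct z, w; simpl; intros; subst; reflexivity. Qed.

Lemma Re_plus (z w : C) : Re (z + w) = Re z + Re w.
Proof. reflexivity. Qed.
Lemma Im_plus (z w : C) : Im (z + w) = Im z + Im w.
Proof. reflexivity. Qed.
Lemma Re_opp (z : C) : Re (- z) = - Re z.
Proof. reflexivity. Qed.
Lemma Im_opp (z : C) : Im (- z) = - Im z.
Proof. reflexivity. Qed.
Lemma Re_minus (z w : C) : Re (z - w) = Re z - Re w.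
Proof. reflexivity. Qed.
Lemma Im_minus (z w : C) : Im (z - w) = Im z - Im w.
Proof. reflexivity. Qed.
Lemma Re_mult (z w : C) : Re (z * w) = Re z * Re w - Im z * Im w.
Proof. reflexivity. Qed.
Lemma Im_mult (z w : C) : Im (z * w) = Re z * Im w + Im z * Re w.
Proof. reflexivity. Qed.
Lemma Re_RtoC (x : R) : Re (RtoC x) = x.
Proof. reflexivity. Qed.
Lemma Im_RtoC (x : R) : Im (RtoC x) = 0.
Proof. reflexivity. Qed.
Lemma Re_pair (x y : R) : Re (x, y) = x.
Proof. reflexivity. Qed.
Lemma Im_pair (x y : R) : Im (x, y) = y.
Proof. reflexivity. Qed.
Lemma Re_Ci : Re Ci = 0.
Proof. reflexivity. Qed.
Lemma Im_Ci : Im Ci = 1.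
Proof. reflexivity. Qed.

#[global] Hint Rewrite Re_plus Im_plus Re_opp Im_opp Re_minus Im_minus Re_mult Im_mult
  Re_RtoC Im_RtoC Re_pair Im_pair Re_Ci Im_Ci : ReIm.

Ltac C_eq := apply C_ext; autorewrite with ReIm.

Lemma Im_le_Cmod (z : C) : Rabs (Im z) <= Cmod z.
Proof.
  le_via (Rmax_r (Rabs (fst z))); apply Rmax_Cmod.
Qed.

Lemma Re_le_Cmod (z : C) : Rabs (Re z) <= Cmod z.
Proof. apply re_le_Cmod. Qed.

Lemma Cmod_le_Re_Im (z : C) : Cmod z <= Rabs (Re z) + Rabs (Im z).
Proof.
  replace z with (RtoC (Re z) + Ci * RtoC (Im z))%C at 1 by (C_eq; ring). le_via Cmod_triangle.
  rewrite Cmod_mult, Cmod_Ci, !Cmod_R; lra.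
Qed.

Lemma Cmod_sqr (z : C) : Cmod z * Cmod z = Re z * Re z + Im z * Im z.
Proof. generalize (Cmod2_alt z); simpl; lra. Qed.

Lemma Cmod_minus_sym (z w : C) : Cmod (z - w) = Cmod (w - z).
Proof. rewrite <- (Cmod_opp (z - w)); f_equal; ring. Qed.

Lemma Cmod_triangle_minus (z w : C) : Cmod (z - w) <= Cmod z + Cmod w.
Proof.
  unfold Cminus; le_via Cmod_triangle; rewrite Cmod_opp; lra.
Qed.

Lemma Cmod_minus_ge (z w : C) : Cmod z - Cmod w <= Cmod (z - w).
Proof.
  generalize (Cmod_triangle (z - w) w); replace (z - w + w)%C with z by ring; lra.
Qed.

Lemma Cmod_dist_triangle (x y z : C) : Cmod (x - z) <= Cmod (x - y) + Cmod (y - z).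
Proof.
  replace (x - z)%C with ((x - y) + (y - z))%C by ring; apply Cmod_triangle.
Qed.

Lemma Cmod_eq_0_iff (z : C) : Cmod z = 0 <-> z = 0%C.
Proof. split; [ apply Cmod_eq_0 | intros ->; apply Cmod_0 ]. Qed.

Lemma Cmod_lt_eq (v w : C) : (forall eps, 0 < eps -> Cmod (v - w) < eps) -> v = w.
Proof.
  intros H; assert (E : (v - w)%C = 0%C).
  { apply Cmod_eq_0_iff, Rle_antisym; [ apply le_epsilon; intros e He; generalize (H e He); lra | apply Cmod_ge_0 ]. }
  replace v with (v - w + w)%C by ring; rewrite E; ring.
Qed.

(** Both components have numerator 0. This makes [Cinv_mult] unconditional, so that quotients of
    products of [G] can be rearranged even where a denominator vanishes. *)
Lemma Cinv_zero : (/ 0)%C = 0%C.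
Proof. unfold Cinv; simpl; apply C_ext; simpl; unfold Rdiv; ring. Qed.

Lemma Cinv_mult (z w : C) : (/ (z * w))%C = (/ z * / w)%C.
Proof.
  destruct (Ceq_dec z 0) as [->|Hz].
  - rewrite Cmult_0_l, Cinv_zero; ring.
  - destruct (Ceq_dec w 0) as [->|Hw].
    + rewrite Cmult_0_r, Cinv_zero; ring.
    + field; split; auto.
Qed.

Lemma Cexp_plus (z w : C) : Cexp (z + w) = (Cexp z * Cexp w)%C.
Proof.
  unfold Cexp; C_eq; rewrite exp_plus, cos_plus, sin_plus; ring.
Qed.

Lemma Cexp_R (x : R) : Cexp (RtoC x) = RtoC (exp x).
Proof. unfold Cexp; C_eq; rewrite cos_0, sin_0; ring. Qed.

Lemma Cexp_0 : Cexp 0 = 1%C.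
Proof. rewrite Cexp_R, exp_0; reflexivity. Qed.

Lemma Cmod_Cexp (z : C) : Cmod (Cexp z) = exp (Re z).
Proof.
  unfold Cexp; rewrite Cmod_mult, Cmod_R, Rabs_pos_eq by pos. unfold Cmod; simpl fst; simpl snd.
  replace (cos (Im z) ^ 2 + sin (Im z) ^ 2) with 1.
  - rewrite sqrt_1; ring.
  - generalize (sin2_cos2 (Im z)); unfold Rsqr; simpl; lra.
Qed.

Lemma Cexp_neq_0 (z : C) : Cexp z <> 0%C.
Proof.
  intros H; apply Cmod_eq_0_iff in H; rewrite Cmod_Cexp in H. generalize (exp_pos (Re z)); lra.
Qed.

Lemma Cexp_opp (z : C) : Cexp (- z) = (/ Cexp z)%C.
Proof.
  assert (E : (Cexp (- z) * Cexp z)%C = 1%C) by (rewrite <- Cexp_plus, <- Cexp_0; f_equal; ring).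
  rewrite <- (Cmult_1_l (/ Cexp z)), <- E; field; apply Cexp_neq_0.
Qed.

Lemma Cexp_minus (z w : C) : Cexp (z - w) = (Cexp z / Cexp w)%C.
Proof. unfold Cminus; rewrite Cexp_plus, Cexp_opp; reflexivity. Qed.

Lemma Cexp_pow (z : C) (n : nat) : Cexp (RtoC (INR n) * z) = (Cexp z ^ n)%C.
Proof.
  induction n as [|n IH].
  - simpl; rewrite <- Cexp_0; f_equal; ring.
  - rewrite S_INR; simpl Cpow; rewrite <- IH, <- Cexp_plus; f_equal. rewrite RtoC_plus; ring.
Qed.

(** * Derivatives *)

(** Componentwise, so that real derivatives and the [velocity] of a contour apply directly; [dR_eps]
    gives the form used in estimates. *)
Definition dR (F : R -> C) (t : R) (v : C) : Prop :=
  is_derive (fun u => Re (F u)) t (Re v) /\ is_derive (fun u => Im (F u)) t (Im v).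

Lemma is_derive_eps (f : R -> R) (t l : R) :
  is_derive f t l <->
  forall eps, 0 < eps -> exists d, 0 < d /\ forall u, Rabs (u - t) < d ->
    Rabs (f u - f t - (u - t) * l) <= eps * Rabs (u - t).
Proof.
  split.
  - intros [_ H] eps He; destruct (H t (fun P HP => HP) (mkposreal eps He)) as [d K].
    exists d; split; [ apply cond_pos | exact K ].
  - intros H; split; [ apply (is_linear_scal_l (K := R_AbsRing) (V := R_NormedModule)) | ].
    intros x Hx eps; rewrite <- (is_filter_lim_locally_unique (K := R_AbsRing) (V := R_NormedModule) t x Hx).
    destruct (H eps (cond_pos eps)) as [d [Hd K]]; exists (mkposreal d Hd); exact K.
Qed.

Lemma dR_eps (F : R -> C) (t : R) (v : C) :
  dR F t v <->
  forall eps, 0 < eps -> exists d, 0 < d /\ forall u, Rabs (u - t) < d ->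
    Cmod (F u - F t - v * (RtoC u - RtoC t)) <= eps * Cmod (RtoC u - RtoC t).
Proof.
  assert (E1 : forall u, Re (F u - F t - v * (RtoC u - RtoC t)) = Re (F u) - Re (F t) - (u - t) * Re v)
    by (intros; autorewrite with ReIm; ring).
  assert (E2 : forall u, Im (F u - F t - v * (RtoC u - RtoC t)) = Im (F u) - Im (F t) - (u - t) * Im v)
    by (intros; autorewrite with ReIm; ring).
  unfold dR; rewrite !is_derive_eps; split.
  - intros [H1 H2] eps He. destruct (H1 (eps / 2)) as [d1 [Hd1 H1']]; [ lra | ].
    destruct (H2 (eps / 2)) as [d2 [Hd2 H2']]; [ lra | ]. exists (Rmin d1 d2); split; [ pos | intros u Hu ].
    specialize (H1' u (Rlt_le_trans _ _ _ Hu (Rmin_l _ _))).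
    specialize (H2' u (Rlt_le_trans _ _ _ Hu (Rmin_r _ _))).
    le_via Cmod_le_Re_Im; rewrite E1, E2, <- RtoC_minus, Cmod_R; lra.
  - intros H; split; intros eps He; destruct (H eps He) as [d [Hd H']];
      exists d; (split; [ auto | intros u Hu; specialize (H' u Hu); rewrite <- (RtoC_minus u t), Cmod_R in H' ]).
    + rewrite <- E1, RtoC_minus in *; le_via Re_le_Cmod; exact H'.
    + rewrite <- E2, RtoC_minus in *; le_via Im_le_Cmod; exact H'.
Qed.

(* Reduction to the real mean value inequality by projecting on the direction
   of [F b - F a]. *)
Lemma mean_value_ineq (F F' : R -> C) (a b M : R) :
  a <= b -> (forall t, a <= t <= b -> dR F t (F' t)) ->
  (forall t, a <= t <= b -> Cmod (F' t) <= M) ->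
  Cmod (F b - F a) <= M * (b - a).
Proof.
  intros Hab HF HM. set (d := (F b - F a)%C). set (p := fun z : C => Re d * Re z + Im d * Im z).
  assert (Hp : forall z, p z <= Cmod d * Cmod z). { intros z; unfold p.
    replace (Re d * Re z + Im d * Im z) with (Re (Cconj d * z)) by (destruct d, z; simpl; ring).
    rewrite <- (Cmod_conj d), <- Cmod_mult. le_via Rle_abs; apply Re_le_Cmod. }
  assert (Hd : p d = Cmod d * Cmod d) by (unfold p; rewrite Cmod_sqr; ring).
  assert (Hdp : 0 <= Cmod d) by apply Cmod_ge_0. destruct (Req_dec (Cmod d) 0) as [H0|H0].
  { rewrite H0. apply Rmult_le_pos; [ | lra ]. le_via Cmod_ge_0; apply (HM a); lra. }
  assert (HpF : forall t, a <= t <= b -> is_derive (fun t => p (F t)) t (p (F' t))).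
  { intros t Ht; destruct (HF t Ht) as [H1 H2]; unfold p.
    apply (is_derive_plus (fun t => Re d * Re (F t)) (fun t => Im d * Im (F t)));
      apply is_derive_scal; auto. }
  destruct (MVT_gen (fun t => p (F t)) a b (fun t => p (F' t))) as [c [Hc Hc']].
  - intros t Ht; rewrite Rmin_left, Rmax_right in Ht by lra; apply HpF; lra.
  - intros t Ht; rewrite Rmin_left, Rmax_right in Ht by lra. apply continuity_pt_filterlim.
    apply (ex_derive_continuous (fun t => p (F t))); eexists; apply HpF; lra.
  - rewrite Rmin_left, Rmax_right in Hc by lra.
    assert (E : p (F b) - p (F a) = p d) by (unfold p, d; autorewrite with ReIm; ring). rewrite E, Hd in Hc'.
    apply (Rmult_le_reg_l (Cmod d)); [ lra | ]. rewrite Hc'.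
    apply Rle_trans with (Cmod d * Cmod (F' c) * (b - a)).
    + apply Rmult_le_compat_r; [ lra | apply Hp ].
    + rewrite Rmult_assoc; apply Rmult_le_compat_l; [ auto | ].
      apply Rmult_le_compat_r; [ lra | apply HM; auto ].
Qed.

Lemma dR_Cexp_scal (h : C) (t : R) :
  dR (fun u => Cexp (RtoC u * h)) t (h * Cexp (RtoC t * h))%C.
Proof.
  assert (E1 : forall u, Re (RtoC u * h) = u * Re h) by (intros; autorewrite with ReIm; ring).
  assert (E2 : forall u, Im (RtoC u * h) = u * Im h) by (intros; autorewrite with ReIm; ring).
  split; unfold Cexp.
  - apply (is_derive_ext (fun u => exp (u * Re h) * cos (u * Im h))).
    { intros u; rewrite E1, E2; simpl; ring. }
    auto_derive; [ trivial | rewrite Re_mult, E1, E2 || rewrite Im_mult, E1, E2; simpl; unfold Re, Im; ring ].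
  - apply (is_derive_ext (fun u => exp (u * Re h) * sin (u * Im h))).
    { intros u; rewrite E1, E2; simpl; ring. }
    auto_derive; [ trivial | rewrite Re_mult, E1, E2 || rewrite Im_mult, E1, E2; simpl; unfold Re, Im; ring ].
Qed.

Lemma exp_le_compat (x y : R) : x <= y -> exp x <= exp y.
Proof. intros [H| ->]; [ left; apply exp_increasing; auto | right; reflexivity ]. Qed.

Lemma Re_scal_le (h : C) (t : R) : 0 <= t <= 1 -> Re (RtoC t * h) <= Cmod h.
Proof.
  intros Ht; le_via Rle_abs. le_via Re_le_Cmod. rewrite Cmod_mult, Cmod_R, Rabs_pos_eq by lra.
  generalize (Cmod_ge_0 h); nra.
Qed.

Lemma Cmod_Cexp_Ci (x : R) : Cmod (Cexp (Ci * RtoC x)) = 1.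
Proof. rewrite Cmod_Cexp; autorewrite with ReIm; rewrite <- exp_0; f_equal; ring. Qed.

Lemma Cmod_Cexp_le (z w : C) : Cmod (Cexp (- z * w)) <= exp (Cmod w * Cmod z).
Proof.
  rewrite Cmod_Cexp; apply exp_le_compat; le_via Rle_abs; le_via Re_le_Cmod. rewrite Cmod_mult, Cmod_opp; lra.
Qed.

(** Mean value inequality for [Cexp (u h)] on [[0, 1]]. The factor [exp (Cmod h)] keeps the bound
    valid for large [h], which occurs when [h] is multiplied by a far point of the contour. *)
Lemma Cexp_sub_1 (h : C) : Cmod (Cexp h - 1) <= Cmod h * exp (Cmod h).
Proof.
  generalize (mean_value_ineq (fun u => Cexp (RtoC u * h))
    (fun t => (h * Cexp (RtoC t * h))%C) 0 1 (Cmod h * exp (Cmod h))).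
  rewrite Cmult_1_l, Cmult_0_l, Cexp_0; intros H. le_via H; [ lra | | | right; ring ].
  - intros t _; apply dR_Cexp_scal.
  - intros t Ht; rewrite Cmod_mult, Cmod_Cexp.
    apply Rmult_le_compat_l; [ apply Cmod_ge_0 | apply exp_le_compat, Re_scal_le, Ht ].
Qed.

Lemma dR_minus (F G : R -> C) (t : R) (v w : C) :
  dR F t v -> dR G t w -> dR (fun u => F u - G u)%C t (v - w)%C.
Proof.
  intros [H1 H2] [H3 H4]; split;
    [ apply (is_derive_minus (fun u => Re (F u)) (fun u => Re (G u)) t (Re v) (Re w))
    | apply (is_derive_minus (fun u => Im (F u)) (fun u => Im (G u)) t (Im v) (Im w)) ]; auto.
Qed.

Lemma dR_line (p h : C) (t : R) : dR (fun u => p + RtoC u * h)%C t h.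
Proof.
  apply dR_eps; intros eps He; exists 1; split; [ lra | intros u _ ].
  replace (p + RtoC u * h - (p + RtoC t * h) - h * (RtoC u - RtoC t))%C with (RtoC 0) by ring.
  rewrite Cmod_0; pos.
Qed.

Lemma dR_ext (F G : R -> C) (t : R) (v : C) :
  (forall u, F u = G u) -> dR F t v -> dR G t v.
Proof.
  intros E [H1 H2]; split;
    [ apply (is_derive_ext (fun u => Re (F u))) | apply (is_derive_ext (fun u => Im (F u))) ];
    auto; intros u; rewrite E; reflexivity.
Qed.

Lemma Cexp_sub_1_id (h : C) : Cmod (Cexp h - 1 - h) <= Cmod h * Cmod h * exp (Cmod h).
Proof.
  generalize (mean_value_ineq (fun u => Cexp (RtoC u * h) - (0 + RtoC u * h))%C
    (fun t => (h * Cexp (RtoC t * h) - h)%C) 0 1 (Cmod h * Cmod h * exp (Cmod h))).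
  rewrite Cmult_1_l, Cmult_0_l, Cexp_0; intros H.
  replace (Cexp h - 1 - h)%C with (Cexp h - (0 + h) - (1 - (0 + 0)))%C by ring.
  le_via H; [ lra | | | right; ring ].
  - intros t _; apply dR_minus; [ apply dR_Cexp_scal | apply dR_line ].
  - intros t Ht. replace (h * Cexp (RtoC t * h) - h)%C with (h * (Cexp (RtoC t * h) - 1))%C by ring.
    rewrite Cmod_mult, Rmult_assoc; apply Rmult_le_compat_l; [ apply Cmod_ge_0 | ]. le_via Cexp_sub_1.
    assert (Cmod (RtoC t * h) <= Cmod h). { rewrite Cmod_mult, Cmod_R, Rabs_pos_eq by lra.
      generalize (Cmod_ge_0 h); nra. }
    apply Rmult_le_compat; [ apply Cmod_ge_0 | pos | auto | apply exp_le_compat; auto ].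
Qed.

Lemma dR_RtoC (f : R -> R) (t l : R) : is_derive f t l -> dR (fun u => RtoC (f u)) t (RtoC l).
Proof.
  intros H; split; [ exact H | ].
  rewrite Im_RtoC; apply (is_derive_const (K := R_AbsRing) (V := R_NormedModule) 0 t).
Qed.

(** * Limits *)

Lemma mult_eps (v w : C) (eps : R) : 0 < eps ->
  exists d, 0 < d /\ forall x y, Cmod (x - v) < d -> Cmod (y - w) < d ->
    Cmod (x * y - v * w) < eps.
Proof.
  assert (P1 := Cmod_ge_0 v). assert (P2 := Cmod_ge_0 w). exists (Rmin 1 (eps / (Cmod v + Cmod w + 2))).
  split; [ pos | ]. intros x y Hx Hy. assert (Hx1 := Rlt_le_trans _ _ _ Hx (Rmin_l _ _)).
  assert (Hx2 := Rlt_le_trans _ _ _ Hx (Rmin_r _ _)). assert (Hy2 := Rlt_le_trans _ _ _ Hy (Rmin_r _ _)).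
  set (e := eps / (Cmod v + Cmod w + 2)) in *.
  assert (Ee : e * (Cmod v + Cmod w + 2) = eps) by (unfold e; field; lra).
  replace (x * y - v * w)%C with ((x - v) * w + v * (y - w) + (x - v) * (y - w))%C by ring.
  lt_via Cmod_triangle. eapply Rle_lt_trans; [ apply Rplus_le_compat_r, Cmod_triangle | ]. rewrite !Cmod_mult.
  generalize (Cmod_ge_0 (x - v)) (Cmod_ge_0 (y - w)); nra.
Qed.

Lemma scal_eps (c : C) (eps : R) : 0 < eps ->
  exists d, 0 < d /\ forall x y, Cmod (x - y) < d -> Cmod (c * x - c * y) < eps.
Proof.
  intros He; assert (P := Cmod_ge_0 c); exists (eps / (Cmod c + 1)); split; [ pos | intros x y H ].
  replace (c * x - c * y)%C with (c * (x - y))%C by ring; rewrite Cmod_mult.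
  assert (E : eps / (Cmod c + 1) * (Cmod c + 1) = eps) by (field; lra); nra.
Qed.

(** Neighbourhood filters given by a radius: discs, intervals and one-sided punctured intervals are
    all instances, so the algebra of limits is proved once. *)
Definition small {T : Type} (D : R -> T -> Prop) (P : T -> Prop) : Prop :=
  exists d, 0 < d /\ forall x, D d x -> P x.

Lemma small_filter {T : Type} (D : R -> T -> Prop) :
  (forall d d' x, d <= d' -> D d x -> D d' x) -> Filter (small D).
Proof.
  intros HD; split.
  - exists 1; split; [ lra | trivial ].
  - intros P Q [d1 [H1 K1]] [d2 [H2 K2]]; exists (Rmin d1 d2). split; [ pos | intros x Hx; split ].
    + apply K1; revert Hx; apply HD, Rmin_l.
    + apply K2; revert Hx; apply HD, Rmin_r.
  - intros P Q H [d [Hd K]]; exists d; auto.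
Qed.

Definition near (z : C) : (C -> Prop) -> Prop := small (fun d y => Cmod (y - z) < d).
Definition nearR (t : R) : (R -> Prop) -> Prop := small (fun d u => Rabs (u - t) < d).
Definition before (t : R) : (R -> Prop) -> Prop := small (fun d u => t - d < u < t).
Definition after (t : R) : (R -> Prop) -> Prop := small (fun d u => t < u < t + d).

Global Instance near_filter (z : C) : Filter (near z).
Proof. apply small_filter; intros; lra. Qed.
Global Instance nearR_filter (t : R) : Filter (nearR t).
Proof. apply small_filter; intros; lra. Qed.
Global Instance before_filter (t : R) : Filter (before t).
Proof. apply small_filter; intros; lra. Qed.
Global Instance after_filter (t : R) : Filter (after t).
Proof. apply small_filter; intros; lra. Qed.

(** Limits measured by [Cmod]; [tends_filterlim] translates them into the uniform structure used for
    limits and integrals in the theorem. *)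
Definition tends {T : Type} (F : (T -> Prop) -> Prop) (f : T -> C) (l : C) : Prop :=
  forall eps, 0 < eps -> F (fun x => Cmod (f x - l) < eps).

Section Tends.

Context {T : Type} {F : (T -> Prop) -> Prop} {FF : Filter F}.

Lemma tends_const (c : C) : tends F (fun _ => c) c.
Proof.
  intros eps He; apply filter_forall; intros _. replace (c - c)%C with (RtoC 0) by ring; rewrite Cmod_0; auto.
Qed.

Lemma tends_ext (f g : T -> C) (l : C) : F (fun x => f x = g x) -> tends F f l -> tends F g l.
Proof.
  intros E H eps He; generalize (filter_and _ _ E (H eps He)); apply filter_imp; intros x [<- K]; exact K.
Qed.

Lemma tends_plus (f g : T -> C) (l m : C) :
  tends F f l -> tends F g m -> tends F (fun x => f x + g x)%C (l + m).
Proof.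
  intros Hf Hg eps He; assert (He2 : 0 < eps / 2) by lra. generalize (filter_and _ _ (Hf _ He2) (Hg _ He2)).
  apply filter_imp; intros x [K1 K2]. replace (f x + g x - (l + m))%C with ((f x - l) + (g x - m))%C by ring.
  lt_via Cmod_triangle; lra.
Qed.

Lemma tends_mult (f g : T -> C) (l m : C) :
  tends F f l -> tends F g m -> tends F (fun x => f x * g x)%C (l * m).
Proof.
  intros Hf Hg eps He; destruct (mult_eps l m eps He) as [d [Hd K]].
  generalize (filter_and _ _ (Hf d Hd) (Hg d Hd)); apply filter_imp; intros x [K1 K2]; auto.
Qed.

Lemma tends_comp (h : C -> C) (f : T -> C) (l m : C) :
  tends (near l) h m -> tends F f l -> tends F (fun x => h (f x)) m.
Proof.
  intros Hh Hf eps He; destruct (Hh eps He) as [d [Hd K]]; generalize (Hf d Hd); apply filter_imp; auto.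
Qed.

Lemma tends_le (f g : T -> C) (l m : C) : (forall x, Cmod (g x - m) <= Cmod (f x - l)) ->
  tends F f l -> tends F g m.
Proof.
  intros H Hf eps He; generalize (Hf eps He); apply filter_imp; intros x; eapply Rle_lt_trans, H.
Qed.

End Tends.

(** The balls of the product structure on [C] are squares, hence the factor [sqrt 2]. *)
Lemma locally_Cmod (v : C) (P : C -> Prop) :
  locally (T := C_R_NormedModule) v P <-> near v P.
Proof.
  split.
  - intros [eps H]; exists eps; split; [ apply cond_pos | intros y Hy; apply H ].
    apply (C_NormedModule_mixin_compat1 v y eps), Hy.
  - intros [d [Hd H]]. assert (H2 := Rlt_sqrt2_0). assert (He2 : 0 < d / sqrt 2) by pos.
    exists (mkposreal _ He2); intros y Hy; apply H.
    apply (C_NormedModule_mixin_compat2 v y (mkposreal _ He2)) in Hy; simpl in Hy.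
    replace (sqrt 2 * (d / sqrt 2)) with d in Hy by (field; lra); exact Hy.
Qed.

Lemma tends_filterlim {T : Type} (F : (T -> Prop) -> Prop) {FF : Filter F} (f : T -> C) (l : C) :
  tends F f l <-> filterlim f F (locally (T := C_R_NormedModule) l).
Proof.
  split.
  - intros H P HP; apply locally_Cmod in HP; destruct HP as [d [Hd HP]].
    generalize (H d Hd); unfold filtermap; apply filter_imp; auto.
  - intros H eps He; apply (H (fun y => Cmod (y - l) < eps)), locally_Cmod; exists eps; auto.
Qed.

Definition ccont (f : C -> C) (z : C) : Prop := tends (near z) f (f z).
Definition rcont (g : R -> C) (t : R) : Prop := tends (nearR t) g (g t).

Lemma rcont_continuous (g : R -> C) (t : R) :
  rcont g t <-> continuous (U := C_R_NormedModule) g t.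
Proof.
  unfold rcont; rewrite (tends_filterlim (nearR t)); unfold continuous, filterlim, filter_le, filtermap.
  split; intros H P HP; specialize (H P HP).
  - destruct H as [d [Hd K]]; exists (mkposreal d Hd); exact K.
  - destruct H as [d K]; exists d; split; [ apply cond_pos | exact K ].
Qed.

Lemma near_at (z : C) (P : C -> Prop) : near z P -> P z.
Proof.
  intros [d [Hd H]]; apply H; replace (z - z)%C with (RtoC 0) by ring. rewrite Cmod_0; auto.
Qed.

Lemma near_near (z : C) (P : C -> Prop) : near z P -> near z (fun y => near y P).
Proof.
  intros [d [Hd H]]; exists d; split; [ auto | intros y Hy ].
  exists (d - Cmod (y - z)); split; [ lra | intros x Hx; apply H ].
  generalize (Cmod_dist_triangle x y z); lra.
Qed.

Lemma near_ball (z c : C) (r : R) : Cmod (z - c) < r -> near z (fun y => Cmod (y - c) < r).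
Proof.
  intros H; exists (r - Cmod (z - c)); split; [ lra | intros y Hy ].
  generalize (Cmod_dist_triangle y z c); lra.
Qed.

Lemma ccont_const (c z : C) : ccont (fun _ => c) z.
Proof. apply tends_const. Qed.

Lemma ccont_id (z : C) : ccont (fun y => y) z.
Proof. intros eps He; exists eps; auto. Qed.

Lemma ccont_plus (f g : C -> C) (z : C) : ccont f z -> ccont g z -> ccont (fun y => f y + g y)%C z.
Proof. apply tends_plus. Qed.

Lemma ccont_mult (f g : C -> C) (z : C) : ccont f z -> ccont g z -> ccont (fun y => f y * g y)%C z.
Proof. apply tends_mult. Qed.

Lemma ccont_minus (f g : C -> C) (z : C) : ccont f z -> ccont g z -> ccont (fun y => f y - g y)%C z.
Proof.
  intros Hf Hg; apply (ccont_plus f (fun y => - g y)%C); [ auto | ].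
  revert Hg; apply tends_le; intros y; replace (- g y - - g z)%C with (- (g y - g z))%C by ring.
  rewrite Cmod_opp; lra.
Qed.

Lemma ccont_comp (f g : C -> C) (z : C) : ccont f (g z) -> ccont g z -> ccont (fun y => f (g y)) z.
Proof. apply tends_comp. Qed.

Lemma ccont_ext_near (f g : C -> C) (z : C) : near z (fun y => f y = g y) -> ccont f z -> ccont g z.
Proof. intros E; unfold ccont; rewrite <- (near_at _ _ E); apply tends_ext, E. Qed.

Lemma ccont_neq_0 (f : C -> C) (z : C) :
  ccont f z -> f z <> 0%C -> near z (fun y => f y <> 0%C).
Proof.
  intros Hf Hz; generalize (Hf (Cmod (f z)) (proj1 (Cmod_gt_0 _) Hz)); apply filter_imp; intros y K E.
  rewrite E in K; replace (0 - f z)%C with (- f z)%C in K by ring; rewrite Cmod_opp in K; lra.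
Qed.

Lemma ccont_inv_id (z : C) : z <> 0%C -> ccont (fun y => / y)%C z.
Proof.
  intros Hz eps He; assert (Pz : 0 < Cmod z) by (apply Cmod_gt_0; auto). set (r := Cmod z) in *.
  exists (Rmin (r / 2) (eps * (r * r / 2))); split; [ pos | intros y Hy ].
  assert (Hy1 := Rlt_le_trans _ _ _ Hy (Rmin_l _ _)). assert (Hy2 := Rlt_le_trans _ _ _ Hy (Rmin_r _ _)).
  assert (Py : r / 2 < Cmod y) by (generalize (Cmod_minus_ge z y); rewrite (Cmod_minus_sym z y); fold r; lra).
  assert (Hy0 : y <> 0%C) by (apply Cmod_gt_0; lra).
  replace (/ y - / z)%C with (- (y - z) / (y * z))%C by (field; auto).
  rewrite Cmod_div, Cmod_opp, Cmod_mult by (apply Cmult_neq_0; auto); fold r.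
  apply (Rmult_lt_reg_r (Cmod y * r)); [ nra | ].
  unfold Rdiv; rewrite Rmult_assoc, Rinv_l by nra; apply Rlt_trans with (eps * (r * r / 2)); [ lra | ].
  apply Rmult_lt_compat_l; nra.
Qed.

Lemma ccont_inv (f : C -> C) (z : C) : f z <> 0%C -> ccont f z -> ccont (fun y => / f y)%C z.
Proof. intros H; apply (ccont_comp (fun y => / y)%C), ccont_inv_id, H. Qed.

Lemma rcont_const (c : C) (t : R) : rcont (fun _ => c) t.
Proof. apply tends_const. Qed.

Lemma rcont_RtoC (t : R) : rcont RtoC t.
Proof. intros eps He; exists eps; split; [ auto | intros u Hu; rewrite <- RtoC_minus, Cmod_R; auto ]. Qed.

Lemma rcont_plus (f g : R -> C) (t : R) : rcont f t -> rcont g t -> rcont (fun u => f u + g u)%C t.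
Proof. apply tends_plus. Qed.

Lemma rcont_mult (f g : R -> C) (t : R) : rcont f t -> rcont g t -> rcont (fun u => f u * g u)%C t.
Proof. apply tends_mult. Qed.

Lemma rcont_comp (f : C -> C) (g : R -> C) (t : R) : ccont f (g t) -> rcont g t -> rcont (fun u => f (g u)) t.
Proof. apply tends_comp. Qed.

Lemma rcont_ext (f g : R -> C) (t : R) : (forall u, f u = g u) -> rcont f t -> rcont g t.
Proof. intros E; unfold rcont; rewrite <- E; apply tends_ext, filter_forall, E. Qed.

Lemma rcont_line (p h : C) (t : R) : rcont (fun u => p + RtoC u * h)%C t.
Proof. apply rcont_plus, rcont_mult; [ apply rcont_const | apply rcont_RtoC | apply rcont_const ]. Qed.

(** * Complex derivatives *)

Definition cder (f : C -> C) (z l : C) : Prop :=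
  forall eps, 0 < eps -> exists d, 0 < d /\ forall y, Cmod (y - z) < d ->
    Cmod (f y - f z - l * (y - z)) <= eps * Cmod (y - z).

(* Caratheodory's form of differentiability along [i], which is the identity
   of [C] or the inclusion of [R]. *)
Lemma caratheodory {T : Type} (i : T -> C) (f : T -> C) (z : T) (l : C) (D : R -> T -> Prop) :
  (forall d y, D d y -> Cmod (i y - i z) < d) -> (forall y, i y = i z -> y = z) ->
  (forall eps, 0 < eps -> small D (fun y => Cmod (f y - f z - l * (i y - i z)) <= eps * Cmod (i y - i z))) <->
  exists q : T -> C, (forall y, f y - f z = q y * (i y - i z))%C /\ tends (small D) q (q z) /\ q z = l.
Proof.
  intros HD Hi; split.
  - intros H; exists (fun y => if Ceq_dec (i y) (i z) then l else ((f y - f z) / (i y - i z))%C).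
    assert (N : forall y, i y <> i z -> (i y - i z)%C <> 0%C).
    { intros y Hy E; apply Hy; replace (i y) with (i y - i z + i z)%C by ring; rewrite E; ring. }
    destruct (Ceq_dec (i z) (i z)) as [_|]; [ split; [ | split; [ | reflexivity ] ] | contradiction ].
    + intros y; destruct (Ceq_dec (i y) (i z)) as [E|E]; [ rewrite (Hi y E); ring | field; apply N, E ].
    + intros eps He; destruct (H (eps / 2)) as [d [Hd K]]; [ lra | exists d; split; [ auto | intros y Hy ] ].
      specialize (K y Hy); destruct (Ceq_dec (i y) (i z)) as [E|E].
      { replace (l - l)%C with (RtoC 0) by ring; rewrite Cmod_0; auto. }
      assert (P := proj1 (Cmod_gt_0 _) (N y E)).
      replace ((f y - f z) / (i y - i z) - l)%C with ((f y - f z - l * (i y - i z)) / (i y - i z))%C by (field; apply N, E).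
      rewrite Cmod_div by apply N, E; apply (Rmult_lt_reg_r (Cmod (i y - i z))); [ auto | ].
      unfold Rdiv; rewrite Rmult_assoc, Rinv_l by lra; nra.
  - intros [q [E [Hq <-]]] eps He; destruct (Hq eps He) as [d [Hd K]]; exists d; split; [ auto | intros y Hy ].
    specialize (K y Hy); rewrite E.
    replace (q y * (i y - i z) - q z * (i y - i z))%C with ((q y - q z) * (i y - i z))%C by ring.
    rewrite Cmod_mult; apply Rmult_le_compat_r; [ apply Cmod_ge_0 | lra ].
Qed.

Lemma cder_quotient (f : C -> C) (z l : C) : cder f z l <->
  exists q, (forall y, f y - f z = q y * (y - z))%C /\ ccont q z /\ q z = l.
Proof.
  exact (caratheodory (fun y => y) f z l (fun d y => Cmod (y - z) < d) (fun d y Hy => Hy) (fun y Hy => Hy)).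
Qed.

Lemma dR_quotient (F : R -> C) (t : R) (v : C) : dR F t v <->
  exists q, (forall u, F u - F t = q u * (RtoC u - RtoC t))%C /\ rcont q t /\ q t = v.
Proof.
  rewrite dR_eps; apply (caratheodory RtoC F t v (fun d u => Rabs (u - t) < d)); [ | intros y; apply RtoC_inj ].
  intros d y; rewrite <- RtoC_minus, Cmod_R; trivial.
Qed.

Lemma cder_ccont (f : C -> C) (z l : C) : cder f z l -> ccont f z.
Proof.
  intros H; apply cder_quotient in H; destruct H as [q [E [Hq _]]].
  apply (ccont_ext_near (fun y => f z + q y * (y - z))%C).
  - apply filter_forall; intros y; rewrite <- E; ring.
  - apply ccont_plus, ccont_mult, ccont_minus; auto using ccont_const, ccont_id.
Qed.

Lemma dR_rcont (F : R -> C) (t : R) (v : C) : dR F t v -> rcont F t.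
Proof.
  intros H; apply dR_quotient in H; destruct H as [q [E [Hq _]]].
  apply (rcont_ext (fun u => F t + q u * (- RtoC t + RtoC u * 1))%C).
  - intros u; replace (- RtoC t + RtoC u * 1)%C with (RtoC u - RtoC t)%C by ring; rewrite <- E; ring.
  - apply rcont_plus, rcont_mult; auto using rcont_const, rcont_line.
Qed.

Lemma cder_eq (f : C -> C) (z l m : C) : cder f z l -> l = m -> cder f z m.
Proof. intros H <-; exact H. Qed.

Lemma dR_eq (F : R -> C) (t : R) (v w : C) : dR F t v -> v = w -> dR F t w.
Proof. intros H <-; exact H. Qed.

Lemma cder_ext_near (f g : C -> C) (z l : C) :
  near z (fun y => f y = g y) -> cder f z l -> cder g z l.
Proof.
  intros Hn H eps He; generalize (filter_and (F := near z) _ _ Hn (H eps He)); apply (filter_imp (F := near z)).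
  intros y [<- K]; rewrite <- (near_at _ _ Hn); exact K.
Qed.

Lemma cder_ext (f g : C -> C) (z l : C) :
  (forall y, f y = g y) -> cder f z l -> cder g z l.
Proof. intros H; apply cder_ext_near, filter_forall, H. Qed.

Lemma cder_unique (f : C -> C) (z l l' : C) : cder f z l -> cder f z l' -> l = l'.
Proof.
  intros H H'; apply Cmod_lt_eq; intros eps He.
  destruct (filter_and (F := near z) _ _ (H (eps / 3) ltac:(lra)) (H' (eps / 3) ltac:(lra))) as [d [Hd K]].
  assert (P : Cmod (RtoC (d / 2)) = d / 2) by (rewrite Cmod_R, Rabs_pos_eq; lra).
  destruct (K (z + RtoC (d / 2))%C); replace (z + RtoC (d / 2) - z)%C with (RtoC (d / 2)) in * by ring; [ lra | ].
  apply (Rmult_lt_reg_r (d / 2)); [ lra | rewrite <- P at 1; rewrite <- Cmod_mult ].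
  set (u := (f (z + RtoC (d / 2)) - f z)%C) in *.
  replace ((l - l') * RtoC (d / 2))%C with (u - l' * RtoC (d / 2) - (u - l * RtoC (d / 2)))%C by ring.
  lt_via Cmod_triangle_minus; nra.
Qed.

Lemma cder_quadratic (f : C -> C) (z l : C) (M : R) : 0 <= M ->
  (forall h, Cmod h < 1 -> Cmod (f (z + h)%C - f z - l * h) <= M * (Cmod h * Cmod h)) -> cder f z l.
Proof.
  intros HM H eps He; exists (Rmin 1 (eps / (M + 1))); split. { pos. }
  intros y Hy; specialize (H (y - z)%C (Rlt_le_trans _ _ _ Hy (Rmin_l _ _))).
  assert (Hy2 := Rlt_le_trans _ _ _ Hy (Rmin_r _ _)).
  assert (E : eps / (M + 1) * (M + 1) = eps) by (field; lra).
  replace (z + (y - z))%C with y in H by ring; assert (P := Cmod_ge_0 (y - z)).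
  assert (Cmod (y - z) * (M + 1) <= eps) by nra. nra.
Qed.

Lemma cder_const (c z : C) : cder (fun _ => c) z 0.
Proof. apply cder_quotient; exists (fun _ => RtoC 0); split; [ intros; ring | auto using ccont_const ]. Qed.

Lemma cder_id (z : C) : cder (fun y => y) z 1.
Proof. apply cder_quotient; exists (fun _ => RtoC 1); split; [ intros; ring | auto using ccont_const ]. Qed.

Lemma cder_plus (f g : C -> C) (z l m : C) :
  cder f z l -> cder g z m -> cder (fun y => f y + g y)%C z (l + m)%C.
Proof.
  rewrite !cder_quotient; intros [q [E [Hq <-]]] [r [E' [Hr <-]]]; exists (fun y => q y + r y)%C.
  split; [ intros y | auto using ccont_plus ].
  replace (f y + g y - (f z + g z))%C with ((f y - f z) + (g y - g z))%C by ring; rewrite E, E'; ring.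
Qed.

Lemma cder_mult (f g : C -> C) (z l m : C) :
  cder f z l -> cder g z m -> cder (fun y => f y * g y)%C z (l * g z + f z * m)%C.
Proof.
  intros Hf Hg; assert (Cg := cder_ccont _ _ _ Hg); revert Hf Hg.
  rewrite !cder_quotient; intros [q [E [Hq <-]]] [r [E' [Hr <-]]].
  exists (fun y => q y * g y + f z * r y)%C; split; [ intros y | auto using ccont_plus, ccont_mult, ccont_const ].
  replace (f y * g y - f z * g z)%C with ((f y - f z) * g y + f z * (g y - g z))%C by ring; rewrite E, E'; ring.
Qed.

Lemma cder_comp (f g : C -> C) (z l m : C) :
  cder f (g z) l -> cder g z m -> cder (fun y => f (g y)) z (l * m)%C.
Proof.
  intros Hf Hg; assert (Cg := cder_ccont _ _ _ Hg); revert Hf Hg.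
  rewrite !cder_quotient; intros [q [E [Hq <-]]] [r [E' [Hr <-]]].
  exists (fun y => q (g y) * r y)%C; split; [ intros y; rewrite E, E'; ring | ].
  split; [ apply ccont_mult; [ apply ccont_comp | ]; auto | reflexivity ].
Qed.

Lemma dR_comp (F : C -> C) (c : R -> C) (t : R) (l v : C) :
  cder F (c t) l -> dR c t v -> dR (fun u => F (c u)) t (l * v)%C.
Proof.
  intros Hf Hg; assert (Cg := dR_rcont _ _ _ Hg); revert Hf Hg.
  rewrite cder_quotient, !dR_quotient; intros [q [E [Hq <-]]] [r [E' [Hr <-]]].
  exists (fun y => q (c y) * r y)%C; split; [ intros y; rewrite E, E'; ring | ].
  split; [ apply rcont_mult; [ apply rcont_comp | ]; auto | reflexivity ].
Qed.

Lemma dR_mult (F G : R -> C) (t : R) (v w : C) :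
  dR F t v -> dR G t w -> dR (fun u => F u * G u)%C t (v * G t + F t * w)%C.
Proof.
  intros Hf Hg; assert (Cg := dR_rcont _ _ _ Hg); revert Hf Hg.
  rewrite !dR_quotient; intros [q [E [Hq <-]]] [r [E' [Hr <-]]].
  exists (fun y => q y * G y + F t * r y)%C; split; [ intros y | auto using rcont_plus, rcont_mult, rcont_const ].
  replace (F y * G y - F t * G t)%C with ((F y - F t) * G y + F t * (G y - G t))%C by ring; rewrite E, E'; ring.
Qed.

Lemma cder_inv_id (z : C) : z <> 0%C -> cder (fun y => / y)%C z (- (/ z * / z))%C.
Proof.
  (* Near [z] the inverse is [1 / z - (y - z) / (z y)], an expression whose difference quotient is
     explicit for every [y], including [y = 0]. *)
  intros Hz; apply (cder_ext_near (fun y => / z + - (y - z) * (/ z * / y))%C).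
  { generalize (ccont_neq_0 _ _ (ccont_id z) Hz); apply filter_imp; intros y Hy; field; auto. }
  apply cder_quotient; exists (fun y => - (1) * (/ z * / y))%C; split; [ intros y; ring | split; [ | ring ] ].
  apply ccont_mult, ccont_mult, ccont_inv_id, Hz; apply ccont_const.
Qed.

Lemma cder_inv (f : C -> C) (z l : C) :
  f z <> 0%C -> cder f z l -> cder (fun y => / f y)%C z (- (/ f z * / f z) * l)%C.
Proof. intros H Hf; apply cder_comp; [ apply cder_inv_id, H | auto ]. Qed.

Lemma cder_Cexp (z : C) : cder Cexp z (Cexp z).
Proof.
  apply (cder_quadratic _ _ _ (exp (Re z) * 3)); [ generalize (exp_pos (Re z)); lra | intros h Hh ].
  replace (Cexp (z + h) - Cexp z - Cexp z * h)%C with (Cexp z * (Cexp h - 1 - h))%C by (rewrite Cexp_plus; ring).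
  rewrite Cmod_mult, Cmod_Cexp, Rmult_assoc; apply Rmult_le_compat_l; [ pos | ].
  le_via Cexp_sub_1_id; rewrite Rmult_comm; apply Rmult_le_compat_r.
  - pos.
  - eapply Rle_trans; [ apply exp_le_compat; left; apply Hh | apply exp_le_3 ].
Qed.

Lemma cder_scal (k : C) (f : C -> C) (z l : C) :
  cder f z l -> cder (fun y => k * f y)%C z (k * l)%C.
Proof.
  intros H; replace (k * l)%C with (0 * f z + k * l)%C by ring.
  apply (cder_mult (fun _ => k)); [ apply cder_const | auto ].
Qed.

Lemma cder_scal_id (a b z : C) : cder (fun y => a * y + b)%C z a.
Proof.
  eapply cder_eq; [ apply cder_plus; [ apply cder_scal, cder_id | apply cder_const ] | ring ].
Qed.

(** * Germs with holomorphic derivatives of all orders *)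

Fixpoint sm (k : nat) (f : C -> C) (z : C) : Prop :=
  match k with
  | O => ccont f z
  | S k' => exists f' : C -> C, near z (fun y => cder f y (f' y)) /\ sm k' f' z
  end.

(** Analyticity as complex differentiability of every order near the point: the class is closed
    under [dC] by construction, and each closure property is an induction on [k]. *)
Definition an (f : C -> C) (z : C) : Prop := forall k, sm k f z.

Lemma sm_ext_near (k : nat) (f g : C -> C) (z : C) :
  near z (fun y => f y = g y) -> sm k f z -> sm k g z.
Proof.
  destruct k as [|k]; simpl; intros E H.
  - eapply ccont_ext_near; eassumption.
  - destruct H as [f' [H1 H2]]; exists f'; split; [ | auto ].
    assert (N := filter_and _ _ (near_near _ _ E) H1).
    revert N; apply filter_imp; intros y [Hy Hy']; eapply cder_ext_near; eassumption.
Qed.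

Lemma sm_pred (k : nat) : forall (f : C -> C) (z : C), sm (S k) f z -> sm k f z.
Proof.
  induction k as [|k IH]; intros f z [f' [H1 H2]].
  - eapply cder_ccont, (near_at _ _ H1).
  - exists f'; split; [ auto | apply IH, H2 ].
Qed.

Lemma sm_const (k : nat) : forall (c z : C), sm k (fun _ => c) z.
Proof.
  induction k as [|k IH]; intros c z; [ apply ccont_const | ].
  exists (fun _ => RtoC 0); split; [ apply filter_forall; intros; apply cder_const | apply IH ].
Qed.

Lemma sm_id (k : nat) (z : C) : sm k (fun y => y) z.
Proof.
  destruct k as [|k]; [ eapply cder_ccont, cder_id | ].
  exists (fun _ => RtoC 1); split; [ apply filter_forall; intros; apply cder_id | apply sm_const ].
Qed.

Lemma sm_plus (k : nat) : forall (f g : C -> C) (z : C),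
  sm k f z -> sm k g z -> sm k (fun y => f y + g y)%C z.
Proof.
  induction k as [|k IH]; intros f g z; [ apply ccont_plus | ]. intros [f' [Hf Hf']] [g' [Hg Hg']].
  exists (fun y => f' y + g' y)%C; split; [ | apply IH; auto ].
  generalize (filter_and _ _ Hf Hg); apply filter_imp. intros y [H1 H2]; apply cder_plus; auto.
Qed.

Lemma sm_mult (k : nat) : forall (f g : C -> C) (z : C),
  sm k f z -> sm k g z -> sm k (fun y => f y * g y)%C z.
Proof.
  induction k as [|k IH]; intros f g z; [ apply ccont_mult | ].
  intros Hf Hg. assert (Hf0 := sm_pred _ _ _ Hf). assert (Hg0 := sm_pred _ _ _ Hg).
  destruct Hf as [f' [Hf Hf']], Hg as [g' [Hg Hg']]. exists (fun y => f' y * g y + f y * g' y)%C; split.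
  - generalize (filter_and _ _ Hf Hg); apply filter_imp. intros y [H1 H2]; apply cder_mult; auto.
  - apply sm_plus; apply IH; auto.
Qed.

Lemma sm_comp (k : nat) : forall (f g : C -> C) (z : C),
  sm k f (g z) -> sm k g z -> sm k (fun y => f (g y)) z.
Proof.
  induction k as [|k IH]; intros f g z; [ apply ccont_comp | ].
  intros [f' [[d [Hd Hf]] Hf']] Hg. assert (Hg0 := sm_pred _ _ _ Hg). destruct Hg as [g' [Hg Hg']].
  exists (fun y => f' (g y) * g' y)%C; split; [ | apply sm_mult; auto ].
  generalize (filter_and _ _ (cder_ccont _ _ _ (near_at _ _ Hg) d Hd) Hg); apply filter_imp.
  intros y [H1 H2]; apply cder_comp; auto.
Qed.

Lemma sm_inv (k : nat) (z : C) : z <> 0%C -> sm k (fun y => / y)%C z.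
Proof.
  intros Hz; induction k as [|k IH]; [ apply ccont_inv_id, Hz | ].
  exists (fun y => - (1) * (/ y * / y))%C; split; [ | repeat apply sm_mult; auto using sm_const ].
  generalize (ccont_neq_0 _ _ (ccont_id z) Hz); apply filter_imp; intros y Hy.
  apply (cder_eq _ _ _ _ (cder_inv_id y Hy)); ring.
Qed.

Lemma sm_Cexp (k : nat) (z : C) : sm k Cexp z.
Proof.
  induction k as [|k IH]; [ eapply cder_ccont, cder_Cexp | ].
  exists Cexp; split; [ apply filter_forall, cder_Cexp | apply IH ].
Qed.

Definition dC (f : C -> C) (z : C) : C := epsilon (inhabits (RtoC 0)) (cder f z).

Lemma dC_spec (f : C -> C) (z l : C) : cder f z l -> dC f z = l.
Proof.
  intros H; apply (cder_unique f z); [ | auto ]. unfold dC; apply epsilon_spec; exists l; auto.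
Qed.

Lemma sm_dC (k : nat) (f : C -> C) (z : C) : sm (S k) f z -> sm k (dC f) z.
Proof.
  intros [f' [H1 H2]]; eapply sm_ext_near; [ | apply H2 ].
  revert H1; apply filter_imp; intros y Hy; symmetry; apply dC_spec, Hy.
Qed.

Lemma an_cder (f : C -> C) (z : C) : an f z -> cder f z (dC f z).
Proof.
  intros H; destruct (H 1%nat) as [f' [H1 _]]; apply near_at in H1. rewrite (dC_spec _ _ _ H1); auto.
Qed.

Lemma an_dC (f : C -> C) (z : C) : an f z -> an (dC f) z.
Proof. intros H k; apply sm_dC, H. Qed.

Lemma an_ccont (f : C -> C) (z : C) : an f z -> ccont f z.
Proof. intros H; apply (H 0%nat). Qed.

Lemma an_const (c z : C) : an (fun _ => c) z.
Proof. intros k; apply sm_const. Qed.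
Lemma an_id (z : C) : an (fun y => y) z.
Proof. intros k; apply sm_id. Qed.
Lemma an_plus (f g : C -> C) (z : C) : an f z -> an g z -> an (fun y => f y + g y)%C z.
Proof. intros Hf Hg k; apply sm_plus; auto. Qed.
Lemma an_mult (f g : C -> C) (z : C) : an f z -> an g z -> an (fun y => f y * g y)%C z.
Proof. intros Hf Hg k; apply sm_mult; auto. Qed.
Lemma an_comp (f g : C -> C) (z : C) : an f (g z) -> an g z -> an (fun y => f (g y)) z.
Proof. intros Hf Hg k; apply sm_comp; auto. Qed.
Lemma an_inv (f : C -> C) (z : C) : f z <> 0%C -> an f z -> an (fun y => / f y)%C z.
Proof. intros H; apply (an_comp (fun y => / y)%C); intros k; apply sm_inv, H. Qed.
Lemma an_Cexp (f : C -> C) (z : C) : an f z -> an (fun y => Cexp (f y)) z.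
Proof. apply an_comp; intros k; apply sm_Cexp. Qed.
Lemma an_affine (f : C -> C) (a b z : C) :
  an f (a * z + b)%C -> an (fun y => f (a * y + b)%C) z.
Proof.
  intros Hf; apply an_comp, an_plus, an_const; [ auto | apply an_mult; [ apply an_const | apply an_id ] ].
Qed.
Lemma an_ext_near (f g : C -> C) (z : C) : near z (fun y => f y = g y) -> an f z -> an g z.
Proof. intros H Hf k; eapply sm_ext_near; [ apply H | apply Hf ]. Qed.
Lemma an_ext (f g : C -> C) (z : C) : (forall y, f y = g y) -> an f z -> an g z.
Proof. intros H; apply an_ext_near, filter_forall, H. Qed.
Lemma an_opp (f : C -> C) (z : C) : an f z -> an (fun y => - f y)%C z.
Proof.
  intros H; apply (an_ext (fun y => (- (1)) * f y)%C); [ intros; ring | ].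
  apply an_mult; [ apply an_const | auto ].
Qed.
Lemma an_minus (f g : C -> C) (z : C) : an f z -> an g z -> an (fun y => f y - g y)%C z.
Proof. intros Hf Hg; apply an_plus; [ auto | apply an_opp; auto ]. Qed.
Lemma an_pow (f : C -> C) (z : C) (n : nat) : an f z -> an (fun y => f y ^ n)%C z.
Proof.
  intros H; induction n as [|n IH]; simpl; [ apply an_const | apply an_mult; auto ].
Qed.

Lemma an_Cprod {A : Type} (g : A -> C -> C) (l : list A) (z : C) :
  (forall a, In a l -> an (g a) z) -> an (fun y => Cprod (map (fun a => g a y) l)) z.
Proof.
  induction l as [|a l IH]; intros H; simpl.
  - apply an_const.
  - apply (an_mult (g a)); [ apply H; left; reflexivity | apply IH; intros; apply H; right; auto ].
Qed.

(** * Complex-valued Riemann integrals *)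

Definition is_CI (f : R -> C) (a b : R) (v : C) : Prop :=
  is_RInt (V := C_R_NormedModule) f a b v.

Definition CI (f : R -> C) (a b : R) : C := RInt (V := C_R_CompleteNormedModule) f a b.

Lemma is_CI_pair (f : R -> C) (a b : R) (v : C) :
  is_RInt (fun t => Re (f t)) a b (Re v) -> is_RInt (fun t => Im (f t)) a b (Im v) ->
  is_CI f a b v.
Proof.
  apply (is_RInt_fct_extend_pair (U := R_NormedModule) (V := R_NormedModule)); auto.
Qed.

Lemma is_CI_Re (f : R -> C) (a b : R) (v : C) :
  is_CI f a b v -> is_RInt (fun t => Re (f t)) a b (Re v).
Proof. intros H; apply (is_RInt_fct_extend_fst (U := R_NormedModule) (V := R_NormedModule) f a b v H). Qed.

Lemma is_CI_Im (f : R -> C) (a b : R) (v : C) :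
  is_CI f a b v -> is_RInt (fun t => Im (f t)) a b (Im v).
Proof. intros H; apply (is_RInt_fct_extend_snd (U := R_NormedModule) (V := R_NormedModule) f a b v H). Qed.

Lemma is_CI_unique (f : R -> C) (a b : R) (v w : C) : is_CI f a b v -> is_CI f a b w -> v = w.
Proof.
  intros H1 H2; rewrite <- (is_RInt_unique (V := C_R_CompleteNormedModule) f a b v H1).
  apply (is_RInt_unique (V := C_R_CompleteNormedModule) f a b w H2).
Qed.

Lemma CI_correct (f : R -> C) (a b : R) : (exists v, is_CI f a b v) -> is_CI f a b (CI f a b).
Proof. intros H; apply (RInt_correct (V := C_R_CompleteNormedModule) f a b H). Qed.

Lemma CI_eq (f : R -> C) (a b : R) (v : C) : is_CI f a b v -> CI f a b = v.
Proof. intros H; apply (is_RInt_unique (V := C_R_CompleteNormedModule) f a b v H). Qed.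

Lemma is_CI_plus (f g : R -> C) (a b : R) (v w : C) :
  is_CI f a b v -> is_CI g a b w -> is_CI (fun t => f t + g t)%C a b (v + w)%C.
Proof. intros H1 H2; apply (is_RInt_plus (V := C_R_NormedModule) f g a b v w H1 H2). Qed.

Lemma is_CI_minus (f g : R -> C) (a b : R) (v w : C) :
  is_CI f a b v -> is_CI g a b w -> is_CI (fun t => f t - g t)%C a b (v - w)%C.
Proof. intros H1 H2; apply (is_RInt_minus (V := C_R_NormedModule) f g a b v w H1 H2). Qed.

(** The integral lives in a module over the reals, so a complex scalar has to be handled on
    components. *)
Lemma is_CI_scal (c : C) (f : R -> C) (a b : R) (v : C) :
  is_CI f a b v -> is_CI (fun t => c * f t)%C a b (c * v)%C.
Proof.
  intros H; assert (H1 := is_CI_Re _ _ _ _ H); assert (H2 := is_CI_Im _ _ _ _ H).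
  apply is_CI_pair; autorewrite with ReIm.
  - apply (is_RInt_minus (V := R_NormedModule) (fun t => Re c * Re (f t)) (fun t => Im c * Im (f t)) a b
      (Re c * Re v) (Im c * Im v)); apply (is_RInt_scal (V := R_NormedModule)); auto.
  - apply (is_RInt_plus (V := R_NormedModule) (fun t => Re c * Im (f t)) (fun t => Im c * Re (f t)) a b
      (Re c * Im v) (Im c * Re v)); apply (is_RInt_scal (V := R_NormedModule)); auto.
Qed.

Lemma is_CI_ext (f g : R -> C) (a b : R) (v : C) :
  a <= b -> (forall t, a < t < b -> f t = g t) -> is_CI f a b v -> is_CI g a b v.
Proof.
  intros Hab H; apply (is_RInt_ext (V := C_R_NormedModule)); intros t Ht.
  rewrite Rmin_left, Rmax_right in Ht by auto; auto.
Qed.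

Lemma is_CI_ext_all (f g : R -> C) (a b : R) (v : C) :
  (forall t, f t = g t) -> is_CI f a b v -> is_CI g a b v.
Proof. intros H; apply (is_RInt_ext (V := C_R_NormedModule)); auto. Qed.

Lemma is_CI_Chasles (f : R -> C) (a b c : R) (v w : C) :
  is_CI f a b v -> is_CI f b c w -> is_CI f a c (v + w)%C.
Proof. intros H1 H2; apply (is_RInt_Chasles (V := C_R_NormedModule) f a b c v w H1 H2). Qed.

Lemma is_CI_swap (f : R -> C) (a b : R) (v : C) : is_CI f a b v -> is_CI f b a (- v)%C.
Proof. intros H; apply (is_RInt_swap (V := C_R_NormedModule) f b a v H). Qed.

Lemma is_CI_const (c : C) (a b : R) : is_CI (fun _ => c) a b (RtoC (b - a) * c)%C.
Proof.
  apply is_CI_pair; autorewrite with ReIm.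
  - replace ((b - a) * Re c - 0 * Im c) with ((b - a) * Re c) by ring.
    apply (is_RInt_const (V := R_NormedModule)).
  - replace ((b - a) * Im c + 0 * Re c) with ((b - a) * Im c) by ring.
    apply (is_RInt_const (V := R_NormedModule)).
Qed.

Lemma is_CI_Cmod_le (f : R -> C) (g : R -> R) (a b : R) (v : C) (w : R) :
  a <= b -> (forall t, a <= t <= b -> Cmod (f t) <= g t) ->
  is_CI f a b v -> is_RInt g a b w -> Cmod v <= w.
Proof.
  intros Hab H H1 H2; rewrite Cmod_norm.
  apply (norm_RInt_le (V := C_R_NormedModule) f g a b v w Hab); try assumption.
  intros t Ht; specialize (H t Ht); rewrite Cmod_norm in H; exact H.
Qed.

Lemma is_CI_Cmod_le_const (f : R -> C) (M a b : R) (v : C) :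
  a <= b -> (forall t, a <= t <= b -> Cmod (f t) <= M) ->
  is_CI f a b v -> Cmod v <= M * (b - a).
Proof.
  intros Hab H H1; apply (is_CI_Cmod_le f (fun _ => M) a b v); try assumption.
  rewrite Rmult_comm; apply (is_RInt_const (V := R_NormedModule)).
Qed.

Lemma ex_CI_rcont (f : R -> C) (a b : R) :
  a <= b -> (forall t, a <= t <= b -> rcont f t) -> exists v, is_CI f a b v.
Proof.
  intros Hab H; apply (ex_RInt_continuous (V := C_R_CompleteNormedModule) f a b).
  intros t Ht; rewrite Rmin_left, Rmax_right in Ht by auto. apply rcont_continuous, H, Ht.
Qed.

Lemma rcont_proj (p : C -> R) (f : R -> C) (t : R) :
  (forall z w, Rabs (p z - p w) <= Cmod (z - w)) -> rcont f t -> continuous (fun u => p (f u)) t.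
Proof.
  intros Hp H; apply filterlim_locally; intros eps; destruct (H eps (cond_pos eps)) as [d [Hd' K]].
  exists (mkposreal d Hd'); intros u Hu; eapply Rle_lt_trans; [ apply Hp | apply K, Hu ].
Qed.

Lemma Re_lipschitz (z w : C) : Rabs (Re z - Re w) <= Cmod (z - w).
Proof. rewrite <- Re_minus; apply Re_le_Cmod. Qed.

Lemma Im_lipschitz (z w : C) : Rabs (Im z - Im w) <= Cmod (z - w).
Proof. rewrite <- Im_minus; apply Im_le_Cmod. Qed.

Lemma dR_const_eq (D : R -> C) (a b : R) :
  a <= b -> (forall t, a <= t <= b -> rcont D t) -> (forall t, a < t < b -> dR D t 0) ->
  D b = D a.
Proof.
  intros Hab Hc Hd. assert (K : forall p : C -> R, (forall z w, Rabs (p z - p w) <= Cmod (z - w)) ->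
    (forall t, a < t < b -> is_derive (fun u => p (D u)) t 0) -> p (D b) = p (D a)).
  { intros p Hp Hpd. destruct (MVT_gen (fun u => p (D u)) a b (fun _ => 0)) as [c [_ E]].
    - intros t Ht; rewrite Rmin_left, Rmax_right in Ht by auto; apply Hpd, Ht.
    - intros t Ht; rewrite Rmin_left, Rmax_right in Ht by auto.
      apply continuity_pt_filterlim, (rcont_proj p D), Hc; auto.
    - lra. }
  apply C_ext; apply K; try apply Re_lipschitz; try apply Im_lipschitz; intros t Ht; apply (Hd t Ht).
Qed.

Lemma is_CI_dR (f : R -> C) (F : R -> C) (a b : R) :
  a <= b -> (forall t, a <= t <= b -> dR F t (f t)) ->
  (forall t, a <= t <= b -> rcont f t) -> is_CI f a b (F b - F a)%C.
Proof.
  intros Hab HF Hf. apply is_CI_pair; autorewrite with ReIm.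
  - apply (is_RInt_derive (V := R_CompleteNormedModule) (fun t => Re (F t)) (fun t => Re (f t))).
    + intros t Ht; rewrite Rmin_left, Rmax_right in Ht by auto; apply (HF t Ht).
    + intros t Ht; rewrite Rmin_left, Rmax_right in Ht by auto.
      apply (rcont_proj Re); [ apply Re_lipschitz | apply Hf, Ht ].
  - apply (is_RInt_derive (V := R_CompleteNormedModule) (fun t => Im (F t)) (fun t => Im (f t))).
    + intros t Ht; rewrite Rmin_left, Rmax_right in Ht by auto; apply (HF t Ht).
    + intros t Ht; rewrite Rmin_left, Rmax_right in Ht by auto.
      apply (rcont_proj Im); [ apply Im_lipschitz | apply Hf, Ht ].
Qed.

(** * Piecewise continuous functions *)

Definition llim (g : R -> C) (t : R) (v : C) : Prop := tends (before t) g v.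
Definition rlim (g : R -> C) (t : R) (v : C) : Prop := tends (after t) g v.

(** This is what [piecewise_smooth] yields for a velocity: one-sided limits everywhere and
    continuity off a finite set. The values at corners stay arbitrary, since [velocity] there is
    [Derive] at a point where the derivative need not exist. *)
Definition pwc (g : R -> C) : Prop :=
  (forall t, exists v, llim g t v) /\ (forall t, exists v, rlim g t v) /\
  exists l : list R, forall t, ~ In t l -> rcont g t.

Lemma rcont_llim (g : R -> C) (t : R) : rcont g t -> llim g t (g t).
Proof.
  intros H eps He; destruct (H eps He) as [d [Hd K]]; exists d; split; [ auto | ].
  intros u Hu; apply K, Rabs_def1; lra.
Qed.

Lemma rcont_rlim (g : R -> C) (t : R) : rcont g t -> rlim g t (g t).
Proof.
  intros H eps He; destruct (H eps He) as [d [Hd K]]; exists d; split; [ auto | ].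
  intros u Hu; apply K, Rabs_def1; lra.
Qed.

Lemma pwc_rcont (g : R -> C) : (forall t, rcont g t) -> pwc g.
Proof.
  intros H; split; [ | split ].
  - intros t; eexists; apply rcont_llim, H.
  - intros t; eexists; apply rcont_rlim, H.
  - exists nil; auto.
Qed.

Lemma pwc_map2 (op : C -> C -> C) (f g : R -> C) :
  (forall (F : (R -> Prop) -> Prop) v w, Filter F -> tends F f v -> tends F g w ->
    tends F (fun t => op (f t) (g t)) (op v w)) ->
  pwc f -> pwc g -> pwc (fun t => op (f t) (g t)).
Proof.
  intros H [Lf [Rf [lf Cf]]] [Lg [Rg [lg Cg]]]; split; [ | split ].
  - intros t; destruct (Lf t) as [v Hv], (Lg t) as [w Hw]; exists (op v w); apply H; auto using before_filter.
  - intros t; destruct (Rf t) as [v Hv], (Rg t) as [w Hw]; exists (op v w); apply H; auto using after_filter.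
  - exists (lf ++ lg); intros t Ht; apply H; [ apply nearR_filter | apply Cf | apply Cg ];
      intros K; apply Ht, in_or_app; auto.
Qed.

Lemma pwc_mult (f g : R -> C) : pwc f -> pwc g -> pwc (fun t => f t * g t)%C.
Proof. apply pwc_map2; intros; apply tends_mult; auto. Qed.

Lemma pwc_Cmod (g : R -> C) : pwc g -> pwc (fun t => RtoC (Cmod (g t))).
Proof.
  intros Hg; apply (pwc_map2 (fun v _ => RtoC (Cmod v)) g g); try assumption; intros F v w FF Hv _.
  revert Hv; apply tends_le; intros x; rewrite <- RtoC_minus, Cmod_R; apply Rabs_le; split.
  - generalize (Cmod_minus_ge v (g x)); rewrite Cmod_minus_sym; lra.
  - generalize (Cmod_minus_ge (g x) v); lra.
Qed.

(** Between two consecutive exceptional points a piecewise continuous function agrees with this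
    continuous one, and the Riemann integral ignores the end points. *)
Definition cont_ext (g : R -> C) (a b : R) (va vb : C) (t : R) : C :=
  if Rle_dec t a then va else if Rle_dec b t then vb else g t.

Lemma cont_ext_in (g : R -> C) (a b : R) (va vb : C) (t : R) :
  a < t < b -> cont_ext g a b va vb t = g t.
Proof.
  intros Ht; unfold cont_ext; destruct (Rle_dec t a); [ lra | ].
  destruct (Rle_dec b t); [ lra | reflexivity ].
Qed.

Lemma cont_ext_rcont (g : R -> C) (a b : R) (va vb : C) :
  a < b -> rlim g a va -> llim g b vb -> (forall t, a < t < b -> rcont g t) ->
  forall t, a <= t <= b -> rcont (cont_ext g a b va vb) t.
Proof.
  intros Hab Ha Hb Hg t Ht eps He. assert (P0 : forall v : C, Cmod (v - v) < eps).
  { intros v; replace (v - v)%C with (RtoC 0) by ring; rewrite Cmod_0; auto. }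
  destruct (Req_dec t a) as [->|Hta]. { destruct (Ha eps He) as [d [Hd K]].
    exists (Rmin d (b - a)); split; [ pos | intros u Hu ].
    generalize (Rmin_l d (b - a)), (Rmin_r d (b - a)); intros M1 M2. apply Rabs_def2 in Hu; unfold cont_ext.
    destruct (Rle_dec a a); [ | lra ].
    destruct (Rle_dec u a); [ apply P0 | destruct (Rle_dec b u); [ lra | apply K; lra ] ]. }
  destruct (Req_dec t b) as [->|Htb]. { destruct (Hb eps He) as [d [Hd K]].
    exists (Rmin d (b - a)); split; [ pos | intros u Hu ].
    generalize (Rmin_l d (b - a)), (Rmin_r d (b - a)); intros M1 M2. apply Rabs_def2 in Hu; unfold cont_ext.
    destruct (Rle_dec b a); [ lra | ]. destruct (Rle_dec b b); [ | lra ].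
    destruct (Rle_dec u a); [ lra | destruct (Rle_dec b u); [ apply P0 | apply K; lra ] ]. }
  destruct (Hg t) with (eps := eps) as [d [Hd K]]; [ lra | auto | ]. exists (Rmin d (Rmin (t - a) (b - t))).
  split; [ pos | intros u Hu ].
  generalize (Rmin_l d (Rmin (t - a) (b - t))), (Rmin_r d (Rmin (t - a) (b - t))),
    (Rmin_l (t - a) (b - t)), (Rmin_r (t - a) (b - t)); intros M1 M2 M3 M4.
  assert (Hu' := Rabs_def2 _ _ Hu). rewrite !cont_ext_in by lra; apply K; lra.
Qed.

(** Induction on the exceptional points: one inside the interval splits it, one outside is
    dropped. *)
Lemma ex_CI_pwc_aux (g : R -> C) : (forall t, exists v, llim g t v) -> (forall t, exists v, rlim g t v) ->
  forall (l : list R) (a b : R), a <= b ->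
  (forall t, a < t < b -> ~ In t l -> rcont g t) -> exists v, is_CI g a b v.
Proof.
  intros Lg Rg l; induction l as [|c l IH]; intros a b Hab Hg.
  - destruct Hab as [Hab| ->].
    2:{ exists (RtoC 0). apply (is_RInt_point (V := C_R_NormedModule)). }
    destruct (Rg a) as [va Ha], (Lg b) as [vb Hb].
    assert (Hc := cont_ext_rcont g a b va vb Hab Ha Hb (fun t Ht => Hg t Ht (fun H => H))).
    destruct (ex_CI_rcont _ a b (Rlt_le _ _ Hab) Hc) as [v Hv]; exists v.
    revert Hv; apply is_CI_ext; [ lra | intros; apply cont_ext_in; auto ].
  - destruct (Rlt_dec a c) as [Hac|Hac]; [ destruct (Rlt_dec c b) as [Hcb|Hcb] | ].
    + destruct (IH a c) as [v Hv]; [ | | destruct (IH c b) as [w Hw] ];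
        [ .. | exists (v + w)%C; eapply is_CI_Chasles; eassumption ];
        try lra; intros t Ht Hl; apply Hg; try lra; intros [->|Hin]; (lra || auto).
    + apply IH; [ lra | intros t Ht Hl; apply Hg; [ lra | intros [->|Hin]; (lra || auto) ] ].
    + apply IH; [ lra | intros t Ht Hl; apply Hg; [ lra | intros [->|Hin]; (lra || auto) ] ].
Qed.

Lemma ex_CI_pwc (g : R -> C) (a b : R) : pwc g -> exists v, is_CI g a b v.
Proof.
  intros [Lg [Rg [l Cg]]]; destruct (Rle_dec a b) as [H|H].
  - apply (ex_CI_pwc_aux g Lg Rg l); auto.
  - destruct (ex_CI_pwc_aux g Lg Rg l b a) as [v Hv]; [ lra | auto | ]. exists (- v)%C; apply is_CI_swap, Hv.
Qed.

Lemma CI_pwc (g : R -> C) (a b : R) : pwc g -> is_CI g a b (CI g a b).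
Proof. intros H; apply CI_correct, ex_CI_pwc, H. Qed.

Lemma pwc_primitive (g : R -> C) (a t : R) : pwc g ->
  rcont (CI g a) t /\ (rcont g t -> dR (CI g a) t (g t)).
Proof.
  intros Hg; split.
  - apply rcont_continuous, (continuous_RInt_1 (V := C_R_NormedModule) g a t).
    apply filter_forall; intros u; apply CI_pwc, Hg.
  - intros Ht; split.
    + apply (is_derive_RInt (V := R_NormedModule) (fun u => Re (g u)) (fun u => Re (CI g a u)) a).
      * apply filter_forall; intros u; apply is_CI_Re, CI_pwc, Hg.
      * apply (rcont_proj Re); [ apply Re_lipschitz | auto ].
    + apply (is_derive_RInt (V := R_NormedModule) (fun u => Im (g u)) (fun u => Im (CI g a u)) a).
      * apply filter_forall; intros u; apply is_CI_Im, CI_pwc, Hg.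
      * apply (rcont_proj Im); [ apply Im_lipschitz | auto ].
Qed.

Lemma dR_0_const (F : R -> C) (l : list R) : forall a b, a <= b ->
  (forall t, a <= t <= b -> rcont F t) -> (forall t, a < t < b -> ~ In t l -> dR F t 0) -> F b = F a.
Proof.
  induction l as [|c l IH]; intros a b Hab HF Hd; [ apply dR_const_eq; auto | ].
  destruct (Rlt_dec a c) as [Hac|Hac]; [ destruct (Rlt_dec c b) as [Hcb|Hcb]; [ transitivity (F c) | ] | ];
    apply IH; try lra; try (intros; apply HF; lra); intros t Ht Hl; apply Hd; try lra;
    intros [->|Hin]; (lra || auto).
Qed.

(** [F] and the indefinite integral of [g] both have derivative [g] off a finite set, so their
    continuous difference is constant by [dR_0_const]. *)
Lemma pw_ftc (F g : R -> C) (l : list R) (a b : R) :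
  pwc g -> a <= b -> (forall t, a <= t <= b -> rcont F t) ->
  (forall t, a < t < b -> ~ In t l -> dR F t (g t)) -> is_CI g a b (F b - F a)%C.
Proof.
  intros Hg Hab HF Hd; assert (E : (F b - CI g a b)%C = (F a - CI g a a)%C).
  { destruct Hg as [Lg [Rg [lg Cg]]]. assert (Hg : pwc g) by (repeat split; eauto).
    apply (dR_0_const (fun t => F t - CI g a t)%C (l ++ lg)); [ auto | | ].
    - intros t Ht; apply (rcont_ext (fun t => F t + (- (1)) * CI g a t)%C); [ intros; ring | ].
      apply rcont_plus, rcont_mult; [ auto | apply rcont_const | apply pwc_primitive, Hg ].
    - intros t Ht Hl; replace (RtoC 0) with (g t - g t)%C by ring.
      apply dR_minus; [ apply Hd | apply pwc_primitive, Cg ]; auto; intros H; apply Hl, in_or_app; auto. }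
  rewrite (CI_eq g a a 0) in E by apply (is_RInt_point (V := C_R_NormedModule)).
  replace (F b - F a)%C with (CI g a b); [ apply CI_pwc, Hg | ].
  replace (F b) with (F b - CI g a b + CI g a b)%C by ring; rewrite E; ring.
Qed.

(** * Integrals along segments depending holomorphically on the end point *)

(** Heine-Borel for a tolerance [d]: as [P] survives when [d] shrinks, the least of finitely many
    local tolerances serves everywhere. *)
Lemma uniform_on_segment (P : R -> R -> Prop) (a b : R) :
  (forall u d d', 0 < d' <= d -> P u d -> P u d') ->
  (forall u, a <= u <= b -> exists d, 0 < d /\
     forall u', a <= u' <= b -> Rabs (u' - u) < d -> P u' d) ->
  exists d, 0 < d /\ forall u, a <= u <= b -> P u d.
Proof.
  intros Hmon Hloc. assert (Hd : forall u, exists d : posreal, a <= u <= b ->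
    forall u', a <= u' <= b -> Rabs (u' - u) < d -> P u' d).
  { intros u; destruct (classic (a <= u <= b)) as [Hu|Hu].
    - destruct (Hloc u Hu) as [d [Hd K]]; exists (mkposreal d Hd); auto.
    - exists (mkposreal 1 Rlt_0_1); tauto. }
  set (delta := fun u => proj1_sig (constructive_indefinite_description _ (Hd u))).
  destruct (compactness_value_1d a b delta) as [d K]. exists d; split; [ apply cond_pos | intros u Hu ].
  (* Compactness comes under a double negation; it provides a tag [t] near [u] whose gauge is at
     least [d]. *)
  destruct (NNPP _ (K u Hu)) as [t [Ht [H1 H2]]].
  apply Hmon with (delta t); [ split; [ apply cond_pos | auto ] | ].
  unfold delta in *; destruct (constructive_indefinite_description _ (Hd t)) as [dt Hdt]. simpl in *; auto.
Qed.

Definition cvx (U : C -> Prop) : Prop :=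
  forall p z t, U p -> U z -> 0 <= t <= 1 -> U (p + RtoC t * (z - p))%C.
Definition opn (U : C -> Prop) : Prop := forall z, U z -> near z U.

Lemma cvx_ball (c : C) (r : R) : cvx (fun z => Cmod (z - c) < r).
Proof.
  intros p z t Hp Hz Ht. replace (p + RtoC t * (z - p) - c)%C with
    (RtoC (1 - t) * (p - c) + RtoC t * (z - c))%C by (rewrite RtoC_minus; ring).
  lt_via Cmod_triangle. rewrite !Cmod_mult, !Cmod_R, !Rabs_pos_eq by lra.
  destruct (Req_dec t 0) as [->|H0]; [ lra | ].
  assert (t * Cmod (z - c) < t * r) by (apply Rmult_lt_compat_l; lra).
  assert ((1 - t) * Cmod (p - c) <= (1 - t) * r) by (apply Rmult_le_compat_l; lra). lra.
Qed.

Lemma opn_ball (c : C) (r : R) : opn (fun z => Cmod (z - c) < r).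
Proof. intros z; apply near_ball. Qed.

Lemma segment_mean_value (h h' : C -> C) (k x y : C) (M : R) :
  (forall t, 0 <= t <= 1 -> cder h (x + RtoC t * (y - x))%C (h' (x + RtoC t * (y - x))%C)) ->
  (forall t, 0 <= t <= 1 -> Cmod (h' (x + RtoC t * (y - x))%C - k) <= M) ->
  Cmod (h y - h x - k * (y - x)) <= M * Cmod (y - x).
Proof.
  intros Hd HM.
  generalize (mean_value_ineq (fun t => h (x + RtoC t * (y - x))%C - (0 + RtoC t * (k * (y - x))))%C
    (fun t => h' (x + RtoC t * (y - x))%C * (y - x) - k * (y - x))%C 0 1 (M * Cmod (y - x))).
  replace (x + RtoC 1 * (y - x))%C with y by ring. replace (x + RtoC 0 * (y - x))%C with x by ring.
  replace (h y - (0 + RtoC 1 * (k * (y - x))) - (h x - (0 + RtoC 0 * (k * (y - x)))))%C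
    with (h y - h x - k * (y - x))%C by ring.
  intros H; le_via H; [ lra | | | lra ].
  - intros t Ht; apply dR_minus; [ | apply dR_line ].
    apply (dR_comp h (fun t => x + RtoC t * (y - x))%C); [ apply Hd, Ht | apply dR_line ].
  - intros t Ht. replace (h' (x + RtoC t * (y - x)) * (y - x) - k * (y - x))%C
      with ((h' (x + RtoC t * (y - x)) - k) * (y - x))%C by ring.
    rewrite Cmod_mult; apply Rmult_le_compat_r; [ apply Cmod_ge_0 | apply HM, Ht ].
Qed.

(** The weight [c] makes the family stable under differentiation in [z], which replaces [c u] by
    [u * c u] and [h] by its derivative. Analyticity then follows by one induction on the order. *)
Definition seg_int (c : R -> C) (h : C -> C) (p z : C) : C :=
  CI (fun u => c u * h (p + RtoC u * (z - p)))%C 0 1.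

Lemma seg_int_correct (c : R -> C) (h : C -> C) (U : C -> Prop) (p z : C) :
  (forall u, rcont c u) -> cvx U -> (forall y, U y -> ccont h y) -> U p -> U z ->
  is_CI (fun u => c u * h (p + RtoC u * (z - p)))%C 0 1 (seg_int c h p z).
Proof.
  intros Hc HU Hh Hp Hz; apply CI_correct, ex_CI_rcont; [ lra | intros t Ht ].
  apply rcont_mult; [ apply Hc | ].
  apply (rcont_comp h (fun u => p + RtoC u * (z - p))%C); [ apply Hh, HU; auto | apply rcont_line ].
Qed.

(** A bound [M] is encoded as the tolerance [d = 1 / M], so that [uniform_on_segment] applies. *)
Lemma loc_bounded (c : R -> C) (a b : R) :
  (forall u, a <= u <= b -> exists M, nearR u (fun x => Cmod (c x) <= M)) ->
  exists M, 0 < M /\ forall u, a <= u <= b -> Cmod (c u) <= M.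
Proof.
  intros H; destruct (uniform_on_segment (fun u d => Cmod (c u) <= / d) a b) as [d [Hd K]].
  - intros u d d' Hd K; le_via K; apply Rinv_le_contravar; lra.
  - intros u Hu; destruct (H u Hu) as [M [d [Hd K]]]; assert (P := Rabs_pos M).
    exists (Rmin d (/ (Rabs M + 1))); split; [ pos | intros x _ Hx ].
    le_via (K x (Rlt_le_trans _ _ _ Hx (Rmin_l _ _))).
    apply Rle_trans with (Rabs M + 1); [ generalize (Rle_abs M); lra | ].
    rewrite <- (Rinv_inv (Rabs M + 1)) at 1; apply Rinv_le_contravar; [ pos | apply Rmin_r ].
  - exists (/ d); split; [ pos | auto ].
Qed.

Lemma rcont_bounded (c : R -> C) (a b : R) : a <= b ->
  (forall u, a <= u <= b -> rcont c u) -> exists M, 0 < M /\ forall u, a <= u <= b -> Cmod (c u) <= M.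
Proof.
  intros _ Hc; apply loc_bounded; intros u Hu; exists (Cmod (c u) + 1).
  generalize (Hc u Hu 1 Rlt_0_1); apply filter_imp; intros x; generalize (Cmod_minus_ge (c x) (c u)); lra.
Qed.

Lemma seg_int_cder (c : R -> C) (h h' : C -> C) (U : C -> Prop) (p z : C) :
  (forall u, rcont c u) -> cvx U -> opn U -> U p -> U z ->
  (forall y, U y -> cder h y (h' y)) -> (forall y, U y -> ccont h' y) ->
  cder (seg_int c h p) z (seg_int (fun u => RtoC u * c u)%C h' p z).
Proof.
  intros Hc HU HO Hp Hz Hh Hh' eps He. destruct (rcont_bounded c 0 1) as [B [HB KB]]; [ lra | auto | ].
  set (e := eps / (2 * B)). assert (He' : 0 < e) by (unfold e; pos).
  set (s := fun x u => (p + RtoC u * (x - p))%C).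
  (* A tube of radius [d] around the segment, inside [U], on which [h'] stays within [2 e] of its
     values on the segment: this makes the remainder uniform in the variable of integration. *)
  destruct (uniform_on_segment (fun u d => forall w, Cmod (w - s z u) < d ->
    U w /\ Cmod (h' w - h' (s z u)) <= 2 * e) 0 1) as [d [Hd K]].
  - intros u d d' Hd' H w Hw; apply H; lra.
  - intros u0 Hu0; assert (Us0 : U (s z u0)) by (apply HU; auto).
    destruct (HO _ Us0) as [r1 [Hr1 K1]]. destruct (Hh' _ Us0 e He') as [r2 [Hr2 K2]].
    assert (R1 := Rmin_l r1 r2). assert (R2 := Rmin_r r1 r2). set (r := Rmin r1 r2) in *.
    assert (Hr : 0 < r) by pos. destruct (rcont_line p (z - p) u0 (r / 2)) as [d [Hd K]]; [ lra | ].
    exists (Rmin d (r / 2)); split; [ pos | intros u Hu Huu w Hw ].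
    assert (M1 := Rmin_l d (r / 2)). assert (M2 := Rmin_r d (r / 2)).
    specialize (K u ltac:(lra)); fold (s z u) (s z u0) in K.
    assert (H1 := Cmod_dist_triangle w (s z u) (s z u0)). split; [ apply K1; lra | ].
    assert (A1 := K2 w ltac:(lra)). assert (A2 := K2 (s z u) ltac:(lra)).
    generalize (Cmod_dist_triangle (h' w) (h' (s z u0)) (h' (s z u))); rewrite (Cmod_minus_sym (h' (s z u0))); lra.
  - exists d; split; [ auto | intros y Hy ].
    assert (Hs : forall u t, 0 <= u <= 1 -> 0 <= t <= 1 -> Cmod (s z u + RtoC t * (s y u - s z u) - s z u) < d).
    { intros u t Hu Ht; unfold s.
      replace (p + RtoC u * (z - p) + RtoC t * (p + RtoC u * (y - p) - (p + RtoC u * (z - p)))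
        - (p + RtoC u * (z - p)))%C with (RtoC t * (RtoC u * (y - z)))%C by ring.
      rewrite !Cmod_mult, !Cmod_R, !Rabs_pos_eq by lra. assert (P := Cmod_ge_0 (y - z)).
      assert (u * Cmod (y - z) <= Cmod (y - z)) by nra. nra. }
    assert (Uy : U y). { apply (K 1 ltac:(lra)); generalize (Hs 1 1 ltac:(lra) ltac:(lra)); unfold s.
      match goal with |- Cmod ?a < _ -> Cmod ?b < _ => replace b with a by ring end; auto. }
    assert (Hhc : forall y, U y -> ccont h y) by (intros; eapply cder_ccont, Hh; auto).
    assert (I1 := seg_int_correct c h U p y Hc HU Hhc Hp Uy).
    assert (I2 := seg_int_correct c h U p z Hc HU Hhc Hp Hz).
    assert (I3 := seg_int_correct (fun u => RtoC u * c u)%C h' U p z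
      (fun u => rcont_mult _ _ _ (rcont_RtoC u) (Hc u)) HU Hh' Hp Hz).
    assert (I4 := is_CI_minus _ _ _ _ _ _ (is_CI_minus _ _ _ _ _ _ I1 I2) (is_CI_scal (y - z)%C _ _ _ _ I3)).
    replace (seg_int c h p y - seg_int c h p z - seg_int (fun u : R => RtoC u * c u) h' p z * (y - z))%C with
      (seg_int c h p y - seg_int c h p z - (y - z) * seg_int (fun u : R => RtoC u * c u)%C h' p z)%C by ring.
    replace (eps * Cmod (y - z)) with (B * (2 * e * Cmod (y - z)) * (1 - 0)) by (unfold e; field; lra).
    eapply is_CI_Cmod_le_const; [ lra | | apply I4 ]. intros t Ht; cbv beta.
    replace (c t * h (p + RtoC t * (y - p)) - c t * h (p + RtoC t * (z - p)) -
      (y - z) * (RtoC t * c t * h' (p + RtoC t * (z - p))))%C with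
      (c t * (h (p + RtoC t * (y - p)) - h (p + RtoC t * (z - p))
      - RtoC t * h' (p + RtoC t * (z - p)) * (y - z)))%C by ring.
    rewrite Cmod_mult; apply Rmult_le_compat; try apply Cmod_ge_0; [ apply KB, Ht | ].
    replace (RtoC t * h' (p + RtoC t * (z - p)) * (y - z))%C with (h' (s z t) * (s y t - s z t))%C by (unfold s; ring).
    apply Rle_trans with (2 * e * Cmod (s y t - s z t)).
    + apply (segment_mean_value h h'); intros u Hu; [ apply Hh | ]; apply (K t Ht), Hs; auto.
    + apply Rmult_le_compat_l; [ lra | ].
      replace (s y t - s z t)%C with (RtoC t * (y - z))%C by (unfold s; ring).
      rewrite Cmod_mult, Cmod_R, Rabs_pos_eq by lra; generalize (Cmod_ge_0 (y - z)); nra.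
Qed.

Lemma seg_int_sm (U : C -> Prop) (p : C) : cvx U -> opn U -> U p ->
  forall (k : nat) (c : R -> C) (h : C -> C), (forall u, rcont c u) ->
  (forall y, U y -> an h y) -> forall z, U z -> sm k (seg_int c h p) z.
Proof.
  intros HU HO Hp; induction k as [|k IH]; intros c h Hc Hh z Hz.
  - eapply cder_ccont, (seg_int_cder c h (dC h) U); try assumption.
    + intros; apply an_cder; auto.
    + intros; apply an_ccont, an_dC; auto.
  - exists (seg_int (fun u => RtoC u * c u)%C (dC h) p); split.
    + generalize (HO z Hz); apply filter_imp; intros y Hy. apply (seg_int_cder c h (dC h) U); try assumption.
      * intros; apply an_cder; auto.
      * intros; apply an_ccont, an_dC; auto.
    + apply IH; [ | intros; apply an_dC; auto | auto ].
      intros u; apply rcont_mult; [ apply rcont_RtoC | apply Hc ].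
Qed.

Lemma seg_int_an (U : C -> Prop) (c : R -> C) (h : C -> C) (p z : C) :
  cvx U -> opn U -> U p -> (forall u, rcont c u) -> (forall y, U y -> an h y) ->
  U z -> an (seg_int c h p) z.
Proof. intros; intro k; apply (seg_int_sm U); auto. Qed.

Definition prim (h : C -> C) (p z : C) : C := ((z - p) * seg_int (fun _ => 1%C) h p z)%C.

Lemma prim_cder (U : C -> Prop) (h : C -> C) (p z : C) :
  cvx U -> opn U -> U p -> (forall y, U y -> an h y) -> U z -> cder (prim h p) z (h z).
Proof.
  intros HU HO Hp Hh Hz. assert (Hc1 : forall u, rcont (fun _ => 1%C) u) by (intros; apply rcont_const).
  assert (D := seg_int_cder (fun _ => 1%C) h (dC h) U p z Hc1 HU HO Hp Hz
    (fun y Hy => an_cder _ _ (Hh y Hy)) (fun y Hy => an_ccont _ _ (an_dC _ _ (Hh y Hy)))).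
  (* The product rule in [z] produces the integral over [[0, 1]] of the [u]-derivative of
     [u * h (p + u (z - p))], which equals [h z]. *)
  assert (E : h z = (1 * seg_int (fun _ => 1%C) h p z +
    (z - p) * seg_int (fun u => RtoC u * 1)%C (dC h) p z)%C).
  { assert (I1 := seg_int_correct (fun _ => 1%C) h U p z Hc1 HU (fun y Hy => an_ccont _ _ (Hh y Hy)) Hp Hz).
    assert (I2 := seg_int_correct (fun u => RtoC u * 1)%C (dC h) U p z
      (fun u => rcont_mult _ _ _ (rcont_RtoC u) (Hc1 u)) HU
      (fun y Hy => an_ccont _ _ (an_dC _ _ (Hh y Hy))) Hp Hz).
    assert (I3 := is_CI_plus _ _ _ _ _ _ I1 (is_CI_scal (z - p)%C _ _ _ _ I2)).
    rewrite Cmult_1_l; symmetry; refine (is_CI_unique _ _ _ _ _ I3 _).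
    set (F := fun u : R => (RtoC u * h (p + RtoC u * (z - p)))%C). replace (h z) with (F 1 - F 0)%C.
    2:{ unfold F; replace (p + RtoC 1 * (z - p))%C with z by ring; ring. } apply is_CI_dR; [ lra | | ].
    - intros t Ht. assert (K : dR F t (1 * h (p + RtoC t * (z - p)) +
        RtoC t * (dC h (p + RtoC t * (z - p)) * (z - p)))%C).
      { apply (dR_mult RtoC (fun u => h (p + RtoC u * (z - p)))%C);
          [ apply (dR_RtoC (fun u => u)), (is_derive_id (K := R_AbsRing)) | ].
        apply (dR_comp h (fun u => p + RtoC u * (z - p))%C); [ apply an_cder; auto | apply dR_line ]. }
      replace (1 * h (p + RtoC t * (z - p)) + (z - p) * (RtoC t * 1 * dC h (p + RtoC t * (z - p))))%C with
        (1 * h (p + RtoC t * (z - p)) + RtoC t * (dC h (p + RtoC t * (z - p)) * (z - p)))%C by ring.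
      exact K.
    - intros t Ht. apply rcont_plus.
      + apply rcont_mult; [ apply rcont_const | ].
        apply (rcont_comp h (fun u => p + RtoC u * (z - p))%C); [ apply an_ccont; auto | apply rcont_line ].
      + apply rcont_mult; [ apply rcont_const | apply rcont_mult ].
        * apply rcont_mult; [ apply rcont_RtoC | apply rcont_const ].
        * apply (rcont_comp (dC h) (fun u => p + RtoC u * (z - p))%C);
            [ apply an_ccont, an_dC; auto | apply rcont_line ]. }
  rewrite E; apply (cder_mult (fun z => z - p)%C).
  - apply (cder_ext (fun y => 1 * y + - p)%C); [ intros; ring | apply cder_scal_id ].
  - exact D.
Qed.

Lemma prim_an (U : C -> Prop) (h : C -> C) (p z : C) :
  cvx U -> opn U -> U p -> (forall y, U y -> an h y) -> U z -> an (prim h p) z.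
Proof.
  intros HU HO Hp Hh Hz; apply an_mult.
  - apply an_minus; [ apply an_id | apply an_const ].
  - apply (seg_int_an U); try assumption; intros; apply rcont_const.
Qed.

Lemma prim_self (h : C -> C) (p : C) : prim h p p = 0%C.
Proof. unfold prim; ring. Qed.

Lemma prim_diff_bound (U : C -> Prop) (g h : C -> C) (p z : C) (M : R) :
  cvx U -> opn U -> U p -> U z -> (forall y, U y -> an g y) -> (forall y, U y -> an h y) ->
  (forall t, 0 <= t <= 1 -> Cmod (g (p + RtoC t * (z - p)) - h (p + RtoC t * (z - p)))%C <= M) ->
  Cmod (prim g p z - prim h p z) <= M * Cmod (z - p).
Proof.
  intros HU HO Hp Hz Hg Hh HM. replace (prim g p z - prim h p z)%C with (prim g p z + - (1) * prim h p z
    - (prim g p p + - (1) * prim h p p) - 0 * (z - p))%C by (rewrite !prim_self; ring).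
  apply (segment_mean_value (fun y => prim g p y + - (1) * prim h p y)%C (fun y => g y + - (1) * h y)%C).
  - intros t Ht; apply cder_plus, cder_scal; apply (prim_cder U); auto.
  - intros t Ht; eapply Rle_trans; [ | apply HM, Ht ]; apply Req_le, (f_equal Cmod); ring.
Qed.

Lemma cder_0_const (U : C -> Prop) (f : C -> C) (p z : C) :
  cvx U -> U p -> U z -> (forall y, U y -> cder f y 0) -> f z = f p.
Proof.
  intros HU Hp Hz Hf. assert (K : forall t, 0 <= t <= 1 -> dR (fun u => f (p + RtoC u * (z - p))%C) t 0).
  { intros t Ht; replace (RtoC 0) with (0 * (z - p))%C by ring.
    apply (dR_comp f (fun u => p + RtoC u * (z - p))%C); [ apply Hf, HU; auto | apply dR_line ]. }
  assert (E : f (p + RtoC 1 * (z - p))%C = f (p + RtoC 0 * (z - p))%C).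
  { apply (dR_const_eq (fun u => f (p + RtoC u * (z - p))%C)); [ lra | | ].
    - intros t Ht; eapply dR_rcont, K, Ht.
    - intros t Ht; apply K; lra. }
  replace (p + RtoC 1 * (z - p))%C with z in E by ring. replace (p + RtoC 0 * (z - p))%C with p in E by ring.
  exact E.
Qed.

(** Hadamard's lemma: the quotient is the integral of the derivative along the segment from [p],
    hence analytic at [p] too. It lowers the order of a pole in [partial_fractions]. *)
Lemma taylor_quotient (U : C -> Prop) (h : C -> C) (p : C) :
  cvx U -> opn U -> U p -> (forall y, U y -> an h y) ->
  exists h1, (forall y, U y -> an h1 y) /\
    forall y, U y -> h y = (h p + (y - p) * h1 y)%C.
Proof.
  intros HU HO Hp Hh; exists (seg_int (fun _ => 1%C) (dC h) p).
  assert (Hh' : forall y, U y -> an (dC h) y) by (intros; apply an_dC; auto). split.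
  - intros y Hy; apply (seg_int_an U); try assumption; intros; apply rcont_const.
  - intros y Hy; change (h y = (h p + prim (dC h) p y)%C).
    assert (E := cder_0_const U (fun z => h z + - (1) * prim (dC h) p z)%C p y HU Hp Hy); cbv beta in E.
    rewrite prim_self in E; transitivity (h y + - (1) * prim (dC h) p y + prim (dC h) p y)%C; [ ring | ].
    rewrite E; [ ring | intros z Hz; apply (cder_eq _ _ (dC h z + - (1) * dC h z)%C); [ | ring ] ].
    apply cder_plus; [ apply an_cder; auto | apply cder_scal, (prim_cder U); auto ].
Qed.

(** * The double product *)

Definition Csum (l : list C) : C := fold_right Cplus (RtoC 0) l.
Definition Rsum (l : list R) : R := fold_right Rplus 0 l.

Lemma Csum_app (l m : list C) : Csum (l ++ m) = (Csum l + Csum m)%C.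
Proof. induction l as [|x l IH]; simpl; [ ring | rewrite IH; ring ]. Qed.

Lemma Rsum_app (l m : list R) : Rsum (l ++ m) = Rsum l + Rsum m.
Proof. induction l as [|x l IH]; simpl; [ ring | rewrite IH; ring ]. Qed.

Lemma Cprod_app (l m : list C) : Cprod (l ++ m) = (Cprod l * Cprod m)%C.
Proof. induction l as [|x l IH]; simpl; [ ring | rewrite IH; ring ]. Qed.

Lemma Cprod_perm (l m : list C) : Permutation l m -> Cprod l = Cprod m.
Proof. induction 1; simpl; try congruence; ring. Qed.

Lemma Cprod_neq_0 (l : list C) : (forall x, In x l -> x <> 0%C) -> Cprod l <> 0%C.
Proof.
  induction l as [|x l IH]; simpl; intros H.
  - intros E; apply (f_equal Re) in E; simpl in E; lra.
  - apply Cmult_neq_0; auto.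
Qed.

Lemma Cprod_eq_0 (l : list C) : Cprod l = 0%C -> In (RtoC 0) l.
Proof.
  intros H; apply NNPP; intros K; revert H; apply Cprod_neq_0. intros x Hx ->; auto.
Qed.

Lemma Cprod_in_0 (l : list C) : In (RtoC 0) l -> Cprod l = 0%C.
Proof.
  induction l as [|x l IH]; simpl; [ tauto | intros [->|H] ]; [ ring | rewrite (IH H); ring ].
Qed.

Lemma Cprod_map_mult {A : Type} (f g : A -> C) (l : list A) :
  Cprod (map (fun a => f a * g a)%C l) = (Cprod (map f l) * Cprod (map g l))%C.
Proof. induction l as [|x l IH]; simpl; [ ring | rewrite IH; ring ]. Qed.

Lemma Cprod_bounds {A : Type} (f : A -> C) (a b : A -> R) (l : list A) :
  (forall x, In x l -> exp (a x - b x) <= Cmod (f x) <= exp (a x + b x)) ->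
  exp (Rsum (map a l) - Rsum (map b l)) <= Cmod (Cprod (map f l))
    <= exp (Rsum (map a l) + Rsum (map b l)).
Proof.
  induction l as [|x l IH]; simpl; intros H.
  - rewrite Rminus_0_r, Rplus_0_r, exp_0, Cmod_1; lra.
  - rewrite Cmod_mult. replace (a x + Rsum (map a l) - (b x + Rsum (map b l))) with
      ((a x - b x) + (Rsum (map a l) - Rsum (map b l))) by ring.
    replace (a x + Rsum (map a l) + (b x + Rsum (map b l))) with
      ((a x + b x) + (Rsum (map a l) + Rsum (map b l))) by ring.
    rewrite (exp_plus (a x - b x)), (exp_plus (a x + b x)).
    destruct (H x (or_introl eq_refl)) as [H1 H2]; destruct IH as [H3 H4]; [ auto | ].
    split; apply Rmult_le_compat; try assumption; try (pos); apply Cmod_ge_0.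
Qed.

Definition lat (tau : R) (kl : nat * nat) : R := INR (fst kl) * tau + INR (snd kl).

(** The pairs with maximum [i]. The squares along which the double product is taken are unions of
    shells, and on shell [i] all [k tau + l] are comparable to [i], so double sums become single
    series. *)
Definition shell (i : nat) : list (nat * nat) :=
  map (fun l => (i, l)) (seq 0 (S i)) ++ map (fun k => (k, i)) (seq 0 i).

Definition shells (a n : nat) : list (nat * nat) := flat_map shell (seq a n).

Lemma shells_S (a n : nat) : shells a (S n) = shells a n ++ shell (a + n).
Proof. unfold shells; rewrite seq_S, flat_map_app; simpl; rewrite app_nil_r; reflexivity. Qed.

Lemma shells_add (a n m : nat) : shells a (n + m) = shells a n ++ shells (a + n) m.
Proof. unfold shells; rewrite seq_app, flat_map_app; reflexivity. Qed.

Lemma list_prod_snoc_r {A B : Type} (l : list A) (m : list B) (y : B) :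
  Permutation (list_prod l (m ++ [y])) (list_prod l m ++ map (fun x => (x, y)) l).
Proof.
  induction l as [|x l IH]; simpl; [ constructor | ].
  rewrite map_app, <- !app_assoc; apply Permutation_app_head; simpl. rewrite IH; apply Permutation_middle.
Qed.

Lemma list_prod_snoc_l {A B : Type} (l : list A) (m : list B) (x : A) :
  list_prod (l ++ [x]) m = list_prod l m ++ map (fun y => (x, y)) m.
Proof.
  induction l as [|a l IH]; simpl; [ apply app_nil_r | rewrite IH, app_assoc; reflexivity ].
Qed.

Lemma box_shells (n : nat) :
  Permutation (list_prod (seq 0 (S n)) (seq 0 (S n))) (shells 0 (S n)).
Proof.
  induction n as [|n IH]; [ simpl; apply Permutation_refl | ].
  rewrite shells_S, <- IH, (seq_S (S n)), Nat.add_0_l.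
  rewrite list_prod_snoc_l, list_prod_snoc_r, <- app_assoc.
  apply Permutation_app_head; unfold shell; rewrite (seq_S (S n)), Nat.add_0_l. apply Permutation_app_comm.
Qed.

Lemma in_shell (i : nat) (kl : nat * nat) :
  In kl (shell i) -> (fst kl = i /\ snd kl <= i \/ fst kl <= i /\ snd kl = i)%nat.
Proof.
  unfold shell; rewrite in_app_iff, !in_map_iff; intros [[l [<- H]]|[k [<- H]]];
    apply in_seq in H; simpl; lia.
Qed.

Lemma length_shell (i : nat) : length (shell i) = (2 * i + 1)%nat.
Proof. unfold shell; rewrite length_app, !length_map, !length_seq; lia. Qed.

Lemma in_shells (a n : nat) (kl : nat * nat) :
  In kl (shells a n) -> exists i, (a <= i < a + n)%nat /\ In kl (shell i).
Proof.
  unfold shells; rewrite in_flat_map; intros [i [H1 H2]]; apply in_seq in H1; eauto.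
Qed.

Definition cmin (tau : R) : R := Rmin tau 1.

Lemma cmin_pos (tau : R) : 0 < tau -> 0 < cmin tau.
Proof. intros; apply Rmin_pos; lra. Qed.

Lemma lat_shell (tau : R) (i : nat) (kl : nat * nat) : 0 < tau -> In kl (shell i) ->
  cmin tau * INR i <= lat tau kl <= (tau + 1) * INR i.
Proof.
  intros Ht H; apply in_shell in H; unfold lat. assert (C1 : cmin tau <= tau) by apply Rmin_l.
  assert (C2 : cmin tau <= 1) by apply Rmin_r. destruct kl as [k l]; simpl in *.
  assert (Pk := pos_INR k). assert (Pl := pos_INR l).
  destruct H as [[-> H]|[H ->]]; apply le_INR in H; split; nra.
Qed.

Lemma lat_nonneg (tau : R) (kl : nat * nat) : 0 < tau -> 0 <= lat tau kl.
Proof.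
  intros; unfold lat; generalize (pos_INR (fst kl)) (pos_INR (snd kl)); nra.
Qed.

Lemma lat_eq_0 (tau : R) (kl : nat * nat) : 0 < tau -> lat tau kl = 0 -> kl = (0, 0)%nat.
Proof.
  destruct kl as [k l]; unfold lat; simpl; intros Ht H. generalize (pos_INR k) (pos_INR l); intros.
  f_equal; apply INR_eq; simpl; nra.
Qed.

Lemma barnes_factor_lat (tau : R) (z : C) (kl : nat * nat) : kl <> (0, 0)%nat ->
  barnes_factor tau z kl =
  ((1 + z / RtoC (lat tau kl)) *
   Cexp (- (z / RtoC (lat tau kl)) + z ^ 2 / (RtoC 2 * RtoC (lat tau kl) ^ 2)))%C.
Proof.
  destruct kl as [k l]; intros H; unfold barnes_factor, lat; simpl fst; simpl snd.
  destruct k as [|k]; [ destruct l as [|l]; [ congruence | ] | ]; reflexivity.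
Qed.

(** * Limits of complex sequences *)

Definition cvg (u : nat -> C) (l : C) : Prop := tends eventually u l.

Lemma cvg_unique (u : nat -> C) (l m : C) : cvg u l -> cvg u m -> l = m.
Proof.
  intros Hl Hm; apply Cmod_lt_eq; intros eps He.
  destruct (Hl (eps / 2)) as [N1 H1]; [ lra | ]. destruct (Hm (eps / 2)) as [N2 H2]; [ lra | ].
  specialize (H1 (N1 + N2)%nat ltac:(lia)); specialize (H2 (N1 + N2)%nat ltac:(lia)).
  generalize (Cmod_dist_triangle l (u (N1 + N2)%nat) m); rewrite (Cmod_minus_sym l (u _)); lra.
Qed.

Lemma cvg_ext (u v : nat -> C) (l : C) (N : nat) :
  (forall n, (N <= n)%nat -> u n = v n) -> cvg u l -> cvg v l.
Proof. intros E; apply tends_ext; exists N; auto. Qed.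

Lemma cvg_const (c : C) : cvg (fun _ => c) c.
Proof. apply tends_const. Qed.

Lemma cvg_mult (u v : nat -> C) (l m : C) :
  cvg u l -> cvg v m -> cvg (fun n => u n * v n)%C (l * m)%C.
Proof. apply tends_mult. Qed.

Lemma cvg_comp (f : C -> C) (u : nat -> C) (l : C) : ccont f l -> cvg u l -> cvg (fun n => f (u n)) (f l).
Proof. apply tends_comp. Qed.

Lemma cvg_inv (u : nat -> C) (l : C) : l <> 0%C -> cvg u l -> cvg (fun n => / u n)%C (/ l)%C.
Proof. intros H; apply (cvg_comp (fun z => / z)%C), ccont_inv_id, H. Qed.

Lemma cvg_filterlim (u : nat -> C) (l : C) :
  cvg u l <-> filterlim u eventually (locally (T := C_UniformSpace) l).
Proof. exact (tends_filterlim eventually u l). Qed.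

Lemma inv_INR_small (B eps : R) : 0 < eps -> exists N : nat, forall n, (N <= n)%nat ->
  B / (INR n + 1) < eps.
Proof.
  intros He. destruct (archimed_cor1 (eps / (Rabs B + 1))) as [N [H1 H2]].
  { apply Rdiv_lt_0_compat; [ auto | generalize (Rabs_pos B); lra ]. } exists N; intros n Hn.
  assert (0 < INR N) by (apply lt_0_INR; auto). assert (INR N <= INR n) by (apply le_INR; auto).
  assert (P := Rabs_pos B). apply Rle_lt_trans with ((Rabs B + 1) * / INR N).
  - unfold Rdiv; apply Rle_trans with ((Rabs B + 1) * / (INR n + 1)).
    + apply Rmult_le_compat_r; [ pos | ]. generalize (Rle_abs B); lra.
    + apply Rmult_le_compat_l; [ lra | apply Rinv_le_contravar; lra ].
  - apply (Rmult_lt_compat_l (Rabs B + 1)) in H1; [ | lra ].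
    replace ((Rabs B + 1) * (eps / (Rabs B + 1))) with eps in H1 by (field; lra). auto.
Qed.

(** Telescoping with a bootstrap: the increment at [n] may be estimated from the bound already known
    for [u n - u 0]. Products need this, their increments being proportional to [u n]. *)
Lemma telescope_le (u : nat -> C) (e : nat -> R) :
  (forall n, Cmod (u n - u 0%nat) <= e 0%nat - e n -> Cmod (u (S n) - u n) <= e n - e (S n)) ->
  forall n n', (n <= n')%nat -> Cmod (u n' - u n) <= e n - e n'.
Proof.
  intros H. assert (K : forall n, n = 0%nat \/ (forall m, Cmod (u m - u 0%nat) <= e 0%nat - e m) ->
    forall n', (n <= n')%nat -> Cmod (u n' - u n) <= e n - e n').
  { intros n Hn n' H'; induction H' as [|n' H' IH].
    - replace (u n - u n)%C with (RtoC 0) by ring; rewrite Cmod_0; lra.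
    - le_via (Cmod_dist_triangle _ (u n')).
      assert (Cmod (u (S n') - u n') <= e n' - e (S n')) by (apply H; destruct Hn as [->|Hn]; auto). lra. }
  intros n; apply K; right; intros m; apply (K 0%nat); [ auto | lia ].
Qed.

Lemma cvg_cauchy (u : nat -> C) :
  (forall eps, 0 < eps -> exists N : nat, forall n n', (N <= n)%nat -> (N <= n')%nat ->
    Cmod (u n - u n') < eps) -> exists L, cvg u L.
Proof.
  intros H. assert (K : forall p : C -> R, (forall z w, Rabs (p z - p w) <= Cmod (z - w)) ->
    exists l, Un_cv (fun n => p (u n)) l).
  { intros p Hp. destruct (Rcomplete.R_complete (fun n => p (u n))) as [l Hl]; [ | exists l; exact Hl ].
    intros eps He; destruct (H eps He) as [N HN]. exists N; intros n n' Hn Hn'; unfold R_dist, Rdist.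
    lt_via Hp; apply HN; lia. }
  destruct (K Re) as [x Hx]; [ intros; rewrite <- Re_minus; apply Re_le_Cmod | ].
  destruct (K Im) as [y Hy]; [ intros; rewrite <- Im_minus; apply Im_le_Cmod | ].
  exists (x, y); intros eps He.
  destruct (Hx (eps / 2)) as [N1 H1]; [ lra | ]. destruct (Hy (eps / 2)) as [N2 H2]; [ lra | ].
  exists (N1 + N2)%nat; intros n Hn.
  specialize (H1 n ltac:(lia)); specialize (H2 n ltac:(lia)); unfold R_dist, Rdist in *.
  lt_via Cmod_le_Re_Im; autorewrite with ReIm; lra.
Qed.

Lemma cauchy_rate (P : nat -> C) (B : R) :
  (forall n n', (n <= n')%nat -> Cmod (P n' - P n) <= B / (INR n + 1)) ->
  exists L, forall n, Cmod (P n - L) <= B / (INR n + 1).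
Proof.
  intros H; destruct (cvg_cauchy P) as [L HL].
  - intros eps He; destruct (inv_INR_small B eps He) as [N HN]; exists N; intros n n' Hn Hn'.
    destruct (Nat.le_ge_cases n n') as [Hle|Hle]; [ rewrite Cmod_minus_sym | ];
      (eapply Rle_lt_trans; [ apply H, Hle | apply HN; auto ]).
  - exists L; intros n; apply le_epsilon; intros eps He; destruct (HL eps He) as [N HN].
    specialize (HN (n + N)%nat ltac:(lia)); specialize (H n (n + N)%nat ltac:(lia)).
    generalize (Cmod_dist_triangle (P n) (P (n + N)%nat) L); rewrite (Cmod_minus_sym (P n) (P _)); lra.
Qed.

(** * The logarithmic derivative of the tail of the product *)

(** With [w = lat tau kl], the logarithmic derivative of a factor of the product is [1 / (w + z) - 1
    / w + z / w^2 = z^2 / (w^2 (w + z))], that is, [z * z] times the term with [j = 1]. Larger [j]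
    arise by differentiating in [z]. *)
Definition tail_term (tau : R) (j : nat) (z : C) (kl : nat * nat) : C :=
  ((/ RtoC (lat tau kl)) ^ 2 * (/ (RtoC (lat tau kl) + z)) ^ j)%C.

Definition tail_sum (tau : R) (M j n : nat) (z : C) : C :=
  Csum (map (tail_term tau j z) (shells (S M) n)).

(** Lattice points beyond shell [M] are at least twice as large, so that [w + z] keeps a modulus of
    at least [w / 2]. *)
Definition tail_radius (tau : R) (M : nat) : R := cmin tau * (INR M + 1) / 2.

(** With [c = cmin tau], shell [i] has [2 i + 1] terms, each at most [1 / (c i)^2 * (2 / (c i)) * (2
    / c)^(j - 1)], and [(2 i + 1) / i^3 <= 6 (1 / i - 1 / (i + 1))]; whence [12 / c^3]. *)
Definition tail_const (tau : R) (j : nat) : R :=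
  12 / cmin tau ^ 3 * (2 / cmin tau) ^ (pred j).

Section Tail.

Variables (tau : R) (M : nat).
Hypothesis Htau : 0 < tau.

Let c := cmin tau.
Let Hc : 0 < c := cmin_pos tau Htau.

Lemma lat_tail (kl : nat * nat) (n : nat) : In kl (shells (S M) n) ->
  2 * tail_radius tau M <= lat tau kl.
Proof.
  intros H; apply in_shells in H; destruct H as [i [Hi H]]. apply (lat_shell tau) in H; [ | auto ].
  assert (INR (S M) <= INR i) by (apply le_INR; lia).
  rewrite S_INR in *; unfold tail_radius; fold c in H |- *; nra.
Qed.

Lemma tail_radius_pos : 0 < tail_radius tau M.
Proof. unfold tail_radius; fold c; generalize (pos_INR M); intros; pos. Qed.

Lemma lat_plus_neq_0 (kl : nat * nat) (n : nat) (z : C) : In kl (shells (S M) n) ->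
  Cmod z < tail_radius tau M -> (RtoC (lat tau kl) + z)%C <> 0%C /\ lat tau kl <> 0.
Proof.
  intros H Hz; apply lat_tail in H; assert (P := tail_radius_pos). split; [ | lra ].
  apply Cmod_gt_0; generalize (Cmod_minus_ge (RtoC (lat tau kl)) (- z)).
  rewrite Cmod_opp, Cmod_R, Rabs_pos_eq by lra.
  replace (RtoC (lat tau kl) - - z)%C with (RtoC (lat tau kl) + z)%C by ring; lra.
Qed.

Lemma Csum_Cmod_le {A : Type} (f : A -> C) (B : R) (l : list A) :
  (forall x, In x l -> Cmod (f x) <= B) -> Cmod (Csum (map f l)) <= INR (length l) * B.
Proof.
  induction l as [|x l IH]; intros H.
  - simpl; rewrite Cmod_0; lra.
  - change (Cmod (f x + Csum (map f l)) <= INR (S (length l)) * B). rewrite S_INR; le_via Cmod_triangle.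
    generalize (H x (or_introl eq_refl)) (IH (fun y Hy => H y (or_intror Hy))); lra.
Qed.

Lemma shell_bound (j i : nat) (z : C) : (1 <= j)%nat -> (M < i)%nat ->
  Cmod z < tail_radius tau M ->
  Cmod (Csum (map (tail_term tau j z) (shell i))) <=
    tail_const tau j * (/ INR i - / (INR i + 1)).
Proof.
  intros Hj Hi Hz. assert (Pi : 1 <= INR i) by (apply (le_INR 1); lia).
  assert (HM : INR M + 1 <= INR i) by (rewrite <- S_INR; apply le_INR; lia). set (q := 2 / c).
  assert (Hq : 0 < q) by (unfold q; pos). set (B := (/ (c * INR i)) ^ 2 * (q / INR i * q ^ pred j)).
  le_via (Csum_Cmod_le _ B).
  - intros kl Hkl; unfold tail_term, B. destruct (lat_shell tau i kl Htau Hkl) as [H1 _]; fold c in H1.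
    assert (P1 : 0 < c * INR i) by nra. assert (Hlz : c * INR i / 2 <= Cmod (RtoC (lat tau kl) + z)).
    { generalize (Cmod_minus_ge (RtoC (lat tau kl)) (- z)). rewrite Cmod_opp, Cmod_R, Rabs_pos_eq by lra.
      replace (RtoC (lat tau kl) - - z)%C with (RtoC (lat tau kl) + z)%C by ring.
      unfold tail_radius in Hz; fold c in Hz; nra. }
    assert (N1 : (RtoC (lat tau kl) + z)%C <> 0%C) by (apply Cmod_gt_0; lra).
    rewrite Cmod_mult, !Cmod_pow, Cmod_inv by (apply Cmod_gt_0; rewrite Cmod_R, Rabs_pos_eq; lra).
    rewrite (Cmod_inv _ N1), Cmod_R, Rabs_pos_eq by lra.
    assert (I1 : / Cmod (RtoC (lat tau kl) + z) <= q / INR i).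
    { replace (q / INR i) with (/ (c * INR i / 2)) by (unfold q; field; lra). apply Rinv_le_contravar; lra. }
    assert (I2 : q / INR i <= q). { apply (Rmult_le_reg_r (INR i)); [ lra | ].
      unfold Rdiv; rewrite Rmult_assoc, Rinv_l by lra; nra. }
    assert (I3 : 0 <= / Cmod (RtoC (lat tau kl) + z)). { pos. } apply Rmult_le_compat.
    + nra.
    + pos.
    + apply pow_incr; split; [ pos | ]. apply Rinv_le_contravar; lra.
    + destruct j as [|j]; [ lia | simpl ]. apply Rmult_le_compat; try assumption; [ pos | ].
      apply pow_incr; lra.
  - rewrite length_shell, plus_INR, mult_INR; simpl (INR 2); simpl (INR 1).
    unfold B, tail_const; fold c; fold q. replace ((/ (c * INR i)) ^ 2 * (q / INR i * q ^ pred j)) with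
      (2 / c ^ 3 * q ^ pred j * / (INR i * INR i * INR i)) by (unfold q; field; lra).
    replace (/ INR i - / (INR i + 1)) with (/ (INR i * (INR i + 1))) by (field; lra).
    replace (12 / c ^ 3 * q ^ pred j * / (INR i * (INR i + 1))) with
      (2 / c ^ 3 * q ^ pred j * (6 * / (INR i * (INR i + 1)))) by (field; lra).
    rewrite (Rmult_comm ((1 + 1) * INR i + 1)), Rmult_assoc. apply Rmult_le_compat_l. { pos. }
    apply (Rmult_le_reg_r (INR i * INR i * INR i * (INR i + 1))). { nra. }
    replace (/ (INR i * INR i * INR i) * ((1 + 1) * INR i + 1) *
      (INR i * INR i * INR i * (INR i + 1))) with ((2 * INR i + 1) * (INR i + 1)) by (field; lra).
    replace (6 * / (INR i * (INR i + 1)) * (INR i * INR i * INR i * (INR i + 1))) with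
      (6 * (INR i * INR i)) by (field; lra).
    nra.
Qed.

Lemma tail_const_pos (j : nat) : 0 < tail_const tau j.
Proof.
  unfold tail_const; fold c; apply Rmult_lt_0_compat;
    [ apply Rdiv_lt_0_compat; [ lra | ] | ]; apply pow_lt; try assumption.
  apply Rdiv_lt_0_compat; lra.
Qed.

Lemma tail_sum_diff (j n n' : nat) (z : C) : (1 <= j)%nat -> (n <= n')%nat ->
  Cmod z < tail_radius tau M ->
  Cmod (tail_sum tau M j n' z - tail_sum tau M j n z) <=
    tail_const tau j * (/ (INR M + INR n + 1) - / (INR M + INR n' + 1)).
Proof.
  intros Hj Hn Hz; revert n n' Hn. generalize (telescope_le (fun n => tail_sum tau M j n z)
    (fun n => tail_const tau j * / (INR M + INR n + 1))); intros K n n' Hn.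
  rewrite Rmult_minus_distr_l; apply K; [ | auto ].
  clear n n' Hn; intros n _; assert (B := shell_bound j (S M + n) z Hj ltac:(lia) Hz).
  unfold tail_sum at 1; rewrite shells_S, map_app, Csum_app. rewrite plus_INR, S_INR in B; rewrite S_INR.
  replace (INR M + (INR n + 1) + 1) with (INR M + 1 + INR n + 1) by ring.
  replace (INR M + INR n + 1) with (INR M + 1 + INR n) by ring.
  rewrite <- Rmult_minus_distr_l; eapply Rle_trans; [ | exact B ].
  apply Req_le, f_equal; unfold tail_sum; ring.
Qed.

Lemma tail_sum_bound (j n : nat) (z : C) : (1 <= j)%nat -> Cmod z < tail_radius tau M ->
  Cmod (tail_sum tau M j n z) <= tail_const tau j / (INR M + 1).
Proof.
  intros Hj Hz; assert (H := tail_sum_diff j 0 n z Hj (Nat.le_0_l n) Hz).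
  replace (tail_sum tau M j n z - tail_sum tau M j 0 z)%C with (tail_sum tau M j n z) in H
    by (unfold tail_sum; simpl; ring).
  le_via H; simpl INR; unfold Rdiv. apply Rmult_le_compat_l; [ left; apply tail_const_pos | ].
  rewrite Rplus_0_r. assert (0 < / (INR M + INR n + 1)).
  { apply Rinv_0_lt_compat; generalize (pos_INR M) (pos_INR n); lra. } lra.
Qed.

Lemma tail_limit_exists (j : nat) (z : C) : (1 <= j)%nat -> Cmod z < tail_radius tau M ->
  exists L, forall n, Cmod (tail_sum tau M j n z - L) <= tail_const tau j / (INR n + 1).
Proof.
  intros Hj Hz; apply cauchy_rate; intros n n' Hn. le_via (tail_sum_diff j n n' z Hj Hn Hz); unfold Rdiv.
  apply Rmult_le_compat_l; [ left; apply tail_const_pos | ].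
  generalize (pos_INR M) (pos_INR n) (pos_INR n'); intros. assert (0 < / (INR M + INR n' + 1)) by pos.
  assert (/ (INR M + INR n + 1) <= / (INR n + 1)) by (apply Rinv_le_contravar; lra). lra.
Qed.

Definition tail_lim (j : nat) (z : C) : C :=
  epsilon (inhabits (RtoC 0))
    (fun L => forall n, Cmod (tail_sum tau M j n z - L) <= tail_const tau j / (INR n + 1)).

Lemma tail_lim_spec (j n : nat) (z : C) : (1 <= j)%nat -> Cmod z < tail_radius tau M ->
  Cmod (tail_sum tau M j n z - tail_lim j z) <= tail_const tau j / (INR n + 1).
Proof.
  intros Hj Hz; revert n; unfold tail_lim; apply epsilon_spec, tail_limit_exists; auto.
Qed.

Lemma Cmod_le_limit (x : C) (u : nat -> C) (a B D : R) :
  (forall n, Cmod (u n - x) <= D / (INR n + 1)) -> (forall n, Cmod (u n) <= B) -> Cmod x <= B.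
Proof.
  intros H1 H2; apply le_epsilon; intros eps He. destruct (inv_INR_small D eps He) as [N HN].
  specialize (H1 N); specialize (H2 N); specialize (HN N (Nat.le_refl N)).
  generalize (Cmod_minus_ge x (u N)); rewrite Cmod_minus_sym; lra.
Qed.

Lemma tail_lim_bound (j : nat) (z : C) : (1 <= j)%nat -> Cmod z < tail_radius tau M ->
  Cmod (tail_lim j z) <= tail_const tau j / (INR M + 1).
Proof.
  intros Hj Hz; apply (Cmod_le_limit _ (fun n => tail_sum tau M j n z) 0 _ (tail_const tau j)).
  - intros n; apply tail_lim_spec; auto.
  - intros n; apply tail_sum_bound; auto.
Qed.

Lemma cder_inv_pow (j : nat) (w z : C) : (w + z)%C <> 0%C ->
  cder (fun y => (/ (w + y)) ^ j)%C z (- RtoC (INR j) * (/ (w + z)) ^ (S j))%C.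
Proof.
  intros H; induction j as [|j IH].
  - replace (- RtoC (INR 0) * (/ (w + z)) ^ 1)%C with (RtoC 0) by (simpl; ring).
    apply (cder_ext (fun _ => 1%C)); [ intros; reflexivity | apply cder_const ].
  - assert (D : cder (fun y => / (w + y))%C z (- (/ (w + z) * / (w + z)) * 1)%C).
    { apply (cder_inv (fun y => w + y)%C); [ auto | ].
      apply (cder_ext (fun y => 1 * y + w)%C); [ intros; ring | apply cder_scal_id ]. }
    assert (K := cder_mult _ _ _ _ _ D IH); cbv beta in K. rewrite S_INR.
    replace (- RtoC (INR j + 1) * (/ (w + z)) ^ (S (S j)))%C with
      (- (/ (w + z) * / (w + z)) * 1 * (/ (w + z)) ^ j + / (w + z) * (- RtoC (INR j) * (/ (w + z)) ^ (S j)))%C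
      by (rewrite RtoC_plus; simpl; ring).
    exact K.
Qed.

Lemma cder_Csum {A : Type} (f f' : A -> C -> C) (l : list A) (z : C) :
  (forall a, In a l -> cder (f a) z (f' a z)) ->
  cder (fun y => Csum (map (fun a => f a y) l)) z (Csum (map (fun a => f' a z) l)).
Proof.
  induction l as [|a l IH]; intros H; simpl; [ apply cder_const | ].
  apply (cder_plus (f a)); [ apply H; left; reflexivity | apply IH; intros; apply H; right; auto ].
Qed.

Lemma Csum_scal {A : Type} (k : C) (f : A -> C) (l : list A) :
  Csum (map (fun a => k * f a)%C l) = (k * Csum (map f l))%C.
Proof. induction l as [|a l IH]; simpl; [ ring | rewrite IH; ring ]. Qed.

Lemma tail_sum_cder (j n : nat) (z : C) : Cmod z < tail_radius tau M ->
  cder (tail_sum tau M j n) z (- RtoC (INR j) * tail_sum tau M (S j) n z)%C.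
Proof.
  intros Hz; unfold tail_sum; rewrite <- Csum_scal. apply (cder_Csum (fun kl y => tail_term tau j y kl)
    (fun kl y => - RtoC (INR j) * tail_term tau (S j) y kl)%C).
  intros kl Hkl; destruct (lat_plus_neq_0 kl n z Hkl Hz) as [H _]; unfold tail_term.
  replace (- RtoC (INR j) * ((/ RtoC (lat tau kl)) ^ 2 * (/ (RtoC (lat tau kl) + z)) ^ S j))%C with
    ((/ RtoC (lat tau kl)) ^ 2 * (- RtoC (INR j) * (/ (RtoC (lat tau kl) + z)) ^ S j))%C by ring.
  apply cder_scal, cder_inv_pow, H.
Qed.

Definition disc (z : C) : Prop := Cmod (z - 0) < tail_radius tau M.

Lemma disc_iff (z : C) : disc z <-> Cmod z < tail_radius tau M.
Proof. unfold disc; replace (z - 0)%C with z by ring; tauto. Qed.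

Lemma disc_cvx : cvx disc.
Proof. apply cvx_ball. Qed.

Lemma disc_opn : opn disc.
Proof. apply opn_ball. Qed.

Lemma disc_0 : disc 0.
Proof. apply disc_iff; rewrite Cmod_0; apply tail_radius_pos. Qed.

(** The relation [T_j' = - j T_(j+1)] supplies derivatives of all orders, for the partial sums and
    for their limit alike. *)
Lemma disc_an (T : nat -> C -> C) (j : nat) (z : C) :
  (forall j y, (1 <= j)%nat -> Cmod y < tail_radius tau M ->
    cder (T j) y (- RtoC (INR j) * T (S j) y)%C) ->
  (1 <= j)%nat -> disc z -> an (fun y => y * y * T j y)%C z.
Proof.
  intros H Hj Hz; apply an_mult; [ apply an_mult; apply an_id | ].
  intros k; revert j z Hj Hz; induction k as [|k IH]; intros j z Hj Hz.
  - eapply cder_ccont, H, disc_iff, Hz; auto.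
  - exists (fun y => - RtoC (INR j) * T (S j) y)%C; split.
    + generalize (disc_opn z Hz); apply filter_imp; intros y Hy; apply H, disc_iff; auto.
    + apply sm_mult; [ apply sm_const | apply IH; [ lia | auto ] ].
Qed.

(** Two mean value inequalities, the second derivative being [j (j + 1)] times the sum of index
    [j + 2]. The bound is independent of [n], so it passes to the limit in [tail_lim_cder]. *)
Lemma tail_sum_taylor (j n : nat) (y z : C) : (1 <= j)%nat ->
  Cmod y < tail_radius tau M -> Cmod z < tail_radius tau M ->
  Cmod (tail_sum tau M j n y - tail_sum tau M j n z -
    - RtoC (INR j) * tail_sum tau M (S j) n z * (y - z)) <=
    INR j * INR (S j) * tail_const tau (S (S j)) / (INR M + 1) * Cmod (y - z) * Cmod (y - z).
Proof.
  intros Hj Hy Hz. assert (Hin : forall t, 0 <= t <= 1 -> Cmod (z + RtoC t * (y - z)) < tail_radius tau M).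
  { intros t Ht; apply disc_iff, disc_cvx; try apply disc_iff; auto. }
  assert (Pj := pos_INR j). assert (PSj := pos_INR (S j)).
  assert (PB := tail_const_pos (S (S j))). assert (PM := pos_INR M).
  set (B := tail_const tau (S (S j)) / (INR M + 1)). assert (HB : 0 < B) by (unfold B; pos).
  apply (segment_mean_value (tail_sum tau M j n) (fun x => - RtoC (INR j) * tail_sum tau M (S j) n x)%C).
  - intros t Ht; apply tail_sum_cder, Hin, Ht.
  - intros t Ht; set (x := (z + RtoC t * (y - z))%C).
    replace (- RtoC (INR j) * tail_sum tau M (S j) n x - - RtoC (INR j) * tail_sum tau M (S j) n z)%C
      with (- RtoC (INR j) * (tail_sum tau M (S j) n x - tail_sum tau M (S j) n z - 0 * (x - z)))%C by ring.
    rewrite Cmod_mult, Cmod_opp, Cmod_R, Rabs_pos_eq by auto.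
    replace (INR j * INR (S j) * tail_const tau (S (S j)) / (INR M + 1) * Cmod (y - z))
      with (INR j * (INR (S j) * B * Cmod (y - z))) by (unfold B; field; lra).
    apply Rmult_le_compat_l; [ auto | ]. apply Rle_trans with (INR (S j) * B * Cmod (x - z)).
    + apply (segment_mean_value (tail_sum tau M (S j) n)
        (fun x => - RtoC (INR (S j)) * tail_sum tau M (S (S j)) n x)%C).
      * intros u Hu; apply tail_sum_cder, disc_iff, disc_cvx; try apply disc_iff; auto; apply Hin, Ht.
      * intros u Hu. replace (- RtoC (INR (S j)) * tail_sum tau M (S (S j)) n (z + RtoC u * (x - z)) - 0)%C
          with (- RtoC (INR (S j)) * tail_sum tau M (S (S j)) n (z + RtoC u * (x - z)))%C by ring.
        rewrite Cmod_mult, Cmod_opp, Cmod_R, Rabs_pos_eq by auto. apply Rmult_le_compat_l; [ auto | ].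
        apply tail_sum_bound; [ lia | ]. apply disc_iff, disc_cvx; try apply disc_iff; auto; apply Hin, Ht.
    + apply Rmult_le_compat_l; [ nra | ].
      unfold x; replace (z + RtoC t * (y - z) - z)%C with (RtoC t * (y - z))%C by ring.
      rewrite Cmod_mult, Cmod_R, Rabs_pos_eq by lra. generalize (Cmod_ge_0 (y - z)); nra.
Qed.

Lemma tail_lim_cder (j : nat) (z : C) : (1 <= j)%nat -> Cmod z < tail_radius tau M ->
  cder (tail_lim j) z (- RtoC (INR j) * tail_lim (S j) z)%C.
Proof.
  intros Hj Hz eps He. set (K := INR j * INR (S j) * tail_const tau (S (S j)) / (INR M + 1)).
  assert (HK : 0 <= K).
  { unfold K; generalize (pos_INR j) (pos_INR (S j)) (pos_INR M) (tail_const_pos (S (S j))); intros. pos. }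
  exists (Rmin (tail_radius tau M - Cmod z) (eps / (K + 1))); split. { pos. } intros y Hy.
  assert (Hy1 := Rlt_le_trans _ _ _ Hy (Rmin_l _ _)). assert (Hy2 := Rlt_le_trans _ _ _ Hy (Rmin_r _ _)).
  assert (Hyr : Cmod y < tail_radius tau M) by (generalize (Cmod_minus_ge y z); lra).
  apply Rle_trans with (K * Cmod (y - z) * Cmod (y - z)).
  - assert (Q := Cmod_ge_0 (y - z)). assert (PSj := pos_INR j).
    apply (Cmod_le_limit _ (fun n => tail_sum tau M j n y - tail_sum tau M j n z -
      - RtoC (INR j) * tail_sum tau M (S j) n z * (y - z))%C 0 _
      (tail_const tau j + tail_const tau j + INR j * tail_const tau (S j) * Cmod (y - z))).
    + intros n. replace (tail_sum tau M j n y - tail_sum tau M j n z -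
        - RtoC (INR j) * tail_sum tau M (S j) n z * (y - z) -
        (tail_lim j y - tail_lim j z - - RtoC (INR j) * tail_lim (S j) z * (y - z)))%C with
        ((tail_sum tau M j n y - tail_lim j y) - (tail_sum tau M j n z - tail_lim j z)
         + RtoC (INR j) * (tail_sum tau M (S j) n z - tail_lim (S j) z) * (y - z))%C by ring.
      le_via Cmod_triangle. eapply Rle_trans; [ apply Rplus_le_compat_r, Cmod_triangle_minus | ].
      rewrite !Cmod_mult, Cmod_R, Rabs_pos_eq by auto.
      assert (L1 := tail_lim_spec j n y Hj Hyr). assert (L2 := tail_lim_spec j n z Hj Hz).
      assert (L3 := tail_lim_spec (S j) n z ltac:(lia) Hz). unfold Rdiv in *; rewrite !Rmult_plus_distr_r.
      apply Rplus_le_compat; [ apply Rplus_le_compat; auto | ].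
      replace (INR j * tail_const tau (S j) * Cmod (y - z) * / (INR n + 1)) with
        (INR j * (tail_const tau (S j) * / (INR n + 1)) * Cmod (y - z)) by ring.
      apply Rmult_le_compat_r; [ auto | apply Rmult_le_compat_l; auto ].
    + intros n; apply tail_sum_taylor; auto.
  - apply Rmult_le_compat_r; [ apply Cmod_ge_0 | ]. apply Rle_trans with (K * (eps / (K + 1))).
    + nra.
    + replace (K * (eps / (K + 1))) with (eps - eps / (K + 1)) by (field; lra).
      assert (0 < eps / (K + 1)) by pos. lra.
Qed.

Lemma tail_lim_an (z : C) : disc z -> an (fun y => y * y * tail_lim 1 y)%C z.
Proof. apply disc_an; auto using tail_lim_cder. Qed.

Lemma tail_sum_an (n : nat) (z : C) : disc z -> an (fun y => y * y * tail_sum tau M 1 n y)%C z.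
Proof. apply (disc_an (fun j => tail_sum tau M j n)); auto; intros; apply tail_sum_cder; auto. Qed.

#[local] Hint Resolve disc_cvx disc_opn disc_0 tail_lim_an tail_sum_an : core.

(** A logarithm of the tail of the product, normalised at 0, where every factor is 1. *)
Definition tail_log (z : C) : C := prim (fun y => y * y * tail_lim 1 y)%C 0 z.

Lemma tail_log_an (z : C) : Cmod z < tail_radius tau M -> an tail_log z.
Proof.
  intros Hz; apply (prim_an disc); auto. apply disc_iff, Hz.
Qed.

Lemma square_mul_bound (z t : C) (u : R) (B : R) : 0 <= u <= 1 -> Cmod t <= B ->
  Cmod ((0 + RtoC u * (z - 0)) * (0 + RtoC u * (z - 0)) * t) <= Cmod z * Cmod z * B.
Proof.
  intros Hu HB; replace (0 + RtoC u * (z - 0))%C with (RtoC u * z)%C by ring.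
  rewrite !Cmod_mult, Cmod_R, Rabs_pos_eq by lra. assert (P := Cmod_ge_0 z). assert (Pt := Cmod_ge_0 t).
  assert (0 <= u * Cmod z <= Cmod z) by nra. apply Rmult_le_compat; nra.
Qed.

(** Cubic in [z], divided by [M + 1]: when [M] is of the order of [Cmod z] this is quadratic,
    negligible against [Cmod z ^ 2 * ln (Cmod z)]. *)
Lemma tail_log_bound (z : C) : Cmod z < tail_radius tau M ->
  Cmod (tail_log z) <= Cmod z * Cmod z * (tail_const tau 1 / (INR M + 1)) * Cmod z.
Proof.
  intros Hz. replace (tail_log z) with (tail_log z - tail_log 0 - 0 * (z - 0))%C
    by (unfold tail_log; rewrite prim_self; ring).
  replace (Cmod z) with (Cmod (z - 0)) at 3 by (f_equal; ring).
  apply disc_iff in Hz; assert (Hd := fun t Ht => disc_cvx 0 z t disc_0 Hz Ht).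
  apply (segment_mean_value tail_log (fun y => y * y * tail_lim 1 y)%C).
  - intros t Ht; apply (prim_cder disc (fun y => y * y * tail_lim 1 y)%C); auto.
  - intros t Ht; le_via Cmod_triangle_minus; rewrite Cmod_0, Rplus_0_r.
    apply square_mul_bound, tail_lim_bound, disc_iff; auto.
Qed.

Lemma barnes_factor_cder (kl : nat * nat) (n : nat) (z : C) : In kl (shells (S M) n) ->
  Cmod z < tail_radius tau M ->
  cder (fun y => barnes_factor tau y kl) z (z * z * tail_term tau 1 z kl * barnes_factor tau z kl)%C.
Proof.
  intros Hkl Hz; destruct (lat_plus_neq_0 kl n z Hkl Hz) as [H1 H2].
  assert (Hkl0 : kl <> (0, 0)%nat) by (intros ->; apply H2; unfold lat; simpl; ring).
  set (w := RtoC (lat tau kl)) in *. assert (Hw : w <> 0%C) by (intros E; apply RtoC_inj in E; auto).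
  apply (cder_ext (fun y => (/ w * y + 1) * Cexp ((/ (2 * w * w)) * (y * y) + (- / w) * y))%C).
  { intros y; rewrite barnes_factor_lat by auto; fold w.
    f_equal; [ unfold Cdiv; ring | f_equal; simpl; field; auto ]. }
  rewrite barnes_factor_lat by auto; fold w. assert (D1 := cder_scal_id (/ w) 1 z).
  assert (D2 : cder (fun y => Cexp ((/ (2 * w * w)) * (y * y) + (- / w) * y))%C z
    (Cexp ((/ (2 * w * w)) * (z * z) + (- / w) * z) * ((/ (2 * w * w)) * (1 * z + z * 1) + (- / w) * 1))%C).
  { apply cder_comp; [ apply cder_Cexp | ].
    apply (cder_plus (fun y => (/ (2 * w * w)) * (y * y))%C (fun y => (- / w) * y)%C);
      apply cder_scal; [ apply (cder_mult (fun y => y) (fun y => y)); apply cder_id | apply cder_id ]. }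
  assert (D := cder_mult _ _ _ _ _ D1 D2); cbv beta in D. apply (cder_eq _ _ _ _ D).
  replace (- (z / w) + z ^ 2 / (2 * w ^ 2))%C with ((/ (2 * w * w)) * (z * z) + (- / w) * z)%C
    by (simpl; field; auto).
  unfold tail_term; fold w; simpl; field; repeat split; auto.
Qed.

Lemma tail_prod_cder (l : list (nat * nat)) (n : nat) (z : C) :
  incl l (shells (S M) n) -> Cmod z < tail_radius tau M ->
  cder (fun y => Cprod (map (barnes_factor tau y) l)) z
    (z * z * Csum (map (tail_term tau 1 z) l) * Cprod (map (barnes_factor tau z) l))%C.
Proof.
  intros Hl Hz; induction l as [|kl l IH]; simpl.
  - replace (z * z * 0 * 1)%C with (RtoC 0) by ring; apply cder_const.
  - assert (D1 := barnes_factor_cder kl n z (Hl kl (or_introl eq_refl)) Hz).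
    assert (D2 := IH (fun x Hx => Hl x (or_intror Hx))).
    assert (D := cder_mult _ _ _ _ _ D1 D2); cbv beta in D. apply (cder_eq _ _ _ _ D); ring.
Qed.

(** The product times the exponential of minus its integrated logarithmic derivative has derivative
    0 on the disc, and its value at 0 is 1. *)
Lemma tail_prod_exp (n : nat) (z : C) : Cmod z < tail_radius tau M ->
  Cprod (map (barnes_factor tau z) (shells (S M) n)) =
  Cexp (prim (fun y => y * y * tail_sum tau M 1 n y)%C 0 z).
Proof.
  intros Hz. set (h := (fun y => y * y * tail_sum tau M 1 n y)%C). assert (Hh : forall y, disc y -> an h y).
  { intros y Hy; apply tail_sum_an, Hy. }
  assert (E : (Cprod (map (barnes_factor tau z) (shells (S M) n)) * Cexp ((- (1)) * prim h 0 z))%C =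
    (Cprod (map (barnes_factor tau 0) (shells (S M) n)) * Cexp ((- (1)) * prim h 0 0))%C).
  { apply (cder_0_const disc (fun z => Cprod (map (barnes_factor tau z) (shells (S M) n)) *
      Cexp ((- (1)) * prim h 0 z))%C); [ apply disc_cvx | apply disc_0 | apply disc_iff, Hz | ].
    intros y Hy. assert (D1 := tail_prod_cder _ n y (incl_refl _) (proj1 (disc_iff y) Hy)).
    assert (D2 : cder (fun z => Cexp ((- (1)) * prim h 0 z))%C y
      (Cexp ((- (1)) * prim h 0 y) * ((- (1)) * h y))%C).
    { apply cder_comp; [ apply cder_Cexp | apply cder_scal ]. apply (prim_cder disc); auto. }
    assert (D := cder_mult _ _ _ _ _ D1 D2); cbv beta in D.
    apply (cder_eq _ _ _ _ D); unfold h, tail_sum; ring. }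
  rewrite prim_self in E. replace (Cprod (map (barnes_factor tau 0) (shells (S M) n))) with (RtoC 1) in E.
  - replace (- (1) * 0)%C with (RtoC 0) in E by ring; rewrite Cexp_0, Cmult_1_l in E.
    replace (- (1) * prim h 0 z)%C with (- prim h 0 z)%C in E by ring. rewrite Cexp_opp in E.
    match type of E with (?P * _)%C = _ => transitivity (P * / Cexp (prim h 0 z) * Cexp (prim h 0 z))%C end.
    + field; apply Cexp_neq_0.
    + rewrite E; ring.
  - generalize (incl_refl (shells (S M) n)); generalize (shells (S M) n) at 1 3.
    intros l; induction l as [|kl l IH]; intros Hl; [ reflexivity | simpl ].
    rewrite <- IH by (intros x Hx; apply Hl; right; auto).
    destruct (lat_plus_neq_0 kl n 0%C (Hl kl (or_introl eq_refl))) as [_ H2].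
    { rewrite Cmod_0; apply tail_radius_pos. }
    rewrite barnes_factor_lat by (intros ->; apply H2; unfold lat; simpl; ring).
    assert (Hw : RtoC (lat tau kl) <> 0%C) by (intros E'; apply RtoC_inj in E'; auto).
    replace (- (0 / RtoC (lat tau kl)) + 0 ^ 2 / (2 * RtoC (lat tau kl) ^ 2))%C with (RtoC 0)
      by (simpl; field; auto).
    rewrite Cexp_0; field; auto.
Qed.

Lemma tail_prod_cvg (z : C) : Cmod z < tail_radius tau M ->
  cvg (fun n => Cprod (map (barnes_factor tau z) (shells (S M) n))) (Cexp (tail_log z)).
Proof.
  intros Hz. apply (cvg_ext (fun n => Cexp (prim (fun y => y * y * tail_sum tau M 1 n y)%C 0 z)) _ _ 0).
  { intros; symmetry; apply tail_prod_exp, Hz. } apply cvg_comp; [ eapply cder_ccont, cder_Cexp | ].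
  set (B := Cmod z * (Cmod z * Cmod z * tail_const tau 1)).
  assert (HB : forall n, Cmod (prim (fun y => y * y * tail_sum tau M 1 n y)%C 0 z - tail_log z)
    <= B / (INR n + 1)).
  { intros n; replace (B / (INR n + 1)) with (Cmod z * Cmod z * (tail_const tau 1 / (INR n + 1)) * Cmod z)
      by (unfold B, Rdiv; ring).
    replace (Cmod z) with (Cmod (z - 0)) at 3 by (f_equal; ring).
    apply disc_iff in Hz; assert (Hd := fun t Ht => disc_cvx 0 z t disc_0 Hz Ht).
    apply (prim_diff_bound disc); auto.
    intros t Ht; refine (Rle_trans _ _ _ (Req_le _ _ (f_equal Cmod _)) (square_mul_bound z _ t _ Ht
      (tail_lim_spec 1 n _ (le_n 1) (proj1 (disc_iff _) (Hd t Ht))))); ring. }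
  intros eps He; destruct (inv_INR_small B eps He) as [N HN]; exists N; intros n Hn. lt_via HB; apply HN, Hn.
Qed.

End Tail.

(** * The double gamma function *)

Definition quad_exp (tau c1 c2 : R) (z : C) : C :=
  Cexp (RtoC c1 * z / RtoC tau + RtoC c2 * z ^ 2 / RtoC (2 * tau ^ 2)).

Lemma shells_0 (M : nat) : shells 0 (S M) = (0, 0)%nat :: shells 1 M.
Proof. reflexivity. Qed.

Lemma in_shells_neq (M : nat) (kl : nat * nat) : In kl (shells 1 M) -> kl <> (0, 0)%nat.
Proof.
  intros H ->; apply in_shells in H; destruct H as [i [Hi H]]; apply in_shell in H. simpl in H; lia.
Qed.

Lemma lat_pos (tau : R) (kl : nat * nat) : 0 < tau -> kl <> (0, 0)%nat -> 0 < lat tau kl.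
Proof.
  intros Ht H; destruct (lat_nonneg tau kl Ht) as [P|P]; [ auto | ]. exfalso; apply H, (lat_eq_0 tau); auto.
Qed.

Lemma RtoC_neq_0 (x : R) : x <> 0 -> RtoC x <> 0%C.
Proof. intros H E; apply RtoC_inj in E; auto. Qed.

Lemma exp_le_cancel (x y : R) : exp x <= exp y -> x <= y.
Proof.
  intros H; destruct (Rle_dec x y) as [|Hn]; [ auto | exfalso ]. apply Rnot_le_lt, exp_increasing in Hn; lra.
Qed.

Section BarnesG.

Variables (tau c1 c2 : R) (G : C -> C).
Hypothesis Htau : 0 < tau.
Hypothesis HG : forall z : C,
  filterlim (barnes_partial tau c1 c2 z) eventually (locally (G z)).

Lemma barnes_G_formula (M : nat) (z : C) : Cmod z < tail_radius tau M ->
  G z = (z / RtoC tau * quad_exp tau c1 c2 z * Cprod (map (barnes_factor tau z) (shells 1 M))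
    * Cexp (tail_log tau M z))%C.
Proof.
  intros Hz. apply (cvg_unique (barnes_partial tau c1 c2 z)); [ apply cvg_filterlim, HG | ].
  apply (cvg_ext (fun n => z / RtoC tau * quad_exp tau c1 c2 z *
    Cprod (map (barnes_factor tau z) (shells 1 M)) *
    Cprod (map (barnes_factor tau z) (shells (S M) (n - M))))%C _ _ M).
  - intros n Hn; unfold barnes_partial; fold (quad_exp tau c1 c2 z).
    rewrite (Cprod_perm _ _ (Permutation_map (barnes_factor tau z) (box_shells n))).
    replace (S n) with (S M + (n - M))%nat by lia.
    rewrite shells_add, shells_0, map_app, Cprod_app; simpl; ring.
  - apply cvg_mult; [ apply cvg_const | ]. assert (H := tail_prod_cvg tau M Htau z Hz); intros eps He.
    destruct (H eps He) as [N K]; exists (N + M)%nat; intros n Hn; apply K; lia.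
Qed.

Lemma barnes_G_zero (kl : nat * nat) : G (- RtoC (lat tau kl))%C = 0%C.
Proof.
  set (z := (- RtoC (lat tau kl))%C).
  apply (cvg_unique (barnes_partial tau c1 c2 z)); [ apply cvg_filterlim, HG | ].
  (* From this index on the square contains [kl], whose factor vanishes; for [(0, 0)] it is the
     prefactor [z / tau] that vanishes. *)
  apply (cvg_ext (fun _ => 0%C) _ _ (fst kl + snd kl)); [ | apply cvg_const ].
  intros n Hn; symmetry; unfold barnes_partial. destruct (classic (kl = (0, 0)%nat)) as [E|E].
  - unfold z; rewrite E; unfold lat; simpl. replace (- RtoC (0 * tau + 0))%C with (RtoC 0)
      by (rewrite Rmult_0_l, Rplus_0_l; ring).
    unfold Cdiv; ring.
  - assert (P := lat_pos tau kl Htau E). assert (N0 := RtoC_neq_0 _ (Rgt_not_eq _ _ P)).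
    rewrite (Cprod_in_0 (map _ _)); [ ring | ]. replace (RtoC 0) with (barnes_factor tau z kl).
    + apply in_map; destruct kl as [k l]; apply in_prod; apply in_seq; simpl in *; lia.
    + rewrite barnes_factor_lat by auto; unfold z.
      replace (1 + - RtoC (lat tau kl) / RtoC (lat tau kl))%C with (RtoC 0) by (field; auto). ring.
Qed.

Definition unit_factor (z : C) (kl : nat * nat) : C :=
  (/ RtoC (lat tau kl) *
   Cexp (- (z / RtoC (lat tau kl)) + z ^ 2 / (RtoC 2 * RtoC (lat tau kl) ^ 2)))%C.

(** With [r] below the tail radius of [M], only the finitely many linear factors of index up to [M]
    can vanish on the disc; the tail is an exponential. Analyticity, the zeros of [G] and the poles
    of its inverse are all read off from this form. The prefactor [z] enters as the linear factor of
    [(0, 0)]. *)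
Lemma barnes_factorization (r : R) :
  exists (ks : list (nat * nat)) (E : C -> C), forall z, Cmod z < r ->
    an E z /\ E z <> 0%C /\
    G z = (Cprod (map (fun kl => z + RtoC (lat tau kl)) ks) * E z)%C.
Proof.
  assert (Pc := cmin_pos tau Htau). destruct (INR_unbounded (2 * r / cmin tau)) as [M HM].
  assert (Hr : r < tail_radius tau M).
  { unfold tail_radius; apply (Rmult_lt_compat_l (cmin tau)) in HM; [ | auto ].
    replace (cmin tau * (2 * r / cmin tau)) with (2 * r) in HM by (field; lra); nra. }
  exists (shells 0 (S M)), (fun z => / RtoC tau * quad_exp tau c1 c2 z *
    Cprod (map (unit_factor z) (shells 1 M)) * Cexp (tail_log tau M z))%C.
  assert (N0 : RtoC tau <> 0%C) by (apply RtoC_neq_0; lra).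
  intros z Hz; assert (Hz' : Cmod z < tail_radius tau M) by lra. split; [ | split ].
  - apply an_mult; [ apply an_mult; [ apply an_mult | ] | ].
    + apply an_const.
    + apply an_Cexp; apply an_plus; unfold Cdiv; apply an_mult; try apply an_const;
        (apply an_mult; [ apply an_const | ]); [ apply an_id | apply an_pow, an_id ].
    + apply (an_Cprod (fun kl y => unit_factor y kl)); intros kl Hkl.
      apply an_mult; [ apply an_const | apply an_Cexp; apply an_plus ].
      * apply an_opp; apply an_mult; [ apply an_id | apply an_const ].
      * apply an_mult; [ apply an_pow, an_id | apply an_const ].
    + apply an_Cexp, tail_log_an; auto.
  - apply Cmult_neq_0; [ apply Cmult_neq_0; [ apply Cmult_neq_0 | ] | apply Cexp_neq_0 ];
      [ | apply Cexp_neq_0 | ].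
    + intros E; apply (f_equal (Cmult (RtoC tau))) in E; rewrite Cinv_r, Cmult_0_r in E by auto.
      apply RtoC_inj in E; lra.
    + apply Cprod_neq_0; intros x Hx; apply in_map_iff in Hx; destruct Hx as [kl [<- Hkl]].
      apply Cmult_neq_0; [ | apply Cexp_neq_0 ]. assert (P := lat_pos tau kl Htau (in_shells_neq _ _ Hkl)).
      intros E; apply (f_equal (Cmult (RtoC (lat tau kl)))) in E.
      rewrite Cinv_r, Cmult_0_r in E by (apply RtoC_neq_0; lra). apply RtoC_inj in E; lra.
  - rewrite (barnes_G_formula M z Hz'), shells_0; simpl map; simpl Cprod.
    replace (Cprod (map (barnes_factor tau z) (shells 1 M))) with
      (Cprod (map (fun kl => z + RtoC (lat tau kl)) (shells 1 M)) *
       Cprod (map (unit_factor z) (shells 1 M)))%C.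
    + unfold lat at 2; simpl. rewrite Rmult_0_l, Rplus_0_r. unfold Cdiv; ring.
    + rewrite <- Cprod_map_mult; f_equal; apply map_ext_in; intros kl Hkl.
      assert (H0 := in_shells_neq _ _ Hkl).
      assert (P := RtoC_neq_0 _ (Rgt_not_eq _ _ (lat_pos tau kl Htau H0))).
      rewrite barnes_factor_lat by auto; unfold unit_factor. set (e := Cexp _); clearbody e; field; auto.
Qed.

Lemma barnes_G_an (z : C) : an G z.
Proof.
  destruct (barnes_factorization (Cmod z + 1)) as [ks [E H]].
  apply (an_ext_near (fun z => Cprod (map (fun kl => z + RtoC (lat tau kl)) ks) * E z)%C).
  - assert (N : Cmod (z - 0) < Cmod z + 1) by (replace (z - 0)%C with z by ring; lra).
    generalize (near_ball _ _ _ N); apply filter_imp; intros y Hy.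
    replace (y - 0)%C with y in Hy by ring; symmetry; apply H, Hy.
  - apply an_mult; [ | apply H; lra ]. apply (an_Cprod (fun kl y => y + RtoC (lat tau kl))%C); intros kl _.
    apply an_plus; [ apply an_id | apply an_const ].
Qed.

Lemma barnes_G_eq_0 (z : C) : G z = 0%C -> exists kl, z = (- RtoC (lat tau kl))%C.
Proof.
  intros H0; destruct (barnes_factorization (Cmod z + 1)) as [ks [E H]].
  destruct (H z) as [_ [HE HGz]]; [ lra | ].
  assert (P : Cprod (map (fun kl => z + RtoC (lat tau kl)) ks)%C = 0%C).
  { apply NNPP; intros P; rewrite H0 in HGz; symmetry in HGz; revert HGz. apply Cmult_neq_0; auto. }
  apply Cprod_eq_0, in_map_iff in P; destruct P as [kl [E1 _]]; exists kl.
  replace z with (z + RtoC (lat tau kl) - RtoC (lat tau kl))%C by ring; rewrite E1; ring.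
Qed.

(** * Growth of the double gamma function off the real axis *)

(** The coefficient of [Re (z * z) / 2] in the logarithm of the modulus of [G]. It is never
    evaluated, only bounded above linearly and below logarithmically in [M]. *)
Definition inv_sq_sum (M : nat) : R := Rsum (map (fun kl => / (lat tau kl) ^ 2) (shells 1 M)).

(** Large enough for [rho] to lie below the tail radius, and still at most linear in [rho]. *)
Definition cutoff (rho : R) : nat := Z.to_nat (up (2 * rho / cmin tau)).

Lemma cutoff_spec (rho : R) : 0 <= rho ->
  2 * rho / cmin tau < INR (cutoff rho) <= 2 * rho / cmin tau + 1.
Proof.
  intros H; assert (Pc := cmin_pos tau Htau); unfold cutoff. assert (P : 0 <= 2 * rho / cmin tau). { pos. }
  destruct (archimed (2 * rho / cmin tau)) as [H1 H2].
  assert (0 <= up (2 * rho / cmin tau))%Z by (apply le_IZR; lra). rewrite INR_IZR_INZ, Z2Nat.id by auto; lra.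
Qed.

Lemma cutoff_radius (rho : R) : 0 <= rho -> rho < tail_radius tau (cutoff rho).
Proof.
  intros H; assert (Pc := cmin_pos tau Htau); destruct (cutoff_spec rho H) as [H1 _].
  apply (Rmult_lt_compat_l (cmin tau)) in H1; [ | auto ].
  replace (cmin tau * (2 * rho / cmin tau)) with (2 * rho) in H1 by (field; lra). unfold tail_radius; nra.
Qed.

(** Shell [i] has [2 i + 1 <= 3 i] elements, so terms of size [B / (3 i)] add up to at most [B] per
    shell. *)
Lemma Rsum_shells_le (f : nat * nat -> R) (B : R) (M : nat) :
  (forall i kl, (1 <= i <= M)%nat -> In kl (shell i) -> f kl <= B / (3 * INR i)) -> 0 <= B ->
  Rsum (map f (shells 1 M)) <= INR M * B.
Proof.
  intros H HB; induction M as [|M IH]; [ simpl; lra | ].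
  rewrite shells_S, map_app, Rsum_app, S_INR, Rmult_plus_distr_r, Rmult_1_l.
  apply Rplus_le_compat; [ apply IH; intros i kl Hi; apply H; lia | ].
  assert (Pi : 1 <= INR (1 + M)) by (apply (le_INR 1); lia).
  assert (K : forall l, (forall kl, In kl l -> f kl <= B / (3 * INR (1 + M))) ->
    Rsum (map f l) <= INR (length l) * (B / (3 * INR (1 + M)))).
  { induction l as [|x l IHl]; intros Hl; [ simpl; lra | ].
    change (f x + Rsum (map f l) <= INR (S (length l)) * (B / (3 * INR (1 + M)))).
    rewrite S_INR; generalize (Hl x (or_introl eq_refl)) (IHl (fun y Hy => Hl y (or_intror Hy))); lra. }
  eapply Rle_trans; [ apply K; intros; apply (H (1 + M)%nat); [ lia | auto ] | ].
  rewrite length_shell, plus_INR, mult_INR; simpl (INR 2); simpl (INR 1). set (x := INR (1 + M)) in *.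
  apply (Rmult_le_reg_r (3 * x)); [ lra | ].
  replace (((1 + 1) * x + 1) * (B / (3 * x)) * (3 * x)) with ((2 * x + 1) * B) by (field; lra). nra.
Qed.

Lemma Rsum_ge_0 {A : Type} (f : A -> R) (l : list A) :
  (forall x, In x l -> 0 <= f x) -> 0 <= Rsum (map f l).
Proof.
  induction l as [|x l IH]; simpl; intros H; [ lra | ].
  generalize (H x (or_introl eq_refl)) (IH (fun y Hy => H y (or_intror Hy))); lra.
Qed.

Lemma inv_sq_sum_le (M : nat) : inv_sq_sum M <= INR M * (3 / cmin tau ^ 2).
Proof.
  assert (Pc := cmin_pos tau Htau). apply Rsum_shells_le.
  - intros i kl Hi Hkl; destruct (lat_shell tau i kl Htau Hkl) as [H _].
    assert (Pi : 1 <= INR i) by (apply (le_INR 1); lia).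
    replace (3 / cmin tau ^ 2 / (3 * INR i)) with (/ (cmin tau ^ 2 * INR i)) by (field; lra).
    apply Rinv_le_contravar; [ nra | ].
    apply Rle_trans with ((cmin tau * INR i) ^ 2); [ | apply pow_incr; nra ]. nra.
  - pos.
Qed.

(** Shell [M + 1] alone contributes at least [1 / ((tau + 1)^2 (M + 1))], and the harmonic sum
    dominates the logarithm. This divergence is the source of the decay of the kernel. *)
Lemma inv_sq_sum_ge (M : nat) : ln (INR M + 1) / (tau + 1) ^ 2 <= inv_sq_sum M.
Proof.
  induction M as [|M IH].
  - simpl; rewrite Rplus_0_l, ln_1; unfold inv_sq_sum; simpl; lra.
  - unfold inv_sq_sum in *; rewrite shells_S, map_app, Rsum_app, S_INR. assert (PM := pos_INR M).
    assert (E : ln (INR M + 1 + 1) <= ln (INR M + 1) + / (INR M + 1)).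
    { replace (INR M + 1 + 1) with ((INR M + 1) * (1 + / (INR M + 1))) by (field; lra).
      assert (0 < / (INR M + 1)) by pos. rewrite ln_mult by lra; apply Rplus_le_compat_l.
      apply exp_le_cancel; rewrite exp_ln by lra; left; apply exp_ineq1; lra. }
    assert (K : / (INR M + 1) / (tau + 1) ^ 2 <= Rsum (map (fun kl => / (lat tau kl) ^ 2) (shell (1 + M)))).
    { assert (L : forall l, (forall kl, In kl l -> 0 < lat tau kl <= (tau + 1) * (INR M + 1)) ->
        INR (length l) * (/ (((tau + 1) * (INR M + 1)) ^ 2)) <= Rsum (map (fun kl => / (lat tau kl) ^ 2) l)).
      { induction l as [|x l IHl]; intros Hl; [ simpl; lra | ].
        change (INR (S (length l)) * (/ (((tau + 1) * (INR M + 1)) ^ 2)) <=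
          / (lat tau x) ^ 2 + Rsum (map (fun kl => / (lat tau kl) ^ 2) l)).
        rewrite S_INR. destruct (Hl x (or_introl eq_refl)) as [H1 H2].
        assert (/ ((tau + 1) * (INR M + 1)) ^ 2 <= / lat tau x ^ 2).
        { apply Rinv_le_contravar; [ pos | apply pow_incr; lra ]. }
        generalize (IHl (fun y Hy => Hl y (or_intror Hy))); lra. }
      eapply Rle_trans; [ | apply L ].
      - rewrite length_shell, plus_INR, mult_INR, (plus_INR 1 M); simpl (INR 2); simpl (INR 1).
        rewrite (Rplus_comm 1 (INR M)). apply (Rmult_le_reg_r ((tau + 1) ^ 2 * (INR M + 1) ^ 2)). { nra. }
        replace (/ (INR M + 1) / (tau + 1) ^ 2 * ((tau + 1) ^ 2 * (INR M + 1) ^ 2)) with (INR M + 1)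
          by (field; lra).
        replace (((1 + 1) * (INR M + 1) + 1) * / ((tau + 1) * (INR M + 1)) ^ 2 *
          ((tau + 1) ^ 2 * (INR M + 1) ^ 2)) with (2 * INR M + 3) by (field; lra).
        lra.
      - intros kl Hkl; destruct (lat_shell tau (1 + M) kl Htau Hkl) as [H1 H2].
        rewrite plus_INR in *; simpl (INR 1) in *. assert (Pc := cmin_pos tau Htau). split; [ nra | lra ]. }
    unfold Rdiv in *; apply (Rmult_le_compat_r (/ (tau + 1) ^ 2)) in E; [ lra | pos ].
Qed.

Lemma exp_ge_1 (x : R) : 0 <= x -> 1 <= exp x.
Proof. intros [H| <-]; [ generalize (exp_ineq1 x); lra | rewrite exp_0; lra ]. Qed.

Lemma exp_ge_id (x : R) : x <= exp x.
Proof.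
  destruct (Req_dec x 0) as [->|H]; [ generalize (exp_pos 0); lra | ]. generalize (exp_ineq1 x H); lra.
Qed.

Lemma exp_ge_1_plus (x : R) : 1 + x <= exp x.
Proof.
  destruct (Req_dec x 0) as [->|H]; [ rewrite exp_0; lra | left; apply exp_ineq1, H ].
Qed.

(** Off the real axis [1 + z / w] has modulus at least [kappa / 2]: by its imaginary part if
    [Cmod z >= w / 2], by the triangle inequality otherwise. From above it is at most
    [exp (rho / w)], and the linear exponential costs another [rho / w]; the quadratic term is the
    main one. *)
Lemma barnes_factor_bounds (kappa rho : R) (z : C) (kl : nat * nat) :
  0 < kappa <= 1 -> kl <> (0, 0)%nat -> Cmod z <= rho -> kappa * rho <= Rabs (Im z) ->
  let w := lat tau kl in
  exp (Re (z * z) / 2 * / w ^ 2 - (ln (2 / kappa) + 2 * rho / w)) <= Cmod (barnes_factor tau z kl)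
    <= exp (Re (z * z) / 2 * / w ^ 2 + (ln (2 / kappa) + 2 * rho / w)).
Proof.
  intros Hk Hkl Hz Him w. assert (Pw : 0 < w) by (apply lat_pos; auto).
  assert (Nw := RtoC_neq_0 w (Rgt_not_eq _ _ Pw)). rewrite barnes_factor_lat by auto; fold w.
  rewrite Cmod_mult, Cmod_Cexp. assert (E : Re (- (z / RtoC w) + z ^ 2 / (2 * RtoC w ^ 2))%C =
    - (Re z / w) + Re (z * z) / 2 * / w ^ 2).
  { replace (- (z / RtoC w) + z ^ 2 / (2 * RtoC w ^ 2))%C with
      (RtoC (- / w) * z + RtoC (/ 2 * / (w * w)) * (z * z))%C.
    - rewrite Re_plus, !(Re_mult (RtoC _)), !Re_RtoC, !Im_RtoC. simpl (w ^ 2); field; lra.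
    - rewrite RtoC_mult, RtoC_opp, !RtoC_inv, RtoC_mult by nra; simpl; field; auto. }
  assert (Hre : Rabs (Re z / w) <= rho / w). { unfold Rdiv; rewrite Rabs_mult, (Rabs_pos_eq (/ w)) by pos.
    apply Rmult_le_compat_r; [ pos | ]. le_via Re_le_Cmod; auto. }
  assert (Pkk : 1 <= 2 / kappa).
  { apply (Rmult_le_reg_r kappa); [ lra | ]. unfold Rdiv; rewrite Rmult_assoc, Rinv_l; lra. }
  assert (Pln : 0 <= ln (2 / kappa)).
  { rewrite <- ln_1; destruct Pkk as [P| <-]; [ left; apply ln_increasing; lra | lra ]. }
  apply Rabs_def2_le in Hre || (apply Rabs_le_between in Hre).
  assert (Hsum : (1 + z / RtoC w)%C = ((z + RtoC w) * / RtoC w)%C) by (field; auto).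
  assert (L1 : exp (- ln (2 / kappa)) <= Cmod (1 + z / RtoC w)). { rewrite exp_Ropp, exp_ln by lra.
    replace (/ (2 / kappa)) with (kappa / 2) by (field; lra).
    rewrite Hsum, Cmod_mult, Cmod_inv, Cmod_R, (Rabs_pos_eq w) by (assumption || lra).
    apply (Rmult_le_reg_r w); [ auto | ]. rewrite Rmult_assoc, Rinv_l, Rmult_1_r by lra.
    destruct (Rle_dec (w / 2) (Cmod z)) as [Hc|Hc].
    - eapply Rle_trans; [ | apply Im_le_Cmod ]. rewrite Im_plus, Im_RtoC, Rplus_0_r. nra.
    - generalize (Cmod_minus_ge (RtoC w) (- z)); rewrite Cmod_opp, Cmod_R, Rabs_pos_eq by lra.
      replace (RtoC w - - z)%C with (z + RtoC w)%C by ring. nra. }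
  assert (U1 : Cmod (1 + z / RtoC w) <= exp (rho / w)). { le_via Cmod_triangle.
    rewrite Cmod_1, Cmod_div, Cmod_R, (Rabs_pos_eq w) by (assumption || lra).
    eapply Rle_trans; [ | apply exp_ge_1_plus ]. apply Rplus_le_compat_l, Rmult_le_compat_r; [ pos | auto ]. }
  replace (2 * rho / w) with (rho / w + rho / w) by (field; lra). split.
  - replace (Re (z * z) / 2 * / w ^ 2 - (ln (2 / kappa) + (rho / w + rho / w))) with
      (- ln (2 / kappa) + (Re (z * z) / 2 * / w ^ 2 - (rho / w + rho / w))) by ring.
    rewrite exp_plus; apply Rmult_le_compat; try (left; apply exp_pos); [ auto | ]. apply exp_le_compat; lra.
  - apply Rle_trans with (exp (rho / w) * exp (rho / w + Re (z * z) / 2 * / w ^ 2)).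
    + apply Rmult_le_compat; try (left; apply exp_pos); [ apply Cmod_ge_0 | auto | ].
      apply exp_le_compat; lra.
    + rewrite <- exp_plus; apply exp_le_compat; lra.
Qed.

Lemma sandwich_mult (x y a1 a2 b1 b2 c1' c2' : R) :
  exp (a1 - b1) <= x <= exp (a1 + b1) -> exp (a2 - b2) <= y <= exp (a2 + b2) ->
  b1 + b2 <= c2' -> c1' = a1 + a2 ->
  exp (c1' - c2') <= x * y <= exp (c1' + c2').
Proof.
  intros [H1 H2] [H3 H4] Hb ->; split.
  - apply Rle_trans with (exp (a1 - b1) * exp (a2 - b2)).
    + rewrite <- exp_plus; apply exp_le_compat; lra.
    + apply Rmult_le_compat; try assumption; pos.
  - apply Rle_trans with (exp (a1 + b1) * exp (a2 + b2)).
    + apply Rmult_le_compat; try assumption; eapply Rle_trans; try eassumption; pos.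
    + rewrite <- exp_plus; apply exp_le_compat; lra.
Qed.

Lemma exp_abs_bounds (x b : R) : Rabs x <= b -> exp (0 - b) <= exp x <= exp (0 + b).
Proof. intros H; apply Rabs_le_between in H; split; apply exp_le_compat; lra. Qed.

Lemma barnes_G_bounds (kappa : R) : 0 < kappa <= 1 ->
  exists K, 0 < K /\ forall (rho : R) (z : C), 1 <= rho -> Cmod z <= rho ->
    kappa * rho <= Rabs (Im z) ->
    exp (Re (z * z) / 2 * inv_sq_sum (cutoff rho) - K * rho ^ 2) <= Cmod (G z)
    <= exp (Re (z * z) / 2 * inv_sq_sum (cutoff rho) + K * rho ^ 2).
Proof.
  intros Hk; assert (Pc := cmin_pos tau Htau). set (c := cmin tau) in *. set (lk := ln (2 / kappa)).
  assert (Pkk : 1 <= 2 / kappa).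
  { apply (Rmult_le_reg_r kappa); [ lra | ]. unfold Rdiv; rewrite Rmult_assoc, Rinv_l; lra. }
  assert (Plk : 0 <= lk).
  { unfold lk; rewrite <- ln_1; destruct Pkk as [P| <-]; [ left; apply ln_increasing; lra | lra ]. }
  (* [K1] to [K4] are the costs of the prefactor [z / tau], of the quadratic exponential, of the
     head of the product and of the logarithm of the tail; [C0 * rho] bounds the cutoff. *)
  set (K1 := / tau + Rabs (ln (kappa / tau))). set (K2 := Rabs c1 / tau + Rabs c2 / (2 * tau ^ 2)).
  set (C0 := 2 / c + 1). set (K3 := C0 * (3 * C0 * lk + 6 / c)). set (K4 := tail_const tau 1 * c).
  assert (PC0 : 0 < C0) by (unfold C0; assert (0 < 2 / c) by pos; lra). assert (P1 : 0 < K1).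
  { unfold K1; generalize (Rabs_pos (ln (kappa / tau))) (Rinv_0_lt_compat _ Htau); lra. }
  assert (P2 : 0 <= K2). { unfold K2; apply Rplus_le_le_0_compat; pos. } assert (P3 : 0 <= K3).
  { unfold K3; assert (0 < 6 / c) by pos. nra. } assert (P4 : 0 < K4).
  { unfold K4; apply Rmult_lt_0_compat; [ apply tail_const_pos, Htau | auto ]. }
  exists (K1 + K2 + K3 + K4); split; [ lra | intros rho z Hrho Hz Him ]. set (M := cutoff rho).
  assert (HM : rho < tail_radius tau M) by (apply cutoff_radius; lra).
  destruct (cutoff_spec rho) as [HM1 HM2]; [ lra | fold M c in HM1, HM2 ]. assert (HM3 : INR M <= C0 * rho).
  { le_via HM2; unfold C0. replace ((2 / c + 1) * rho) with (2 * rho / c + rho) by (field; lra); lra. }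
  assert (Hzz := Cmod_ge_0 z). rewrite (barnes_G_formula M z) by lra; rewrite !Cmod_mult, Cmod_Cexp.
  assert (B1 : exp (0 - K1 * rho ^ 2) <= Cmod (z / RtoC tau) <= exp (0 + K1 * rho ^ 2)).
  { rewrite Cmod_div, Cmod_R, (Rabs_pos_eq tau) by (try apply RtoC_neq_0; lra).
    assert (PI1 : 0 < / tau) by pos. assert (Habs := Rabs_pos (ln (kappa / tau))).
    assert (Hr2 : 1 <= rho ^ 2) by nra. split.
    - apply Rle_trans with (kappa / tau).
      + rewrite <- (exp_ln (kappa / tau)) at 1 by pos. apply exp_le_compat.
        assert (L : - Rabs (ln (kappa / tau)) <= ln (kappa / tau)).
        { generalize (Rle_abs (- ln (kappa / tau))); rewrite Rabs_Ropp; lra. } unfold K1; nra.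
      + apply Rmult_le_compat_r; [ lra | ]. generalize (Im_le_Cmod z); nra.
    - apply Rle_trans with (rho ^ 2 / tau).
      + apply Rmult_le_compat_r; [ lra | nra ].
      + le_via exp_ge_id; apply exp_le_compat. unfold K1, Rdiv; nra. }
  assert (B2 : exp (0 - K2 * rho ^ 2) <= Cmod (quad_exp tau c1 c2 z) <= exp (0 + K2 * rho ^ 2)).
  { unfold quad_exp; rewrite Cmod_Cexp; apply exp_abs_bounds. le_via Re_le_Cmod; le_via Cmod_triangle.
    rewrite !Cmod_div by (apply RtoC_neq_0; nra).
    rewrite !Cmod_mult, Cmod_pow, !Cmod_R, (Rabs_pos_eq tau), (Rabs_pos_eq (2 * tau ^ 2)) by nra.
    unfold K2; rewrite Rmult_plus_distr_r; unfold Rdiv.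
    assert (Cmod z <= rho ^ 2) by nra. assert (Cmod z ^ 2 <= rho ^ 2) by (apply pow_incr; lra).
    apply Rplus_le_compat.
    - rewrite !Rmult_assoc; apply Rmult_le_compat_l; [ apply Rabs_pos | ].
      rewrite Rmult_comm; apply Rmult_le_compat_l; [ pos | auto ].
    - rewrite !Rmult_assoc; apply Rmult_le_compat_l; [ apply Rabs_pos | ].
      rewrite Rmult_comm; apply Rmult_le_compat_l; [ pos | auto ]. }
  assert (B3 : exp (Re (z * z) / 2 * inv_sq_sum M - K3 * rho ^ 2) <=
    Cmod (Cprod (map (barnes_factor tau z) (shells 1 M))) <=
    exp (Re (z * z) / 2 * inv_sq_sum M + K3 * rho ^ 2)).
  { assert (B := Cprod_bounds (barnes_factor tau z) (fun kl => Re (z * z) / 2 * / lat tau kl ^ 2)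
      (fun kl => lk + 2 * rho / lat tau kl) (shells 1 M)).
    destruct B as [B1' B2'].
    { intros kl Hkl; apply barnes_factor_bounds; try assumption; eapply in_shells_neq, Hkl. }
    assert (E : Rsum (map (fun kl => Re (z * z) / 2 * / lat tau kl ^ 2) (shells 1 M)) =
      Re (z * z) / 2 * inv_sq_sum M).
    { unfold inv_sq_sum; generalize (shells 1 M); intros l; induction l as [|x l IH]; simpl in *;
        [ ring | rewrite IH; ring ]. }
    assert (F : Rsum (map (fun kl => lk + 2 * rho / lat tau kl) (shells 1 M)) <= K3 * rho ^ 2).
    (* Each of the at most [3 i] factors of shell [i] costs [lk], at most [3 M lk] per shell, and
       the terms [2 rho / w] add [6 rho / c]; over [M] shells this is [O (rho^2)]. *)
    { le_via (Rsum_shells_le _ (3 * INR M * lk + 6 * rho / c)).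
      - intros i kl Hi Hkl. destruct (lat_shell tau i kl Htau Hkl) as [H _]; fold c in H.
          assert (Pi : 1 <= INR i) by (apply (le_INR 1); lia).
          assert (PiM : INR i <= INR M) by (apply le_INR; lia).
          replace ((3 * INR M * lk + 6 * rho / c) / (3 * INR i)) with
            (INR M / INR i * lk + 2 * rho / (c * INR i)) by (field; lra).
          apply Rplus_le_compat.
          - rewrite <- (Rmult_1_l lk) at 1; apply Rmult_le_compat_r; [ auto | ].
            apply (Rmult_le_reg_r (INR i)); [ lra | ]. unfold Rdiv; rewrite Rmult_assoc, Rinv_l; lra.
          - apply Rmult_le_compat_l; [ lra | apply Rinv_le_contravar; nra ].
      - assert (0 <= 6 * rho / c) by pos. assert (0 <= INR M * lk) by pos. lra.
      - replace (K3 * rho ^ 2) with ((C0 * rho) * ((3 * C0 * lk + 6 / c) * rho)) by (unfold K3; ring).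
        assert (0 <= 6 * rho / c) by pos. assert (PM := pos_INR M).
        assert (Hlk : INR M * lk <= C0 * rho * lk) by (apply Rmult_le_compat_r; auto).
        assert (0 <= INR M * lk) by pos. apply Rmult_le_compat; [ auto | lra | auto | ]. lra. }
    split; [ eapply Rle_trans; [ | apply B1' ] | le_via B2' ]; apply exp_le_compat; lra. }
  assert (B4 : exp (0 - K4 * rho ^ 2) <= exp (Re (tail_log tau M z)) <= exp (0 + K4 * rho ^ 2)).
  { apply exp_abs_bounds; le_via Re_le_Cmod. eapply Rle_trans; [ apply tail_log_bound; [ auto | lra ] | ].
    assert (PT := tail_const_pos tau Htau 1). assert (PM := pos_INR M). assert (H : rho / (INR M + 1) <= c).
    { apply (Rmult_le_reg_r (INR M + 1)); [ lra | ].
      unfold Rdiv; rewrite Rmult_assoc, Rinv_l, Rmult_1_r by lra.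
      unfold tail_radius in HM; fold c in HM; nra. }
    apply Rle_trans with (rho * rho * (tail_const tau 1 / (INR M + 1)) * rho).
    - assert (0 <= tail_const tau 1 / (INR M + 1)). { pos. }
      apply Rmult_le_compat; try lra; [ pos | apply Rmult_le_compat_r; [ auto | nra ] ].
    - replace (rho * rho * (tail_const tau 1 / (INR M + 1)) * rho) with
        (tail_const tau 1 * (rho / (INR M + 1)) * rho ^ 2) by (field; lra).
      apply Rmult_le_compat_r; [ nra | ]. apply Rmult_le_compat_l; lra. }
  refine (sandwich_mult _ _ _ _ _ _ _ _ (sandwich_mult _ _ _ _ _ _ _ _
    (sandwich_mult _ _ _ _ _ _ _ _ B1 B2 (Rle_refl _) eq_refl) B3 (Rle_refl _) eq_refl) B4 _ _).
  - lra.
  - ring.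
Qed.

End BarnesG.

(** * Decay of the kernel *)

Lemma list_Cmod_bound (l : list C) : exists A, 0 <= A /\ forall x, In x l -> Cmod x <= A.
Proof.
  induction l as [|y l [A [HA H]]].
  - exists 0; split; [ lra | intros x [] ].
  - exists (Rmax A (Cmod y)); split; [ le_via HA; apply Rmax_l | ].
    intros x [<-|Hx]; [ apply Rmax_r | eapply Rle_trans; [ apply H, Hx | apply Rmax_l ] ].
Qed.

Lemma Rsum_const {A : Type} (x : R) (l : list A) :
  Rsum (map (fun _ => x) l) = INR (length l) * x.
Proof.
  induction l as [|a l IH]; [ simpl; ring | ].
  change (x + Rsum (map (fun _ => x) l) = INR (S (length l)) * x). rewrite IH, S_INR; ring.
Qed.

Section Decay.

Variables (tau c1 c2 : R) (G : C -> C).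
Hypothesis Htau : 0 < tau.
Hypothesis HG : forall z : C,
  filterlim (barnes_partial tau c1 c2 z) eventually (locally (G z)).

(** The cutoff is taken at [2 * Cmod s] for every argument [c0 + s] or [c0 - s], so that all factors
    of the kernel share exactly this main term and it ends up multiplied by the integer [N]. *)
Let X (s : C) : R := Re (s * s) / 2 * inv_sq_sum tau (cutoff tau (2 * Cmod s)).

Lemma barnes_G_shift_bounds (kappa A : R) : 0 < kappa <= 1 -> 0 <= A ->
  exists K r0, 0 < K /\ 1 <= r0 /\ forall s z c0 : C,
    r0 <= Cmod s -> kappa * Cmod s <= Rabs (Im s) -> Cmod c0 <= A ->
    (z = c0 + s \/ z = c0 - s)%C ->
    exp (X s - K * Cmod s ^ 2) <= Cmod (G z) <= exp (X s + K * Cmod s ^ 2).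
Proof.
  (* Far out the shift [c0] takes away at most half of the imaginary part, leaving
     [kappa / 2 * Cmod s], which is [kappa / 4] relative to the radius [2 * Cmod s]. *)
  intros Hk HA. destruct (barnes_G_bounds tau c1 c2 G Htau HG (kappa / 4)) as [K0 [HK0 HB]]; [ lra | ].
  assert (Pc := cmin_pos tau Htau). set (D := (4 / cmin tau + 1) * (3 / cmin tau ^ 2)).
  assert (P4c : 0 < 4 / cmin tau) by pos. assert (P3c : 0 < 3 / cmin tau ^ 2) by pos.
  assert (HD : 0 < D) by (unfold D; pos). set (r0 := 1 + A + 2 * A / kappa).
  assert (HAk : 0 <= A / kappa) by pos. exists (4 * K0 + 3 * A * D), r0; split; [ | split ].
  - nra.
  - unfold r0; unfold Rdiv in *; lra.
  - intros s z c0 Hs Him Hc0 Hz; set (r := Cmod s) in *. assert (Hr1 : 1 <= r) by (unfold r0, Rdiv in *; lra).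
    assert (HrA : A <= r) by (unfold r0, Rdiv in *; lra). assert (HkA : 2 * A <= kappa * r).
    { assert (E : kappa * (A / kappa) = A) by (field; lra).
      assert (kappa * (1 + A + 2 * A / kappa) <= kappa * r) by (apply Rmult_le_compat_l; [ lra | exact Hs ]).
      replace (kappa * (1 + A + 2 * A / kappa)) with (kappa + kappa * A + 2 * (kappa * (A / kappa)))
        in * by (field; lra).
      rewrite E in *; nra. }
    assert (Hz1 : Cmod z <= 2 * r). { destruct Hz as [-> | ->]; [ le_via Cmod_triangle
        | le_via Cmod_triangle_minus ]; fold r; lra. }
    assert (Hz2 : kappa / 4 * (2 * r) <= Rabs (Im z)).
    { assert (Hi : Rabs (Im c0) <= A) by (le_via Im_le_Cmod; auto).
      destruct Hz as [-> | ->]; autorewrite with ReIm; revert Hi Him; unfold Rabs;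
        repeat destruct Rcase_abs; lra. }
    assert (B := HB (2 * r) z ltac:(lra) Hz1 Hz2). set (Q := inv_sq_sum tau (cutoff tau (2 * r))) in *.
    assert (HQ0 : 0 <= Q).
    { unfold Q, inv_sq_sum; apply Rsum_ge_0; intros kl Hkl; left; apply Rinv_0_lt_compat, pow_lt.
      apply lat_pos; [ auto | eapply in_shells_neq, Hkl ]. }
    assert (HQ : Q <= D * r). { eapply Rle_trans; [ apply inv_sq_sum_le, Htau | ].
      destruct (cutoff_spec tau Htau (2 * r)) as [_ H]; [ lra | ].
      replace (D * r) with ((4 / cmin tau + 1) * r * (3 / cmin tau ^ 2)) by (unfold D; ring).
      apply Rmult_le_compat_r; [ lra | ]. lra. }
    (* The shift changes [z * z] by [O (Cmod s)] and the sum [Q] is [O (Cmod s)], so the main term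
       moves by [O (Cmod s ^ 2)] only. *)
    assert (HX : Rabs (Re (z * z) / 2 * Q - X s) <= 3 * A * D * r ^ 2). { unfold X; fold r; fold Q.
      replace (Re (z * z) / 2 * Q - Re (s * s) / 2 * Q) with (Re (z * z - s * s) * (Q / 2))
        by (rewrite Re_minus; field).
      rewrite Rabs_mult, (Rabs_pos_eq (Q / 2)) by lra. assert (HR : Rabs (Re (z * z - s * s)) <= 3 * A * r).
      { le_via Re_le_Cmod. assert (E : Cmod (z * z - s * s) <= Cmod c0 * (Cmod c0 + 2 * r)).
        { destruct Hz as [-> | ->].
          - replace ((c0 + s) * (c0 + s) - s * s)%C with (c0 * (c0 + 2 * s))%C by ring.
            rewrite Cmod_mult; apply Rmult_le_compat_l; [ apply Cmod_ge_0 | ]. le_via Cmod_triangle.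
            rewrite Cmod_mult, Cmod_R, Rabs_pos_eq by lra; fold r; lra.
          - replace ((c0 - s) * (c0 - s) - s * s)%C with (c0 * (c0 - 2 * s))%C by ring.
            rewrite Cmod_mult; apply Rmult_le_compat_l; [ apply Cmod_ge_0 | ]. le_via Cmod_triangle_minus.
            rewrite Cmod_mult, Cmod_R, Rabs_pos_eq by lra; fold r; lra. }
        le_via E. replace (3 * A * r) with (A * (3 * r)) by ring.
        apply Rmult_le_compat; try lra; [ apply Cmod_ge_0 | generalize (Cmod_ge_0 c0); lra ]. }
      apply Rle_trans with (3 * A * r * (D * r)); [ | right; ring ].
      apply Rmult_le_compat; try lra; apply Rabs_pos. }
    apply Rabs_le_between in HX. split; [ eapply Rle_trans; [ | apply B ] | le_via B ];
      apply exp_le_compat; lra.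
Qed.

(** Counting factors, the logarithm of the modulus is at most [N * X s + E * Cmod s ^ 2]. Being a
    negative integer, [N] is at most -1, while [X s] grows like [Cmod s ^ 2 * ln (Cmod s)] and so
    absorbs any multiple of [Cmod s ^ 2]. *)
Lemma kernel_decay (m n : nat) (a b : list C) (alpha : C) (kappa A : R) :
  (m <= length b)%nat -> (n <= length a)%nat ->
  (order_N m n (length a) (length b) < 0)%Z -> 0 < kappa <= 1 ->
  exists r0, 1 <= r0 /\ forall s : C, r0 <= Cmod s -> kappa * Cmod s <= Rabs (Im s) ->
    kappa * Cmod s ^ 2 <= Re (s * s) ->
    Cmod (kernel G tau m n a b alpha s) <= exp (- A * Cmod s ^ 2).
Proof.
  intros Hm Hn HN Hk. destruct (list_Cmod_bound (a ++ b)) as [A0 [HA0 HA]].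
  destruct (barnes_G_shift_bounds kappa (A0 + 1 + tau)) as [K [r1 [HK [Hr1 HB]]]]; [ lra | lra | ].
  set (L := INR (length a + length b)). set (E := L * K + PI * Cmod alpha / tau). set (q := / (tau + 1) ^ 2).
  assert (Pq : 0 < q) by pos. assert (Pc := cmin_pos tau Htau).
  (* If [Cmod s >= exp w], the logarithm in [inv_sq_sum_ge] is at least [w], and [w] is tuned to
     give [X s >= (Rabs A + Rabs E) * Cmod s ^ 2]. *)
  set (w := 2 * (Rabs A + Rabs E) / (kappa * q)). exists (Rmax r1 (exp w)); split.
  { le_via Hr1; apply Rmax_l. } intros s Hs Him Hre.
  assert (Hs1 : r1 <= Cmod s) by (le_via Rmax_l; apply Hs).
  assert (Hs2 : exp w <= Cmod s) by (le_via Rmax_r; apply Hs). set (r := Cmod s) in *.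
  assert (HT : Cmod (RtoC (1 + tau)) = 1 + tau) by (rewrite Cmod_R; apply Rabs_pos_eq; lra).
  assert (Hprod : forall (f : C -> C) (l : list C), (forall x, In x l ->
      exists c0, Cmod c0 <= A0 + 1 + tau /\ (f x = c0 + s \/ f x = c0 - s)%C) ->
      exp (INR (length l) * X s - INR (length l) * (K * r ^ 2)) <= Cmod (Cprod (map (fun x => G (f x)) l))
      <= exp (INR (length l) * X s + INR (length l) * (K * r ^ 2))).
  { intros f l Hf. assert (B := Cprod_bounds (fun x => G (f x)) (fun _ => X s) (fun _ => K * r ^ 2) l).
    rewrite !Rsum_const in B; apply B; intros x Hx; destruct (Hf x Hx) as [c0 [Hc0 H]].
    apply (HB s (f x) c0); auto. }
  assert (Ha : forall x, In x a -> Cmod x <= A0) by (intros; apply HA, in_or_app; auto).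
  assert (Hb : forall x, In x b -> Cmod x <= A0) by (intros; apply HA, in_or_app; auto).
  assert (Hfa : forall k x, In x (firstn k a) -> In x a)
    by (intros k x Hx; rewrite <- (firstn_skipn k a); apply in_or_app; auto).
  assert (Hsa : forall k x, In x (skipn k a) -> In x a)
    by (intros k x Hx; rewrite <- (firstn_skipn k a); apply in_or_app; auto).
  assert (Hfb : forall k x, In x (firstn k b) -> In x b)
    by (intros k x Hx; rewrite <- (firstn_skipn k b); apply in_or_app; auto).
  assert (Hsb : forall k x, In x (skipn k b) -> In x b)
    by (intros k x Hx; rewrite <- (firstn_skipn k b); apply in_or_app; auto).
  assert (Q1 := Hprod (fun x => x - s)%C (firstn m b)).
  assert (Q2 := Hprod (fun x => RtoC (1 + tau) - x + s)%C (firstn n a)).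
  assert (Q3 := Hprod (fun x => RtoC (1 + tau) - x + s)%C (skipn m b)).
  assert (Q4 := Hprod (fun x => x - s)%C (skipn n a)). rewrite length_firstn, Nat.min_l in Q1, Q2 by auto.
  rewrite length_skipn in Q3, Q4. destruct Q1 as [_ U1].
  { intros x Hx; exists x; split; [ specialize (Hb x (Hfb _ _ Hx)); lra | auto ]. } destruct Q2 as [_ U2].
  { intros x Hx; exists (RtoC (1 + tau) - x)%C; split; [ | auto ]. le_via Cmod_triangle_minus; rewrite HT.
    specialize (Ha x (Hfa _ _ Hx)); lra. }
  destruct Q3 as [L3 _]. { intros x Hx; exists (RtoC (1 + tau) - x)%C; split; [ | auto ].
    le_via Cmod_triangle_minus; rewrite HT. specialize (Hb x (Hsb _ _ Hx)); lra. }
  destruct Q4 as [L4 _]. { intros x Hx; exists x; split; [ specialize (Ha x (Hsa _ _ Hx)); lra | auto ]. }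
  unfold kernel. set (D1 := Cprod (map (fun bj => G (RtoC (1 + tau) - bj + s)%C) (skipn m b))) in *.
  set (D2 := Cprod (map (fun aj => G (aj - s)%C) (skipn n a))) in *.
  assert (PD1 : 0 < Cmod D1) by (eapply Rlt_le_trans; [ apply exp_pos | apply L3 ]).
  assert (PD2 : 0 < Cmod D2) by (eapply Rlt_le_trans; [ apply exp_pos | apply L4 ]).
  rewrite !Cmod_mult, Cmod_div, !Cmod_mult, Cmod_Cexp.
  2:{ apply Cmult_neq_0; apply Cmod_gt_0; auto. }
  assert (U5 : Re (RtoC PI * alpha * s ^ 2 / RtoC tau) <= PI * Cmod alpha / tau * r ^ 2).
  { le_via Rle_abs; le_via Re_le_Cmod.
    rewrite Cmod_div, !Cmod_mult, Cmod_pow, !Cmod_R, (Rabs_pos_eq tau), (Rabs_pos_eq PI)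
      by (try apply RtoC_neq_0; generalize PI_RGT_0; lra).
    fold r; right; field; lra. }
  set (xb := INR (length b)) in *. set (xa := INR (length a)) in *.
  assert (Em : INR (length b - m) = xb - INR m) by (unfold xb; apply minus_INR; auto).
  assert (En : INR (length a - n) = xa - INR n) by (unfold xa; apply minus_INR; auto).
  rewrite Em in L3; rewrite En in L4. assert (EN : 2 * (INR m + INR n) - xa - xb <= -1).
  { unfold order_N in HN; unfold xa, xb; rewrite !INR_IZR_INZ.
    rewrite <- plus_IZR, <- mult_IZR, <- !minus_IZR; apply (IZR_le _ (-1)%Z); lia. }
  assert (EL : L = xa + xb) by (unfold L, xa, xb; apply plus_INR).
  assert (HXge : kappa / 2 * q * w * r ^ 2 <= X s). {
    assert (H := inv_sq_sum_ge tau Htau (cutoff tau (2 * r))).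
    destruct (cutoff_spec tau Htau (2 * r)) as [Hc _]; [ lra | ].
    assert (Hcr : r <= INR (cutoff tau (2 * r)) + 1). { assert (cmin tau <= 1) by apply Rmin_r.
      assert (r <= 2 * (2 * r) / cmin tau); [ | lra ]. apply (Rmult_le_reg_r (cmin tau)); [ auto | ].
      replace (2 * (2 * r) / cmin tau * cmin tau) with (4 * r) by (field; lra). nra. }
    assert (Hw : w <= ln (INR (cutoff tau (2 * r)) + 1)). { apply exp_le_cancel; rewrite exp_ln by lra; lra. }
    replace (kappa / 2 * q * w * r ^ 2) with (kappa * r ^ 2 / 2 * (w * q)) by field. assert (0 <= w).
    { unfold w; apply Rmult_le_pos; [ generalize (Rabs_pos A) (Rabs_pos E); lra | ]. pos. }
    apply Rmult_le_compat; [ nra | nra | lra | ]. eapply Rle_trans; [ | apply H ]; unfold Rdiv; fold q.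
    apply Rmult_le_compat_r; [ lra | auto ]. }
  assert (EX : kappa / 2 * q * w * r ^ 2 = (Rabs A + Rabs E) * r ^ 2) by (unfold w; field; lra).
  rewrite EX in HXge. assert (PX : 0 <= X s). { eapply Rle_trans; [ | apply HXge ].
    apply Rmult_le_pos; [ generalize (Rabs_pos A) (Rabs_pos E); lra | nra ]. }
  apply Rle_trans with (exp (INR m * X s + INR m * (K * r ^ 2)) * exp (INR n * X s + INR n * (K * r ^ 2)) *
    / (exp ((xb - INR m) * X s - (xb - INR m) * (K * r ^ 2)) *
       exp ((xa - INR n) * X s - (xa - INR n) * (K * r ^ 2))) * exp (PI * Cmod alpha / tau * r ^ 2)).
  - apply Rmult_le_compat.
    + pos.
    + pos.
    + apply Rmult_le_compat.
      * pos.
      * pos.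
      * apply Rmult_le_compat; try apply Cmod_ge_0; auto.
      * apply Rinv_le_contravar; [ pos | ]. apply Rmult_le_compat; try assumption; pos.
    + apply exp_le_compat, U5.
  - rewrite <- !exp_plus, <- exp_Ropp, <- !exp_plus; apply exp_le_compat.
    assert (HE : E * r ^ 2 <= Rabs E * r ^ 2) by (apply Rmult_le_compat_r; [ nra | apply Rle_abs ]).
    assert (HAA : - Rabs A * r ^ 2 <= - A * r ^ 2).
    { apply Rmult_le_compat_r; [ nra | generalize (Rle_abs A); lra ]. }
    assert (HNX : (2 * (INR m + INR n) - xa - xb) * X s <= - X s) by nra.
    assert (F : INR m * X s + INR m * (K * r ^ 2) + (INR n * X s + INR n * (K * r ^ 2)) +
      - ((xb - INR m) * X s - (xb - INR m) * (K * r ^ 2) +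
         ((xa - INR n) * X s - (xa - INR n) * (K * r ^ 2))) + PI * Cmod alpha / tau * r ^ 2 =
      (2 * (INR m + INR n) - xa - xb) * X s + E * r ^ 2) by (unfold E; rewrite EL; ring).
    rewrite F; lra.
Qed.

End Decay.

(** * The gamma function and the beta integral *)

Lemma cvg_Clim_seq (u : nat -> C) (l : C) : cvg u l -> Clim_seq u = l.
Proof.
  intros H; unfold Clim_seq. assert (K : forall p : C -> R, (forall z w, Rabs (p z - p w) <= Cmod (z - w)) ->
    real (Lim_seq (fun n => p (u n))) = p l).
  { intros p Hp; rewrite (is_lim_seq_unique (fun n => p (u n)) (p l)); [ reflexivity | ].
    apply is_lim_seq_spec; intros eps; destruct (H eps (cond_pos eps)) as [N HN].
    exists N; intros n Hn; lt_via Hp; apply HN, Hn. }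
  apply C_ext; [ apply (K Re) | apply (K Im) ]; intros z w;
    [ rewrite <- Re_minus; apply Re_le_Cmod | rewrite <- Im_minus; apply Im_le_Cmod ].
Qed.

(** As long as [u n] stays below twice [Cmod (u N)], its increments add up to at most
    [2 * Cmod (u N) * B / N <= Cmod (u N) / 2]. So the bound on [u n] persists, and the limit cannot
    be 0. *)
Lemma prod_cvg (u : nat -> C) (B : R) (N : nat) : (1 <= N)%nat -> 4 * B <= INR N ->
  0 <= B -> u N <> 0%C ->
  (forall n, (N <= n)%nat -> Cmod (u (S n) - u n) <= Cmod (u n) * (B * (/ INR n - / (INR n + 1)))) ->
  exists L, cvg u L /\ L <> 0%C.
Proof.
  intros HN HB HB0 Hu H. assert (PN : 1 <= INR N) by (apply (le_INR 1), HN).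
  assert (Pu : 0 < Cmod (u N)) by (apply Cmod_gt_0, Hu).
  set (e := fun n => 2 * Cmod (u N) * B * / (INR N + INR n)). assert (Pe : forall n, 0 <= e n).
  { intros n; repeat apply Rmult_le_pos; try lra; left; apply Rinv_0_lt_compat; generalize (pos_INR n); lra. }
  assert (He0 : e 0%nat <= Cmod (u N) / 2).
  { unfold e; simpl; rewrite Rplus_0_r; apply (Rmult_le_reg_r (INR N)); [ lra | ].
    rewrite Rmult_assoc, Rinv_l; nra. }
  assert (K : forall n n', (n <= n')%nat -> Cmod (u (N + n')%nat - u (N + n)%nat) <= e n - e n').
  { apply (telescope_le (fun n => u (N + n)%nat)); intros n Hn; rewrite Nat.add_0_r in Hn.
    rewrite Nat.add_succ_r; le_via (H (N + n)%nat); [ lia | ].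
    unfold e; rewrite S_INR, plus_INR, <- Rplus_assoc, <- Rmult_minus_distr_l, (Rmult_assoc _ B).
    assert (Pn := pos_INR n).
    assert (/ (INR N + INR n + 1) <= / (INR N + INR n)) by (apply Rinv_le_contravar; lra).
    apply Rmult_le_compat_r; [ pos | ]. generalize (Cmod_minus_ge (u (N + n)%nat) (u N)) (Pe n); lra. }
  destruct (cauchy_rate (fun n => u (N + n)%nat) (2 * Cmod (u N) * B)) as [L HL].
  { intros n n' Hn; le_via K; [ auto | apply Rle_trans with (e n); [ generalize (Pe n'); lra | ] ].
    apply Rmult_le_compat_l; [ pos | ]. generalize (pos_INR n); intros; apply Rinv_le_contravar; lra. }
  exists L; split.
  - intros eps He; destruct (inv_INR_small (2 * Cmod (u N) * B) eps He) as [N' HN'].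
    exists (N + N')%nat; intros n Hn; replace n with (N + (n - N))%nat by lia. lt_via HL; apply HN'; lia.
  - intros ->; destruct (inv_INR_small (2 * Cmod (u N) * B) (Cmod (u N) / 2)) as [N' HN']; [ lra | ].
    specialize (HL N'); specialize (HN' N' (Nat.le_refl _)); specialize (K 0%nat N' (Nat.le_0_l _)).
    rewrite Nat.add_0_r, Cmod_minus_sym in K; generalize (Pe N') (Cmod_minus_ge (u N) (u (N + N')%nat)).
    replace (u (N + N')%nat - 0)%C with (u (N + N')%nat) in HL by ring; lra.
Qed.

Lemma Rcpow_plus (x : R) (c d : C) : Rcpow x (c + d) = (Rcpow x c * Rcpow x d)%C.
Proof. unfold Rcpow; rewrite <- Cexp_plus; f_equal; ring. Qed.

Lemma Rcpow_0 (x : R) : Rcpow x 0 = 1%C.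
Proof. unfold Rcpow; rewrite Cmult_0_l; apply Cexp_0. Qed.

Lemma Rcpow_1 (x : R) : 0 < x -> Rcpow x 1 = RtoC x.
Proof. intros H; unfold Rcpow; rewrite Cmult_1_l, Cexp_R, exp_ln by auto; reflexivity. Qed.

Lemma Rcpow_neq_0 (x : R) (c : C) : Rcpow x c <> 0%C.
Proof. apply Cexp_neq_0. Qed.

Lemma Rcpow_opp (x : R) (c : C) : Rcpow x (- c) = (/ Rcpow x c)%C.
Proof. unfold Rcpow; rewrite <- Cexp_opp; f_equal; ring. Qed.

Lemma Cmod_Rcpow (x : R) (c : C) : Cmod (Rcpow x c) = Rpower x (Re c).
Proof.
  unfold Rcpow, Rpower; rewrite Cmod_Cexp, Re_mult, Re_RtoC, Im_RtoC; f_equal; ring.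
Qed.

Lemma Rcpow_R (x y : R) : Rcpow x (RtoC y) = RtoC (Rpower x y).
Proof. unfold Rcpow, Rpower; rewrite <- RtoC_mult, Cexp_R; reflexivity. Qed.

Definition gauss (z : C) (n : nat) : C :=
  (RtoC (INR (fact n)) * Rcpow (INR n) z
    / Cprod (map (fun k => z + RtoC (INR k)) (seq 0 (S n))))%C.

Definition poch (z : C) (n : nat) : C := Cprod (map (fun k => z + RtoC (INR k))%C (seq 0 n)).

Lemma poch_S (z : C) (n : nat) : poch z (S n) = (poch z n * (z + RtoC (INR n)))%C.
Proof. unfold poch; rewrite seq_S, map_app, Cprod_app; simpl; ring. Qed.

Lemma poch_S_l (z : C) (n : nat) : poch z (S n) = (z * poch (z + 1) n)%C.
Proof.
  induction n as [|n IH].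
  - unfold poch; simpl; ring.
  - rewrite poch_S, IH, (poch_S (z + 1)), S_INR, RtoC_plus; ring.
Qed.

Lemma poch_neq_0 (z : C) (n : nat) : not_Gamma_pole z -> poch z n <> 0%C.
Proof.
  intros Hz; apply Cprod_neq_0; intros x Hx; apply in_map_iff in Hx; destruct Hx as [k [<- _]].
  intros E; apply (Hz k).
  replace z with (z + RtoC (INR k) - RtoC (INR k))%C by ring; rewrite E, RtoC_opp; ring.
Qed.

Lemma gauss_neq_0 (z : C) (n : nat) : not_Gamma_pole z -> gauss z n <> 0%C.
Proof.
  intros Hz E; apply Cmod_eq_0_iff in E; unfold gauss in E.
  assert (N := poch_neq_0 z (S n) Hz); unfold poch in N.
  rewrite Cmod_div, Cmod_mult in E by auto; apply Cmod_gt_0 in N.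
  assert (N1 : 0 < Cmod (Rcpow (INR n) z)) by (apply Cmod_gt_0, Rcpow_neq_0).
  assert (N2 : 0 < Cmod (RtoC (INR (fact n)))) by (apply Cmod_gt_0, RtoC_neq_0, INR_fact_neq_0).
  assert (0 < Cmod (RtoC (INR (fact n))) * Cmod (Rcpow (INR n) z) /
    Cmod (Cprod (map (fun k : nat => (z + INR k)%C) (seq 0 (S n))))).
  { pos. } lra.
Qed.

Lemma ln_1_plus_bounds (x : R) : 0 < x -> x / (1 + x) <= ln (1 + x) <= x.
Proof.
  intros Hx; split.
  - apply exp_le_cancel; rewrite exp_ln by lra.
    replace (1 + x) with (/ (1 - x / (1 + x))) at 2 by (field; split; lra). assert (P : 0 < 1 - x / (1 + x)).
    { replace (1 - x / (1 + x)) with (/ (1 + x)) by (field; lra); pos. }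
    rewrite <- (Rinv_inv (exp _)), <- exp_Ropp.
    apply Rinv_le_contravar; [ auto | generalize (exp_ge_1_plus (- (x / (1 + x)))); lra ].
  - apply exp_le_cancel; rewrite exp_ln by lra; apply exp_ge_1_plus.
Qed.

(** With [h = ln (1 + 1 / n)], consecutive terms have the ratio [exp (z h) (n + 1) / (z + n + 1)].
    The first-order terms cancel, leaving [1 + O (1 / n^2)], as [prod_cvg] requires. *)
Lemma gauss_cvg (z : C) : not_Gamma_pole z -> exists L, cvg (gauss z) L /\ L <> 0%C.
Proof.
  intros Hz. set (r := Cmod z). assert (Hr : 0 <= r) by apply Cmod_ge_0. set (B := 4 * (r + r * r * exp r)).
  assert (PB : 0 <= B) by (unfold B; generalize (exp_pos r); nra).
  destruct (INR_unbounded (4 * B + 2 * r + 1)) as [N HN].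
  assert (HN1 : (1 <= N)%nat) by (destruct N; [ simpl in HN; nra | lia ]).
  apply (prod_cvg (gauss z) B N); try assumption; [ nra | apply gauss_neq_0, Hz | ]. intros n Hn.
  assert (PN : INR N <= INR n) by (apply le_INR, Hn). set (x := INR n) in *. set (h := ln (1 + / x)).
  assert (Pix : 0 < / x) by pos.
  assert (Pix1 : / x <= 1) by (rewrite <- Rinv_1; apply Rinv_le_contravar; lra).
  assert (Hh : / (x + 1) <= h <= / x). { destruct (ln_1_plus_bounds (/ x) Pix) as [H1 H2]; split; [ | auto ].
    replace (/ (x + 1)) with (/ x / (1 + / x)) by (field; lra); auto. }
  assert (N1 : (z + RtoC (x + 1))%C <> 0%C).
  { apply Cmod_gt_0; generalize (Cmod_minus_ge (RtoC (x + 1)) (- z)).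
    rewrite Cmod_opp, Cmod_R, Rabs_pos_eq by lra.
    replace (RtoC (x + 1) - - z)%C with (z + RtoC (x + 1))%C by ring; fold r; lra. }
  assert (Nx1 : RtoC (x + 1) <> 0%C) by (apply RtoC_neq_0; lra).
  assert (E : gauss z (S n) = (gauss z n * (Cexp (z * RtoC h) * (RtoC (x + 1) / (z + RtoC (x + 1)))))%C).
  { unfold gauss; fold (poch z (S (S n))) (poch z (S n)); rewrite (poch_S z (S n)).
    assert (Np := poch_neq_0 z (S n) Hz). rewrite fact_simpl, mult_INR, S_INR, RtoC_mult; fold x.
    replace (Rcpow (x + 1) z) with (Rcpow x z * Cexp (z * RtoC h))%C.
    - field; split; auto.
    - unfold Rcpow; rewrite <- Cexp_plus; f_equal. replace (x + 1) with (x * (1 + / x)) by (field; lra).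
      rewrite ln_mult by lra; fold h; rewrite RtoC_plus; ring. }
  rewrite E.
  replace (gauss z n * (Cexp (z * RtoC h) * (RtoC (x + 1) / (z + RtoC (x + 1)))) - gauss z n)%C with
    (gauss z n * ((Cexp (z * RtoC h) - 1 - z * RtoC (/ (x + 1))) * (RtoC (x + 1) / (z + RtoC (x + 1)))))%C.
  2:{ rewrite RtoC_inv by lra; field; split; auto. }
  rewrite Cmod_mult; apply Rmult_le_compat_l; [ apply Cmod_ge_0 | ].
  replace (B * (/ x - / (x + 1))) with (2 * ((r + r * r * exp r) / x / (x + 1)) * 2) by (unfold B; field; lra).
  rewrite Cmod_mult; apply Rmult_le_compat; try apply Cmod_ge_0.
  - replace (Cexp (z * RtoC h) - 1 - z * RtoC (/ (x + 1)))%C with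
      ((Cexp (z * RtoC h) - 1 - z * RtoC h) + z * RtoC (h - / (x + 1)))%C by (rewrite RtoC_minus; ring).
    le_via Cmod_triangle. assert (Hzh : Cmod (z * RtoC h) <= r / x). { rewrite Cmod_mult, Cmod_R, Rabs_pos_eq.
      - fold r; apply Rmult_le_compat_l; lra.
      - apply Rle_trans with (/ (x + 1)); [ pos | ]; lra. }
    assert (Hxx : / x / x <= 2 * (/ x / (x + 1))).
    { replace (2 * (/ x / (x + 1))) with (/ x * (2 / (x + 1))) by (field; lra).
      apply Rmult_le_compat_l; [ lra | ]. apply (Rmult_le_reg_r (x * (x + 1))); [ nra | ].
      replace (/ x * (x * (x + 1))) with (x + 1) by (field; lra).
      replace (2 / (x + 1) * (x * (x + 1))) with (2 * x) by (field; lra). lra. }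
    assert (T1 : Cmod (Cexp (z * RtoC h) - 1 - z * RtoC h) <= r * r * exp r * (/ x / x)).
    { le_via Cexp_sub_1_id.
      replace (r * r * exp r * (/ x / x)) with (r / x * (r / x) * exp r) by (field; lra).
      assert (r / x <= r) by (unfold Rdiv; nra). apply Rmult_le_compat; [ pos | pos | | ].
      - apply Rmult_le_compat; try apply Cmod_ge_0; auto.
      - apply exp_le_compat; lra. }
    assert (T2 : Cmod (z * RtoC (h - / (x + 1))) <= r * (/ x / (x + 1))).
    { rewrite Cmod_mult, Cmod_R, Rabs_pos_eq by lra; fold r. apply Rmult_le_compat_l; [ auto | ].
      replace (/ x / (x + 1)) with (/ x - / (x + 1)) by (field; lra); lra. }
    assert (P1 : 0 <= / x / (x + 1)). { nra. }
    assert (P2 : 0 <= r * r * exp r) by (generalize (exp_pos r); nra).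
    assert (r * r * exp r * (/ x / x) <= r * r * exp r * (2 * (/ x / (x + 1)))). { nra. }
    assert (0 <= r * (/ x / (x + 1))) by pos. lra.
  - rewrite Cmod_div, Cmod_R, Rabs_pos_eq by (assumption || lra).
    assert (P : (x + 1) / 2 <= Cmod (z + RtoC (x + 1))). { generalize (Cmod_minus_ge (RtoC (x + 1)) (- z)).
      rewrite Cmod_opp, Cmod_R, Rabs_pos_eq by lra.
      replace (RtoC (x + 1) - - z)%C with (z + RtoC (x + 1))%C by ring; fold r; lra. }
    apply (Rmult_le_reg_r (Cmod (z + RtoC (x + 1)))); [ lra | ].
    unfold Rdiv; rewrite Rmult_assoc, Rinv_l; lra.
Qed.

Lemma CGamma_cvg (z : C) : not_Gamma_pole z -> cvg (gauss z) (CGamma z).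
Proof.
  intros Hz; destruct (gauss_cvg z Hz) as [L [HL _]].
  replace (CGamma z) with L; [ auto | symmetry; apply cvg_Clim_seq, HL ].
Qed.

Lemma CGamma_neq_0 (z : C) : not_Gamma_pole z -> CGamma z <> 0%C.
Proof.
  intros Hz; destruct (gauss_cvg z Hz) as [L [HL HL0]].
  replace (CGamma z) with L; [ auto | symmetry; apply cvg_Clim_seq, HL ].
Qed.

Lemma not_pole_S (z : C) : not_Gamma_pole z -> not_Gamma_pole (z + 1).
Proof.
  intros H k E; apply (H (S k)); rewrite S_INR.
  replace z with (z + 1 - 1)%C by ring; rewrite E, !RtoC_opp, RtoC_plus; ring.
Qed.

Lemma not_pole_neq_0 (z : C) : not_Gamma_pole z -> z <> 0%C.
Proof. intros H E; apply (H 0%nat); rewrite E; simpl; f_equal; ring. Qed.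

Lemma not_pole_Re (z : C) : 0 < Re z -> not_Gamma_pole z.
Proof.
  intros H k E; rewrite E in H; simpl in H; generalize (pos_INR k); lra.
Qed.

Lemma CGamma_S (z : C) : not_Gamma_pole z -> CGamma (z + 1) = (z * CGamma z)%C.
Proof.
  intros Hz; apply (cvg_unique (gauss (z + 1))); [ apply CGamma_cvg, not_pole_S, Hz | ].
  (* Term by term, [gauss (z + 1) n] is [z * gauss z n] times a factor tending to 1; the starting
     index keeps [z + 1 + n] away from 0. *)
  apply (cvg_ext (fun n => z * gauss z n * / (1 + (z + 1) * RtoC (/ (INR n))))%C _ _
    (S (Z.to_nat (up (Cmod (z + 1)))))).
  - intros n Hn. assert (Pn : 1 <= INR n) by (apply (le_INR 1); lia). assert (Hzn : Cmod (z + 1) < INR n).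
    { destruct (archimed (Cmod (z + 1))) as [H _]; apply le_INR in Hn; rewrite S_INR in Hn.
      assert (Hup : Z.le 0 (up (Cmod (z + 1)))) by (apply le_IZR; generalize (Cmod_ge_0 (z + 1)); lra).
      rewrite INR_IZR_INZ, Z2Nat.id in Hn by auto; lra. }
    assert (N0 : RtoC (INR n) <> 0%C) by (apply RtoC_neq_0; lra).
    assert (N1 : (z + 1 + RtoC (INR n))%C <> 0%C).
    { apply Cmod_gt_0; generalize (Cmod_minus_ge (RtoC (INR n)) (- (z + 1))).
      rewrite Cmod_opp, Cmod_R, Rabs_pos_eq by lra.
      replace (RtoC (INR n) - - (z + 1))%C with (z + 1 + RtoC (INR n))%C by ring; lra. }
    unfold gauss; fold (poch z (S n)) (poch (z + 1) (S n)).
    rewrite (poch_S_l z n), (poch_S (z + 1) n), Rcpow_plus, Rcpow_1 by lra.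
    assert (N2 := poch_neq_0 (z + 1) n (not_pole_S _ Hz)). assert (N3 := not_pole_neq_0 _ Hz).
    rewrite RtoC_inv by lra; field; repeat split; auto.
  - replace (z * CGamma z)%C with (z * CGamma z * / 1)%C by field.
    apply cvg_mult; [ apply cvg_mult; [ apply cvg_const | apply CGamma_cvg, Hz ] | ].
    apply cvg_inv; [ apply RtoC_neq_0; lra | ].
    intros eps He; destruct (inv_INR_small (2 * Cmod (z + 1)) eps He) as [N HN]. exists (S N); intros n Hn.
    replace (1 + (z + 1) * RtoC (/ INR n) - 1)%C with ((z + 1) * RtoC (/ INR n))%C by ring.
    assert (Pn : 1 <= INR n) by (apply (le_INR 1); lia). assert (0 < / INR n) by pos.
    rewrite Cmod_mult, Cmod_R, Rabs_pos_eq by lra. eapply Rle_lt_trans; [ | apply (HN n); lia ].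
    unfold Rdiv; rewrite (Rmult_comm 2), Rmult_assoc; apply Rmult_le_compat_l; [ apply Cmod_ge_0 | ].
    apply (Rmult_le_reg_r (INR n * (INR n + 1))); [ nra | ].
    replace (/ INR n * (INR n * (INR n + 1))) with (INR n + 1) by (field; lra).
    replace (2 * / (INR n + 1) * (INR n * (INR n + 1))) with (2 * INR n) by (field; lra). lra.
Qed.

Lemma CGamma_poch (z : C) (k : nat) : not_Gamma_pole z ->
  CGamma (z + RtoC (INR k)) = (poch z k * CGamma z)%C.
Proof.
  intros Hz; induction k as [|k IH].
  - unfold poch; simpl; rewrite Cmult_1_l; f_equal; ring.
  - rewrite S_INR, RtoC_plus, Cplus_assoc, CGamma_S, IH, poch_S; [ ring | ].
    clear IH; induction k as [|k IH]; [ simpl; replace (z + 0)%C with z by ring; auto | ].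
    rewrite S_INR, RtoC_plus, Cplus_assoc; apply not_pole_S, IH.
Qed.

Lemma dR_scal (c : C) (F : R -> C) (t : R) (v : C) :
  dR F t v -> dR (fun u => c * F u)%C t (c * v)%C.
Proof.
  intros H; apply (dR_comp (fun z => c * z)%C F); [ | auto ].
  apply (cder_ext (fun z => c * z + 0)%C); [ intros; ring | apply cder_scal_id ].
Qed.

Lemma Rcpow_sub_1 (t : R) (c : C) : 0 < t -> Rcpow t c = (RtoC t * Rcpow t (c - 1))%C.
Proof.
  intros Ht; replace c with (1 + (c - 1))%C at 1 by ring; rewrite Rcpow_plus, Rcpow_1 by auto. reflexivity.
Qed.

Lemma dR_Rcpow (c : C) (t : R) : 0 < t -> dR (fun u => Rcpow u c) t (c * Rcpow t (c - 1))%C.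
Proof.
  intros Ht; unfold Rcpow at 1. apply (dR_eq _ _ (Cexp (c * RtoC (ln t)) * (c * RtoC (/ t)))%C).
  - apply (dR_comp Cexp (fun u => c * RtoC (ln u))%C); [ apply cder_Cexp | ].
    apply dR_scal, dR_RtoC, is_derive_ln, Ht.
  - fold (Rcpow t c); rewrite (Rcpow_sub_1 t c Ht), RtoC_inv by lra. field; apply RtoC_neq_0; lra.
Qed.

Lemma dR_Rcpow_1m (c : C) (t : R) : t < 1 ->
  dR (fun u => Rcpow (1 - u) c) t (- (c * Rcpow (1 - t) (c - 1)))%C.
Proof.
  intros Ht; unfold Rcpow at 1. apply (dR_eq _ _ (Cexp (c * RtoC (ln (1 - t))) * (c * RtoC (- / (1 - t))))%C).
  - apply (dR_comp Cexp (fun u => c * RtoC (ln (1 - u)))%C); [ apply cder_Cexp | ].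
    apply dR_scal, dR_RtoC; auto_derive; [ lra | field; lra ].
  - fold (Rcpow (1 - t) c); rewrite (Rcpow_sub_1 (1 - t) c) by lra.
    rewrite RtoC_opp, RtoC_inv by lra; field; apply RtoC_neq_0; lra.
Qed.

Definition beta_fun (x y : C) (t : R) : C := (Rcpow t (x - 1) * Rcpow (1 - t) (y - 1))%C.

Lemma beta_fun_rcont (x y : C) (t : R) : 0 < t < 1 -> rcont (beta_fun x y) t.
Proof.
  intros Ht; apply rcont_mult; eapply dR_rcont; [ apply dR_Rcpow | apply dR_Rcpow_1m ]; lra.
Qed.

Definition beta_part (x y : C) (a b : R) : C := CI (beta_fun x y) a b.

Lemma beta_part_correct (x y : C) (a b : R) : 0 < a -> a <= b -> b < 1 ->
  is_CI (beta_fun x y) a b (beta_part x y a b).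
Proof.
  intros; apply CI_correct, ex_CI_rcont; [ auto | intros; apply beta_fun_rcont; lra ].
Qed.

Lemma Rpower_le_1 (t x : R) : 0 < t <= 1 -> 0 <= x -> Rpower t x <= 1.
Proof.
  intros Ht Hx; unfold Rpower; rewrite <- exp_0; apply exp_le_compat.
  assert (ln t <= 0) by (rewrite <- ln_1; destruct (proj2 Ht) as [H| ->];
    [ left; apply ln_increasing; lra | lra ]). nra.
Qed.

Lemma Rpower_anti (t x y : R) : 0 < t <= 1 -> x <= y -> Rpower t y <= Rpower t x.
Proof.
  intros Ht Hx; unfold Rpower; apply exp_le_compat.
  assert (ln t <= 0) by (rewrite <- ln_1; destruct (proj2 Ht) as [H| ->];
    [ left; apply ln_increasing; lra | lra ]). nra.
Qed.

Lemma Rpower_half (t x : R) : 1 / 2 <= t <= 1 -> 0 <= x -> Rpower t (x - 1) <= 2.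
Proof.
  intros Ht Hx; apply Rle_trans with (Rpower t (- (1))); [ apply Rpower_anti; lra | ].
  rewrite Rpower_Ropp, Rpower_1 by lra. replace 2 with (/ (1 / 2)) by field; apply Rinv_le_contravar; lra.
Qed.

Lemma is_RInt_Rpower (x a b : R) : 0 < x -> 0 < a <= b ->
  is_RInt (fun t => 2 * Rpower t (x - 1)) a b (2 / x * (Rpower b x - Rpower a x)).
Proof.
  intros Hx Hab. replace (2 / x * (Rpower b x - Rpower a x)) with
    (minus (2 / x * Rpower b x) (2 / x * Rpower a x)) by (unfold minus, plus, opp; simpl; ring).
  assert (D : forall t, 0 < t -> is_derive (fun u => 2 / x * Rpower u x) t (2 * Rpower t (x - 1))).
  { intros t Ht; unfold Rpower; auto_derive; [ auto | ].
    replace ((x - 1) * ln t) with (x * ln t + - ln t) by ring.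
    rewrite exp_plus, exp_Ropp, exp_ln by auto; field; lra. }
  apply (is_RInt_derive (V := R_CompleteNormedModule) (fun u => 2 / x * Rpower u x)).
  - intros t Ht; rewrite Rmin_left, Rmax_right in Ht by lra; apply D; lra.
  - intros t Ht; rewrite Rmin_left, Rmax_right in Ht by lra.
    apply (ex_derive_continuous (fun t => 2 * Rpower t (x - 1))); unfold Rpower; auto_derive; lra.
Qed.

Lemma is_RInt_Rpower_1m (x a b : R) : 0 < x -> a <= b < 1 ->
  is_RInt (fun t => 2 * Rpower (1 - t) (x - 1)) a b (2 / x * (Rpower (1 - a) x - Rpower (1 - b) x)).
Proof.
  intros Hx Hab. assert (H := is_RInt_Rpower x (1 - b) (1 - a) Hx ltac:(lra)).
  apply (is_RInt_swap (V := R_NormedModule)) in H.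
  replace (1 - b) with (-1 * b + 1) in H by ring; replace (1 - a) with (-1 * a + 1) in H by ring.
  apply (is_RInt_comp_lin (V := R_NormedModule)) in H. apply (is_RInt_opp (V := R_NormedModule)) in H.
  replace (2 / x * (Rpower (1 - a) x - Rpower (1 - b) x)) with
    (opp (opp (2 / x * (Rpower (1 - a) x - Rpower (1 - b) x)))) by apply opp_opp.
  replace (1 - b) with (-1 * b + 1) by ring; replace (1 - a) with (-1 * a + 1) by ring.
  revert H; apply (is_RInt_ext (V := R_NormedModule)); intros t _.
  unfold scal, opp; simpl; unfold mult; simpl; replace (-1 * t + 1) with (1 - t) by ring; ring.
Qed.

(** On [t <= 1 / 2] the factor in [1 - t] is at most 2. The bound depends on [x] only through a
    lower bound [X] of its real part, which makes it uniform along a contour. *)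
Lemma beta_left (X : R) (x y : C) (a a' : R) : 0 < X <= Re x -> 0 < Re y -> 0 < a' <= a -> a <= 1 / 2 ->
  Cmod (beta_part x y a' a) <= 2 / X * Rpower a X.
Proof.
  intros Hx Hy Ha Ha2. apply Rle_trans with (2 / X * (Rpower a X - Rpower a' X)).
  - refine (is_CI_Cmod_le _ (fun t => 2 * Rpower t (X - 1)) a' a _ _ _ _
      (beta_part_correct x y a' a ltac:(lra) ltac:(lra) ltac:(lra)) (is_RInt_Rpower X a' a ltac:(lra) ltac:(lra)));
      [ lra | ].
    intros t Ht; unfold beta_fun; rewrite Cmod_mult, !Cmod_Rcpow, !Re_minus, Re_RtoC, Rmult_comm.
    apply Rmult_le_compat; try (pos).
    + apply Rpower_half; lra.
    + apply Rpower_anti; lra.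
  - assert (0 < 2 / X) by pos. assert (0 < Rpower a' X) by pos. nra.
Qed.

Lemma beta_right (Y : R) (x y : C) (b b' : R) : 0 < Re x -> 0 < Y <= Re y -> 1 / 2 <= b -> b <= b' < 1 ->
  Cmod (beta_part x y b b') <= 2 / Y * Rpower (1 - b) Y.
Proof.
  intros Hx Hy Hb Hb'. apply Rle_trans with (2 / Y * (Rpower (1 - b) Y - Rpower (1 - b') Y)).
  - refine (is_CI_Cmod_le _ (fun t => 2 * Rpower (1 - t) (Y - 1)) b b' _ _ _ _
      (beta_part_correct x y b b' ltac:(lra) ltac:(lra) ltac:(lra)) (is_RInt_Rpower_1m Y b b' ltac:(lra) ltac:(lra)));
      [ lra | ].
    intros t Ht; unfold beta_fun; rewrite Cmod_mult, !Cmod_Rcpow, !Re_minus, Re_RtoC.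
    apply Rmult_le_compat; try (pos).
    + apply Rpower_half; lra.
    + apply Rpower_anti; lra.
  - assert (0 < 2 / Y) by pos. assert (0 < Rpower (1 - b') Y) by pos. nra.
Qed.

Lemma Rpower_small (X eps : R) : 0 < X -> 0 < eps -> exists d, 0 < d /\ d <= 1 / 2 /\
  forall t, 0 < t < d -> 2 / X * Rpower t X < eps.
Proof.
  intros HX He. assert (P : 0 < X * eps / 2) by pos.
  exists (Rmin (1 / 2) (exp (ln (X * eps / 2) / X))); split; [ | split ].
  - pos.
  - apply Rmin_l.
  - intros t Ht. assert (Ht2 := Rlt_le_trans _ _ _ (proj2 Ht) (Rmin_r _ _)).
    assert (L : ln t < ln (X * eps / 2) / X).
    { rewrite <- (ln_exp (ln (X * eps / 2) / X)); apply ln_increasing; lra. }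
    apply (Rmult_lt_compat_l X) in L; [ | auto ].
    replace (X * (ln (X * eps / 2) / X)) with (ln (X * eps / 2)) in L by (field; lra).
    apply exp_increasing in L; rewrite exp_ln in L by auto. apply (Rmult_lt_compat_l (2 / X)) in L; [ | pos ].
    replace (2 / X * (X * eps / 2)) with eps in L by (field; lra); auto.
Qed.

Lemma beta_part_Chasles (x y : C) (a b c : R) : 0 < a -> a <= b -> b <= c -> c < 1 ->
  beta_part x y a c = (beta_part x y a b + beta_part x y b c)%C.
Proof.
  intros; apply CI_eq, is_CI_Chasles with b; apply beta_part_correct; lra.
Qed.

Lemma beta_exists (x y : C) : 0 < Re x -> 0 < Re y -> exists L : C,
  forall X Y a b, 0 < X <= Re x -> 0 < Y <= Re y -> 0 < a <= 1 / 2 -> 1 / 2 <= b < 1 ->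
    Cmod (beta_part x y a b - L) <= 2 / X * Rpower a X + 2 / Y * Rpower (1 - b) Y.
Proof.
  intros Hx Hy.
  assert (D : forall X Y a b a' b', 0 < X <= Re x -> 0 < Y <= Re y -> 0 < a' <= a -> a <= 1 / 2 ->
    1 / 2 <= b -> b <= b' < 1 ->
    Cmod (beta_part x y a b - beta_part x y a' b') <= 2 / X * Rpower a X + 2 / Y * Rpower (1 - b) Y).
  { intros X Y a b a' b' HX HY Ha Ha2 Hb Hb'.
    rewrite (beta_part_Chasles x y a' a b'), (beta_part_Chasles x y a b b') by lra.
    replace (beta_part x y a b - (beta_part x y a' a + (beta_part x y a b + beta_part x y b b')))%C
      with (- (beta_part x y a' a + beta_part x y b b'))%C by ring.
    rewrite Cmod_opp; le_via Cmod_triangle; apply Rplus_le_compat;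
      [ apply beta_left | apply beta_right ]; lra. }
  set (s := fun n : nat => / (INR n + 2)). assert (Hs : forall n, 0 < s n <= 1 / 2).
  { intros n; unfold s; generalize (pos_INR n); intros; split; [ pos | ].
    replace (1 / 2) with (/ 2) by field; apply Rinv_le_contravar; lra. }
  assert (Hmon : forall n n', (n <= n')%nat -> s n' <= s n).
  { intros n n' H; apply le_INR in H; unfold s; generalize (pos_INR n); intros; apply Rinv_le_contravar; lra. }
  assert (Hs0 : forall d, 0 < d -> exists N, forall n, (N <= n)%nat -> s n < d).
  { intros d Hd; destruct (inv_INR_small 1 d Hd) as [N HN]; exists N; intros n Hn.
    eapply Rle_lt_trans; [ | apply (HN n Hn) ]; unfold s, Rdiv; rewrite Rmult_1_l.
    generalize (pos_INR n); intros; apply Rinv_le_contravar; lra. }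
  destruct (cvg_cauchy (fun n => beta_part x y (s n) (1 - s n))) as [L HL]. { intros eps He.
    destruct (Rpower_small (Re x) (eps / 2)) as [d1 [P1 [_ H1]]]; [ auto | lra | ].
    destruct (Rpower_small (Re y) (eps / 2)) as [d2 [P2 [_ H2]]]; [ auto | lra | ].
    destruct (Hs0 (Rmin d1 d2)) as [N HN]; [ pos | ].
    assert (K : forall n n', (N <= n)%nat -> (n <= n')%nat ->
      Cmod (beta_part x y (s n) (1 - s n) - beta_part x y (s n') (1 - s n')) < eps).
    { intros n n' Hn Hn'; specialize (HN n Hn).
      assert (Hsn := Hs n). assert (Hsn' := Hs n'). assert (Hm := Hmon n n' Hn').
      eapply Rle_lt_trans; [ apply (D (Re x) (Re y)); lra | ]. replace (1 - (1 - s n)) with (s n) by ring.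
      assert (G1 := Rmin_l d1 d2). assert (G2 := Rmin_r d1 d2).
      specialize (H1 (s n) ltac:(lra)); specialize (H2 (s n) ltac:(lra)); lra. }
    exists N; intros n n' Hn Hn'; destruct (Nat.le_ge_cases n n').
    - auto.
    - rewrite Cmod_minus_sym; apply K; auto. }
  exists L; intros X Y a b HX HY Ha Hb. apply le_epsilon; intros eps He.
  destruct (HL eps He) as [N1 HN1]. destruct (Hs0 (Rmin a (1 - b))) as [N2 HN2]; [ pos | ].
  specialize (HN1 (N1 + N2)%nat ltac:(lia)); specialize (HN2 (N1 + N2)%nat ltac:(lia)); cbv beta in HN1.
  set (t := s (N1 + N2)%nat) in *. assert (G1 := Rmin_l a (1 - b)). assert (G2 := Rmin_r a (1 - b)).
  assert (Ht := Hs (N1 + N2)%nat); fold t in Ht.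
  generalize (D X Y a b t (1 - t) HX HY ltac:(lra) ltac:(lra) ltac:(lra) ltac:(lra)).
  generalize (Cmod_dist_triangle (beta_part x y a b) (beta_part x y t (1 - t)) L); lra.
Qed.

(** Euler's beta integral, chosen together with the rate at which truncated integrals approach it,
    for all lower bounds [X], [Y] of the real parts. *)
Definition Beta (x y : C) : C :=
  epsilon (inhabits (RtoC 0)) (fun L : C =>
    forall X Y a b, 0 < X <= Re x -> 0 < Y <= Re y -> 0 < a <= 1 / 2 -> 1 / 2 <= b < 1 ->
    Cmod (beta_part x y a b - L) <= 2 / X * Rpower a X + 2 / Y * Rpower (1 - b) Y).

Lemma Beta_spec (x y : C) (X Y a b : R) : 0 < X <= Re x -> 0 < Y <= Re y ->
  0 < a <= 1 / 2 -> 1 / 2 <= b < 1 ->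
  Cmod (beta_part x y a b - Beta x y) <= 2 / X * Rpower a X + 2 / Y * Rpower (1 - b) Y.
Proof.
  intros HX HY; revert X Y a b HX HY.
  assert (K : 0 < Re x -> 0 < Re y -> forall X Y a b, 0 < X <= Re x -> 0 < Y <= Re y ->
    0 < a <= 1 / 2 -> 1 / 2 <= b < 1 ->
    Cmod (beta_part x y a b - Beta x y) <= 2 / X * Rpower a X + 2 / Y * Rpower (1 - b) Y).
  { intros Hx Hy; unfold Beta; apply epsilon_spec, beta_exists; auto. } intros X Y a b HX HY; apply K; lra.
Qed.

Lemma Beta_near (x y : C) (eps : R) : 0 < Re x -> 0 < Re y -> 0 < eps ->
  exists d, 0 < d /\ d <= 1 / 2 /\ forall a b, 0 < a < d -> 1 - d < b < 1 ->
    Cmod (beta_part x y a b - Beta x y) < eps.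
Proof.
  intros Hx Hy He. destruct (Rpower_small (Re x) (eps / 2)) as [d1 [P1 [Q1 H1]]]; [ auto | lra | ].
  destruct (Rpower_small (Re y) (eps / 2)) as [d2 [P2 [Q2 H2]]]; [ auto | lra | ].
  assert (G1 := Rmin_l d1 d2). assert (G2 := Rmin_r d1 d2).
  exists (Rmin d1 d2); split; [ pos | split; [ lra | ] ].
  intros a b Ha Hb; eapply Rle_lt_trans; [ apply (Beta_spec x y (Re x) (Re y)); lra | ].
  specialize (H1 a ltac:(lra)); specialize (H2 (1 - b) ltac:(lra)); lra.
Qed.

Lemma Beta_unique (x y L : C) : 0 < Re x -> 0 < Re y ->
  (forall eps, 0 < eps -> exists d, 0 < d /\ forall a b, 0 < a < d -> 1 - d < b < 1 -> a <= b ->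
    Cmod (beta_part x y a b - L) < eps) -> Beta x y = L.
Proof.
  intros Hx Hy HL; destruct (Ceq_dec (Beta x y) L) as [|Hne]; [ auto | exfalso ].
  assert (Hp : 0 < Cmod (Beta x y - L)). { apply Cmod_gt_0; intros E; apply Hne.
    replace (Beta x y) with (Beta x y - L + L)%C by ring; rewrite E; ring. }
  destruct (HL (Cmod (Beta x y - L) / 2)) as [d1 [P1 H1]]; [ lra | ].
  destruct (Beta_near x y (Cmod (Beta x y - L) / 2)) as [d2 [P2 [Q2 H2]]]; try assumption; [ lra | ].
  set (d := Rmin d1 d2). assert (Pd : 0 < d) by pos.
  assert (G1 : d <= d1) by apply Rmin_l. assert (G2 : d <= d2) by apply Rmin_r.
  specialize (H1 (d / 2) (1 - d / 2) ltac:(lra) ltac:(lra) ltac:(lra)).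
  specialize (H2 (d / 2) (1 - d / 2) ltac:(lra) ltac:(lra)).
  generalize (Cmod_dist_triangle (Beta x y) (beta_part x y (d / 2) (1 - d / 2)) L).
  rewrite (Cmod_minus_sym (Beta x y) (beta_part _ _ _ _)); lra.
Qed.

(** Integration by parts: the derivative of [t^x (1 - t)^y] is the combination of the two
    integrands, and its boundary values tend to 0. *)
Lemma Beta_S (x y : C) : 0 < Re x -> 0 < Re y -> ((x + y) * Beta x (y + 1))%C = (y * Beta x y)%C.
Proof.
  intros Hx Hy.
  assert (Nxy : (x + y)%C <> 0%C) by (intros E; apply (f_equal Re) in E; simpl in E; unfold Re in *; lra).
  assert (Hy1 : 0 < Re (y + 1)) by (rewrite Re_plus, Re_RtoC; lra).
  rewrite (Beta_unique x (y + 1) (y * Beta x y / (x + y))); [ field; auto | auto | auto | ].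
  set (F := fun t => (Rcpow t x * Rcpow (1 - t) y)%C). assert (K : forall a b, 0 < a -> a <= b -> b < 1 ->
    ((x + y) * beta_part x (y + 1) a b)%C = (y * beta_part x y a b + (F b - F a))%C).
  { intros a b Ha Hab Hb. assert (I1 := is_CI_minus _ _ _ _ _ _
      (is_CI_scal (x + y)%C _ _ _ _ (beta_part_correct x (y + 1) a b Ha Hab Hb))
      (is_CI_scal y _ _ _ _ (beta_part_correct x y a b Ha Hab Hb))).
    assert (E : ((x + y) * beta_part x (y + 1) a b - y * beta_part x y a b)%C = (F b - F a)%C).
    { apply (is_CI_unique _ _ _ _ _ I1); apply is_CI_dR; [ auto | | ].
      - intros t Ht; unfold F.
        apply (dR_eq _ _ _ _ (dR_mult _ _ _ _ _ (dR_Rcpow x t ltac:(lra)) (dR_Rcpow_1m y t ltac:(lra)))).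
        unfold beta_fun; replace (y + 1 - 1)%C with y by ring.
        rewrite (Rcpow_sub_1 t x), (Rcpow_sub_1 (1 - t) y), RtoC_minus by lra; ring.
      - intros t Ht; apply (rcont_ext (fun t => (x + y) * beta_fun x (y + 1) t + (- y) * beta_fun x y t)%C);
          [ intros; ring | ].
        apply rcont_plus; (apply rcont_mult; [ apply rcont_const | apply beta_fun_rcont; lra ]). }
    rewrite <- E; ring. }
  intros eps He. set (A := Cmod (x + y)). assert (PA : 0 < A) by (apply Cmod_gt_0, Nxy).
  assert (PY : 0 < Cmod y) by (apply Cmod_gt_0; intros E; rewrite E in Hy; simpl in Hy; lra).
  destruct (Beta_near x y (A * eps / (3 * Cmod y))) as [d0 [P0 [Q0 H0]]]; try assumption. { pos. }
  destruct (Rpower_small (Re x) (2 / Re x * (A * eps / 3))) as [d1 [P1 [Q1 H1]]]; [ auto | | ]. { pos. }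
  destruct (Rpower_small (Re y) (2 / Re y * (A * eps / 3))) as [d2 [P2 [Q2 H2]]]; [ auto | | ]. { pos. }
  exists (Rmin d0 (Rmin d1 d2)); split; [ pos | ]. intros a b Ha Hb Hab.
  assert (G0 := Rmin_l d0 (Rmin d1 d2)). assert (G0' := Rmin_r d0 (Rmin d1 d2)).
  assert (G1 := Rmin_l d1 d2). assert (G2 := Rmin_r d1 d2).
  specialize (H0 a b ltac:(lra) ltac:(lra)); specialize (H1 a ltac:(lra)). specialize (H2 (1 - b) ltac:(lra)).
  apply Rmult_lt_reg_l in H1; [ | pos ]. apply Rmult_lt_reg_l in H2; [ | pos ].
  specialize (K a b ltac:(lra) Hab ltac:(lra)).
  apply (Rmult_lt_reg_l A); [ auto | unfold A; rewrite <- Cmod_mult ].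
  replace ((x + y) * (beta_part x (y + 1) a b - y * Beta x y / (x + y)))%C with
    ((x + y) * beta_part x (y + 1) a b - y * Beta x y)%C by (field; auto).
  rewrite K; fold A. replace (y * beta_part x y a b + (F b - F a) - y * Beta x y)%C with
    (y * (beta_part x y a b - Beta x y) + F b - F a)%C by ring.
  lt_via Cmod_triangle_minus. eapply Rle_lt_trans; [ apply Rplus_le_compat_r, Cmod_triangle | ].
  assert (T0 : Cmod (y * (beta_part x y a b - Beta x y)) < A * eps / 3).
  { rewrite Cmod_mult; apply (Rmult_lt_compat_l (Cmod y)) in H0; [ | auto ].
    replace (Cmod y * (A * eps / (3 * Cmod y))) with (A * eps / 3) in H0 by (field; lra); auto. }
  assert (T1 : Cmod (F a) < A * eps / 3). { unfold F; rewrite Cmod_mult, !Cmod_Rcpow.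
    assert (Rpower (1 - a) (Re y) <= 1) by (apply Rpower_le_1; lra).
    assert (0 < Rpower a (Re x)) by pos. nra. }
  assert (T2 : Cmod (F b) < A * eps / 3). { unfold F; rewrite Cmod_mult, !Cmod_Rcpow.
    assert (Rpower b (Re x) <= 1) by (apply Rpower_le_1; lra).
    assert (0 < Rpower (1 - b) (Re y)) by pos. nra. }
  lra.
Qed.

Lemma Beta_1 (x : C) : 0 < Re x -> Beta x 1 = (/ x)%C.
Proof.
  intros Hx. assert (Nx : x <> 0%C) by (intros E; rewrite E in Hx; simpl in Hx; lra).
  assert (Px : 0 < Cmod x) by (apply Cmod_gt_0, Nx).
  assert (K : forall a b, 0 < a -> a <= b -> b < 1 -> (x * beta_part x 1 a b)%C = (Rcpow b x - Rcpow a x)%C).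
  { intros a b Ha Hab Hb.
    apply (is_CI_unique _ _ _ _ _ (is_CI_scal x _ _ _ _ (beta_part_correct x 1 a b Ha Hab Hb))).
    apply (is_CI_dR _ (fun t => Rcpow t x)); [ auto | | ].
    - intros t Ht; apply (dR_eq _ _ _ _ (dR_Rcpow x t ltac:(lra))).
      unfold beta_fun; replace (1 - 1)%C with (RtoC 0) by ring; rewrite Rcpow_0; ring.
    - intros t Ht; apply rcont_mult; [ apply rcont_const | apply beta_fun_rcont; lra ]. }
  apply Beta_unique; [ auto | simpl; lra | intros eps He ].
  destruct (Rpower_small (Re x) (2 / Re x * (Cmod x * eps / 2))) as [d1 [P1 [Q1 H1]]]; [ auto | | ]. { pos. }
  destruct (dR_rcont _ _ _ (dR_Rcpow x 1 Rlt_0_1) (Cmod x * eps / 2)) as [d2 [P2 H2]]; [ nra | ].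
  exists (Rmin d1 d2); split; [ pos | intros a b Ha Hb Hab ].
  assert (G1 := Rmin_l d1 d2). assert (G2 := Rmin_r d1 d2).
  specialize (H1 a ltac:(lra)); apply Rmult_lt_reg_l in H1; [ | pos ].
  specialize (H2 b ltac:(apply Rabs_def1; lra)). replace (Rcpow 1 x) with (RtoC 1) in H2
    by (unfold Rcpow; rewrite ln_1, Cmult_0_r, Cexp_0; reflexivity).
  apply (Rmult_lt_reg_l (Cmod x)); [ auto | rewrite <- Cmod_mult ].
  replace (x * (beta_part x 1 a b - / x))%C with (x * beta_part x 1 a b - 1)%C by (field; auto).
  rewrite K by lra. replace (Rcpow b x - Rcpow a x - 1)%C with ((Rcpow b x - 1) - Rcpow a x)%C by ring.
  lt_via Cmod_triangle_minus; rewrite Cmod_Rcpow; lra.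
Qed.

Lemma Beta_poch (x y : C) (n : nat) : 0 < Re x -> 0 < Re y ->
  (poch (x + y) n * Beta x (y + RtoC (INR n)))%C = (poch y n * Beta x y)%C.
Proof.
  intros Hx Hy; induction n as [|n IH].
  - unfold poch; simpl; f_equal; f_equal; ring.
  - rewrite !poch_S, S_INR, RtoC_plus, Cplus_assoc.
    transitivity (poch (x + y) n * ((x + (y + RtoC (INR n))) * Beta x (y + RtoC (INR n) + 1)))%C; [ ring | ].
    rewrite Beta_S; [ | auto | rewrite Re_plus, Re_RtoC; generalize (pos_INR n); lra ].
    transitivity ((y + RtoC (INR n)) * (poch (x + y) n * Beta x (y + RtoC (INR n))))%C; [ ring | ].
    rewrite IH; ring.
Qed.

Lemma poch_1 (n : nat) : poch 1 n = RtoC (INR (fact n)).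
Proof.
  induction n as [|n IH]; [ unfold poch; simpl; reflexivity | ].
  rewrite poch_S, IH, fact_simpl, mult_INR, S_INR, RtoC_mult, RtoC_plus; ring.
Qed.

(** Hence [gauss x n] is [n^x] times this value: Gauss products are beta integrals with an integer
    parameter. *)
Lemma Beta_nat (x : C) (n : nat) : 0 < Re x ->
  Beta x (1 + RtoC (INR n)) = (RtoC (INR (fact n)) / poch x (S n))%C.
Proof.
  intros Hx; assert (H := Beta_poch x 1 n Hx ltac:(simpl; lra)). rewrite Beta_1, poch_1 in H by auto.
  rewrite poch_S_l. assert (N1 := poch_neq_0 (x + 1) n (not_pole_S _ (not_pole_Re _ Hx))).
  assert (N2 := not_pole_neq_0 _ (not_pole_Re _ Hx)).
  transitivity (poch (x + 1) n * Beta x (1 + RtoC (INR n)) / poch (x + 1) n)%C; [ field; auto | ].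
  rewrite H; field; split; auto.
Qed.

Lemma one_minus_Rcpow_bound (y : C) (t : R) : 0 < Re y -> 0 < t < 1 ->
  Cmod (1 - Rcpow (1 - t) y) <= Cmod y * t / (1 - t).
Proof.
  intros Hy Ht.
  assert (H := mean_value_ineq (fun u => Rcpow (1 - u) y) (fun u => - (y * Rcpow (1 - u) (y - 1)))%C
    0 t (Cmod y / (1 - t))).
  cbv beta in H; replace (Rcpow (1 - 0) y) with (RtoC 1) in H
    by (unfold Rcpow; rewrite Rminus_0_r, ln_1, Cmult_0_r, Cexp_0; reflexivity).
  rewrite Cmod_minus_sym; le_via H; [ lra | | | right; field; lra ].
  - intros u Hu; apply dR_Rcpow_1m; lra.
  - intros u Hu; rewrite Cmod_opp, Cmod_mult, Cmod_Rcpow, Re_minus, Re_RtoC.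
    apply Rmult_le_compat_l; [ apply Cmod_ge_0 | ].
    apply Rle_trans with (Rpower (1 - u) (- (1))); [ apply Rpower_anti; lra | ].
    rewrite Rpower_Ropp, Rpower_1 by lra; apply Rinv_le_contravar; lra.
Qed.

(** Between the integrands, [(1 - t)^(n + 1) - (1 - t)^(n + 1 + y)] is at most
    [Cmod y * t * (1 - t)^n] in modulus. The extra [t] raises the first parameter by one, which
    gains a factor of order [1 / n]. *)
Lemma Beta_diff_bound (x y : C) (n : nat) : 0 < Re x -> 0 < Re y -> 
  Cmod (Beta x (1 + RtoC (INR (S n))) - Beta x (y + RtoC (INR (S (S n))))) <=
  Cmod y * Cmod (Beta (RtoC (Re x) + 1) (1 + RtoC (INR n))).
Proof.
  intros Hx Hy; apply le_epsilon; intros eps He.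
  set (y1 := (1 + RtoC (INR (S n)))%C). set (y2 := (y + RtoC (INR (S (S n))))%C).
  set (x3 := (RtoC (Re x) + 1)%C). set (y3 := (1 + RtoC (INR n))%C). assert (Pn := pos_INR n).
  assert (R1 : 0 < Re y1) by (unfold y1; rewrite Re_plus, !Re_RtoC, S_INR; lra).
  assert (R2 : 0 < Re y2) by (unfold y2; rewrite Re_plus, !Re_RtoC, !S_INR; lra).
  assert (R3 : 0 < Re x3) by (unfold x3; rewrite Re_plus, !Re_RtoC; lra).
  assert (R4 : 0 < Re y3) by (unfold y3; rewrite Re_plus, !Re_RtoC; lra). assert (PY := Cmod_ge_0 y).
  set (e := eps / (3 * (Cmod y + 1))). assert (He' : 0 < e) by pos.
  assert (Ee : e * (Cmod y + 1) = eps / 3) by (unfold e; field; lra).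
  destruct (Beta_near x y1 e Hx R1 He') as [d1 [P1 [Q1 H1]]].
  destruct (Beta_near x y2 e Hx R2 He') as [d2 [P2 [Q2 H2]]].
  destruct (Beta_near x3 y3 e R3 R4 He') as [d3 [P3 [Q3 H3]]]. set (d := Rmin d1 (Rmin d2 d3)).
  assert (Pd : 0 < d) by pos. assert (G1 : d <= d1) by apply Rmin_l.
  assert (G2 : d <= d2) by (le_via Rmin_r; apply Rmin_l).
  assert (G3 : d <= d3) by (le_via Rmin_r; apply Rmin_r). set (a := d / 2). set (b := 1 - d / 2).
  specialize (H1 a b ltac:(unfold a; lra) ltac:(unfold b; lra)).
  specialize (H2 a b ltac:(unfold a; lra) ltac:(unfold b; lra)).
  specialize (H3 a b ltac:(unfold a; lra) ltac:(unfold b; lra)).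
  assert (Hab : a <= b) by (unfold a, b; lra). assert (Ha : 0 < a) by (unfold a; lra).
  assert (Hb : b < 1) by (unfold b; lra).
  assert (I12 := is_CI_minus _ _ _ _ _ _ (beta_part_correct x y1 a b Ha Hab Hb)
    (beta_part_correct x y2 a b Ha Hab Hb)).
  assert (I3 := is_CI_scal (RtoC (Cmod y)) _ _ _ _ (beta_part_correct x3 y3 a b Ha Hab Hb)).
  assert (I3' := is_CI_Re _ _ _ _ I3). assert (Hint : Cmod (beta_part x y1 a b - beta_part x y2 a b) <=
    Re (RtoC (Cmod y) * beta_part x3 y3 a b)).
  { refine (is_CI_Cmod_le _ _ a b _ _ Hab _ I12 I3'). intros t Ht; cbv beta; unfold beta_fun.
    assert (Ht0 : 0 < t) by lra. assert (Ht1 : 0 < 1 - t) by lra.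
    replace (y1 - 1)%C with (RtoC (INR n) + 1)%C by (unfold y1; rewrite S_INR, RtoC_plus; ring).
    replace (y2 - 1)%C with (RtoC (INR n) + 1 + y)%C by (unfold y2; rewrite !S_INR, !RtoC_plus; ring).
    replace (x3 - 1)%C with (RtoC (Re x)) by (unfold x3; ring).
    replace (y3 - 1)%C with (RtoC (INR n)) by (unfold y3; ring).
    rewrite (Rcpow_plus (1 - t) (RtoC (INR n) + 1) y), (Rcpow_plus (1 - t) _ 1), Rcpow_1, !Rcpow_R by auto.
    rewrite <- !RtoC_mult, Re_RtoC.
    rewrite RtoC_mult. replace (Rcpow t (x - 1) * (RtoC (Rpower (1 - t) (INR n)) * RtoC (1 - t)) -
      Rcpow t (x - 1) * (RtoC (Rpower (1 - t) (INR n)) * RtoC (1 - t) * Rcpow (1 - t) y))%C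
      with (Rcpow t (x - 1) * (RtoC (Rpower (1 - t) (INR n)) * RtoC (1 - t)) * (1 - Rcpow (1 - t) y))%C by ring.
    rewrite !Cmod_mult, Cmod_Rcpow, !Cmod_R, Re_minus, Re_RtoC. rewrite (Rabs_pos_eq (Rpower _ _)) by pos.
    rewrite (Rabs_pos_eq (1 - t)) by lra. assert (B := one_minus_Rcpow_bound y t Hy ltac:(lra)).
    assert (E : Rpower t (Re x) = t * Rpower t (Re x - 1)).
    { replace (Re x) with (1 + (Re x - 1)) at 1 by ring; rewrite Rpower_plus, Rpower_1 by auto; reflexivity. }
    rewrite E.
    apply Rle_trans with (Rpower t (Re x - 1) * (Rpower (1 - t) (INR n) * (1 - t)) * (Cmod y * t / (1 - t))).
    - apply Rmult_le_compat_l; [ pos | auto ].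
    - right; field; lra. }
  assert (HR : Re (RtoC (Cmod y) * beta_part x3 y3 a b) <= Cmod y * Cmod (beta_part x3 y3 a b)).
  { le_via Rle_abs; le_via Re_le_Cmod. rewrite Cmod_mult, Cmod_R, Rabs_pos_eq by auto; lra. }
  assert (HL : Cmod (beta_part x3 y3 a b) <= Cmod (Beta x3 y3) + e).
  { generalize (Cmod_minus_ge (beta_part x3 y3 a b) (Beta x3 y3)); lra. }
  generalize (Cmod_dist_triangle (Beta x y1) (beta_part x y1 a b) (Beta x y2)).
  generalize (Cmod_dist_triangle (beta_part x y1 a b) (beta_part x y2 a b) (Beta x y2)).
  rewrite (Cmod_minus_sym (Beta x y1) (beta_part x y1 a b)). nra.
Qed.

(* Euler's argument: Gauss products turn the recurrence of [Beta] into
   [Beta x (y+n+1) n^x -> Gamma x]. *)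
Lemma Beta_CGamma (x y : C) : 0 < Re x -> 0 < Re y ->
  (CGamma x * CGamma y)%C = (CGamma (x + y) * Beta x y)%C.
Proof.
  intros Hx Hy. assert (Hxy : 0 < Re (x + y)) by (rewrite Re_plus; lra).
  assert (NPx := not_pole_Re _ Hx). assert (NPy := not_pole_Re _ Hy). assert (NPxy := not_pole_Re _ Hxy).
  assert (HX : 0 < Re (RtoC (Re x))) by (rewrite Re_RtoC; auto). assert (NPX := not_pole_Re _ HX).
  set (u := fun n => (Rcpow (INR n) x * Beta x (y + RtoC (INR (S n))))%C). assert (Hu : cvg u (CGamma x)).
  { assert (Hd : forall n, Cmod (u (S n) - gauss x (S n)) <=
      Cmod y * Re x * Cmod (gauss (RtoC (Re x)) (S n)) / (INR n + 1)).
    { intros n; unfold u, gauss; fold (poch x (S (S n))) (poch (RtoC (Re x)) (S (S n))).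
      assert (E1 := Beta_nat x (S n) Hx).
      replace (RtoC (INR (fact (S n))) * Rcpow (INR (S n)) x / poch x (S (S n)))%C with
        (Rcpow (INR (S n)) x * Beta x (1 + RtoC (INR (S n))))%C.
      2:{ rewrite E1; field; apply poch_neq_0, NPx. }
      replace (Rcpow (INR (S n)) x * Beta x (y + RtoC (INR (S (S n)))) -
        Rcpow (INR (S n)) x * Beta x (1 + RtoC (INR (S n))))%C with
        (- (Rcpow (INR (S n)) x * (Beta x (1 + RtoC (INR (S n))) - Beta x (y + RtoC (INR (S (S n)))))))%C by ring.
      rewrite Cmod_opp, Cmod_mult.
      eapply Rle_trans; [ apply Rmult_le_compat_l; [ apply Cmod_ge_0 | apply Beta_diff_bound; auto ] | ].
      rewrite Beta_nat by (rewrite Re_plus, !Re_RtoC; lra).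
      assert (N1 := poch_neq_0 (RtoC (Re x) + 1) (S n) (not_pole_S _ NPX)).
      assert (N2 := not_pole_neq_0 _ NPX). rewrite (poch_S_l (RtoC (Re x))).
      rewrite !Cmod_div by first [ assumption | apply Cmult_neq_0; auto ].
      rewrite !Cmod_mult, !Cmod_Rcpow, Re_RtoC, !Cmod_R. rewrite fact_simpl, mult_INR, S_INR, Rabs_mult.
      generalize (pos_INR n); intros Pn. rewrite (Rabs_pos_eq (INR n + 1)), (Rabs_pos_eq (Re x)) by lra.
      apply Cmod_gt_0 in N1. right; field; repeat split; lra. }
    assert (Hg := CGamma_cvg _ NPX). destruct (Hg 1 Rlt_0_1) as [N1 HN1].
    set (B := Cmod y * Re x * (Cmod (CGamma (RtoC (Re x))) + 1)). intros eps He.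
    destruct (CGamma_cvg x NPx (eps / 2)) as [N2 HN2]; [ lra | ].
    destruct (inv_INR_small B (eps / 2)) as [N3 HN3]; [ lra | ].
    exists (S (N1 + N2 + N3)); intros n Hn; destruct n as [|n]; [ lia | ].
    specialize (HN1 (S n) ltac:(lia)); specialize (HN2 (S n) ltac:(lia)); specialize (HN3 n ltac:(lia)).
    lt_via (Cmod_dist_triangle _ (gauss x (S n))).
    assert (Hle : Cmod (u (S n) - gauss x (S n)) <= B / (INR n + 1)). { le_via Hd; unfold B, Rdiv.
      apply Rmult_le_compat_r; [ left; apply Rinv_0_lt_compat; generalize (pos_INR n); lra | ].
      apply Rmult_le_compat_l; [ pos | ].
      generalize (Cmod_minus_ge (gauss (RtoC (Re x)) (S n)) (CGamma (RtoC (Re x)))); lra. }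
    lra. }
  (* By [Beta_poch] the products of Gauss terms agree exactly for each [n]; in the limit the common
     factor [CGamma x], which is not 0, cancels. *)
  assert (E : (CGamma x * CGamma y * CGamma x)%C = (CGamma (x + y) * Beta x y * CGamma x)%C).
  { apply (cvg_unique (fun n => gauss x n * gauss y n * u n)%C).
    - repeat apply cvg_mult; try apply CGamma_cvg; auto.
    - apply (cvg_ext (fun n => gauss (x + y) n * Beta x y * gauss x n)%C _ _ 0).
      + intros n _; unfold u, gauss. fold (poch x (S n)) (poch y (S n)) (poch (x + y) (S n)).
        assert (H := Beta_poch x y (S n) Hx Hy).
        assert (N1 := poch_neq_0 x (S n) NPx). assert (N2 := poch_neq_0 y (S n) NPy).
        assert (N3 := poch_neq_0 (x + y) (S n) NPxy).
        assert (HB : Beta x (y + RtoC (INR (S n))) = (poch y (S n) * Beta x y / poch (x + y) (S n))%C).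
        { rewrite <- H; field; auto. } rewrite HB, Rcpow_plus; field; repeat split; auto.
      + repeat apply cvg_mult; try apply cvg_const; apply CGamma_cvg; auto. }
  assert (N := CGamma_neq_0 x NPx).
  transitivity (CGamma x * CGamma y * CGamma x / CGamma x)%C; [ field; auto | ]. rewrite E; field; auto.
Qed.

(** * Path integrals *)

Definition curve (g v : R -> C) : Prop :=
  (forall t, rcont g t) /\ pwc v /\ exists l : list R, forall t, ~ In t l -> dR g t (v t).

(** Freezing a function outside an interval turns hypotheses known only on that interval into global
    ones, as [pwc] and [rcont] everywhere demand. *)
Definition clamp (a b t : R) : R := Rmax a (Rmin b t).

Lemma clamp_in (a b t : R) : a <= b -> a <= clamp a b t <= b.
Proof. intros H; unfold clamp, Rmax, Rmin; repeat destruct Rle_dec; lra. Qed.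

Lemma clamp_id (a b t : R) : a <= t <= b -> clamp a b t = t.
Proof. intros H; unfold clamp, Rmax, Rmin; repeat destruct Rle_dec; lra. Qed.

Lemma rcont_clamp (f : R -> C) (a b t : R) : a <= b ->
  (forall t, a <= t <= b -> rcont f t) -> rcont (fun u => f (clamp a b u)) t.
Proof.
  intros Hab H eps He; destruct (H (clamp a b t) (clamp_in a b t Hab) eps He) as [d [Hd K]].
  exists d; split; [ auto | intros u Hu; apply K ]. eapply Rle_lt_trans; [ | apply Hu ].
  unfold clamp, Rmax, Rmin; repeat destruct Rle_dec; unfold Rabs; repeat destruct Rcase_abs; lra.
Qed.

Definition path_int (f : C -> C) (g v : R -> C) (a b : R) : C := CI (fun t => f (g t) * v t)%C a b.

Lemma path_pwc (f : C -> C) (g v : R -> C) (a b : R) : curve g v -> a <= b ->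
  (forall t, a <= t <= b -> ccont f (g t)) -> pwc (fun t => f (g (clamp a b t)) * v t)%C.
Proof.
  intros [Hg [Hv _]] Hab Hf; apply pwc_mult; [ | auto ].
  apply pwc_rcont; intros t; apply (rcont_clamp (fun t => f (g t))); [ auto | ].
  intros u Hu; apply rcont_comp; auto.
Qed.

Lemma path_correct (f : C -> C) (g v : R -> C) (a b : R) : curve g v -> a <= b ->
  (forall t, a <= t <= b -> ccont f (g t)) ->
  is_CI (fun t => f (g t) * v t)%C a b (path_int f g v a b).
Proof.
  intros Hc Hab Hf; apply CI_correct.
  destruct (ex_CI_pwc _ a b (path_pwc f g v a b Hc Hab Hf)) as [w Hw]; exists w.
  revert Hw; apply is_CI_ext; [ auto | intros t Ht; rewrite clamp_id by lra; reflexivity ].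
Qed.

Lemma path_ftc (f F : C -> C) (g v : R -> C) (a b : R) : curve g v -> a <= b ->
  (forall t, a <= t <= b -> ccont f (g t)) ->
  (forall t, a <= t <= b -> cder F (g t) (f (g t))) ->
  path_int f g v a b = (F (g b) - F (g a))%C.
Proof.
  intros Hc Hab Hf HF; apply CI_eq. assert (P := path_pwc f g v a b Hc Hab Hf).
  destruct Hc as [Hg [_ [l Hl]]].
  assert (K : is_CI (fun t => f (g (clamp a b t)) * v t)%C a b (F (g b) - F (g a))%C).
  { apply (pw_ftc (fun t => F (g t)) _ l); try assumption.
    - intros t Ht; apply rcont_comp; [ eapply cder_ccont, HF, Ht | apply Hg ].
    - intros t Ht Hin; rewrite clamp_id by lra; apply dR_comp; [ apply HF; lra | apply Hl, Hin ]. }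
  revert K; apply is_CI_ext; [ auto | intros t Ht; rewrite clamp_id by lra; reflexivity ].
Qed.

Lemma path_plus (f h : C -> C) (g v : R -> C) (a b : R) : curve g v -> a <= b ->
  (forall t, a <= t <= b -> ccont f (g t)) -> (forall t, a <= t <= b -> ccont h (g t)) ->
  path_int (fun z => f z + h z)%C g v a b = (path_int f g v a b + path_int h g v a b)%C.
Proof.
  intros Hc Hab Hf Hh; apply CI_eq.
  apply (is_CI_ext_all (fun t => f (g t) * v t + h (g t) * v t)%C); [ intros; ring | ].
  apply is_CI_plus; apply path_correct; auto.
Qed.

Lemma path_scal (k : C) (f : C -> C) (g v : R -> C) (a b : R) : curve g v -> a <= b ->
  (forall t, a <= t <= b -> ccont f (g t)) ->
  path_int (fun z => k * f z)%C g v a b = (k * path_int f g v a b)%C.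
Proof.
  intros Hc Hab Hf; apply CI_eq. apply (is_CI_ext_all (fun t => k * (f (g t) * v t))%C); [ intros; ring | ].
  apply is_CI_scal, path_correct; auto.
Qed.

Lemma path_ext (f h : C -> C) (g v : R -> C) (a b : R) : curve g v -> a <= b ->
  (forall t, a <= t <= b -> ccont f (g t)) -> (forall t, a <= t <= b -> f (g t) = h (g t)) ->
  path_int f g v a b = path_int h g v a b.
Proof.
  intros Hc Hab Hf Hh; symmetry; apply CI_eq.
  apply (is_CI_ext (fun t => f (g t) * v t)%C); [ auto | | apply path_correct; auto ].
  intros t Ht; rewrite Hh by lra; reflexivity.
Qed.

Lemma path_Chasles (f : C -> C) (g v : R -> C) (a b c : R) : curve g v -> a <= b -> b <= c ->
  (forall t, a <= t <= c -> ccont f (g t)) ->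
  path_int f g v a c = (path_int f g v a b + path_int f g v b c)%C.
Proof.
  intros Hc Hab Hbc Hf; apply CI_eq, is_CI_Chasles with b; apply path_correct; try assumption;
    intros; apply Hf; lra.
Qed.

Lemma path_bound (f : C -> C) (g v : R -> C) (a b M : R) : curve g v -> a <= b ->
  (forall t, a <= t <= b -> ccont f (g t)) -> (forall t, a <= t <= b -> Cmod (f (g t)) <= M) ->
  Cmod (path_int f g v a b) <= M * Re (CI (fun t => RtoC (Cmod (v t))) a b).
Proof.
  intros Hc Hab Hf HM. assert (I := CI_pwc _ a b (pwc_Cmod v (proj1 (proj2 Hc)))).
  assert (I' := is_CI_Re _ _ _ _ (is_CI_scal (RtoC M) _ _ _ _ I)).
  rewrite Re_mult, Re_RtoC, Im_RtoC, Rmult_0_l, Rminus_0_r in I'.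
  refine (is_CI_Cmod_le _ _ a b _ _ Hab _ (path_correct f g v a b Hc Hab Hf) I').
  intros t Ht; rewrite Cmod_mult, <- RtoC_mult, Re_RtoC.
  apply Rmult_le_compat_r; [ apply Cmod_ge_0 | apply HM, Ht ].
Qed.

Lemma curve_line (p q : C) : curve (fun u => p + RtoC u * (q - p))%C (fun _ => (q - p)%C).
Proof.
  split; [ | split ].
  - intros; apply rcont_line.
  - apply pwc_rcont; intros; apply rcont_const.
  - exists nil; intros; apply dR_line.
Qed.

Definition segment (f : C -> C) (p q : C) : C :=
  path_int f (fun u => p + RtoC u * (q - p))%C (fun _ => (q - p)%C) 0 1.

Lemma segment_ftc (f F : C -> C) (p q : C) :
  (forall u, 0 <= u <= 1 -> ccont f (p + RtoC u * (q - p))%C) ->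
  (forall u, 0 <= u <= 1 -> cder F (p + RtoC u * (q - p))%C (f (p + RtoC u * (q - p))%C)) ->
  segment f p q = (F q - F p)%C.
Proof.
  intros Hf HF; unfold segment. rewrite (path_ftc f F _ _ 0 1 (curve_line p q)) by (assumption || lra).
  f_equal; [ | f_equal ]; f_equal; ring.
Qed.

Definition invp (p z : C) : C := (/ (z - p))%C.

Lemma Cminus_neq_0 (z p : C) : z <> p -> (z - p)%C <> 0%C.
Proof. intros H E; apply H; replace z with (z - p + p)%C by ring; rewrite E; ring. Qed.

Lemma an_invp (p z : C) : z <> p -> an (invp p) z.
Proof.
  intros H; apply (an_inv (fun y => y - p)%C); [ apply Cminus_neq_0, H | ].
  apply an_minus; [ apply an_id | apply an_const ].
Qed.

(** * Winding numbers *)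

(** [(g t - p)] times the exponential of minus the integral up to [t] is continuous with derivative
    0 off a finite set, hence constant. *)
Lemma path_log (g v : R -> C) (a b : R) (p : C) : curve g v -> a <= b ->
  (forall t, a <= t <= b -> g t <> p) ->
  Cexp (path_int (invp p) g v a b) = ((g b - p) / (g a - p))%C.
Proof.
  intros Hc Hab Hp.
  assert (Hf : forall t, a <= t <= b -> ccont (invp p) (g t)) by (intros; apply an_ccont, an_invp; auto).
  assert (P := path_pwc _ g v a b Hc Hab Hf). set (h := fun t => (invp p (g (clamp a b t)) * v t)%C) in *.
  set (F := fun t => ((g t - p) * Cexp (- (1) * CI h a t))%C). assert (EF : F b = F a).
  { destruct P as [P1 [P2 [lh Plh]]]. assert (P : pwc h) by (split; [ | split; [ | exists lh ] ]; auto).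
    destruct Hc as [Hg [Hv [l Hl]]]. assert (Hgp : forall t, rcont (fun t => g t - p)%C t).
    { intros t; apply (rcont_ext (fun t => g t + (- p))%C); [ intros; ring | ].
      apply rcont_plus; [ apply Hg | apply rcont_const ]. }
    apply (dR_0_const F (l ++ lh)); [ auto | | ].
    - intros t Ht; apply rcont_mult; [ apply Hgp | ].
      apply (rcont_comp Cexp (fun t => - (1) * CI h a t)%C); [ eapply cder_ccont, cder_Cexp | ].
      apply rcont_mult; [ apply rcont_const | apply pwc_primitive, P ].
    - intros t Ht Hin. assert (D1 : dR (fun t => g t - p)%C t (v t)).
      { apply (dR_ext (fun t => g t - (p + RtoC t * 0))%C); [ intros; ring | ].
        apply (dR_eq _ _ (v t - 0)%C); [ | ring ].
        apply dR_minus; [ apply Hl; intros H; apply Hin, in_or_app; auto | apply dR_line ]. }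
      assert (D2 : dR (fun t => Cexp (- (1) * CI h a t))%C t (Cexp (- (1) * CI h a t) * (- (1) * h t))%C).
      { apply (dR_comp Cexp (fun t => - (1) * CI h a t)%C); [ apply cder_Cexp | ].
        apply dR_scal, pwc_primitive; [ auto | ]. apply Plh; intros H; apply Hin, in_or_app; auto. }
      apply (dR_eq _ _ _ _ (dR_mult _ _ _ _ _ D1 D2)). unfold h, invp; rewrite clamp_id by lra.
      field; apply Cminus_neq_0, Hp; lra. }
  assert (E0 : CI h a a = 0%C) by (apply CI_eq, (is_RInt_point (V := C_R_NormedModule))).
  assert (E1 : CI h a b = path_int (invp p) g v a b). { apply CI_eq; unfold path_int.
    apply (is_CI_ext (fun t => invp p (g t) * v t)%C); [ auto | | apply path_correct; auto ].
    intros t Ht; unfold h; rewrite clamp_id by lra; reflexivity. }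
  unfold F in EF; rewrite E0, E1 in EF.
  replace (- (1) * 0)%C with (RtoC 0) in EF by ring; rewrite Cexp_0 in EF.
  replace (- (1) * path_int (invp p) g v a b)%C with (- path_int (invp p) g v a b)%C in EF by ring.
  rewrite Cexp_opp in EF. assert (N1 := Cminus_neq_0 _ _ (Hp a ltac:(lra))).
  assert (N3 := Cexp_neq_0 (path_int (invp p) g v a b)).
  assert (E : (g b - p)%C = ((g a - p) * Cexp (path_int (invp p) g v a b))%C).
  { transitivity ((g b - p) * / Cexp (path_int (invp p) g v a b) * Cexp (path_int (invp p) g v a b))%C.
    - field; auto.
    - rewrite EF; ring. }
  rewrite E; field; auto.
Qed.

Lemma Rbetween_Rmin (x y z : R) : (x <= z <= y \/ y <= z <= x) -> Rmin x y <= z <= Rmax x y.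
Proof. unfold Rmin, Rmax; destruct (Rle_dec x y); lra. Qed.

(* If the point [pth u] never meets the path and the path is long, the
   increment of the argument of [(z - pth u) / (z - pth 1)] along the path
   stays in (-pi/2, pi/2), because its exponential has positive real part. *)
Lemma winding_small (g v : R -> C) (a b : R) (pth : R -> C) :
  curve g v -> a <= b -> (forall u, rcont pth u) ->
  (forall u t, a <= t <= b -> g t <> pth u) ->
  (forall u, 0 < Re ((g b - pth u) * (g a - pth 1%R) / ((g a - pth u) * (g b - pth 1%R)))%C) ->
  Rabs (Im (path_int (invp (pth 0)) g v a b - path_int (invp (pth 1%R)) g v a b)) < PI / 2.
Proof.
  intros Hc Hab Hpth Hav Hre.
  set (D := fun u => (path_int (invp (pth u)) g v a b - path_int (invp (pth 1%R)) g v a b)%C).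
  assert (Hf : forall u t, a <= t <= b -> ccont (invp (pth u)) (g t))
    by (intros; apply an_ccont, an_invp; auto).
  assert (HD : forall u, rcont D u). { intros u0.
    destruct (uniform_on_segment (fun t d => d <= Cmod (g t - pth u0)) a b) as [d [Hd K]].
    - pos.
    - intros t Ht. assert (P : 0 < Cmod (g t - pth u0)) by (apply Cmod_gt_0, Cminus_neq_0; auto).
      destruct (proj1 Hc t (Cmod (g t - pth u0) / 2)) as [d [Hd K]]; [ lra | ].
      exists (Rmin d (Cmod (g t - pth u0) / 2)); split; [ pos | ].
      intros t' _ Ht'; specialize (K t' (Rlt_le_trans _ _ _ Ht' (Rmin_l _ _))). le_via Rmin_r.
      generalize (Cmod_dist_triangle (g t) (g t') (pth u0)); rewrite (Cmod_minus_sym (g t) (g t')); lra.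
    - intros eps He. set (V := Re (CI (fun t => RtoC (Cmod (v t))) a b)).
      assert (P2 : 0 <= Rabs V) by apply Rabs_pos. set (e := Rmin (d / 2) (eps * (d * d / 2) / (Rabs V + 1))).
      assert (Pe : 0 < e). { pos. }
      destruct (Hpth u0 e Pe) as [d' [Hd' K']]; exists d'; split; [ auto | intros u Hu ].
      specialize (K' u Hu).
      assert (K1 := Rlt_le_trans _ _ _ K' (Rmin_l _ _)). assert (K2 := Rlt_le_trans _ _ _ K' (Rmin_r _ _)).
      unfold D; replace (path_int (invp (pth u)) g v a b - path_int (invp (pth 1%R)) g v a b -
        (path_int (invp (pth u0)) g v a b - path_int (invp (pth 1%R)) g v a b))%C with
        (path_int (invp (pth u)) g v a b + - (1) * path_int (invp (pth u0)) g v a b)%C by ring.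
      rewrite <- path_scal, <- path_plus by (auto; intros; apply ccont_mult; auto; apply ccont_const).
      set (del := Cmod (pth u - pth u0)) in *. assert (Pdel : 0 <= del) by apply Cmod_ge_0.
      apply Rle_lt_trans with (del / (d * d / 2) * V).
      + apply path_bound; try assumption.
        * intros t Ht; apply ccont_plus; [ auto | apply ccont_mult; [ apply ccont_const | auto ] ].
        * intros t Ht; specialize (K t Ht). assert (G : d / 2 <= Cmod (g t - pth u)).
          { generalize (Cmod_dist_triangle (g t) (pth u) (pth u0)); fold del; lra. } unfold invp.
          assert (N1 := Cminus_neq_0 _ _ (Hav u t Ht)). assert (N2 := Cminus_neq_0 _ _ (Hav u0 t Ht)).
          replace (/ (g t - pth u) + - (1) * / (g t - pth u0))%C with
            ((pth u - pth u0) / ((g t - pth u) * (g t - pth u0)))%C by (field; split; auto).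
          rewrite Cmod_div, Cmod_mult by (apply Cmult_neq_0; auto); fold del.
          apply Rmult_le_compat_l; [ auto | ]. apply Rinv_le_contravar; [ nra | ].
          replace (d * d / 2) with (d / 2 * d) by field; apply Rmult_le_compat; lra.
      + apply Rle_lt_trans with (del / (d * d / 2) * (Rabs V + 1)).
        * apply Rmult_le_compat_l; [ | generalize (Rle_abs V); lra ]. pos.
        * apply (Rmult_lt_compat_r ((Rabs V + 1) / (d * d / 2))) in K2.
          2:{ pos. } replace (eps * (d * d / 2) / (Rabs V + 1) * ((Rabs V + 1) / (d * d / 2))) with eps in K2
            by (field; split; nra).
          replace (del / (d * d / 2) * (Rabs V + 1)) with (del * ((Rabs V + 1) / (d * d / 2)))
            by (field; nra). auto. }
  assert (Hne : forall u, Rabs (Im (D u)) <> PI / 2). { intros u E. assert (H := Hre u).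
    replace ((g b - pth u) * (g a - pth 1%R) / ((g a - pth u) * (g b - pth 1%R)))%C with (Cexp (D u)) in H.
    - unfold Cexp in H; rewrite Re_mult, Re_RtoC, Im_RtoC, Re_pair in H. assert (Ec : cos (Im (D u)) = 0).
      { unfold Rabs in E; destruct Rcase_abs; [ | rewrite E; apply cos_PI2 ].
        rewrite <- cos_neg, E; apply cos_PI2. }
      rewrite Ec in H; lra.
    - unfold D; rewrite Cexp_minus, !path_log by (assumption || (intros; apply Hav; auto)).
      field; repeat split; apply Cminus_neq_0; apply Hav; lra. }
  assert (HPI := PI_RGT_0). apply Rnot_le_lt; intros Hge; change (PI / 2 <= Rabs (Im (D 0))) in Hge.
  assert (Hcont : continuity (fun u => Rabs (Im (D u)))).
  { intros u; apply continuity_pt_filterlim, filterlim_locally; intros eps.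
    destruct (HD u eps (cond_pos eps)) as [d [Hd K]]. exists (mkposreal d Hd); intros u' Hu'.
    eapply Rle_lt_trans; [ | apply (K u' Hu') ].
    le_via Rabs_triang_inv2; rewrite <- Im_minus; apply Im_le_Cmod. }
  (* The increment is 0 at [u = 1]; to reach [PI / 2] in absolute value at [u = 0] it would have to
     equal it in between, which [Hne] excludes. *)
  destruct (IVT_gen _ 0 1 (PI / 2) Hcont) as [u [_ Hu]].
  - apply Rbetween_Rmin; right; split; [ | auto ].
    unfold D; replace (path_int (invp (pth 1%R)) g v a b - path_int (invp (pth 1%R)) g v a b)%C
      with (RtoC 0) by ring.
    rewrite Im_RtoC, Rabs_R0; lra.
  - exact (Hne u Hu).
Qed.

(** Both [(x - p) / (x - q)] and [(y - q) / (y - p)] are [1 + e] with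
    [Cmod e <= 2 P / (8 P + 1) <= 1 / 4], and [1/4 + 1/4 + 1/16 < 1]. *)
Lemma ratio_Re_pos (x y p q : C) (P : R) : 0 <= P -> Cmod p <= P -> Cmod q <= P ->
  9 * P + 1 <= Cmod x -> 9 * P + 1 <= Cmod y ->
  0 < Re ((x - p) * (y - q) / ((y - p) * (x - q)))%C.
Proof.
  intros HP Hp Hq Hx Hy. assert (A1 : 8 * P + 1 <= Cmod (x - q)) by (generalize (Cmod_minus_ge x q); lra).
  assert (A2 : 8 * P + 1 <= Cmod (y - p)) by (generalize (Cmod_minus_ge y p); lra).
  assert (N1 : (x - q)%C <> 0%C) by (apply Cmod_gt_0; lra).
  assert (N2 : (y - p)%C <> 0%C) by (apply Cmod_gt_0; lra).
  set (e1 := ((q - p) / (x - q))%C). set (e2 := ((p - q) / (y - p))%C).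
  replace ((x - p) * (y - q) / ((y - p) * (x - q)))%C with (1 + (e1 + e2 + e1 * e2))%C
    by (unfold e1, e2; field; split; auto).
  assert (Hpq : Cmod (q - p) <= 2 * P) by (le_via Cmod_triangle_minus; lra).
  assert (K : forall z, 8 * P + 1 <= Cmod z -> Cmod (q - p) / Cmod z <= 1 / 4).
  { intros z Hz; apply (Rmult_le_reg_r (Cmod z)); [ lra | ].
    unfold Rdiv; rewrite Rmult_assoc, Rinv_l by lra; lra. }
  assert (E1 : Cmod e1 <= 1 / 4) by (unfold e1; rewrite Cmod_div by auto; apply K, A1).
  assert (E2 : Cmod e2 <= 1 / 4) by (unfold e2; rewrite Cmod_div, Cmod_minus_sym by auto; apply K, A2).
  rewrite Re_plus, Re_RtoC. assert (E3 : Cmod (e1 + e2 + e1 * e2) <= 9 / 16).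
  { le_via Cmod_triangle; rewrite Cmod_mult.
    generalize (Cmod_triangle e1 e2) (Cmod_ge_0 e1) (Cmod_ge_0 e2); nra. }
  assert (H := Rle_trans _ _ _ (Re_le_Cmod _) E3); apply Rabs_le_between in H; lra.
Qed.

(** Integrality of winding numbers. The identity [cos (2 y) = 1 - 2 (sin y)^2] reduces it to the
    positivity of the sine on [(0, PI)]. *)
Lemma Cexp_eq_1 (z : C) : Cexp z = 1%C -> Rabs (Im z) < 2 * PI -> z = 0%C.
Proof.
  intros H Hz. assert (HR : Re z = 0). { assert (E := f_equal Cmod H); rewrite Cmod_Cexp, Cmod_1 in E.
    rewrite <- (ln_exp (Re z)), E; apply ln_1. }
  unfold Cexp in H; rewrite HR, exp_0 in H. assert (H1 := f_equal Re H); assert (H2 := f_equal Im H).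
  autorewrite with ReIm in H1, H2. assert (Hc : cos (Im z) = 1) by lra. assert (Hs : sin (Im z / 2) = 0).
  { replace (Im z) with (2 * (Im z / 2)) in Hc by field; rewrite cos_2a_sin in Hc. nra. }
  apply C_ext; [ auto | rewrite Im_RtoC ]. apply Rabs_def2 in Hz.
  destruct (Rtotal_order (Im z) 0) as [L|[L|L]]; [ | auto | ].
  - exfalso; assert (0 < sin (- (Im z / 2))) by (apply sin_gt_0; lra). rewrite sin_neg in *; lra.
  - exfalso; assert (0 < sin (Im z / 2)) by (apply sin_gt_0; lra). lra.
Qed.

(** * Cauchy's theorem for the difference of two contours *)

(** [I] stands for integration over a closed chain supported in [D]. Two distinct poles are
    separated by [1 / ((z - p) (z - q)) = (1 / (z - p) - 1 / (z - q)) / (p - q)], which removes one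
    factor. For one repeated pole [taylor_quotient] lowers the power, and [(z - p)^(-k)] with
    [k >= 2] has a primitive. What remains is [I (invp p)], which vanishes by assumption. *)
Lemma partial_fractions (D U : C -> Prop) (I : (C -> C) -> C) (p0 : C) :
  cvx U -> opn U -> U p0 -> (forall z, D z -> U z) ->
  (forall f h, (forall z, D z -> ccont f z) -> (forall z, D z -> f z = h z) -> I f = I h) ->
  (forall f h, (forall z, D z -> ccont f z) -> (forall z, D z -> ccont h z) ->
     I (fun z => f z + h z)%C = (I f + I h)%C) ->
  (forall k f, (forall z, D z -> ccont f z) -> I (fun z => k * f z)%C = (k * I f)%C) ->
  (forall f F, (forall z, D z -> ccont f z) -> (forall z, D z -> cder F z (f z)) -> I f = 0%C) ->
  forall ps : list C, (forall p, In p ps -> ~ D p /\ (U p -> I (invp p) = 0%C)) ->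
  forall H : C -> C, (forall z, U z -> an H z) ->
  I (fun z => H z * Cprod (map (fun p => invp p z) ps))%C = 0%C.
Proof.
  intros HU HO Hp0 HDU Iext Iplus Iscal Iprim.
  assert (Ian : forall H, (forall z, U z -> an H z) -> I H = 0%C). { intros H HH; apply (Iprim H (prim H p0)).
    - intros z Hz; apply an_ccont; auto.
    - intros z Hz; apply (prim_cder U); auto. }
  assert (Hpow : forall p k, ~ D p -> (U p -> I (invp p) = 0%C) ->
    forall H, (forall z, U z -> an H z) -> I (fun z => H z * invp p z ^ k)%C = 0%C).
  { intros p k HDp HIp. assert (Hne : forall z, D z -> z <> p) by (intros z Hz ->; auto).
    destruct (classic (U p)) as [Up|Up].
    - induction k as [|k IH]; intros H HH.
      + apply Ian; intros z Hz; simpl; apply an_mult; [ auto | apply an_const ].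
      + destruct (taylor_quotient U H p HU HO Up HH) as [H1 [HH1 EH]].
        assert (E : I (fun z => H z * invp p z ^ S k)%C =
          (H p * I (fun z => invp p z ^ S k)%C + I (fun z => H1 z * invp p z ^ k)%C)%C).
        { rewrite <- Iscal by (intros; apply an_ccont, an_pow, an_invp; auto). rewrite <- Iplus.
          - apply Iext.
            + intros z Hz; apply an_ccont, an_mult; [ auto | apply an_pow, an_invp; auto ].
            + intros z Hz; rewrite (EH z) by auto; simpl; unfold invp.
              assert (N := Cminus_neq_0 _ _ (Hne z Hz)). set (w := (/ (z - p))%C) in *.
              assert (Ew : ((z - p) * w)%C = 1%C) by (unfold w; field; auto).
              transitivity (H p * (w * w ^ k) + ((z - p) * w) * (H1 z * w ^ k))%C; [ ring | ].
              rewrite Ew; ring.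
          - intros z Hz; apply an_ccont, an_mult; [ apply an_const | apply an_pow, an_invp; auto ].
          - intros z Hz; apply an_ccont, an_mult; [ auto | apply an_pow, an_invp; auto ]. }
        rewrite E, (IH H1 HH1). assert (E0 : I (fun z => invp p z ^ S k)%C = 0%C). { destruct k as [|k].
          - rewrite <- (HIp Up); apply Iext.
            + intros z Hz; apply an_ccont, an_pow, an_invp; auto.
            + intros z Hz; simpl; ring.
          - apply (Iprim _ (fun z => RtoC (- / INR (S k)) * (/ (- p + z)) ^ (S k))%C).
            + intros z Hz; apply an_ccont, an_pow, an_invp; auto.
            + intros z Hz. assert (N := Cminus_neq_0 _ _ (Hne z Hz)).
              assert (N' : (- p + z)%C <> 0%C) by (replace (- p + z)%C with (z - p)%C by ring; auto).
              assert (NS : INR (S k) <> 0) by (apply not_0_INR; lia).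
              apply (cder_eq _ _ (RtoC (- / INR (S k)) * (- RtoC (INR (S k)) * (/ (- p + z)) ^ (S (S k))))%C).
              * apply cder_scal, cder_inv_pow, N'.
              * unfold invp; replace (- p + z)%C with (z - p)%C by ring. rewrite RtoC_opp, RtoC_inv by auto.
                assert (NS' := RtoC_neq_0 _ NS); simpl Cpow.
                set (k1 := RtoC (INR (S k))) in *; clearbody k1; field; repeat split; auto. }
        rewrite E0; ring.
    - intros H HH; apply Ian; intros z Hz; apply an_mult; [ auto | apply an_pow, an_invp ]. intros ->; auto. }
  intros ps; remember (length ps) as len eqn:Hlen; revert ps Hlen.
  induction len as [len IH] using lt_wf_ind; intros ps Hlen Hps H HH. destruct ps as [|p ps].
  { rewrite (Iext _ H); [ apply Ian, HH | | intros; simpl; ring ].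
    intros z Hz; apply an_ccont, an_mult; [ auto | apply (an_Cprod invp); intros q [] ]. }
  assert (HD : forall q z, In q (p :: ps) -> D z -> z <> q).
  { intros q z Hq Hz ->; apply (proj1 (Hps q Hq)), Hz. }
  assert (Hcc : forall l, incl l (p :: ps) -> forall z, D z ->
    ccont (fun z => H z * Cprod (map (fun p => invp p z) l))%C z).
  { intros l Hl z Hz; apply an_ccont, an_mult; [ auto | ].
    apply (an_Cprod invp); intros q Hq; apply an_invp, HD; auto. }
  destruct (classic (exists q, In q ps /\ q <> p)) as [[q [Hq Hqp]]|Hall].
  - destruct (in_split q ps Hq) as [l1 [l2 El]]. assert (Ilp : incl (p :: l1 ++ l2) (p :: ps)).
    { intros x [->|Hx]; [ left; reflexivity | right; rewrite El ].
      apply in_app_or in Hx; apply in_or_app; simpl; tauto. }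
    assert (Ilq : incl (q :: l1 ++ l2) (p :: ps)). { intros x [->|Hx]; right; [ auto | rewrite El ].
      apply in_app_or in Hx; apply in_or_app; simpl; tauto. }
    assert (Npq : (p - q)%C <> 0%C) by (apply Cminus_neq_0; auto).
    assert (E : I (fun z => H z * Cprod (map (fun p => invp p z) (p :: ps)))%C =
      (/ (p - q) * I (fun z => H z * Cprod (map (fun p => invp p z) (p :: l1 ++ l2)))%C +
       (- / (p - q)) * I (fun z => H z * Cprod (map (fun p => invp p z) (q :: l1 ++ l2)))%C)%C).
    { rewrite <- !Iscal by (apply Hcc; auto).
      rewrite <- Iplus by (intros; apply ccont_mult; [ apply ccont_const | apply Hcc; auto ]).
      apply Iext; [ apply Hcc, incl_refl | ]. intros z Hz; rewrite El; simpl map; simpl Cprod.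
      rewrite !map_app, !Cprod_app; simpl map; simpl Cprod.
      set (P1 := Cprod _); set (P2 := Cprod _); unfold invp.
      assert (N1 := Cminus_neq_0 _ _ (HD p z (or_introl eq_refl) Hz)).
      assert (N2 := Cminus_neq_0 _ _ (HD q z (or_intror Hq) Hz)). field; repeat split; auto. }
    rewrite E. assert (Hl : length ps = S (length (l1 ++ l2))) by (rewrite El, !length_app; simpl; lia).
    simpl in Hlen. rewrite (IH (length (p :: l1 ++ l2))), (IH (length (q :: l1 ++ l2)));
      try assumption; try reflexivity; try (simpl; lia); try ring.
    + auto.
    + auto.
  - destruct (Hps p (or_introl eq_refl)) as [HDp HIp]. rewrite <- (Hpow p (length (p :: ps)) HDp HIp H HH).
    apply Iext; [ apply Hcc, incl_refl | ]. intros z Hz; f_equal.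
    assert (Hall' : forall x, In x (p :: ps) -> x = p).
    { intros x [->|Hx]; [ reflexivity | apply NNPP; intros Hn; apply Hall; eauto ]. }
    revert Hall'; generalize (p :: ps); intros l Hl; induction l as [|x l IHl]; [ reflexivity | ].
    simpl; rewrite (Hl x (or_introl eq_refl)), IHl; [ reflexivity | ]. intros y Hy; apply Hl; right; auto.
Qed.

Section Chain.

Variables (g0 v0 g1 v1 : R -> C).
Hypotheses (Hc0 : curve g0 v0) (Hc1 : curve g1 v1).

Definition on_chain (a b : R) (z : C) : Prop :=
  (exists t, a <= t <= b /\ z = g0 t) \/ (exists t, a <= t <= b /\ z = g1 t) \/
  (exists u, 0 <= u <= 1 /\ z = (g0 b + RtoC u * (g1 b - g0 b))%C) \/
  (exists u, 0 <= u <= 1 /\ z = (g0 a + RtoC u * (g1 a - g0 a))%C).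

(** [g1] forwards, [g0] backwards, closed by the segments joining their ends; the signs make it a
    closed loop. *)
Definition chain (a b : R) (f : C -> C) : C :=
  (path_int f g1 v1 a b - path_int f g0 v0 a b - segment f (g0 b) (g1 b) + segment f (g0 a) (g1 a))%C.

Lemma chain_ext (a b : R) (f h : C -> C) : a <= b ->
  (forall z, on_chain a b z -> ccont f z) -> (forall z, on_chain a b z -> f z = h z) ->
  chain a b f = chain a b h.
Proof.
  intros Hab Hf E; unfold chain, segment.
  rewrite (path_ext f h g1 v1), (path_ext f h g0 v0), (path_ext f h _ _ 0 1 (curve_line (g0 b) (g1 b))),
    (path_ext f h _ _ 0 1 (curve_line (g0 a) (g1 a))); [ reflexivity | .. ]; try assumption; try lra;
    intros t Ht; first [ apply Hf | apply E ]; unfold on_chain; eauto 6.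
Qed.

Lemma chain_plus (a b : R) (f h : C -> C) : a <= b ->
  (forall z, on_chain a b z -> ccont f z) -> (forall z, on_chain a b z -> ccont h z) ->
  chain a b (fun z => f z + h z)%C = (chain a b f + chain a b h)%C.
Proof.
  intros Hab Hf E; unfold chain, segment.
  rewrite (path_plus f h g1 v1), (path_plus f h g0 v0), (path_plus f h _ _ 0 1 (curve_line (g0 b) (g1 b))),
    (path_plus f h _ _ 0 1 (curve_line (g0 a) (g1 a))); [ ring | .. ]; try assumption; try lra;
    intros t Ht; first [ apply Hf | apply E ]; unfold on_chain; eauto 6.
Qed.

Lemma chain_scal (a b : R) (k : C) (f : C -> C) : a <= b ->
  (forall z, on_chain a b z -> ccont f z) ->
  chain a b (fun z => k * f z)%C = (k * chain a b f)%C.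
Proof.
  intros Hab Hf; unfold chain, segment.
  rewrite (path_scal k f g1 v1), (path_scal k f g0 v0), (path_scal k f _ _ 0 1 (curve_line (g0 b) (g1 b))),
    (path_scal k f _ _ 0 1 (curve_line (g0 a) (g1 a))); [ ring | .. ]; try assumption; try lra;
    intros t Ht; apply Hf; unfold on_chain; eauto 6.
Qed.

Lemma chain_prim (a b : R) (f F : C -> C) : a <= b ->
  (forall z, on_chain a b z -> ccont f z) -> (forall z, on_chain a b z -> cder F z (f z)) ->
  chain a b f = 0%C.
Proof.
  intros Hab Hf HF; unfold chain. rewrite (path_ftc f F g1 v1), (path_ftc f F g0 v0), !(segment_ftc f F);
    [ ring | .. ]; try assumption; try lra;
    intros t Ht; first [ apply Hf | apply HF ]; unfold on_chain; eauto 6.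
Qed.

Lemma chain_bounded (a b : R) : a <= b -> exists M, 0 < M /\ forall z, on_chain a b z -> Cmod z < M.
Proof.
  intros Hab. destruct (rcont_bounded g0 a b Hab (fun t _ => proj1 Hc0 t)) as [M0 [P0 H0]].
  destruct (rcont_bounded g1 a b Hab (fun t _ => proj1 Hc1 t)) as [M1 [P1 H1]]. set (M := M0 + M1 + 1).
  assert (B : forall t, a <= t <= b -> Cmod (g0 t - 0) < M /\ Cmod (g1 t - 0) < M).
  { intros t Ht; specialize (H0 t Ht); specialize (H1 t Ht); unfold M.
    replace (g0 t - 0)%C with (g0 t) by ring; replace (g1 t - 0)%C with (g1 t) by ring; lra. }
  exists M; split; [ unfold M; lra | ]. intros z Hz; replace z with (z - 0)%C by ring.
  destruct Hz as [[t [Ht ->]]|[[t [Ht ->]]|[[u [Hu ->]]|[u [Hu ->]]]]].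
  - apply B, Ht.
  - apply B, Ht.
  - apply cvx_ball; try assumption; apply B; lra.
  - apply cvx_ball; try assumption; apply B; lra.
Qed.

Definition upper (Y : R) (z : C) : Prop := Y < Im z.
Definition lower (Y : R) (z : C) : Prop := Im z < - Y.

Lemma cvx_upper (Y : R) : cvx (upper Y).
Proof.
  intros p z t Hp Hz Ht; unfold upper in *; autorewrite with ReIm. destruct (Req_dec t 0) as [->|H0]; nra.
Qed.

Lemma cvx_lower (Y : R) : cvx (lower Y).
Proof.
  intros p z t Hp Hz Ht; unfold lower in *; autorewrite with ReIm. destruct (Req_dec t 0) as [->|H0]; nra.
Qed.

Lemma opn_upper (Y : R) : opn (upper Y).
Proof.
  intros z Hz; unfold upper in *; exists (Im z - Y); split; [ lra | intros y Hy ].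
  assert (H := Rle_lt_trans _ _ _ (Im_le_Cmod _) Hy); apply Rabs_def2 in H. rewrite Im_minus in H; lra.
Qed.

Lemma opn_lower (Y : R) : opn (lower Y).
Proof.
  intros z Hz; unfold lower in *; exists (- Y - Im z); split; [ lra | intros y Hy ].
  assert (H := Rle_lt_trans _ _ _ (Im_le_Cmod _) Hy); apply Rabs_def2 in H. rewrite Im_minus in H; lra.
Qed.

Variables (Y R1 : R).
Hypothesis HY : 0 <= Y.
Hypothesis HR1 : 0 < R1.
Hypothesis Hup : forall t, R1 <= t -> upper Y (g0 t) /\ upper Y (g1 t).
Hypothesis Hlow : forall t, t <= - R1 -> lower Y (g0 t) /\ lower Y (g1 t).

(** In the half-planes above [Y] and below [- Y] the function has a primitive, so the added pieces
    of curve and the moved segments cancel. Chains of any length thus reduce to a fixed one. *)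
Lemma chain_extend (a b : R) (f : C -> C) : a <= - R1 -> R1 <= b ->
  (forall z, on_chain (- R1) R1 z -> ccont f z) ->
  (forall z, upper Y z -> an f z) -> (forall z, lower Y z -> an f z) ->
  chain a b f = chain (- R1) R1 f.
Proof.
  intros Ha Hb Hf Hfu Hfl. set (pu := g0 R1). set (pl := g0 (- R1)).
  assert (Upu : upper Y pu) by (apply Hup; lra). assert (Lpl : lower Y pl) by (apply Hlow; lra).
  set (Fu := prim f pu). set (Fl := prim f pl). assert (DU : forall z, upper Y z -> cder Fu z (f z)).
  { intros z Hz; apply (prim_cder (upper Y)); auto using cvx_upper, opn_upper. }
  assert (DL : forall z, lower Y z -> cder Fl z (f z)).
  { intros z Hz; apply (prim_cder (lower Y)); auto using cvx_lower, opn_lower. }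
  assert (CU : forall z, upper Y z -> ccont f z) by (intros; apply an_ccont; auto).
  assert (CL : forall z, lower Y z -> ccont f z) by (intros; apply an_ccont; auto).
  assert (C0 : forall t, a <= t <= b -> ccont f (g0 t) /\ ccont f (g1 t)).
  { intros t Ht; destruct (Rle_dec t (- R1)); [ split; apply CL, Hlow; auto | ].
    destruct (Rle_dec R1 t); [ split; apply CU, Hup; auto | ].
    split; apply Hf; [ left | right; left ]; exists t; split; (lra || reflexivity). }
  assert (S1 : forall g v, curve g v -> (forall t, a <= t <= b -> ccont f (g t)) ->
    (forall t, R1 <= t -> upper Y (g t)) -> (forall t, t <= - R1 -> lower Y (g t)) ->
    path_int f g v a b = (path_int f g v (- R1) R1 + (Fu (g b) - Fu (g R1)) + (Fl (g (- R1)%R) - Fl (g a)))%C).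
  { intros g v Hc Hcc HU HL. rewrite (path_Chasles f g v a (- R1) b), (path_Chasles f g v (- R1) R1 b) by
      (assumption || lra || (intros; apply Hcc; lra)).
    rewrite (path_ftc f Fl g v a (- R1)), (path_ftc f Fu g v R1 b);
      try assumption; try lra; try ring; intros t Ht; try (apply Hcc; lra).
    - apply DU, HU; lra.
    - apply DL, HL; lra. }
  unfold chain. rewrite (S1 g0 v0 Hc0), (S1 g1 v1 Hc1); try (intros; apply C0; auto);
    try (intros; apply Hup; auto); try (intros; apply Hlow; auto).
  assert (SU : forall t, R1 <= t -> segment f (g0 t) (g1 t) = (Fu (g1 t) - Fu (g0 t))%C).
  { intros t Ht; apply segment_ftc; intros u Hu; [ apply CU | apply DU ];
      apply cvx_upper; try assumption; apply Hup, Ht. }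
  assert (SL : forall t, t <= - R1 -> segment f (g0 t) (g1 t) = (Fl (g1 t) - Fl (g0 t))%C).
  { intros t Ht; apply segment_ftc; intros u Hu; [ apply CL | apply DL ];
      apply cvx_lower; try assumption; apply Hlow, Ht. }
  rewrite (SU b), (SU R1), (SL a), (SL (- R1)) by lra; ring.
Qed.

(** The loop is closed, so the four quotients given by [path_log] multiply to 1. *)
Lemma chain_exp (a b : R) (p : C) : a <= b -> ~ on_chain a b p -> Cexp (chain a b (invp p)) = 1%C.
Proof.
  intros Hab Hp; unfold chain.
  assert (N0 : forall t, a <= t <= b -> g0 t <> p) by (intros t Ht E; apply Hp; left; eauto).
  assert (N1 : forall t, a <= t <= b -> g1 t <> p) by (intros t Ht E; apply Hp; right; left; eauto).
  rewrite Cexp_plus, !Cexp_minus; unfold segment. rewrite (path_log g1 v1), (path_log g0 v0) by auto.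
  rewrite (path_log _ _ 0 1 p (curve_line (g0 b) (g1 b))), (path_log _ _ 0 1 p (curve_line (g0 a) (g1 a)));
    try lra.
  - replace (g0 b + RtoC 1 * (g1 b - g0 b) - p)%C with (g1 b - p)%C by ring.
    field; repeat split; apply Cminus_neq_0; try apply N0; try apply N1; lra.
  - intros u Hu E; apply Hp; right; right; right; eauto.
  - intros u Hu E; apply Hp; right; right; left; eauto.
Qed.

Lemma same_side_path (g : R -> C) (p q : C) : same_side g p q ->
  exists pth : R -> C, (forall u, rcont pth u) /\ pth 0 = p /\ pth 1 = q /\ forall u t, g t <> pth u.
Proof.
  intros [path [H1 [H2 [H3 H4]]]]. exists (fun u => path (clamp 0 1 u)); split; [ | split; [ | split ] ].
  - intros u; apply rcont_clamp; [ lra | intros t _; apply rcont_continuous, H1 ].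
  - rewrite clamp_id by lra; auto.
  - rewrite clamp_id by lra; auto.
  - intros u t E; apply (H4 (clamp 0 1 u) t); [ apply clamp_in; lra | auto ].
Qed.

Lemma same_side_winding (g v : R -> C) (p q : C) : curve g v -> same_side g p q ->
  exists P, forall a b, a <= b -> P <= Cmod (g a) -> P <= Cmod (g b) ->
    Rabs (Im (path_int (invp p) g v a b - path_int (invp q) g v a b)) < PI / 2.
Proof.
  intros Hc Hs; destruct (same_side_path g p q Hs) as [pth [H1 [H2 [H3 H4]]]].
  destruct (rcont_bounded (fun u => pth (clamp 0 1 u)) 0 1) as [P [HP HB]]; [ lra | | ].
  (* [P] bounds the whole path from [p] to [q], and [9 * P + 1] is the threshold of
     [ratio_Re_pos]. *)
  { intros u Hu; apply rcont_clamp; [ lra | auto ]. } exists (9 * P + 1); intros a b Hab Ha Hb.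
  rewrite <- H2, <- H3. set (pth' := fun u => pth (clamp 0 1 u)).
  replace (pth 0) with (pth' 0) by (unfold pth'; rewrite clamp_id by lra; reflexivity).
  replace (pth 1) with (pth' 1) by (unfold pth'; rewrite clamp_id by lra; reflexivity).
  apply winding_small; try assumption.
  - intros u; unfold pth'; apply rcont_clamp; [ lra | auto ].
  - intros u t _; apply H4.
  - assert (B : forall u, Cmod (pth' u) <= P).
    { intros u; unfold pth'; generalize (HB (clamp 0 1 u) (clamp_in 0 1 u ltac:(lra))).
      rewrite (clamp_id 0 1 (clamp 0 1 u)); [ auto | apply clamp_in; lra ]. }
    intros u; apply (ratio_Re_pos _ _ _ _ P); auto; lra.
Qed.

Lemma segment_winding (p q y0 y1 : C) (P : R) : 0 <= P -> Cmod p <= P -> Cmod q <= P ->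
  9 * P + 1 <= Cmod y0 -> 9 * P + 1 <= Cmod y1 ->
  (forall u w, 0 <= u <= 1 -> 0 <= w <= 1 -> (y0 + RtoC u * (y1 - y0))%C <> (p + RtoC w * (q - p))%C) ->
  Rabs (Im (segment (invp p) y0 y1 - segment (invp q) y0 y1)) < PI / 2.
Proof.
  intros HP Hp Hq H0 H1 Hav; unfold segment. set (pth := fun u => (p + RtoC (clamp 0 1 u) * (q - p))%C).
  replace (invp p) with (invp (pth 0)).
  2:{ f_equal; unfold pth; rewrite clamp_id by lra; ring. } replace (invp q) with (invp (pth 1)).
  2:{ f_equal; unfold pth; rewrite clamp_id by lra; ring. }
  apply winding_small; [ apply curve_line | lra | | | ].
  - intros u; apply (rcont_clamp (fun u => p + RtoC u * (q - p))%C); [ lra | intros; apply rcont_line ].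
  - intros u t Ht; apply Hav; [ auto | apply clamp_in; lra ].
  - assert (B : forall u, Cmod (pth u) <= P).
    { intros u; unfold pth; set (c := clamp 0 1 u). assert (Hc : 0 <= c <= 1) by (apply clamp_in; lra).
      replace (p + RtoC c * (q - p))%C with (RtoC (1 - c) * p + RtoC c * q)%C by (rewrite RtoC_minus; ring).
      le_via Cmod_triangle. rewrite !Cmod_mult, !Cmod_R, !Rabs_pos_eq by lra. nra. }
    intros u; apply (ratio_Re_pos _ _ _ _ P); auto.
    + replace (y0 + RtoC 1 * (y1 - y0))%C with y1 by ring; auto.
    + replace (y0 + RtoC 0 * (y1 - y0))%C with y0 by ring; auto.
Qed.

Hypothesis Hinf : forall P, exists R, forall t, R <= t ->
  upper P (g0 t) /\ upper P (g1 t) /\ lower P (g0 (- t)) /\ lower P (g1 (- t)).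

Lemma off_chain (a b : R) (p : C) : a <= - R1 -> R1 <= b -> Rabs (Im p) <= Y ->
  (forall t, g0 t <> p) -> (forall t, g1 t <> p) -> ~ on_chain a b p.
Proof.
  intros Ha Hb Hp N0 N1; apply Rabs_le_between in Hp.
  intros [[t [Ht E]]|[[t [Ht E]]|[[u [Hu E]]|[u [Hu E]]]]].
  - apply (N0 t); auto.
  - apply (N1 t); auto.
  - assert (H : upper Y p) by (rewrite E; apply cvx_upper; try assumption; apply Hup; lra).
    unfold upper in H; lra.
  - assert (H : lower Y p) by (rewrite E; apply cvx_lower; try assumption; apply Hlow; lra).
    unfold lower in H; lra.
Qed.

(** The integrals for [p] and for [x] differ by four increments of argument, along two curves and
    two segments, each less than [PI / 2]. Their sum is less than [2 PI], so by integrality the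
    integral for [p] vanishes with the one for [x]. *)
Lemma chain_winding (p x : C) : Rabs (Im p) <= Y -> Im x = 0 ->
  same_side g0 p x -> same_side g1 p x -> chain (- R1) R1 (invp x) = 0%C ->
  (forall t, g0 t <> x) -> (forall t, g1 t <> x) ->
  chain (- R1) R1 (invp p) = 0%C.
Proof.
  intros Hp Hx Hs0 Hs1 Hchx Nx0 Nx1. destruct (same_side_winding g0 v0 p x Hc0 Hs0) as [P0 HP0].
  destruct (same_side_winding g1 v1 p x Hc1 Hs1) as [P1 HP1]. assert (Np0 : forall t, g0 t <> p).
  { destruct (same_side_path _ _ _ Hs0) as [pth [_ [<- [_ H]]]]; auto. } assert (Np1 : forall t, g1 t <> p).
  { destruct (same_side_path _ _ _ Hs1) as [pth [_ [<- [_ H]]]]; auto. } set (P2 := Cmod p + Cmod x).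
  assert (Hp2 := Cmod_ge_0 p). assert (Hx2 := Cmod_ge_0 x). set (P := Rabs P0 + Rabs P1 + (9 * P2 + 1)).
  assert (HA0 := Rabs_pos P0). assert (HA1 := Rabs_pos P1).
  assert (HB0 := Rle_abs P0). assert (HB1 := Rle_abs P1).
  assert (HPP : P0 <= P /\ P1 <= P) by (unfold P, P2; lra). destruct (Hinf P) as [RR HRR].
  set (b := Rmax R1 RR). assert (Hb1 : R1 <= b) by apply Rmax_l. assert (Hb2 : RR <= b) by apply Rmax_r.
  destruct (HRR b Hb2) as [B0 [B1 [A0 A1]]]. assert (Big : forall z, upper P z \/ lower P z -> P <= Cmod z).
  { intros z Hz; eapply Rle_trans; [ | apply Im_le_Cmod ].
    unfold upper, lower in Hz; destruct (Rcase_abs (Im z)) as [Hi|Hi].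
    - rewrite Rabs_left by auto; lra.
    - rewrite Rabs_right by auto; lra. }
  (* The chain is lengthened until its ends are far from [p] and [x], where the comparison of
     arguments is valid; this leaves both integrals unchanged. *)
  assert (E : forall y, Rabs (Im y) <= Y -> (forall t, g0 t <> y) -> (forall t, g1 t <> y) ->
    chain (- b) b (invp y) = chain (- R1) R1 (invp y)).
  { intros y Hy N0 N1; assert (Hy' := proj1 (Rabs_le_between _ _) Hy).
    apply chain_extend; [ lra | auto | | | ].
    - intros z Hz; apply an_ccont, an_invp; intros ->; revert Hz; apply off_chain; (assumption || lra).
    - intros z Hz; apply an_invp; intros ->; unfold upper in Hz; lra.
    - intros z Hz; apply an_invp; intros ->; unfold lower in Hz; lra. }
  assert (HxY : Rabs (Im x) <= Y) by (rewrite Hx, Rabs_R0; auto). rewrite <- (E x HxY Nx0 Nx1) in Hchx.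
  rewrite <- (E p Hp Np0 Np1).
  apply Cexp_eq_1; [ apply chain_exp; [ lra | apply off_chain; (assumption || lra) ] | ].
  replace (chain (- b) b (invp p)) with (chain (- b) b (invp p) - chain (- b) b (invp x))%C
    by (rewrite Hchx; ring).
  unfold chain. match goal with |- Rabs (Im (?a1 - ?a2 - ?a3 + ?a4 - (?b1 - ?b2 - ?b3 + ?b4))) < _ =>
    replace (a1 - a2 - a3 + a4 - (b1 - b2 - b3 + b4))%C with
      ((a1 - b1) - (a2 - b2) - (a3 - b3) + (a4 - b4))%C by ring end.
  assert (Hav : forall y0 y1, (upper P y0 /\ upper P y1 /\ upper Y y0 /\ upper Y y1) \/
      (lower P y0 /\ lower P y1 /\ lower Y y0 /\ lower Y y1) ->
      Rabs (Im (segment (invp p) y0 y1 - segment (invp x) y0 y1)) < PI / 2).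
  { intros y0 y1 Hy; apply (segment_winding p x y0 y1 P2); try (unfold P2; lra).
    - apply Rle_trans with P; [ unfold P; lra | apply Big; tauto ].
    - apply Rle_trans with P; [ unfold P; lra | apply Big; tauto ].
    - intros u w Hu Hw Euw. assert (Hpw : - Y <= Im (p + RtoC w * (x - p))%C <= Y).
      { apply Rabs_le_between in Hp; autorewrite with ReIm; rewrite Hx; nra. } rewrite <- Euw in Hpw.
      destruct Hy as [[_ [_ [V0 V1]]]|[_ [_ [V0 V1]]]].
      + assert (V := cvx_upper Y y0 y1 u V0 V1 Hu); unfold upper in V; lra.
      + assert (V := cvx_lower Y y0 y1 u V0 V1 Hu); unfold lower in V; lra. }
  assert (W1 := HP1 (- b) b ltac:(lra) ltac:(generalize (Big _ (or_intror A1)); intros; lra)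
    ltac:(generalize (Big _ (or_introl B1)); intros; lra)).
  assert (W0 := HP0 (- b) b ltac:(lra) ltac:(generalize (Big _ (or_intror A0)); intros; lra)
    ltac:(generalize (Big _ (or_introl B0)); intros; lra)).
  assert (W2 := Hav (g0 b) (g1 b) ltac:(left; repeat split; try assumption; apply Hup; auto)).
  assert (W3 := Hav (g0 (- b)) (g1 (- b)) ltac:(right; repeat split; try assumption; apply Hlow; lra)).
  rewrite Im_plus, !(Im_minus (_ - _)).
  apply Rabs_def2 in W0; apply Rabs_def2 in W1; apply Rabs_def2 in W2; apply Rabs_def2 in W3.
  apply Rabs_def1; lra.
Qed.

(** The sign [s] tells the side: 1 for poles to the right of the contours, -1 for poles to the left.
    Both curves have to leave [p] on the side of the same far real points, around which the chain
    does not wind. *)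
Definition linked (p : C) : Prop :=
  exists s : R, (s = 1 \/ s = -1) /\ exists M : R, forall x : R, M <= x ->
    same_side g0 p (RtoC (s * x)) /\ same_side g1 p (RtoC (s * x)).

Lemma chain_cauchy (poles : C -> Prop) (f : C -> C) :
  (forall p, poles p -> Rabs (Im p) <= Y /\ linked p) ->
  (forall z, ~ poles z -> an f z) ->
  (forall r, exists (ps : list C) (H : C -> C), (forall p, In p ps -> poles p) /\
     (forall z, Cmod z < r -> an H z) /\
     (forall z, Cmod z < r -> ~ poles z ->
        f z = (H z * Cprod (map (fun p => invp p z) ps))%C)) ->
  forall a b, a <= - R1 -> R1 <= b -> chain a b f = 0%C.
Proof.
  intros Hpoles Hf Hfac a b Ha Hb. assert (Hoff : forall p, poles p -> ~ on_chain (- R1) R1 p).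
  { intros p Hp; destruct (Hpoles p Hp) as [Hi [s [_ [M HM]]]]. destruct (HM M (Rle_refl _)) as [S0 S1].
    apply off_chain; [ lra | lra | auto | | ].
    - destruct (same_side_path _ _ _ S0) as [pth [_ [<- [_ H]]]]; auto.
    - destruct (same_side_path _ _ _ S1) as [pth [_ [<- [_ H]]]]; auto. }
  rewrite chain_extend; try assumption.
  2:{ intros z Hz; apply an_ccont, Hf; intros Hp; exact (Hoff z Hp Hz). }
  2:{ intros z Hz; apply Hf; intros Hp; destruct (Hpoles z Hp) as [Hi _].
      apply Rabs_le_between in Hi; unfold upper in Hz; lra. }
  2:{ intros z Hz; apply Hf; intros Hp; destruct (Hpoles z Hp) as [Hi _].
      apply Rabs_le_between in Hi; unfold lower in Hz; lra. }
  destruct (chain_bounded (- R1) R1 ltac:(lra)) as [r [Hr Hin]]. destruct (Hfac r) as [ps [H [Hps [HH E]]]].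
  set (U := fun z => Cmod (z - 0) < r). assert (HUin : forall z, U z <-> Cmod z < r).
  { intros z; unfold U; replace (z - 0)%C with z by ring; tauto. }
  rewrite (chain_ext _ _ f (fun z => H z * Cprod (map (fun p => invp p z) ps))%C); [ | lra | | ].
  2:{ intros z Hz; apply an_ccont, Hf; intros Hp; exact (Hoff z Hp Hz). }
  2:{ intros z Hz; apply E; [ apply Hin, Hz | intros Hp; exact (Hoff z Hp Hz) ]. }
  apply (partial_fractions (on_chain (- R1) R1) U (chain (- R1) R1) 0%C).
  - apply cvx_ball.
  - apply opn_ball.
  - apply HUin; rewrite Cmod_0; auto.
  - intros z Hz; apply HUin, Hin, Hz.
  - intros; apply chain_ext; (assumption || lra).
  - intros; apply chain_plus; (assumption || lra).
  - intros; apply chain_scal; (assumption || lra).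
  - intros f' F Hf' HF; apply (chain_prim _ _ f' F); (assumption || lra).
  - intros p Hp; split; [ apply Hoff, Hps, Hp | intros _ ].
    (* Far enough to be linked with [p], and outside the disc [U] that contains the chain; there
       [invp (s * x)] has a primitive on [U]. *)
    destruct (Hpoles p (Hps p Hp)) as [Hi [s [Hs [M HM]]]]. set (x := Rabs M + r).
    destruct (HM x) as [S0 S1]; [ unfold x; generalize (Rle_abs M); lra | ]. assert (PM := Rabs_pos M).
    assert (Hxr : r <= Cmod (RtoC (s * x))). { rewrite Cmod_R, Rabs_mult, (Rabs_pos_eq x) by (unfold x; lra).
      replace (Rabs s) with 1; [ unfold x; lra | ].
      destruct Hs as [-> | ->]; [ rewrite Rabs_R1 | rewrite Rabs_left by lra ]; lra. }
    assert (Nend : forall g, same_side g p (RtoC (s * x)) -> forall t, g t <> RtoC (s * x)).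
    { intros g Hg; destruct (same_side_path _ _ _ Hg) as [pth [_ [_ [<- Hq]]]]; auto. }
    apply (chain_winding p (RtoC (s * x))); try assumption; [ reflexivity | | apply Nend, S0 | apply Nend, S1 ].
    assert (HUan : forall z, U z -> an (invp (RtoC (s * x))) z).
    { intros z Hz; apply an_invp; intros Ez; rewrite Ez in Hz.
      exact (Rle_not_lt _ _ Hxr (proj1 (HUin _) Hz)). }
    assert (U0 : U 0%C) by (apply HUin; rewrite Cmod_0; auto).
    apply (chain_prim _ _ _ (prim (invp (RtoC (s * x))) 0)); [ lra | | ].
    + intros z Hz; apply an_ccont, HUan, HUin, Hin, Hz.
    + intros z Hz; apply (prim_cder U); auto; [ apply cvx_ball | apply opn_ball | apply HUin, Hin, Hz ].
  - intros z Hz; apply HH, HUin, Hz.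
Qed.

End Chain.

(** * Integrals over the real line *)

Definition gen_int (h : R -> C) (v : C) : Prop :=
  forall eps, 0 < eps -> exists R0, forall a b, a <= - R0 -> R0 <= b ->
    exists w, is_CI h a b w /\ Cmod (w - v) < eps.

Lemma gen_int_iff (h : R -> C) (v : C) :
  is_RInt_gen (V := C_R_NormedModule) h (Rbar_locally m_infty) (Rbar_locally p_infty) v
  <-> gen_int h v.
Proof.
  split.
  - intros H eps He. assert (HP : locally (T := C_R_NormedModule) v (fun y => Cmod (y - v) < eps)).
    { apply locally_Cmod; exists eps; auto. } destruct (H _ HP) as [Q S [M1 HQ] [M2 HS] HQS].
    exists (Rabs M1 + Rabs M2 + 1); intros a b Ha Hb.
    generalize (Rle_abs (- M1)), (Rle_abs M2), (Rabs_pos M1), (Rabs_pos M2); rewrite Rabs_Ropp; intros.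
    destruct (HQS a b) as [w [Hw1 Hw2]]; [ apply HQ; lra | apply HS; lra | ]. exists w; split; auto.
  - intros H P HP; apply locally_Cmod in HP; destruct HP as [d [Hd HP]]. destruct (H d Hd) as [R0 HR].
    apply (Filter_prod _ _ _ (fun a => a < - R0) (fun b => R0 < b)).
    + exists (- R0); auto.
    + exists R0; auto.
    + intros a b Ha Hb; destruct (HR a b) as [w [Hw1 Hw2]]; [ lra | lra | ].
      exists w; split; [ exact Hw1 | apply HP, Hw2 ].
Qed.

Lemma gen_int_unique (h : R -> C) (v w : C) : gen_int h v -> gen_int h w -> v = w.
Proof.
  intros Hv Hw; apply Cmod_lt_eq; intros eps He.
  destruct (Hv (eps / 2)) as [R1 H1]; [ lra | ]. destruct (Hw (eps / 2)) as [R2 H2]; [ lra | ].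
  assert (M1 := Rmax_l R1 R2). assert (M2 := Rmax_r R1 R2). set (R0 := Rmax R1 R2) in *.
  destruct (H1 (- R0) R0) as [x [X1 X2]]; [ lra | lra | ].
  destruct (H2 (- R0) R0) as [y [Y1 Y2]]; [ lra | lra | ]. rewrite (is_CI_unique _ _ _ _ _ Y1 X1) in Y2.
  generalize (Cmod_dist_triangle v x w); rewrite (Cmod_minus_sym v x); lra.
Qed.

Lemma gen_int_ext (h k : R -> C) (v : C) : (forall t, h t = k t) -> gen_int h v -> gen_int k v.
Proof.
  intros E H eps He; destruct (H eps He) as [R0 HR]; exists R0; intros a b Ha Hb.
  destruct (HR a b Ha Hb) as [w [W1 W2]]; exists w; split; [ | auto ]. eapply is_CI_ext_all; eassumption.
Qed.

Lemma gen_int_scal (c : C) (h : R -> C) (v : C) :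
  gen_int h v -> gen_int (fun t => c * h t)%C (c * v)%C.
Proof.
  intros H eps He; destruct (scal_eps c eps He) as [e [He' Ke]]; destruct (H e He') as [R0 HR].
  exists R0; intros a b Ha Hb; destruct (HR a b Ha Hb) as [w [W1 W2]].
  exists (c * w)%C; split; [ apply is_CI_scal, W1 | auto ].
Qed.

Lemma gen_int_plus (h k : R -> C) (v w : C) :
  gen_int h v -> gen_int k w -> gen_int (fun t => h t + k t)%C (v + w)%C.
Proof.
  intros H1 H2 eps He.
  destruct (H1 (eps / 2)) as [R1 K1]; [ lra | ]. destruct (H2 (eps / 2)) as [R2 K2]; [ lra | ].
  exists (Rmax R1 R2); intros a b Ha Hb.
  assert (R1 <= Rmax R1 R2) by apply Rmax_l. assert (R2 <= Rmax R1 R2) by apply Rmax_r.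
  destruct (K1 a b) as [x [X1 X2]]; [ lra | lra | ]. destruct (K2 a b) as [y [Y1 Y2]]; [ lra | lra | ].
  exists (x + y)%C; split; [ apply is_CI_plus; auto | ].
  replace (x + y - (v + w))%C with ((x - v) + (y - w))%C by ring. lt_via Cmod_triangle; lra.
Qed.

Lemma pwc_bounded (g : R -> C) (a b : R) : a <= b -> pwc g ->
  exists M, 0 < M /\ forall u, a <= u <= b -> Cmod (g u) <= M.
Proof.
  intros Hab [L [R0 _]]; apply loc_bounded; intros u _.
  destruct (L u) as [v Hv], (R0 u) as [w Hw]; exists (Cmod v + Cmod w + Cmod (g u) + 1).
  destruct (Hv 1 Rlt_0_1) as [d1 [Hd1 K1]]. destruct (Hw 1 Rlt_0_1) as [d2 [Hd2 K2]].
  exists (Rmin d1 d2); split; [ pos | intros x Hx ].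
  generalize (Rmin_l d1 d2) (Rmin_r d1 d2) (Cmod_ge_0 v) (Cmod_ge_0 w) (Cmod_ge_0 (g u)); intros.
  apply Rabs_def2 in Hx; destruct (Rtotal_order x u) as [H'|[->|H']]; [ | lra | ].
  - specialize (K1 x ltac:(lra)); generalize (Cmod_minus_ge (g x) v); lra.
  - specialize (K2 x ltac:(lra)); generalize (Cmod_minus_ge (g x) w); lra.
Qed.

Definition good (h : R -> C) : Prop :=
  pwc h /\ exists D, forall t, Cmod (h t) <= D * exp (- Rabs t).

Lemma is_RInt_exp (D s a b : R) : s <> 0 ->
  is_RInt (fun t => D * exp (s * t)) a b (D / s * (exp (s * b) - exp (s * a))).
Proof.
  intros Hs; replace (D / s * (exp (s * b) - exp (s * a))) with
    (minus (D / s * exp (s * b)) (D / s * exp (s * a))) by (unfold minus, plus, opp; simpl; ring).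
  apply (is_RInt_derive (V := R_CompleteNormedModule) (fun t => D / s * exp (s * t))).
  - intros t _; auto_derive; [ trivial | field; auto ].
  - intros t _; apply (ex_derive_continuous (fun t => D * exp (s * t))); auto_derive; trivial.
Qed.

Lemma tail_right (h : R -> C) (D b b' : R) : pwc h ->
  (forall t, Cmod (h t) <= D * exp (- Rabs t)) -> 0 <= b -> b <= b' ->
  Cmod (CI h b b') <= D * exp (- b).
Proof.
  intros Hh HD Hb Hb'. assert (PD : 0 <= D).
  { specialize (HD 0); rewrite Rabs_R0, Ropp_0, exp_0 in HD; generalize (Cmod_ge_0 (h 0)); lra. }
  apply Rle_trans with (D / -1 * (exp (-1 * b') - exp (-1 * b))).
  - apply (is_CI_Cmod_le h (fun t => D * exp (-1 * t)) b b'); try assumption;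
      [ | apply CI_pwc, Hh | apply is_RInt_exp; lra ].
    intros t Ht; le_via HD. rewrite Rabs_pos_eq by lra; right; do 2 f_equal; ring.
  - replace (-1 * b) with (- b) by ring.
    assert (0 < exp (-1 * b')) by pos. unfold Rdiv; replace (/ -1) with (-1) by field; nra.
Qed.

Lemma tail_left (h : R -> C) (D a a' : R) : pwc h ->
  (forall t, Cmod (h t) <= D * exp (- Rabs t)) -> a <= 0 -> a' <= a ->
  Cmod (CI h a' a) <= D * exp a.
Proof.
  intros Hh HD Ha Ha'. assert (PD : 0 <= D).
  { specialize (HD 0); rewrite Rabs_R0, Ropp_0, exp_0 in HD; generalize (Cmod_ge_0 (h 0)); lra. }
  apply Rle_trans with (D / 1 * (exp (1 * a) - exp (1 * a'))).
  - apply (is_CI_Cmod_le h (fun t => D * exp (1 * t)) a' a); try assumption;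
      [ | apply CI_pwc, Hh | apply is_RInt_exp; lra ].
    intros t Ht; le_via HD.
    right; do 2 f_equal; unfold Rabs; destruct Rcase_abs; [ ring | replace t with 0 by lra; ring ].
  - replace (1 * a) with a by ring. assert (0 < exp (1 * a')) by pos. unfold Rdiv; rewrite Rinv_1; nra.
Qed.

Lemma exp_small (D eps : R) : 0 < eps -> exists R0, 0 <= R0 /\ forall t, R0 <= t -> D * exp (- t) < eps.
Proof.
  intros He; exists (Rabs D / eps); split. { pos. } intros t Ht. assert (P := exp_pos t). rewrite exp_Ropp.
  apply Rle_lt_trans with (Rabs D * / exp t). { apply Rmult_le_compat_r; [ pos | apply Rle_abs ]. }
  apply (Rmult_lt_reg_r (exp t)); [ auto | rewrite Rmult_assoc, Rinv_l, Rmult_1_r by lra ].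
  apply (Rmult_le_compat_l eps) in Ht; [ | lra ].
  replace (eps * (Rabs D / eps)) with (Rabs D) in Ht by (field; lra).
  assert (1 + t <= exp t) by apply exp_ge_1_plus. nra.
Qed.

Lemma good_gen_int (h : R -> C) : good h -> exists v, gen_int h v.
Proof.
  intros [Hh [D HD]]. destruct (cvg_cauchy (fun n => CI h (- INR n) (INR n))) as [v Hv].
  { intros eps He; destruct (exp_small D (eps / 2)) as [R0 [P0 HR]]; [ lra | ].
    destruct (INR_unbounded R0) as [N HN]. assert (K : forall n n', (N <= n)%nat -> (n <= n')%nat ->
      Cmod (CI h (- INR n) (INR n) - CI h (- INR n') (INR n')) < eps).
    { intros n n' Hn Hn'.
      assert (L1 : INR N <= INR n) by (apply le_INR, Hn). assert (L2 : INR n <= INR n') by (apply le_INR, Hn').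
      replace (CI h (- INR n') (INR n')) with
        (CI h (- INR n') (- INR n) + (CI h (- INR n) (INR n) + CI h (INR n) (INR n')))%C.
      - replace (CI h (- INR n) (INR n) -
          (CI h (- INR n') (- INR n) + (CI h (- INR n) (INR n) + CI h (INR n) (INR n'))))%C with
          (- (CI h (- INR n') (- INR n) + CI h (INR n) (INR n')))%C by ring.
        rewrite Cmod_opp; lt_via Cmod_triangle.
        assert (T1 := tail_right h D (INR n) (INR n') Hh HD ltac:(lra) ltac:(lra)).
        assert (T2 := tail_left h D (- INR n) (- INR n') Hh HD ltac:(lra) ltac:(lra)).
        specialize (HR (INR n) ltac:(lra)); lra.
      - symmetry; apply CI_eq. apply is_CI_Chasles with (- INR n); [ apply CI_pwc, Hh | ].
        apply is_CI_Chasles with (INR n); apply CI_pwc, Hh. }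
    exists N; intros n n' Hn Hn'; destruct (Nat.le_ge_cases n n').
    - auto.
    - rewrite Cmod_minus_sym; apply K; auto. }
  exists v; intros eps He. destruct (exp_small D (eps / 4)) as [R0 [P0 HR]]; [ lra | ].
  exists R0; intros a b Ha Hb; exists (CI h a b); split; [ apply CI_pwc, Hh | ].
  destruct (Hv (eps / 2)) as [N HN]; [ lra | ]. destruct (INR_unbounded (Rabs a + Rabs b + INR N)) as [n Hn].
  assert (PN := pos_INR N).
  generalize (Rle_abs (- a)), (Rle_abs b), (Rabs_pos a), (Rabs_pos b); rewrite Rabs_Ropp; intros.
  specialize (HN n ltac:(apply INR_le; lra)); cbv beta in HN. replace (CI h (- INR n) (INR n)) with
    (CI h (- INR n) a + (CI h a b + CI h b (INR n)))%C in HN.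
  - replace (CI h a b - v)%C with
      (CI h (- INR n) a + (CI h a b + CI h b (INR n)) - v - (CI h (- INR n) a + CI h b (INR n)))%C by ring.
    lt_via Cmod_triangle_minus. assert (T1 := tail_right h D b (INR n) Hh HD ltac:(lra) ltac:(lra)).
    assert (T2 := tail_left h D a (- INR n) Hh HD ltac:(lra) ltac:(lra)).
    assert (E1 := HR b ltac:(lra)). assert (E2 := HR (- a) ltac:(lra)). rewrite Ropp_involutive in E2.
    generalize (Cmod_triangle (CI h (- INR n) a) (CI h b (INR n))); lra.
  - symmetry; apply CI_eq. apply is_CI_Chasles with a; [ apply CI_pwc, Hh | ].
    apply is_CI_Chasles with b; apply CI_pwc, Hh.
Qed.

Lemma gen_int_bound (h : R -> C) (D : R) (v : C) : pwc h ->
  (forall t, Cmod (h t) <= D * exp (- Rabs t)) -> gen_int h v -> Cmod v <= 2 * D.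
Proof.
  intros Hh HD Hv; apply le_epsilon; intros eps He. destruct (Hv eps He) as [R0 HR].
  destruct (HR (- Rabs R0) (Rabs R0)) as [w [W1 W2]]; [ generalize (Rle_abs R0); lra | apply Rle_abs | ].
  assert (P := Rabs_pos R0). assert (E : w = (CI h (- Rabs R0) 0 + CI h 0 (Rabs R0))%C).
  { apply (is_CI_unique _ _ _ _ _ W1), is_CI_Chasles with 0; apply CI_pwc, Hh. }
  assert (T1 := tail_right h D 0 (Rabs R0) Hh HD ltac:(lra) ltac:(lra)).
  assert (T2 := tail_left h D 0 (- Rabs R0) Hh HD ltac:(lra) ltac:(lra)).
  rewrite Ropp_0, exp_0 in T1; rewrite exp_0 in T2.
  assert (Cmod w <= 2 * D) by (rewrite E; le_via Cmod_triangle; lra).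
  generalize (Cmod_minus_ge v w); rewrite Cmod_minus_sym; lra.
Qed.

(** * Contours *)

Lemma filterlim_left (g : R -> C) (t : R) (v : C) :
  filterlim g (at_left t) (locally (T := C_R_NormedModule) v) -> llim g t v.
Proof.
  intros H eps He; apply (proj2 (tends_filterlim _ g v)) in H; destruct (H eps He) as [d Hd]; exists d; split; [ apply cond_pos | intros u Hu ].
  apply Hd; [ apply Rabs_def1; unfold minus, plus, opp; simpl; lra | lra ].
Qed.

Lemma filterlim_right (g : R -> C) (t : R) (v : C) :
  filterlim g (at_right t) (locally (T := C_R_NormedModule) v) -> rlim g t v.
Proof.
  intros H eps He; apply (proj2 (tends_filterlim _ g v)) in H; destruct (H eps He) as [d Hd]; exists d; split; [ apply cond_pos | intros u Hu ].
  apply Hd; [ apply Rabs_def1; unfold minus, plus, opp; simpl; lra | lra ].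
Qed.

Lemma smooth_curve (g : R -> C) : piecewise_smooth g -> curve g (velocity g).
Proof.
  intros [Hc [l [H1 H2]]]. assert (Hv : forall t, ~ In t l -> rcont (velocity g) t).
  { intros t Ht; apply rcont_continuous, (H1 t Ht). } split; [ | split ].
  - intros t; apply rcont_continuous, Hc.
  - split; [ | split; [ | exists l; auto ] ]; intros t; destruct (classic (In t l)) as [Ht|Ht].
    + destruct (H2 t Ht) as [vl [vr [_ [_ [L _]]]]]; exists vl; apply filterlim_left, L.
    + eexists; apply rcont_llim, Hv, Ht.
    + destruct (H2 t Ht) as [vl [vr [_ [_ [_ L]]]]]; exists vr; apply filterlim_right, L.
    + eexists; apply rcont_rlim, Hv, Ht.
  - exists l; intros t Ht; destruct (H1 t Ht) as [D1 [D2 _]]; split; apply Derive_correct; auto.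
Qed.

Lemma velocity_dR (g : R -> C) (t : R) (v : C) : dR g t v -> velocity g t = v.
Proof.
  intros [H1 H2]; unfold velocity; apply C_ext; [ rewrite Re_pair | rewrite Im_pair ];
    apply is_derive_unique; auto.
Qed.

Lemma Cexp_Ci (th : R) : Cexp (Ci * RtoC th) = (cos th, sin th).
Proof.
  unfold Cexp; autorewrite with ReIm.
  replace (0 * th - 1 * 0) with 0 by ring; replace (0 * 0 + 1 * th) with th by ring. rewrite exp_0; ring.
Qed.

Section Standard.

Variables (sigma T thm thp : R).
Hypotheses (HT : 0 < T) (Hthm : sin thm < 0) (Hthp : 0 < sin thp).

(** One formula for the three pieces: [clamp] and [Rmax] are Lipschitz, so continuity at the corners
    requires no gluing. *)
Definition std (t : R) : C :=
  (RtoC sigma + RtoC (clamp (- T) T t) * Ci + RtoC (Rmax 0 (t - T)) * Cexp (Ci * RtoC thp)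
   + RtoC (Rmax 0 (- T - t)) * Cexp (Ci * RtoC thm))%C.

Lemma std_mid (t : R) : - T <= t <= T -> std t = (RtoC sigma + RtoC t * Ci)%C.
Proof.
  intros Ht; unfold std; rewrite clamp_id, !Rmax_left by lra; ring.
Qed.

Lemma std_right (t : R) : T <= t ->
  std t = (RtoC sigma + RtoC T * Ci + RtoC (t - T) * Cexp (Ci * RtoC thp))%C.
Proof.
  intros Ht; unfold std, clamp; rewrite (Rmin_left T t), (Rmax_right (- T) T), (Rmax_right 0 (t - T)),
    (Rmax_left 0 (- T - t)) by lra; ring.
Qed.

Lemma std_left (t : R) : t <= - T ->
  std t = (RtoC sigma - RtoC T * Ci + RtoC (- T - t) * Cexp (Ci * RtoC thm))%C.
Proof.
  intros Ht; unfold std, clamp; rewrite (Rmin_right T t), (Rmax_left (- T) t), (Rmax_left 0 (t - T)),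
    (Rmax_right 0 (- T - t)), RtoC_opp by lra; ring.
Qed.

Lemma Re_std_mid (t : R) : - T <= t <= T -> Re (std t) = sigma.
Proof. intros Ht; rewrite std_mid by auto; autorewrite with ReIm; ring. Qed.

Lemma Im_std_mid (t : R) : - T <= t <= T -> Im (std t) = t.
Proof. intros Ht; rewrite std_mid by auto; autorewrite with ReIm; ring. Qed.

Lemma Im_std_right (t : R) : T <= t -> Im (std t) = T + (t - T) * sin thp.
Proof. intros Ht; rewrite std_right, Cexp_Ci by auto; autorewrite with ReIm; ring. Qed.

Lemma Im_std_left (t : R) : t <= - T -> Im (std t) = - T + (- T - t) * sin thm.
Proof. intros Ht; rewrite std_left, Cexp_Ci by auto; autorewrite with ReIm; ring. Qed.

(** The increasing imaginary part makes the curve simple and confines its part in the strip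
    [|Im| < T] to the vertical segment. *)
Lemma Im_std_incr (t t' : R) : t < t' -> Im (std t) < Im (std t').
Proof.
  intros H. assert (F1 : 0 < (t' - t) * sin thp) by pos. assert (F2 : 0 < (t' - t) * (- sin thm)) by pos.
  assert (F3 : t <= - T -> 0 <= (- T - t) * (- sin thm)) by (intros; pos).
  assert (F5 : T < t' -> 0 < (t' - T) * sin thp) by (intros; pos).
  destruct (Rle_dec t (- T)) as [A|A]; [ rewrite (Im_std_left t) by lra
    | destruct (Rle_dec t T) as [A'|A']; [ rewrite (Im_std_mid t) by lra | rewrite (Im_std_right t) by lra ] ];
  (destruct (Rle_dec t' (- T)) as [B|B]; [ rewrite (Im_std_left t') by lra
    | destruct (Rle_dec t' T) as [B'|B']; [ rewrite (Im_std_mid t') by lra | rewrite (Im_std_right t') by lra ] ]);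
  try specialize (F3 A); try specialize (F5 ltac:(lra)); lra.
Qed.

Lemma std_inside (t : R) : - T < Im (std t) < T -> - T < t < T.
Proof.
  intros H; assert (E1 := Im_std_mid T ltac:(lra)). assert (E2 := Im_std_mid (- T) ltac:(lra)).
  split; apply Rnot_le_lt; intros Ht.
  - destruct Ht as [Ht|Ht]; [ apply Im_std_incr in Ht | rewrite Ht in H ]; lra.
  - destruct Ht as [Ht|Ht]; [ apply Im_std_incr in Ht | rewrite <- Ht in H ]; lra.
Qed.

Lemma rcont_std (t : R) : rcont std t.
Proof.
  assert (K : forall (f : R -> R), (forall u w, Rabs (f u - f w) <= Rabs (u - w)) -> forall t,
    rcont (fun u => RtoC (f u)) t).
  { intros f Hf u eps He; exists eps; split; [ auto | intros w Hw ].
    rewrite <- RtoC_minus, Cmod_R; lt_via Hf; auto. }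
  unfold std; repeat apply rcont_plus; try apply rcont_mult; try apply rcont_const; apply K;
    intros u w; unfold clamp, Rmax, Rmin; repeat destruct Rle_dec; unfold Rabs; repeat destruct Rcase_abs; lra.
Qed.

Lemma dR_ext_loc (F G : R -> C) (t d : R) (v : C) : 0 < d ->
  (forall u, Rabs (u - t) < d -> F u = G u) -> dR F t v -> dR G t v.
Proof.
  intros Hd E; rewrite !dR_eps; intros H eps He; destruct (H eps He) as [d' [Hd' K]].
  exists (Rmin d d'); split; [ pos | intros h Hh ]. rewrite <- !E.
  - apply K; eapply Rlt_le_trans; [ apply Hh | apply Rmin_r ].
  - replace (t - t) with 0 by ring; rewrite Rabs_R0; auto.
  - eapply Rlt_le_trans; [ apply Hh | apply Rmin_l ].
Qed.

Lemma dR_std_mid (t : R) : - T < t < T -> dR std t Ci.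
Proof.
  intros Ht; apply (dR_ext_loc (fun u => RtoC sigma + RtoC u * Ci)%C _ _ (Rmin (t + T) (T - t))).
  - pos.
  - intros u Hu; generalize (Rmin_l (t + T) (T - t)), (Rmin_r (t + T) (T - t)); intros.
    apply Rabs_def2 in Hu; symmetry; apply std_mid; lra.
  - apply dR_line.
Qed.

Lemma dR_std_right (t : R) : T < t -> dR std t (Cexp (Ci * RtoC thp)).
Proof.
  intros Ht; apply (dR_ext_loc (fun u => (RtoC sigma + RtoC T * Ci - RtoC T * Cexp (Ci * RtoC thp))
    + RtoC u * Cexp (Ci * RtoC thp))%C _ _ (t - T)); [ lra | | apply dR_line ].
  intros u Hu; apply Rabs_def2 in Hu; rewrite std_right, RtoC_minus by lra; ring.
Qed.

Lemma dR_std_left (t : R) : t < - T -> dR std t (- Cexp (Ci * RtoC thm))%C.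
Proof.
  intros Ht; apply (dR_ext_loc (fun u => (RtoC sigma - RtoC T * Ci - RtoC T * Cexp (Ci * RtoC thm))
    + RtoC u * (- Cexp (Ci * RtoC thm)))%C _ _ (- T - t)); [ lra | | apply dR_line ].
  intros u Hu; apply Rabs_def2 in Hu; rewrite std_left, !RtoC_minus, RtoC_opp by lra; ring.
Qed.

Lemma velocity_std_mid (t : R) : - T < t < T -> velocity std t = Ci.
Proof. intros; apply velocity_dR, dR_std_mid; auto. Qed.
Lemma velocity_std_right (t : R) : T < t -> velocity std t = Cexp (Ci * RtoC thp).
Proof. intros; apply velocity_dR, dR_std_right; auto. Qed.
Lemma velocity_std_left (t : R) : t < - T -> velocity std t = (- Cexp (Ci * RtoC thm))%C.
Proof. intros; apply velocity_dR, dR_std_left; auto. Qed.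

Lemma filterlim_const_near (g : R -> C) (v : C) (F : (R -> Prop) -> Prop) :
  Filter F -> F (fun u => g u = v) -> filterlim g F (locally (T := C_R_NormedModule) v).
Proof.
  intros FF H P HP; apply (filter_imp (F := F) (fun u => g u = v) (fun u => P (g u))); [ | auto ].
  intros u ->; apply locally_singleton, HP.
Qed.

Lemma std_smooth : piecewise_smooth std.
Proof.
  assert (NCi : Ci <> 0%C) by (intros E; apply (f_equal Im) in E; simpl in E; lra).
  assert (Nopp : (- Cexp (Ci * RtoC thm))%C <> 0%C). { intros E; apply (Cexp_neq_0 (Ci * RtoC thm)).
    replace (Cexp (Ci * RtoC thm)) with (- - Cexp (Ci * RtoC thm))%C by ring; rewrite E; ring. }
  split; [ intros t; apply rcont_continuous, rcont_std | ]. exists [- T; T]; split.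
  - assert (K : forall (t d : R) (v : C), 0 < d -> v <> RtoC 0 -> (forall u, Rabs (u - t) < d -> dR std u v) ->
      ex_derive (fun u => Re (std u)) t /\ ex_derive (fun u => Im (std u)) t /\
      continuous (U := C_R_NormedModule) (velocity std) t /\ velocity std t <> RtoC 0).
    { intros t d v Hd Hv H.
      assert (H0 : dR std t v) by (apply H; replace (t - t) with 0 by ring; rewrite Rabs_R0; auto).
      split; [ exists (Re v); exact (proj1 H0) | split; [ exists (Im v); exact (proj2 H0) | split ] ].
      - apply rcont_continuous; intros eps He; exists d; split; [ auto | intros u Hu ].
        rewrite (velocity_dR _ _ _ H0), (velocity_dR _ _ _ (H u Hu)).
        replace (v - v)%C with (RtoC 0) by ring; rewrite Cmod_0; auto.
      - rewrite (velocity_dR _ _ _ H0); exact Hv. }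
    intros t Ht; simpl in Ht. destruct (Rlt_dec t (- T)) as [A|A]; [ | destruct (Rlt_dec t T) as [B|B] ].
    + apply (K t (- T - t) (- Cexp (Ci * RtoC thm))%C); [ lra | auto | ].
      intros u Hu; apply Rabs_def2 in Hu; apply dR_std_left; lra.
    + apply (K t (Rmin (t + T) (T - t)) Ci); [ pos | auto | ]. intros u Hu; apply Rabs_def2 in Hu.
      generalize (Rmin_l (t + T) (T - t)), (Rmin_r (t + T) (T - t)); intros. apply dR_std_mid; lra.
    + apply (K t (t - T) (Cexp (Ci * RtoC thp))); [ lra | apply Cexp_neq_0 | ].
      intros u Hu; apply Rabs_def2 in Hu; apply dR_std_right; lra.
  - assert (P1 : 0 < 2 * T) by lra. intros t [<-|[<-|[]]].
    + exists (- Cexp (Ci * RtoC thm))%C, Ci; repeat split; try assumption.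
      * apply filterlim_const_near; [ apply at_left_proper_filter | ].
        exists (mkposreal 1 Rlt_0_1); intros u _ Hu; apply velocity_std_left, Hu.
      * apply filterlim_const_near; [ apply at_right_proper_filter | ].
        exists (mkposreal _ P1); intros u Hu Hu2; apply velocity_std_mid.
        apply Rabs_def2 in Hu; unfold minus, plus, opp in Hu; simpl in Hu; lra.
    + exists Ci, (Cexp (Ci * RtoC thp)); repeat split; try assumption; try apply Cexp_neq_0.
      * apply filterlim_const_near; [ apply at_left_proper_filter | ].
        exists (mkposreal _ P1); intros u Hu Hu2; apply velocity_std_mid.
        apply Rabs_def2 in Hu; unfold minus, plus, opp in Hu; simpl in Hu; lra.
      * apply filterlim_const_near; [ apply at_right_proper_filter | ].
        exists (mkposreal 1 Rlt_0_1); intros u _ Hu; apply velocity_std_right, Hu.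
Qed.

(** Inside the strip the contour is the line [Re = sigma], so a pole is joined to the real points on
    its side by straight segments. The sign [k] in [Side] treats both sides at once. *)
Lemma std_is_contour (Lp Lm : C -> Prop) :
  (forall s, Lp s -> sigma < Re s /\ Rabs (Im s) < T) ->
  (forall s, Lm s -> Re s < sigma /\ Rabs (Im s) < T) ->
  is_contour thm thp Lp Lm std.
Proof.
  intros HLp HLm. assert (Off : forall s, Rabs (Im s) < T -> Re s <> sigma -> forall t, s <> std t).
  { intros s Hs Hr t ->; apply Hr, Re_std_mid.
    apply Rabs_def2 in Hs; assert (H := std_inside t ltac:(lra)); lra. }
  assert (Side : forall s x (k : R), (k = 1 \/ k = -1) -> 0 < k * (Re s - sigma) -> 0 < k * (x - sigma) ->
    Rabs (Im s) < T -> same_side std s (RtoC x)).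
  { intros s x k Hk Hs Hx Hi. exists (fun u => s + RtoC u * (RtoC x - s))%C; split; [ | split; [ | split ] ].
    - intros u; apply rcont_continuous, rcont_line.
    - ring.
    - ring.
    - intros u t Hu; apply Off.
      + autorewrite with ReIm; apply Rabs_def2 in Hi; apply Rabs_def1; nra.
      + autorewrite with ReIm; intros E.
        assert (E' : (1 - u) * (k * (Re s - sigma)) + u * (k * (x - sigma)) = 0). { nra. }
        assert (0 <= (1 - u) * (k * (Re s - sigma))) by pos. assert (0 < u * (k * (x - sigma))) by pos. lra. }
  split.
  - intros t t' E; destruct (Rtotal_order t t') as [H|[H|H]]; [ | auto | ];
      apply Im_std_incr in H; rewrite E in H; lra.
  - apply std_smooth.
  - exists T, (RtoC sigma - RtoC T * Ci - RtoC T * Cexp (Ci * RtoC thm))%C,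
      (RtoC sigma + RtoC T * Ci - RtoC T * Cexp (Ci * RtoC thp))%C; split; intros t Ht.
    + rewrite std_left, RtoC_minus, !RtoC_opp by auto; ring.
    + rewrite std_right, RtoC_minus by auto; ring.
  - intros t; split; intros H.
    + destruct (HLp _ H) as [H1 H2]; apply (Off _ H2) with t; [ lra | reflexivity ].
    + destruct (HLm _ H) as [H1 H2]; apply (Off _ H2) with t; [ lra | reflexivity ].
  - intros s Hs; destruct (HLp s Hs) as [H1 H2]; exists (sigma + 1); intros x Hx.
    apply (Side s x 1); (assumption || lra).
  - intros s Hs; destruct (HLm s Hs) as [H1 H2]; exists (1 - sigma); intros x Hx.
    apply (Side s (- x) (-1)); (assumption || lra).
Qed.

End Standard.

(** * The kernel as a meromorphic function *)

(** The shape required by [partial_fractions]: on a disc, an analytic function over finitely many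
    linear factors, the list [ps] repeating multiple poles. *)
Definition mero (P : C -> Prop) (r : R) (f : C -> C) : Prop :=
  exists (ps : list C) (H : C -> C), (forall p, In p ps -> P p) /\
    (forall z, Cmod z < r -> an H z) /\
    (forall z, Cmod z < r -> ~ P z -> f z = (H z * Cprod (map (fun p => invp p z) ps))%C).

Lemma mero_an (P : C -> Prop) (r : R) (f : C -> C) : (forall z, an f z) -> mero P r f.
Proof.
  intros Hf; exists nil, f; split; [ intros p [] | split; [ auto | intros; simpl; ring ] ].
Qed.

Lemma mero_mult (P : C -> Prop) (r : R) (f g : C -> C) :
  mero P r f -> mero P r g -> mero P r (fun z => f z * g z)%C.
Proof.
  intros [pf [Hf [F1 [F2 F3]]]] [pg [Hg [G1 [G2 G3]]]].
  exists (pf ++ pg), (fun z => Hf z * Hg z)%C; split; [ | split ].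
  - intros p Hp; apply in_app_or in Hp; destruct Hp; auto.
  - intros z Hz; apply an_mult; auto.
  - intros z Hz Hp; rewrite F3, G3, map_app, Cprod_app by auto; ring.
Qed.

Lemma mero_Cprod {A : Type} (P : C -> Prop) (r : R) (f : A -> C -> C) (l : list A) :
  (forall x, In x l -> mero P r (f x)) -> mero P r (fun z => Cprod (map (fun x => f x z) l)).
Proof.
  induction l as [|x l IH]; intros H.
  - exists nil, (fun _ => 1%C); split; [ intros p [] | split ].
    + intros; apply an_const.
    + intros; simpl; ring.
  - apply (mero_mult P r (f x) (fun z => Cprod (map (fun x => f x z) l))).
    + apply H; left; reflexivity.
    + apply IH; intros; apply H; right; auto.
Qed.

Lemma mero_ext (P : C -> Prop) (r : R) (f g : C -> C) : (forall z, f z = g z) -> mero P r f -> mero P r g.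
Proof.
  intros E [ps [H [H1 [H2 H3]]]]; exists ps, H; split; [ | split ]; auto. intros; rewrite <- E; auto.
Qed.

Lemma Cinv_Cprod {A : Type} (f : A -> C) (l : list A) :
  (/ Cprod (map f l))%C = Cprod (map (fun x => / f x)%C l).
Proof.
  induction l as [|x l IH]; simpl; [ field | rewrite Cinv_mult, IH; reflexivity ].
Qed.

Definition poles (tau : R) (m n : nat) (a b : list C) (s : C) : Prop :=
  Lambda_plus tau n a s \/ Lambda_minus tau m b s.

Section KernelMero.

Variables (tau c1 c2 : R) (G : C -> C).
Hypothesis Htau : 0 < tau.
Hypothesis HG : forall z : C,
  filterlim (barnes_partial tau c1 c2 z) eventually (locally (G z)).

Lemma G_minus_neq_0 (n : nat) (a : list C) (aj s : C) :
  In aj (skipn n a) -> ~ Lambda_plus tau n a s -> G (aj - s) <> 0%C.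
Proof.
  intros Ha Hs E; apply Hs. destruct (barnes_G_eq_0 tau c1 c2 G Htau HG _ E) as [[k l] Ekl].
  exists aj, k, l; split; [ auto | ].
  replace s with (aj - (aj - s))%C by ring; rewrite Ekl; unfold lat; simpl fst; simpl snd; ring.
Qed.

Lemma G_plus_neq_0 (m : nat) (b : list C) (bj s : C) :
  In bj (skipn m b) -> ~ Lambda_minus tau m b s -> G (RtoC (1 + tau) - bj + s) <> 0%C.
Proof.
  intros Hb Hs E; apply Hs. destruct (barnes_G_eq_0 tau c1 c2 G Htau HG _ E) as [[k l] Ekl].
  (* The shift by [1 + tau] raises both indices by one, which matches the range [l, k >= 1] in
     [Lambda_minus]. *)
  exists bj, (S k), (S l); repeat split; [ auto | lia | lia | ].
  replace s with (RtoC (1 + tau) - bj + s - RtoC (1 + tau) + bj)%C by ring.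
  rewrite Ekl; unfold lat; simpl fst; simpl snd; rewrite !S_INR.
  rewrite !RtoC_plus, !RtoC_mult, !RtoC_plus; ring.
Qed.

Lemma an_G_minus (c z : C) : an (fun s => G (c - s)%C) z.
Proof.
  apply (an_ext (fun s => G (- (1) * s + c))%C); [ intros; f_equal; ring | ].
  apply (an_affine G), (barnes_G_an tau c1 c2 G Htau HG).
Qed.

Lemma an_G_plus (c z : C) : an (fun s => G (c + s)%C) z.
Proof.
  apply (an_ext (fun s => G (1 * s + c))%C); [ intros; f_equal; ring | ].
  apply (an_affine G), (barnes_G_an tau c1 c2 G Htau HG).
Qed.

Lemma kernel_split (m n : nat) (a b : list C) (alpha s : C) :
  kernel G tau m n a b alpha s =
  (Cprod (map (fun bj => G (bj - s)) (firstn m b)) *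
   Cprod (map (fun aj => G (RtoC (1 + tau) - aj + s)) (firstn n a)) *
   (Cprod (map (fun bj => / G (RtoC (1 + tau) - bj + s)) (skipn m b)) *
    Cprod (map (fun aj => / G (aj - s)) (skipn n a))) *
   Cexp (RtoC PI * alpha * s ^ 2 / RtoC tau))%C.
Proof. unfold kernel, Cdiv; rewrite Cinv_mult, !Cinv_Cprod; ring. Qed.

Lemma an_gauss (alpha z : C) : an (fun s => Cexp (RtoC PI * alpha * s ^ 2 / RtoC tau))%C z.
Proof.
  apply an_Cexp; unfold Cdiv; apply an_mult; [ apply an_mult | apply an_const ];
    [ apply an_const | apply an_pow, an_id ].
Qed.

Lemma kernel_an (m n : nat) (a b : list C) (alpha s : C) : ~ poles tau m n a b s ->
  an (kernel G tau m n a b alpha) s.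
Proof.
  intros Hs. eapply an_ext; [ intros; symmetry; apply kernel_split | ].
  apply an_mult; [ apply an_mult; apply an_mult | apply an_gauss ].
  - apply (an_Cprod (fun bj s => G (bj - s)%C)); intros; apply an_G_minus.
  - apply (an_Cprod (fun aj s => G (RtoC (1 + tau) - aj + s)%C)); intros; apply an_G_plus.
  - apply (an_Cprod (fun bj s => / G (RtoC (1 + tau) - bj + s))%C); intros x Hx.
    apply (an_inv (fun s => G (RtoC (1 + tau) - x + s)%C)); [ | apply an_G_plus ].
    apply (G_plus_neq_0 m b); [ auto | intros H; apply Hs; right; auto ].
  - apply (an_Cprod (fun aj s => / G (aj - s))%C); intros x Hx.
    apply (an_inv (fun s => G (x - s)%C)); [ | apply an_G_minus ].
    apply (G_minus_neq_0 n a); [ auto | intros H; apply Hs; left; auto ].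
Qed.

(** [k] is the sign of the variable. As [k * k = 1], one has [c + k z + w = k (z + k (c + w))], so
    each linear factor of [G] gives one [invp] up to the constant [k]. *)
Lemma mero_inv_G (P : C -> Prop) (r : R) (k c : C) : k = 1%C \/ k = (- (1))%C ->
  (forall kl, P (- (k * (c + RtoC (lat tau kl))))%C) ->
  mero P r (fun z => / G (c + k * z))%C.
Proof.
  intros Hk HP. assert (Hkk : (k * k)%C = 1%C) by (destruct Hk as [-> | ->]; ring).
  assert (Hk1 : Cmod k = 1) by (destruct Hk as [-> | ->]; [ apply Cmod_1 | apply Cmod_m1 ]).
  destruct (barnes_factorization tau c1 c2 G Htau HG (Cmod c + r)) as [ks [E HE]].
  assert (Hin : forall z, Cmod z < r -> Cmod (c + k * z) < Cmod c + r).
  { intros z Hz; lt_via Cmod_triangle; rewrite Cmod_mult, Hk1; lra. }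
  exists (map (fun kl => - (k * (c + RtoC (lat tau kl))))%C ks),
    (fun z => Cprod (map (fun _ => k) ks) * / E (k * z + c))%C; split; [ | split ].
  - intros p Hp; apply in_map_iff in Hp; destruct Hp as [kl [<- _]]; apply HP.
  - intros z Hz; apply an_mult; [ apply an_const | ]. assert (Hz' := Hin z Hz); rewrite Cplus_comm in Hz'.
    apply (an_inv (fun z => E (k * z + c)%C)); [ apply HE, Hz' | apply (an_affine E), HE, Hz' ].
  - intros z Hz HPz; rewrite (proj2 (proj2 (HE _ (Hin z Hz)))), Cinv_mult, Cinv_Cprod.
    replace (k * z + c)%C with (c + k * z)%C by ring. rewrite map_map.
    transitivity (Cprod (map (fun _ => k) ks) *
      Cprod (map (fun kl => invp (- (k * (c + RtoC (lat tau kl)))) z) ks) * / E (c + k * z))%C; [ | ring ].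
    f_equal; rewrite <- Cprod_map_mult; f_equal; apply map_ext; intros kl.
    assert (N : (z - - (k * (c + RtoC (lat tau kl))))%C <> 0%C).
    { apply Cminus_neq_0; intros ->; apply HPz, HP. } assert (N2 : (c + k * z + RtoC (lat tau kl))%C <> 0%C).
    { intros E0; apply N. transitivity (k * k * z + k * (c + RtoC (lat tau kl)))%C; [ rewrite Hkk; ring | ].
      transitivity (k * (c + k * z + RtoC (lat tau kl)))%C; [ ring | rewrite E0; ring ]. }
    unfold invp.
    assert (E0 : (z - - (k * (c + RtoC (lat tau kl))))%C = (k * (c + k * z + RtoC (lat tau kl)))%C).
    { transitivity (k * k * z + k * (c + RtoC (lat tau kl)))%C; [ rewrite Hkk; ring | ring ]. }
    rewrite E0; field; split; [ auto | ]. intros E1; rewrite E1, Cmod_0 in Hk1; lra.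
Qed.

Lemma kernel_mero (m n : nat) (a b : list C) (alpha : C) (r : R) :
  mero (poles tau m n a b) r (kernel G tau m n a b alpha).
Proof.
  eapply mero_ext; [ intros; symmetry; apply kernel_split | ].
  apply mero_mult; [ apply mero_mult; apply mero_mult | apply mero_an; intros; apply an_gauss ].
  - apply mero_an; intros z; apply (an_Cprod (fun bj s => G (bj - s)%C)); intros; apply an_G_minus.
  - apply mero_an; intros z; apply (an_Cprod (fun aj s => G (RtoC (1 + tau) - aj + s)%C)); intros; apply an_G_plus.
  - apply (mero_Cprod _ _ (fun bj s => / G (RtoC (1 + tau) - bj + s))%C); intros x Hx.
    apply (mero_ext _ _ (fun s => / G (RtoC (1 + tau) - x + 1 * s))%C); [ intros; do 2 f_equal; ring | ].
    apply mero_inv_G; [ left; reflexivity | intros [k l]; right ].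
    exists x, (S k), (S l); repeat split; [ auto | lia | lia | ].
    unfold lat; simpl fst; simpl snd; rewrite !S_INR, !RtoC_plus, !RtoC_mult, !RtoC_plus; ring.
  - apply (mero_Cprod _ _ (fun aj s => / G (aj - s))%C); intros x Hx.
    apply (mero_ext _ _ (fun s => / G (x + (- (1)) * s))%C); [ intros; do 2 f_equal; ring | ].
    apply mero_inv_G; [ right; reflexivity | intros [k l]; left ].
    exists x, k, l; split; [ auto | unfold lat; simpl fst; simpl snd; ring ].
Qed.

(** * Decay along rays *)

(** Directions uniformly off the real axis and within an angle less than [PI / 4] of it: for
    [s = r e], both [|Im s|] and [Re (s * s)] then have the lower bounds that [kernel_decay] asks
    for. The modulus is only bounded by 1, so that averages of directions qualify. *)
Definition cone (kappa : R) (e : C) : Prop :=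
  kappa <= Rabs (Im e) /\ kappa <= Rabs (Re e) - Rabs (Im e) /\ Cmod e <= 1.

Lemma cone_decay (m n : nat) (a b : list C) (alpha : C) (kappa A0 B : R) :
  (m <= length b)%nat -> (n <= length a)%nat ->
  (order_N m n (length a) (length b) < 0)%Z -> 0 < kappa <= 1 -> 0 <= A0 ->
  exists r0, 1 <= r0 /\ forall (c e : C) (r : R), cone kappa e -> Cmod c <= A0 -> r0 <= r ->
    Cmod (kernel G tau m n a b alpha (c + RtoC r * e)) <= exp (- B * r ^ 2).
Proof.
  intros Hm Hn HN Hk HA.
  (* For large [r], [kappa * r / 2 <= Rabs (Im s)] and [Cmod s <= 2 * r]. Hence [kappa / 4], and the
     rate [4 |B| / kappa^2] in [Cmod s] becomes [|B|] in [r]. *)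
  destruct (kernel_decay tau c1 c2 G Htau HG m n a b alpha (kappa / 4) (4 * Rabs B / kappa ^ 2) Hm Hn HN)
    as [r1 [Hr1 HD]]; [ lra | ].
  assert (PAk : 0 <= A0 / kappa) by pos. assert (Prk : 0 < r1 / kappa) by pos.
  exists (1 + A0 + 4 * (A0 / kappa) + 2 * (r1 / kappa)); split; [ lra | ]. intros c e r [He1 [He2 He3]] Hc Hr.
  assert (Ek2 : kappa * (r1 / kappa) = r1) by (field; lra). assert (K1 : 4 * A0 + 2 * r1 <= kappa * r).
  { pos. } set (s := (c + RtoC r * e)%C).
  assert (Ic : Rabs (Im c) <= A0) by (le_via Im_le_Cmod; auto).
  assert (Rc : Rabs (Re c) <= A0) by (le_via Re_le_Cmod; auto).
  assert (EIm : Im s = Im c + r * Im e) by (unfold s; autorewrite with ReIm; ring).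
  assert (ERe : Re s = Re c + r * Re e) by (unfold s; autorewrite with ReIm; ring).
  assert (Bd : forall x y, Rabs y * r - A0 <= Rabs (x + r * y) <= Rabs y * r + A0 \/ A0 < Rabs x).
  { intros x y; destruct (Rle_dec (Rabs x) A0) as [Hx|Hx]; [ left | right; lra ].
    assert (E : Rabs (r * y) = Rabs y * r) by (rewrite Rabs_mult, (Rabs_pos_eq r) by lra; ring).
    generalize (Rabs_triang x (r * y)), (Rabs_triang_inv (r * y) (- x)).
    replace (r * y - - x) with (x + r * y) by ring; rewrite Rabs_Ropp, E; intros; split; lra. }
  destruct (Bd (Im c) (Im e)) as [BI|BI]; [ | lra ]. rewrite <- EIm in BI.
  destruct (Bd (Re c) (Re e)) as [BR|BR]; [ | lra ]. rewrite <- ERe in BR. assert (Hs2 : Cmod s <= 2 * r).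
  { unfold s; le_via Cmod_triangle; rewrite Cmod_mult, Cmod_R, (Rabs_pos_eq r) by lra.
    generalize (Cmod_ge_0 e); nra. }
  assert (HI : kappa * r / 2 <= Rabs (Im s)) by nra.
  assert (Hs1 : kappa * r / 2 <= Cmod s) by (le_via HI; apply Im_le_Cmod).
  assert (HRI : kappa * r / 2 <= Rabs (Re s) - Rabs (Im s)) by nra.
  assert (HRe2 : Re (s * s) = (Rabs (Re s) - Rabs (Im s)) * (Rabs (Re s) + Rabs (Im s))).
  { rewrite Re_mult; unfold Rabs; repeat destruct Rcase_abs; ring. } le_via HD.
  - lra.
  - nra.
  - rewrite HRe2; apply Rle_trans with (kappa * r / 2 * Cmod s).
    + replace (kappa / 4 * Cmod s ^ 2) with (kappa / 4 * Cmod s * Cmod s) by ring.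
      apply Rmult_le_compat_r; [ apply Cmod_ge_0 | nra ].
    + apply Rmult_le_compat; [ nra | apply Cmod_ge_0 | auto | ]. le_via Cmod_le_Re_Im; lra.
  - apply exp_le_compat. assert (HB := Rle_abs B).
    assert (H1 : (kappa * r / 2) ^ 2 <= Cmod s ^ 2) by (apply pow_incr; split; [ nra | auto ]).
    assert (H2 : 4 * Rabs B / kappa ^ 2 * (kappa * r / 2) ^ 2 <= 4 * Rabs B / kappa ^ 2 * Cmod s ^ 2).
    { apply Rmult_le_compat_l; [ | auto ]. pos. }
    replace (4 * Rabs B / kappa ^ 2 * (kappa * r / 2) ^ 2) with (Rabs B * r ^ 2) in H2 by (field; lra).
    assert (B * r ^ 2 <= Rabs B * r ^ 2) by (apply Rmult_le_compat_r; [ nra | auto ]). lra.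
Qed.

End KernelMero.

Definition sgn_plus (cls : contour_class) : R :=
  match cls with K_right | K_down => 1 | K_left | K_up => -1 end.
Definition sgn_minus (cls : contour_class) : R :=
  match cls with K_right | K_up => 1 | K_left | K_down => -1 end.

(** The ends of the four classes differ only in the sign of the cosine, so one direction with signs
    [sx] and [sy] covers them all. *)
Definition dirn (sx sy eps : R) : C := (sx * cos eps, sy * sin eps).

Lemma Cexp_theta_plus (cls : contour_class) (eps : R) :
  Cexp (Ci * RtoC (theta_plus cls eps)) = dirn (sgn_plus cls) 1 eps.
Proof.
  rewrite Cexp_Ci; unfold dirn; destruct cls; simpl;
    rewrite ?cos_minus, ?sin_minus, ?cos_PI, ?sin_PI; f_equal; ring.
Qed.

Lemma Cexp_theta_minus (cls : contour_class) (eps : R) :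
  Cexp (Ci * RtoC (theta_minus cls eps)) = dirn (sgn_minus cls) (-1) eps.
Proof.
  rewrite Cexp_Ci; unfold dirn; destruct cls; simpl;
    rewrite ?cos_plus, ?sin_plus, ?cos_neg, ?sin_neg, ?cos_PI, ?sin_PI; f_equal; ring.
Qed.

Lemma sin_theta (cls : contour_class) (eps : R) :
  sin (theta_minus cls eps) = - sin eps /\ sin (theta_plus cls eps) = sin eps.
Proof.
  assert (H1 := Cexp_theta_minus cls eps). assert (H2 := Cexp_theta_plus cls eps).
  rewrite Cexp_Ci in H1, H2; split; [ apply (f_equal snd) in H1 | apply (f_equal snd) in H2 ];
    simpl in H1, H2; lra.
Qed.

Definition kap (eps : R) : R := Rmin (sin eps) (cos eps - sin eps).

Lemma eps_trig (eps : R) : 0 < eps < PI / 4 -> 0 < sin eps /\ 0 < cos eps - sin eps.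
Proof.
  intros He; assert (HPI := PI_RGT_0); split; [ apply sin_gt_0; lra | ].
  rewrite <- (cos_shift eps); generalize (cos_decreasing_1 eps (PI / 2 - eps)); lra.
Qed.

Lemma kap_pos (eps : R) : 0 < eps < PI / 4 -> 0 < kap eps <= 1.
Proof.
  intros He; destruct (eps_trig eps He); unfold kap; split; [ pos | ]. le_via Rmin_l; apply SIN_bound.
Qed.

(** Up to signs, the sine and the difference cosine minus sine are averaged, and both are positive;
    the modulus is convex. This is what lets the ends of two contours with different [eps] be
    joined. *)
Lemma cone_combination (eps0 eps1 u sx sy : R) : 0 < eps0 < PI / 4 -> 0 < eps1 < PI / 4 ->
  (sx = 1 \/ sx = -1) -> (sy = 1 \/ sy = -1) -> 0 <= u <= 1 ->
  cone (Rmin (kap eps0) (kap eps1))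
    ((dirn sx sy eps0) + RtoC u * ((dirn sx sy eps1) - (dirn sx sy eps0)))%C.
Proof.
  intros H0 H1 Hsx Hsy Hu. destruct (eps_trig _ H0) as [S0 C0], (eps_trig _ H1) as [S1 C1].
  assert (K0 : kap eps0 <= sin eps0) by apply Rmin_l. assert (K0' : kap eps0 <= cos eps0 - sin eps0) by apply Rmin_r.
  assert (K1 : kap eps1 <= sin eps1) by apply Rmin_l. assert (K1' : kap eps1 <= cos eps1 - sin eps1) by apply Rmin_r.
  assert (M0 := Rmin_l (kap eps0) (kap eps1)). assert (M1 := Rmin_r (kap eps0) (kap eps1)).
  set (k := Rmin (kap eps0) (kap eps1)) in *.
  set (cc := (1 - u) * cos eps0 + u * cos eps1). set (ss := (1 - u) * sin eps0 + u * sin eps1).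
  assert (E : ((dirn sx sy eps0) + RtoC u * ((dirn sx sy eps1) - (dirn sx sy eps0)))%C
    = (sx * cc, sy * ss)) by (unfold cc, ss, dirn; C_eq; ring).
  rewrite E; clear E. assert (Hss : k <= ss) by (unfold ss; nra). assert (Hcs : k <= cc - ss).
  { replace (cc - ss) with ((1 - u) * (cos eps0 - sin eps0) + u * (cos eps1 - sin eps1)) by (unfold cc, ss; ring). nra. }
  assert (Pss : 0 < ss). { pos. } assert (Pcs : 0 < cc - ss).
  { replace (cc - ss) with ((1 - u) * (cos eps0 - sin eps0) + u * (cos eps1 - sin eps1)) by (unfold cc, ss; ring).
    destruct (Req_dec u 0) as [->|]; [ lra | ]. assert (0 < u * (cos eps1 - sin eps1)) by pos.
    assert (0 <= (1 - u) * (cos eps0 - sin eps0)) by pos. lra. }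
  assert (As : Rabs (sy * ss) = ss).
  { destruct Hsy as [-> | ->]; [ rewrite Rmult_1_l, Rabs_pos_eq; lra | rewrite Rabs_left; lra ]. }
  assert (Ac : Rabs (sx * cc) = cc).
  { destruct Hsx as [-> | ->]; [ rewrite Rmult_1_l, Rabs_pos_eq; lra | rewrite Rabs_left; lra ]. }
  unfold cone; rewrite Re_pair, Im_pair, As, Ac.
  assert (Hn : Cmod (sx * cc, sy * ss) * Cmod (sx * cc, sy * ss) <= 1). { rewrite Cmod_sqr, Re_pair, Im_pair.
    assert (T0 := sin2_cos2 eps0). assert (T1 := sin2_cos2 eps1). unfold Rsqr in *.
    assert (Q : sx * cc * (sx * cc) + sy * ss * (sy * ss) = cc * cc + ss * ss)
      by (destruct Hsx as [-> | ->], Hsy as [-> | ->]; ring).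
    rewrite Q; unfold cc, ss.
    assert (D : 0 <= (cos eps0 - cos eps1) * (cos eps0 - cos eps1) + (sin eps0 - sin eps1) * (sin eps0 - sin eps1))
      by (apply Rplus_le_le_0_compat; apply Rle_0_sqr).
    assert (0 <= u * (1 - u)) by pos. nra. }
  generalize (Cmod_ge_0 (sx * cc, sy * ss)); nra.
Qed.

Lemma cone_single (eps sx sy : R) : 0 < eps < PI / 4 -> (sx = 1 \/ sx = -1) -> (sy = 1 \/ sy = -1) ->
  cone (kap eps) (dirn sx sy eps).
Proof.
  intros He Hx Hy. assert (H := cone_combination eps eps 0 sx sy He He Hx Hy ltac:(lra)).
  rewrite Rmin_left in H by lra. replace ((dirn sx sy eps) + RtoC 0 *
    ((dirn sx sy eps) - (dirn sx sy eps)))%C with (dirn sx sy eps) in H by (C_eq; ring).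
  exact H.
Qed.

(** * Abscissas *)

Lemma Rbar_lt_max (x y z : Rbar) : Rbar_lt (Rbar_max x y) z <-> Rbar_lt x z /\ Rbar_lt y z.
Proof.
  unfold Rbar_max; destruct (Rbar_le_dec x y) as [H|H].
  - split; [ intros K; split; [ eapply Rbar_le_lt_trans; eassumption | auto ] | tauto ].
  - apply Rbar_not_le_lt in H; split; [ intros K; split; [ auto | ] | tauto ].
    eapply Rbar_lt_trans; eassumption.
Qed.

Lemma Rbar_lt_min (x y z : Rbar) : Rbar_lt z (Rbar_min x y) <-> Rbar_lt z x /\ Rbar_lt z y.
Proof.
  destruct (Rbar_le_dec x y) as [H|H].
  - assert (E : Rbar_min x y = x).
    { destruct x as [x| |], y as [y| |]; simpl in *; try tauto; try reflexivity.
      f_equal; apply Rmin_left, H. }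
    rewrite E; split; [ intros K; split; [ auto | eapply Rbar_lt_le_trans; eassumption ] | tauto ].
  - apply Rbar_not_le_lt in H. assert (E : Rbar_min x y = y).
    { destruct x as [x| |], y as [y| |]; simpl in *; try tauto; try reflexivity.
      f_equal; apply Rmin_right; lra. }
    rewrite E; split; [ intros K; split; [ eapply Rbar_lt_trans; eassumption | auto ] | tauto ].
Qed.

Lemma lambda_sharp_lt (tau : R) (m : nat) (b : list C) (x : R) :
  Rbar_lt (lambda_sharp tau m b) (Finite x) <-> forall bj, In bj (skipn m b) -> Re bj - tau - 1 < x.
Proof.
  unfold lambda_sharp; induction (skipn m b) as [|y l IH]; cbn [map fold_right].
  - split; [ intros _ bj [] | intros _; exact Logic.I ].
  - rewrite Rbar_lt_max, IH; simpl; split.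
    + intros [H1 H2] bj [<-|H]; auto.
    + auto.
Qed.

Lemma lambda_flat_gt (n : nat) (a : list C) (x : R) :
  Rbar_lt (Finite x) (lambda_flat n a) <-> forall aj, In aj (skipn n a) -> x < Re aj.
Proof.
  unfold lambda_flat; induction (skipn n a) as [|y l IH]; cbn [map fold_right].
  - split; [ intros _ aj [] | intros _; exact Logic.I ].
  - rewrite Rbar_lt_min, IH; simpl; split.
    + intros [H1 H2] aj [<-|H]; auto.
    + auto.
Qed.

Lemma Rbar_between (x y : Rbar) : Rbar_lt x y -> exists s : R, Rbar_lt x (Finite s) /\ Rbar_lt (Finite s) y.
Proof.
  destruct x as [x| |], y as [y| |]; simpl; try tauto; intros H.
  - exists ((x + y) / 2); split; lra.
  - exists (x + 1); split; [ lra | exact Logic.I ].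
  - exists (y - 1); split; [ exact Logic.I | lra ].
  - exists 0; split; exact Logic.I.
Qed.

(* [sigma] is an admissible abscissa and all poles lie in the strip [|Im| < T]. *)
Definition admissible (tau : R) (m n : nat) (a b : list C) (sigma T : R) : Prop :=
  0 < T /\ (forall s, Lambda_plus tau n a s -> sigma < Re s /\ Rabs (Im s) < T) /\
  (forall s, Lambda_minus tau m b s -> Re s < sigma /\ Rabs (Im s) < T).

Lemma admissible_exists (tau : R) (m n : nat) (a b : list C) (sigma : R) : 0 < tau ->
  Rbar_lt (lambda_sharp tau m b) (Finite sigma) -> Rbar_lt (Finite sigma) (lambda_flat n a) ->
  exists T0, forall T, T0 <= T -> admissible tau m n a b sigma T.
Proof.
  intros Ht Hb Ha; rewrite lambda_sharp_lt in Hb; rewrite lambda_flat_gt in Ha.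
  destruct (list_Cmod_bound (a ++ b)) as [A [HA HAb]]. exists (A + 1); intros T HT; split; [ lra | split ].
  - intros s [aj [l [k [Hin ->]]]].
    assert (Hi : In aj a) by (rewrite <- (firstn_skipn n a); apply in_or_app; auto).
    specialize (HAb aj (in_or_app _ _ _ (or_introl Hi))); specialize (Ha aj Hin).
    generalize (pos_INR l), (pos_INR k); intros; autorewrite with ReIm; split; [ nra | ].
    rewrite Rplus_0_r; lt_via Im_le_Cmod; lra.
  - intros s [bj [l [k [Hin [Hl [Hk ->]]]]]].
    assert (Hi : In bj b) by (rewrite <- (firstn_skipn m b); apply in_or_app; auto).
    specialize (HAb bj (in_or_app _ _ _ (or_intror Hi))); specialize (Hb bj Hin).
    apply le_INR in Hl; apply le_INR in Hk; simpl in Hl, Hk. autorewrite with ReIm; split; [ nra | ].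
    rewrite Rminus_0_r; lt_via Im_le_Cmod; lra.
Qed.

(** * Independence of the contour *)

Lemma contour_curve (thm thp : R) (Lp Lm : C -> Prop) (g : R -> C) :
  is_contour thm thp Lp Lm g -> curve g (velocity g).
Proof. intros H; apply smooth_curve, (contour_smooth _ _ _ _ _ H). Qed.

Lemma contour_inf (thm thp : R) (Lp Lm : C -> Prop) (g : R -> C) : sin thm < 0 -> 0 < sin thp ->
  is_contour thm thp Lp Lm g ->
  forall P, exists R0, forall t, R0 <= t -> upper P (g t) /\ lower P (g (- t)).
Proof.
  intros Hm Hp H P; destruct (contour_ends _ _ _ _ _ H) as [T [sm [sp [E1 E2]]]].
  set (Q := Rabs P + Rabs (Im sm) + Rabs (Im sp) + 1).
  assert (PQ : 0 < Q) by (unfold Q; generalize (Rabs_pos P), (Rabs_pos (Im sm)), (Rabs_pos (Im sp)); lra).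
  exists (Rabs T + Q / sin thp + Q / (- sin thm)); intros t Ht. assert (Q1 : 0 < Q / sin thp) by pos.
  assert (Q2 : 0 < Q / (- sin thm)) by pos. assert (HT := Rle_abs T). assert (HT2 := Rabs_pos T).
  assert (G1 : Q <= t * sin thp).
  { apply Rle_trans with (Q / sin thp * sin thp); [ right; field; lra | apply Rmult_le_compat_r; lra ]. }
  assert (G2 : Q <= t * (- sin thm)).
  { apply Rle_trans with (Q / (- sin thm) * (- sin thm)); [ right; field; lra | apply Rmult_le_compat_r; lra ]. }
  assert (B1 := Rle_abs P). assert (B2 := Rle_abs (Im sm)). assert (B3 := Rle_abs (- Im sp)).
  rewrite Rabs_Ropp in B3. assert (B4 := Rabs_pos (Im sm)). assert (B5 := Rabs_pos (Im sp)).
  unfold upper, lower; rewrite E2, E1, !Cexp_Ci by lra; autorewrite with ReIm. unfold Q in *; split; lra.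
Qed.

Lemma contour_cone_end (cls : contour_class) (eps : R) (Lp Lm : C -> Prop) (g : R -> C) :
  is_contour (theta_minus cls eps) (theta_plus cls eps) Lp Lm g ->
  exists (T : R) (sm sp : C), 
    (forall t, T <= t -> g t = (sp + RtoC t * dirn (sgn_plus cls) 1 eps)%C) /\
    (forall t, T <= t -> g (- t) = (sm + RtoC t * dirn (sgn_minus cls) (-1) eps)%C).
Proof.
  intros H; destruct (contour_ends _ _ _ _ _ H) as [T [sm [sp [E1 E2]]]].
  exists T, sm, sp; split; intros t Ht.
  - rewrite E2, Cexp_theta_plus by auto; reflexivity.
  - rewrite E1, Cexp_theta_minus, Ropp_involutive by lra; reflexivity.
Qed.

Lemma sgn_plus_cases (cls : contour_class) : sgn_plus cls = 1 \/ sgn_plus cls = -1.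
Proof. destruct cls; simpl; auto. Qed.
Lemma sgn_minus_cases (cls : contour_class) : sgn_minus cls = 1 \/ sgn_minus cls = -1.
Proof. destruct cls; simpl; auto. Qed.

Lemma same_side_left (g : R -> C) (p : C) (x : R) :
  same_side g p (RtoC (- x)) -> same_side g p (RtoC (-1 * x)).
Proof. replace (- x) with (-1 * x) by ring; trivial. Qed.

Lemma same_side_right (g : R -> C) (p : C) (x : R) :
  same_side g p (RtoC x) -> same_side g p (RtoC (1 * x)).
Proof. rewrite Rmult_1_l; trivial. Qed.

Section KStd.

Variables (tau c1 c2 : R) (G : C -> C).
Hypothesis Htau : 0 < tau.
Hypothesis HG : forall z : C,
  filterlim (barnes_partial tau c1 c2 z) eventually (locally (G z)).
Variables (m n : nat) (a b : list C) (alpha : C).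
Hypotheses (Hm : (m <= length b)%nat) (Hn : (n <= length a)%nat)
  (HN : (order_N m n (length a) (length b) < 0)%Z).
Variable cls : contour_class.

Let phi := kernel G tau m n a b alpha.

Definition integrand (w s : C) : C :=
  (kernel G tau m n a b alpha s * Cexp (- s * w) / (RtoC (2 * PI) * Ci))%C.

Lemma two_pi_i : (RtoC (2 * PI) * Ci)%C <> 0%C /\ 1 <= Cmod (RtoC (2 * PI) * Ci).
Proof.
  assert (H := PI2_1). assert (E : Cmod (RtoC (2 * PI) * Ci) = 2 * PI).
  { rewrite Cmod_mult, Cmod_Ci, Cmod_R, Rabs_pos_eq; lra. }
  rewrite E; split; [ apply Cmod_gt_0; rewrite E; lra | lra ].
Qed.

Lemma integrand_decay (w : C) (kappa A0 : R) : 0 < kappa <= 1 -> 0 <= A0 ->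
  exists r0, 1 <= r0 /\ forall (c e : C) (r : R), cone kappa e -> Cmod c <= A0 -> r0 <= r ->
    Cmod (integrand w (c + RtoC r * e)) <= exp (- (2 * r)).
Proof.
  intros Hk HA.
  (* The part [2 * Cmod w] of the rate pays for [Cexp (- s * w)], since [Cmod s <= 2 * r]; the
     remaining 2 is the rate claimed. *)
  destruct (cone_decay tau c1 c2 G Htau HG m n a b alpha kappa A0 (2 * Cmod w + 2) Hm Hn HN Hk HA)
    as [r0 [Hr0 H]].
  exists (r0 + A0); split; [ lra | ]. intros c e r He Hc Hr; specialize (H c e r He Hc ltac:(lra)).
  destruct two_pi_i as [N1 N2]; unfold integrand. rewrite Cmod_div, Cmod_mult, Cmod_Cexp by auto.
  apply Rle_trans with (exp (- (2 * Cmod w + 2) * r ^ 2) * exp (2 * r * Cmod w)).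
  - apply Rle_trans with (Cmod (kernel G tau m n a b alpha (c + RtoC r * e)) *
      exp (Re (- (c + RtoC r * e) * w)) * 1).
    + apply Rmult_le_compat_l.
      * pos.
      * rewrite <- Rinv_1; apply Rinv_le_contravar; lra.
    + rewrite Rmult_1_r; apply Rmult_le_compat; [ apply Cmod_ge_0 | pos | auto | ].
      apply exp_le_compat; le_via Rle_abs; le_via Re_le_Cmod.
      rewrite Cmod_mult, Cmod_opp; apply Rmult_le_compat_r; [ apply Cmod_ge_0 | ].
      le_via Cmod_triangle; rewrite Cmod_mult, Cmod_R, Rabs_pos_eq by lra.
      destruct He as [_ [_ He]]; generalize (Cmod_ge_0 e); nra.
  - rewrite <- exp_plus; apply exp_le_compat; generalize (Cmod_ge_0 w); intros.
    assert (Hrr : r <= r ^ 2) by nra. nra.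
Qed.

Lemma integrand_an (w s : C) : ~ poles tau m n a b s -> an (integrand w) s.
Proof.
  intros Hs; unfold integrand, Cdiv; apply an_mult; [ apply an_mult | apply an_const ].
  - apply (kernel_an tau c1 c2 G Htau HG), Hs.
  - apply an_Cexp, an_mult; [ apply an_opp, an_id | apply an_const ].
Qed.

Lemma poles_strip : exists Y, 0 <= Y /\ forall p, poles tau m n a b p -> Rabs (Im p) <= Y.
Proof.
  destruct (list_Cmod_bound (a ++ b)) as [A [HA HAb]]. exists A; split; [ auto | ].
  intros p [[aj [l [k [Hin ->]]]]|[bj [l [k [Hin [_ [_ ->]]]]]]].
  - assert (Hi : In aj a) by (rewrite <- (firstn_skipn n a); apply in_or_app; auto).
    specialize (HAb aj (in_or_app _ _ _ (or_introl Hi))).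
    autorewrite with ReIm; rewrite Rplus_0_r; le_via Im_le_Cmod; lra.
  - assert (Hi : In bj b) by (rewrite <- (firstn_skipn m b); apply in_or_app; auto).
    specialize (HAb bj (in_or_app _ _ _ (or_intror Hi))).
    autorewrite with ReIm; rewrite Rminus_0_r; le_via Im_le_Cmod; lra.
Qed.

(* A far segment joining two contours of the same class, with possibly
   different opening angles, lies in a cone where the integrand decays. *)
Lemma far_segment (eps0 eps1 sx sy : R) (p0 p1 w : C) (g0 g1 : R -> C) (T : R) :
  0 < eps0 < PI / 4 -> 0 < eps1 < PI / 4 -> (sx = 1 \/ sx = -1) -> (sy = 1 \/ sy = -1) ->
  (forall t, T <= t -> g0 t = (p0 + RtoC t * dirn sx sy eps0)%C) ->
  (forall t, T <= t -> g1 t = (p1 + RtoC t * dirn sx sy eps1)%C) ->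
  (forall t, T <= t -> forall u, 0 <= u <= 1 -> ~ poles tau m n a b (g0 t + RtoC u * (g1 t - g0 t))%C) ->
  forall eps, 0 < eps -> exists R0, forall t, R0 <= t -> Cmod (segment (integrand w) (g0 t) (g1 t)) < eps.
Proof.
  intros He0 He1 Hsx Hsy E0 E1 Hpol eps He. set (kappa := Rmin (kap eps0) (kap eps1)).
  assert (Hk : 0 < kappa <= 1). { destruct (kap_pos _ He0), (kap_pos _ He1); unfold kappa; split; [ pos | ].
    le_via Rmin_l; auto. }
  set (A0 := Cmod p0 + Cmod p1). assert (P0 := Cmod_ge_0 p0). assert (P1 := Cmod_ge_0 p1).
  destruct (integrand_decay w kappa A0 Hk ltac:(unfold A0; lra)) as [r0 [Hr0 HD]].
  destruct (exp_small (A0 + 2) eps He) as [R1 [HR1 HS]]. exists (Rmax (Rmax r0 T) R1); intros t Ht.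
  assert (Ht1 : Rmax r0 T <= t) by (le_via Rmax_l; apply Ht).
  assert (Ht2 : R1 <= t) by (le_via Rmax_r; apply Ht). assert (Ht3 : r0 <= t) by (le_via Rmax_l; apply Ht1).
  assert (Ht4 : T <= t) by (le_via Rmax_r; apply Ht1).
  assert (Cone := fun u Hu => cone_combination eps0 eps1 u sx sy He0 He1 Hsx Hsy Hu).
  assert (Pt : forall u, (g0 t + RtoC u * (g1 t - g0 t))%C = ((p0 + RtoC u * (p1 - p0)) + RtoC t *
    (dirn sx sy eps0 + RtoC u * (dirn sx sy eps1 - dirn sx sy eps0)))%C).
  { intros u; rewrite E0, E1 by auto; ring. }
  apply Rle_lt_trans with (exp (- (2 * t)) * Cmod (g1 t - g0 t) * (1 - 0)).
  - unfold segment.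
    assert (Hcc : forall u, 0 <= u <= 1 -> ccont (integrand w) (g0 t + RtoC u * (g1 t - g0 t))%C).
    { intros u Hu; apply an_ccont, integrand_an, Hpol; auto. }
    eapply is_CI_Cmod_le_const; [ lra | | apply path_correct; [ apply curve_line | lra | auto ] ].
    intros u Hu; cbv beta; rewrite Cmod_mult; apply Rmult_le_compat_r; [ apply Cmod_ge_0 | ].
    rewrite Pt; apply HD; [ apply Cone, Hu | | auto ].
    replace (p0 + RtoC u * (p1 - p0))%C with (RtoC (1 - u) * p0 + RtoC u * p1)%C by (rewrite RtoC_minus; ring).
    le_via Cmod_triangle. rewrite !Cmod_mult, !Cmod_R, !Rabs_pos_eq by lra; unfold A0; nra.
  - apply Rle_lt_trans with ((A0 + 2) * exp (- t)); [ | apply HS, Ht2 ].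
    assert (B : Cmod (g1 t - g0 t) <= (A0 + 2) * exp t). { rewrite E0, E1 by auto.
      apply Rle_trans with (A0 + 2 * t).
      - assert (D0 := proj2 (proj2 (cone_single eps0 sx sy He0 Hsx Hsy))).
        assert (D1 := proj2 (proj2 (cone_single eps1 sx sy He1 Hsx Hsy))). le_via Cmod_triangle_minus.
        assert (T1 := Cmod_triangle p0 (RtoC t * dirn sx sy eps0)).
        assert (T2 := Cmod_triangle p1 (RtoC t * dirn sx sy eps1)).
        rewrite Cmod_mult, Cmod_R, Rabs_pos_eq in T1, T2 by lra. unfold A0; nra.
      - assert (1 + t <= exp t) by apply exp_ge_1_plus. unfold A0; nra. }
    replace (exp (- (2 * t))) with (exp (- t) * exp (- t)) by (rewrite <- exp_plus; f_equal; ring).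
    assert (Et : exp (- t) * exp t = 1) by (rewrite <- exp_plus, <- exp_0; f_equal; ring).
    apply Rle_trans with (exp (- t) * exp (- t) * ((A0 + 2) * exp t));
      [ | replace (exp (- t) * exp (- t) * ((A0 + 2) * exp t))
            with ((A0 + 2) * exp (- t) * (exp (- t) * exp t)) by ring; rewrite Et; lra ].
    rewrite Rminus_0_r, Rmult_1_r; apply Rmult_le_compat_l; [ nra | auto ].
Qed.

(** Convergence along [g1] is deduced from convergence along [g0]: over a long parameter interval
    the two integrals differ by the two closing segments, which tend to 0 by [far_segment]. *)
Lemma contour_independence (w v : C) (eps0 eps1 : R) (g0 g1 : R -> C) :
  0 < eps0 < PI / 4 -> 0 < eps1 < PI / 4 ->
  is_contour (theta_minus cls eps0) (theta_plus cls eps0) (Lambda_plus tau n a) (Lambda_minus tau m b) g0 ->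
  is_contour (theta_minus cls eps1) (theta_plus cls eps1) (Lambda_plus tau n a) (Lambda_minus tau m b) g1 ->
  gen_int (fun t => integrand w (g0 t) * velocity g0 t)%C v ->
  gen_int (fun t => integrand w (g1 t) * velocity g1 t)%C v.
Proof.
  intros He0 He1 H0 H1 Hv.
  assert (C0 := contour_curve _ _ _ _ _ H0). assert (C1 := contour_curve _ _ _ _ _ H1).
  destruct (eps_trig _ He0) as [S0 _], (eps_trig _ He1) as [S1 _].
  assert (I0 := contour_inf _ _ _ _ _ ltac:(rewrite (proj1 (sin_theta cls eps0)); lra)
    ltac:(rewrite (proj2 (sin_theta cls eps0)); lra) H0).
  assert (I1 := contour_inf _ _ _ _ _ ltac:(rewrite (proj1 (sin_theta cls eps1)); lra)
    ltac:(rewrite (proj2 (sin_theta cls eps1)); lra) H1).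
  destruct poles_strip as [Y [HY Hstrip]]. assert (Hinf : forall P, exists R0, forall t, R0 <= t ->
    upper P (g0 t) /\ upper P (g1 t) /\ lower P (g0 (- t)) /\ lower P (g1 (- t))).
  { intros P; destruct (I0 P) as [R0 HR0], (I1 P) as [R1 HR1]. exists (Rmax R0 R1); intros t Ht.
    destruct (HR0 t) as [U0 L0]; [ le_via Rmax_l; apply Ht | ].
    destruct (HR1 t) as [U1 L1]; [ le_via Rmax_r; apply Ht | ]. auto. }
  destruct (Hinf Y) as [R2 HR2]. set (R1 := Rabs R2 + 1).
  assert (HR1 : 0 < R1) by (unfold R1; generalize (Rabs_pos R2); lra).
  assert (HR12 : R2 <= R1) by (unfold R1; generalize (Rle_abs R2); lra).
  assert (Hup : forall t, R1 <= t -> upper Y (g0 t) /\ upper Y (g1 t)).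
  { intros t Ht; destruct (HR2 t) as [U0 [U1 _]]; [ lra | ]; auto. }
  assert (Hlow : forall t, t <= - R1 -> lower Y (g0 t) /\ lower Y (g1 t)).
  { intros t Ht; destruct (HR2 (- t)) as [_ [_ [U0 U1]]]; [ lra | ]. rewrite Ropp_involutive in *; auto. }
  assert (Hchain : forall s t, s <= - R1 -> R1 <= t ->
    chain g0 (velocity g0) g1 (velocity g1) s t (integrand w) = 0%C).
  { apply (chain_cauchy g0 (velocity g0) g1 (velocity g1) C0 C1 Y R1 HY HR1 Hup Hlow Hinf
      (poles tau m n a b)).
    - intros p Hp; split; [ apply Hstrip, Hp | ]. destruct Hp as [Hp|Hp].
      + destruct (contour_right _ _ _ _ _ H0 p Hp) as [M0 HM0].
        destruct (contour_right _ _ _ _ _ H1 p Hp) as [M1 HM1].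
        exists 1; split; [ left; reflexivity | exists (Rmax M0 M1); intros x Hx ].
        split; apply same_side_right; [ apply HM0 | apply HM1 ];
          (eapply Rle_trans; [ | apply Hx ]); [ apply Rmax_l | apply Rmax_r ].
      + destruct (contour_left _ _ _ _ _ H0 p Hp) as [M0 HM0].
        destruct (contour_left _ _ _ _ _ H1 p Hp) as [M1 HM1].
        exists (-1); split; [ right; reflexivity | exists (Rmax M0 M1); intros x Hx ].
        split; apply same_side_left; [ apply HM0 | apply HM1 ];
          (eapply Rle_trans; [ | apply Hx ]); [ apply Rmax_l | apply Rmax_r ].
    - intros z Hz; apply integrand_an, Hz.
    - intros r; change (mero (poles tau m n a b) r (integrand w)).
      apply (mero_ext _ _ (fun s => kernel G tau m n a b alpha s * (Cexp (- s * w) / (RtoC (2 * PI) * Ci)))%C).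
      { intros s; unfold integrand, Cdiv; ring. }
      apply mero_mult; [ apply (kernel_mero tau c1 c2 G Htau HG) | apply mero_an; intros z ].
      unfold Cdiv; apply an_mult; [ | apply an_const ].
      apply an_Cexp, an_mult; [ apply an_opp, an_id | apply an_const ]. }
  destruct (contour_cone_end _ _ _ _ _ H0) as [T0 [sm0 [sp0 [Ep0 Em0]]]].
  destruct (contour_cone_end _ _ _ _ _ H1) as [T1 [sm1 [sp1 [Ep1 Em1]]]]. set (T := Rmax R1 (Rmax T0 T1)).
  assert (TR : R1 <= T) by apply Rmax_l. assert (TT0 : T0 <= T) by (le_via Rmax_l; apply Rmax_r).
  assert (TT1 : T1 <= T) by (le_via Rmax_r; apply Rmax_r).
  assert (Npol : forall z, upper Y z \/ lower Y z -> ~ poles tau m n a b z).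
  { intros z Hz Hp; apply Hstrip, Rabs_le_between in Hp; unfold upper, lower in Hz; lra. }
  assert (FP := far_segment eps0 eps1 (sgn_plus cls) 1 sp0 sp1 w g0 g1 T He0 He1 (sgn_plus_cases cls)
    (or_introl eq_refl) (fun t Ht => Ep0 t (Rle_trans _ _ _ TT0 Ht)) (fun t Ht => Ep1 t (Rle_trans _ _ _ TT1 Ht))
    (fun t Ht u Hu => Npol _ (or_introl (cvx_upper Y _ _ u (proj1 (Hup t (Rle_trans _ _ _ TR Ht)))
       (proj2 (Hup t (Rle_trans _ _ _ TR Ht))) Hu)))).
  assert (Hneg : forall t, T <= t -> - t <= - R1) by (intros; lra).
  assert (FM := far_segment eps0 eps1 (sgn_minus cls) (-1) sm0 sm1 w (fun t => g0 (- t)) (fun t => g1 (- t)) T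
    He0 He1 (sgn_minus_cases cls)
    (or_intror eq_refl) (fun t Ht => Em0 t (Rle_trans _ _ _ TT0 Ht)) (fun t Ht => Em1 t (Rle_trans _ _ _ TT1 Ht))
    (fun t Ht u Hu => Npol _ (or_intror (cvx_lower Y _ _ u (proj1 (Hlow _ (Hneg t Ht)))
       (proj2 (Hlow _ (Hneg t Ht))) Hu)))).
  intros eps He. destruct (Hv (eps / 3)) as [RV HRV]; [ lra | ].
  destruct (FP (eps / 3)) as [RP HRP]; [ lra | ]. destruct (FM (eps / 3)) as [RM HRM]; [ lra | ].
  set (R3 := Rabs RV + Rabs RP + Rabs RM + R1).
  assert (A1 := Rle_abs RV). assert (A2 := Rle_abs RP). assert (A3 := Rle_abs RM).
  assert (B1 := Rabs_pos RV). assert (B2 := Rabs_pos RP). assert (B3 := Rabs_pos RM).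
  exists R3; intros s t Hs Ht; unfold R3 in *. exists (path_int (integrand w) g1 (velocity g1) s t); split.
  - apply path_correct; [ auto | lra | ].
    intros u _; apply an_ccont, integrand_an; intros Hp; destruct (contour_avoids _ _ _ _ _ H1 u), Hp; tauto.
  - destruct (HRV s t) as [x [X1 X2]]; [ lra | lra | ].
    assert (Ex : x = path_int (integrand w) g0 (velocity g0) s t) by (symmetry; apply CI_eq, X1).
    assert (HC := Hchain s t ltac:(lra) ltac:(lra)); unfold chain in HC; rewrite <- Ex in HC.
    specialize (HRP t ltac:(lra)); specialize (HRM (- s) ltac:(lra)); cbv beta in HRM.
    rewrite Ropp_involutive in HRM. set (p1 := path_int (integrand w) g1 (velocity g1) s t) in *.
    set (q1 := segment (integrand w) (g0 t) (g1 t)) in *. set (q2 := segment (integrand w) (g0 s) (g1 s)) in *.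
    replace (p1 - v)%C with ((p1 - x - q1 + q2) + ((x - v) + (q1 - q2)))%C by ring. rewrite HC, Cplus_0_l.
    lt_via Cmod_triangle. generalize (Cmod_triangle_minus q1 q2); lra.
Qed.

Variables (sigma T : R).
Hypothesis Hadm : admissible tau m n a b sigma T.

Definition std_contour : R -> C := std sigma T (theta_minus cls (PI / 8)) (theta_plus cls (PI / 8)).

Lemma pi8 : 0 < PI / 8 < PI / 4.
Proof. generalize PI_RGT_0; lra. Qed.

Lemma std_sin : sin (theta_minus cls (PI / 8)) < 0 /\ 0 < sin (theta_plus cls (PI / 8)).
Proof.
  destruct (sin_theta cls (PI / 8)) as [-> ->]; destruct (eps_trig _ pi8); split; lra.
Qed.

Lemma std_contour_ok : is_contour (theta_minus cls (PI / 8)) (theta_plus cls (PI / 8))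
  (Lambda_plus tau n a) (Lambda_minus tau m b) std_contour.
Proof.
  destruct std_sin, Hadm as [HT [H1 H2]]; apply std_is_contour; auto.
Qed.

Lemma std_not_pole (t : R) : ~ poles tau m n a b (std_contour t).
Proof. intros H; destruct (contour_avoids _ _ _ _ _ std_contour_ok t), H; tauto. Qed.

(** Everything in the integrand except [Cexp (- s * w)], so that [K] becomes a linear functional of
    that multiplier. *)
Definition weight (t : R) : C :=
  (kernel G tau m n a b alpha (std_contour t) / (RtoC (2 * PI) * Ci) * velocity std_contour t)%C.

Lemma std_contour_growth (t : R) : Cmod (std_contour t) <= Rabs sigma + T + Rabs t.
Proof.
  destruct Hadm as [HT _]. assert (Hs : Cmod (RtoC sigma) = Rabs sigma) by apply Cmod_R.
  assert (HTi : Cmod (RtoC T * Ci) = T) by (rewrite Cmod_mult, Cmod_Ci, Cmod_R, Rabs_pos_eq; lra).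
  unfold std_contour; destruct (Rle_dec t (- T)) as [A|A]; [ | destruct (Rle_dec T t) as [B|B] ].
  - rewrite std_left by lra.
    le_via Cmod_triangle; rewrite Cmod_mult, Cmod_Cexp_Ci, Cmod_R, Rabs_pos_eq by lra.
    generalize (Cmod_triangle_minus (RtoC sigma) (RtoC T * Ci)); rewrite (Rabs_left t) by lra; lra.
  - rewrite std_right by lra.
    le_via Cmod_triangle; rewrite Cmod_mult, Cmod_Cexp_Ci, Cmod_R, Rabs_pos_eq by lra.
    generalize (Cmod_triangle (RtoC sigma) (RtoC T * Ci)); rewrite (Rabs_pos_eq t) by lra; lra.
  - rewrite std_mid by lra. le_via Cmod_triangle; rewrite Cmod_mult, Cmod_Ci, !Cmod_R; lra.
Qed.

Lemma weight_pwc : pwc weight.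
Proof.
  destruct (contour_curve _ _ _ _ _ std_contour_ok) as [H1 [H2 _]].
  apply pwc_mult; [ apply pwc_rcont; intros t | auto ]. apply rcont_mult; [ | apply rcont_const ].
  apply (rcont_comp (kernel G tau m n a b alpha)); [ | apply H1 ].
  apply an_ccont, (kernel_an tau c1 c2 G Htau HG), std_not_pole.
Qed.

Lemma weight_bound (B : R) : exists D, 0 < D /\ forall t, Cmod (weight t) <= D * exp (- B * Rabs t).
Proof.
  destruct Hadm as [HT _]. assert (Hk := kap_pos _ pi8).
  set (dp := dirn (sgn_plus cls) 1 (PI / 8)). set (dm := dirn (sgn_minus cls) (-1) (PI / 8)).
  assert (Cp := cone_single _ _ _ pi8 (sgn_plus_cases cls) (or_introl (eq_refl 1))).
  assert (Cm := cone_single _ _ _ pi8 (sgn_minus_cases cls) (or_intror (eq_refl (-1)))).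
  set (sp := (RtoC sigma + RtoC T * Ci - RtoC T * dp)%C).
  set (sm := (RtoC sigma - RtoC T * Ci - RtoC T * dm)%C).
  destruct (cone_decay tau c1 c2 G Htau HG m n a b alpha (kap (PI / 8)) (Cmod sp + Cmod sm) (Rabs B) Hm Hn HN Hk)
    as [r0 [Hr0 HD]].
  { generalize (Cmod_ge_0 sp), (Cmod_ge_0 sm); lra. } set (R0 := r0 + T + 1).
  destruct (pwc_bounded weight (- R0) R0) as [M [PM HM]]; [ unfold R0; lra | apply weight_pwc | ].
  exists (M * exp (Rabs B * R0) + 1); split. { generalize (exp_pos (Rabs B * R0)); nra. } intros t.
  assert (PB := Rabs_pos B). assert (HB := Rle_abs B). destruct (Rle_dec (Rabs t) R0) as [Ht|Ht].
  - apply Rle_trans with (M * exp (Rabs B * R0) * exp (- B * Rabs t)).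
    + rewrite Rmult_assoc, <- exp_plus, <- (Rmult_1_r (Cmod _)).
      apply Rmult_le_compat; try lra; [ apply Cmod_ge_0 | apply HM, Rabs_le_between, Ht | ].
      apply exp_ge_1; generalize (Rabs_pos t); nra.
    + apply Rmult_le_compat_r; [ pos | lra ].
  - apply Rle_trans with (1 * exp (- B * Rabs t)).
    2:{ apply Rmult_le_compat_r; [ pos | generalize (exp_pos (Rabs B * R0)); nra ]. } rewrite Rmult_1_l.
    assert (Hexp : exp (- Rabs B * Rabs t ^ 2) <= exp (- B * Rabs t)).
    { apply exp_le_compat; unfold R0 in *; assert (1 <= Rabs t) by lra.
      assert (0 <= Rabs B * (Rabs t * (Rabs t - 1))) by pos. assert (0 <= (Rabs B - B) * Rabs t) by pos.
      simpl; lra. }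
    eapply Rle_trans; [ | apply Hexp ]. destruct two_pi_i as [N1 N2]; unfold weight.
    assert (Hfin : forall k v : C, Cmod v = 1 -> Cmod k <= exp (- Rabs B * Rabs t ^ 2) ->
      Cmod (k / (RtoC (2 * PI) * Ci) * v) <= exp (- Rabs B * Rabs t ^ 2)).
    { intros k v Hv Hkk; rewrite Cmod_mult, Hv, Rmult_1_r, Cmod_div by auto.
      eapply Rle_trans; [ | apply Hkk ].
      rewrite <- (Rmult_1_r (Cmod k)) at 2; apply Rmult_le_compat_l; [ apply Cmod_ge_0 | ].
      rewrite <- Rinv_1; apply Rinv_le_contravar; lra. }
    assert (Psp := Cmod_ge_0 sp). assert (Psm := Cmod_ge_0 sm). destruct (Rcase_abs t) as [Hneg|Hpos].
    + rewrite (Rabs_left t) in * by auto; unfold R0 in *. apply Hfin.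
      * unfold std_contour; rewrite velocity_std_left by lra; rewrite Cmod_opp; apply Cmod_Cexp_Ci.
      * replace (std_contour t) with (sm + RtoC (- t) * dm)%C; [ apply HD; (assumption || lra) | ].
        unfold std_contour; rewrite std_left, Cexp_theta_minus by lra; fold dm; unfold sm.
        rewrite RtoC_minus, !RtoC_opp; ring.
    + rewrite (Rabs_right t) in * by auto; unfold R0 in *. apply Hfin.
      * unfold std_contour; rewrite velocity_std_right by lra; apply Cmod_Cexp_Ci.
      * replace (std_contour t) with (sp + RtoC t * dp)%C; [ apply HD; (assumption || lra) | ].
        unfold std_contour; rewrite std_right, Cexp_theta_plus by lra; fold dp; unfold sp.
        rewrite RtoC_minus; ring.
Qed.

Definition J (Q : C -> C) (v : C) : Prop := gen_int (fun t => Q (std_contour t) * weight t)%C v.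

Lemma mult_pwc (Q : C -> C) : (forall t, ccont Q (std_contour t)) ->
  pwc (fun t => Q (std_contour t) * weight t)%C.
Proof.
  intros HQ; apply pwc_mult; [ | apply weight_pwc ].
  apply pwc_rcont; intros t; apply rcont_comp; [ apply HQ | ]. apply (contour_curve _ _ _ _ _ std_contour_ok).
Qed.

(** [D0] depends on the rate [B] alone. This uniformity in [Q] turns pointwise estimates of
    remainders into estimates of integrals. *)
Lemma J_bound (B : R) : exists D0, 0 < D0 /\ forall (Q : C -> C) (D : R),
  (forall t, ccont Q (std_contour t)) -> (forall t, Cmod (Q (std_contour t)) <= D * exp (B * Rabs t)) ->
  (exists v, J Q v) /\ forall v, J Q v -> Cmod v <= D0 * D.
Proof.
  destruct (weight_bound (B + 1)) as [D1 [P1 H1]]. exists (2 * D1); split; [ lra | intros Q D HQ HD ].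
  assert (Hb : forall t, Cmod (Q (std_contour t) * weight t) <= D * D1 * exp (- Rabs t)).
  { intros t; rewrite Cmod_mult.
    apply Rle_trans with (D * exp (B * Rabs t) * (D1 * exp (- (B + 1) * Rabs t))).
    - apply Rmult_le_compat; try apply Cmod_ge_0; auto.
    - replace (- Rabs t) with (B * Rabs t + - (B + 1) * Rabs t) by ring. rewrite exp_plus; right; ring. }
  split.
  - apply good_gen_int; split; [ apply mult_pwc, HQ | exists (D * D1); auto ].
  - intros v Hv; replace (2 * D1 * D) with (2 * (D * D1)) by ring.
    apply (gen_int_bound _ _ v (mult_pwc Q HQ) Hb Hv).
Qed.

Lemma Cexp_growth (w : C) (t : R) :
  Cmod (Cexp (- std_contour t * w)) <= exp (Cmod w * (Rabs sigma + T)) * exp (Cmod w * Rabs t).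
Proof.
  le_via Cmod_Cexp_le; rewrite <- exp_plus, <- Rmult_plus_distr_l; apply exp_le_compat.
  apply Rmult_le_compat_l; [ apply Cmod_ge_0 | apply std_contour_growth ].
Qed.

Lemma an_Cexp_mult (w s : C) : an (fun s => Cexp (- s * w)) s.
Proof. apply an_Cexp, an_mult; [ apply an_opp, an_id | apply an_const ]. Qed.

Lemma J_integrand (w : C) (t : R) :
  (Cexp (- std_contour t * w) * weight t)%C = (integrand w (std_contour t) * velocity std_contour t)%C.
Proof. unfold weight, integrand, Cdiv; ring. Qed.

(** [is_K_value] quantifies over all contours, so existence rests on [contour_independence], and
    uniqueness on the standard contour being one of them. *)
Lemma K_exists (w : C) : exists v, is_K_value G tau cls m n a b alpha w v /\
  forall v', is_K_value G tau cls m n a b alpha w v' -> J (fun s => Cexp (- s * w)) v'.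
Proof.
  destruct (J_bound (Cmod w)) as [D0 [_ HJ]].
  destruct (HJ (fun s => Cexp (- s * w)) (exp (Cmod w * (Rabs sigma + T)))) as [[v Hv] _].
  - intros t; apply an_ccont, an_Cexp_mult.
  - intros t; apply Cexp_growth.
  - assert (Hv' : gen_int (fun t => integrand w (std_contour t) * velocity std_contour t)%C v).
    { revert Hv; apply gen_int_ext; intros t; apply J_integrand. } exists v; split.
    + intros eps g He Hg. exact (proj2 (gen_int_iff _ v)
        (contour_independence w v (PI / 8) eps std_contour g pi8 He std_contour_ok Hg Hv')).
    + intros v' H.
      assert (H' := proj1 (gen_int_iff (fun t => integrand w (std_contour t) * velocity std_contour t)%C v')
        (H (PI / 8) std_contour pi8 std_contour_ok)).
      revert H'; apply gen_int_ext; intros t; symmetry; apply J_integrand.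
Qed.

Lemma K_spec (w : C) : is_K_value G tau cls m n a b alpha w (K G tau cls m n a b alpha w) /\
  J (fun s => Cexp (- s * w)) (K G tau cls m n a b alpha w) /\
  (forall v, is_K_value G tau cls m n a b alpha w v -> K G tau cls m n a b alpha w = v).
Proof.
  destruct (K_exists w) as [v [H1 H2]]. assert (Hu : forall v1 v2, is_K_value G tau cls m n a b alpha w v1 ->
    is_K_value G tau cls m n a b alpha w v2 -> v1 = v2).
  { intros v1 v2 E1 E2; apply (gen_int_unique _ _ _ (H2 v1 E1) (H2 v2 E2)). }
  assert (HK : is_K_value G tau cls m n a b alpha w (K G tau cls m n a b alpha w)).
  { unfold K; apply (iota_correct (V := C_R_CompleteNormedModule)).
    exists v; split; [ auto | intros v' Hv'; apply Hu; auto ]. }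
  split; [ auto | split; [ apply H2, HK | intros v' Hv'; apply Hu; auto ] ].
Qed.

Lemma K_J (w v : C) : J (fun s => Cexp (- s * w)) v -> K G tau cls m n a b alpha w = v.
Proof. intros H; apply (gen_int_unique _ _ _ (proj1 (proj2 (K_spec w))) H). Qed.

End KStd.

(** * Multipliers of a rapidly decaying weight on a contour *)

Section Pairing.

Variables (sc wt : R -> C) (S : R).
Hypothesis sc_growth : forall t, Cmod (sc t) <= S + Rabs t.

Definition pairing (Q : C -> C) (v : C) : Prop := gen_int (fun t => Q (sc t) * wt t)%C v.

Hypothesis pairing_bounded : forall B, exists D0, 0 < D0 /\ forall (Q : C -> C) (D : R),
  (forall t, ccont Q (sc t)) -> (forall t, Cmod (Q (sc t)) <= D * exp (B * Rabs t)) ->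
  (exists v, pairing Q v) /\ forall v, pairing Q v -> Cmod v <= D0 * D.

Lemma pairing_unique (Q : C -> C) (v w : C) : pairing Q v -> pairing Q w -> v = w.
Proof. apply gen_int_unique. Qed.

Lemma pairing_ext (P Q : C -> C) (v : C) : (forall t, P (sc t) = Q (sc t)) -> pairing P v -> pairing Q v.
Proof. intros H; apply gen_int_ext; intros t; rewrite H; reflexivity. Qed.

Lemma pairing_plus (P Q : C -> C) (v w : C) :
  pairing P v -> pairing Q w -> pairing (fun s => P s + Q s)%C (v + w).
Proof.
  intros H1 H2; generalize (gen_int_plus _ _ _ _ H1 H2). apply gen_int_ext; intros t; ring.
Qed.

Lemma pairing_scal (c : C) (P : C -> C) (v : C) : pairing P v -> pairing (fun s => c * P s)%C (c * v).
Proof. intros H; generalize (gen_int_scal c _ _ H); apply gen_int_ext; intros t; ring. Qed.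

Lemma pairing_minus (P Q : C -> C) (v w : C) :
  pairing P v -> pairing Q w -> pairing (fun s => P s - Q s)%C (v - w).
Proof.
  intros H1 H2; generalize (pairing_plus _ _ _ _ H1 (pairing_scal (- (1)) _ _ H2)).
  replace (v + - (1) * w)%C with (v - w)%C by ring. apply pairing_ext; intros t; ring.
Qed.

Definition tempered (Q : C -> C) : Prop :=
  (forall t, ccont Q (sc t)) /\
  exists D B, 0 <= D /\ 0 <= B /\ forall t, Cmod (Q (sc t)) <= D * exp (B * Rabs t).

Lemma tempered_pairing (Q : C -> C) : tempered Q -> exists v, pairing Q v.
Proof.
  intros [Hc [D [B [_ [_ HB]]]]]; destruct (pairing_bounded B) as [D0 [_ H]]. apply (H Q D Hc HB).
Qed.

Lemma tempered_const (c : C) : tempered (fun _ => c).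
Proof.
  split; [ intros t; apply ccont_const | ].
  exists (Cmod c), 0; split; [ apply Cmod_ge_0 | split; [ lra | intros t ] ]. rewrite Rmult_0_l, exp_0; lra.
Qed.

Lemma sc_exp (t : R) : Cmod (sc t) <= exp S * exp (1 * Rabs t).
Proof.
  rewrite <- exp_plus, Rmult_1_l. apply Rle_trans with (S + Rabs t); [ apply sc_growth | ].
  generalize (exp_ge_1_plus (S + Rabs t)); lra.
Qed.

Lemma tempered_id : tempered (fun s => s).
Proof.
  split; [ intros t; apply an_ccont, an_id | ].
  exists (exp S), 1; split; [ pos | split; [ lra | apply sc_exp ] ].
Qed.

Lemma tempered_plus (P Q : C -> C) : tempered P -> tempered Q -> tempered (fun s => P s + Q s)%C.
Proof.
  intros [P1 [D1 [B1 [HD1 [HB1 P2]]]]] [Q1 [D2 [B2 [HD2 [HB2 Q2]]]]].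
  split; [ intros t; apply ccont_plus; auto | ].
  exists (D1 + D2), (B1 + B2); split; [ lra | split; [ lra | intros t ] ]. le_via Cmod_triangle.
  rewrite Rmult_plus_distr_r; assert (PT := Rabs_pos t). apply Rplus_le_compat; [ le_via P2 | le_via Q2 ];
    (apply Rmult_le_compat_l; [ auto | apply exp_le_compat; nra ]).
Qed.

Lemma tempered_mult (P Q : C -> C) : tempered P -> tempered Q -> tempered (fun s => P s * Q s)%C.
Proof.
  intros [P1 [D1 [B1 [HD1 [HB1 P2]]]]] [Q1 [D2 [B2 [HD2 [HB2 Q2]]]]].
  split; [ intros t; apply ccont_mult; auto | ].
  exists (D1 * D2), (B1 + B2); split; [ nra | split; [ lra | intros t ] ].
  rewrite Cmod_mult, Rmult_plus_distr_r, exp_plus. replace (D1 * D2 * (exp (B1 * Rabs t) * exp (B2 * Rabs t)))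
    with (D1 * exp (B1 * Rabs t) * (D2 * exp (B2 * Rabs t))) by ring.
  apply Rmult_le_compat; auto using Cmod_ge_0.
Qed.

Lemma tempered_Cexp (w : C) : tempered (fun s => Cexp (- s * w)).
Proof.
  split; [ intros t; apply an_ccont, an_Cexp, an_mult; [ apply an_opp, an_id | apply an_const ] | ].
  exists (exp (Cmod w * S)), (Cmod w). split; [ pos | split; [ apply Cmod_ge_0 | intros t ] ].
  le_via Cmod_Cexp_le; rewrite <- exp_plus, <- Rmult_plus_distr_l; apply exp_le_compat.
  apply Rmult_le_compat_l; [ apply Cmod_ge_0 | apply sc_growth ].
Qed.

Lemma tempered_poch (k : nat) : tempered (fun s => poch s k).
Proof.
  induction k as [|k IH].
  - unfold poch; simpl; apply tempered_const.
  - assert (H := tempered_mult _ _ IH (tempered_plus _ _ tempered_id (tempered_const (RtoC (INR k))))).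
    cbv beta in H; destruct H as [H1 H2]; split.
    + intros t; apply (ccont_ext_near (fun s => poch s k * (s + RtoC (INR k)))%C);
        [ apply filter_forall; intros y; symmetry; apply poch_S | apply H1 ].
    + destruct H2 as [D [B [HD [HB H2]]]]; exists D, B; split; [ | split ]; try assumption.
      intros t; rewrite poch_S; apply H2.
Qed.

(** For [Cmod h < 1] the remainder [exp (- s h) - 1 + s h] is at most
    [Cmod h ^ 2 * exp (3 * Cmod s)], again a multiplier of exponential growth. Boundedness of the
    pairing then gives a quadratic remainder for [F]. *)
Lemma pairing_cder (P F F1 : C -> C) : tempered P ->
  (forall w, pairing (fun s => P s * Cexp (- s * w))%C (F w)) ->
  (forall w, pairing (fun s => - s * P s * Cexp (- s * w))%C (F1 w)) ->
  forall w, cder F w (F1 w).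
Proof.
  intros [Pc [D [B [HD [HB HP]]]]] HF HF1 w. destruct (pairing_bounded (B + Cmod w + 3)) as [D0 [PD0 HJ]].
  set (M := D * exp ((Cmod w + 3) * S)).
  assert (PM : 0 <= M) by (apply Rmult_le_pos; [ auto | left; apply exp_pos ]).
  apply (cder_quadratic _ _ _ (D0 * M)); [ pos | intros h Hh ].
  { assert (HQ : pairing (fun s => P s * Cexp (- s * w) * (Cexp (- s * h) - 1 - - s * h))%C
      (F (w + h)%C - F w - F1 w * h)).
    { assert (H := pairing_minus _ _ _ _ (pairing_minus _ _ _ _ (HF (w + h)%C) (HF w))
        (pairing_scal h _ _ (HF1 w))).
      rewrite (Cmult_comm (F1 w) h); revert H; apply pairing_ext; intros t; cbv beta.
      replace (- sc t * (w + h))%C with (- sc t * w + - sc t * h)%C by ring. rewrite Cexp_plus; ring. }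
    replace (D0 * M * (Cmod h * Cmod h)) with (D0 * (M * (Cmod h * Cmod h))) by ring.
    refine (proj2 (HJ _ _ _ _) _ HQ).
    - intros t; apply ccont_mult; [ apply ccont_mult; [ apply Pc | ] | ]; apply an_ccont.
      + apply an_Cexp, an_mult; [ apply an_opp, an_id | apply an_const ].
      + apply an_minus; [ apply an_minus; [ | apply an_const ] | ].
        * apply an_Cexp, an_mult; [ apply an_opp, an_id | apply an_const ].
        * apply an_mult; [ apply an_opp, an_id | apply an_const ].
    - intros t; rewrite !Cmod_mult. assert (G := sc_growth t). assert (N := Cmod_ge_0 (sc t)).
      assert (Nw := Cmod_ge_0 w). set (x := Cmod (sc t)) in *.
      assert (E1 : Cmod (Cexp (- sc t * w)) <= exp (Cmod w * x)) by apply Cmod_Cexp_le.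
      assert (E2 : Cmod (Cexp (- sc t * h) - 1 - - sc t * h) <= Cmod h * Cmod h * exp (3 * x)).
      { le_via Cexp_sub_1_id. rewrite Cmod_mult, Cmod_opp; fold x.
        apply Rle_trans with (Cmod h * Cmod h * (exp x * exp x * exp x)).
        - replace (x * Cmod h * (x * Cmod h) * exp (x * Cmod h))
            with (Cmod h * Cmod h * (x * x * exp (x * Cmod h))) by ring.
          apply Rmult_le_compat_l; [ nra | ]. assert (x <= exp x) by (generalize (exp_ge_1_plus x); lra).
          apply Rmult_le_compat; [ nra | pos | nra | apply exp_le_compat; nra ].
        - rewrite <- !exp_plus; right; f_equal; f_equal; ring. }
      apply Rle_trans with (D * exp (B * Rabs t) * exp (Cmod w * x) * (Cmod h * Cmod h * exp (3 * x))).
      + apply Rmult_le_compat; [ | apply Cmod_ge_0 | | auto ].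
        * pos.
        * apply Rmult_le_compat; try apply Cmod_ge_0; [ apply HP | auto ].
      + apply Rle_trans with (D * (Cmod h * Cmod h) * exp (B * Rabs t + Cmod w * x + 3 * x)).
        * rewrite !exp_plus; right; ring.
        * apply Rle_trans with (D * (Cmod h * Cmod h) * (exp ((Cmod w + 3) * S) * exp ((B + Cmod w + 3) * Rabs t)));
            [ | unfold M; right; ring ].
          rewrite <- exp_plus; apply Rmult_le_compat_l; [ nra | apply exp_le_compat; nra ]. }
Qed.

(* Successive [z]-derivatives multiply the integrand by [- (s + j) / z]. *)
Lemma pairing_cder_shift (P F F1 : C -> C) (j : nat) : tempered P ->
  (forall w, pairing (fun s => P s * Cexp (- s * w))%C (Cexp w ^ j * F w)) ->
  (forall w, pairing (fun s => - (s + RtoC (INR j)) * P s * Cexp (- s * w))%C (Cexp w ^ Datatypes.S j * F1 w)) ->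
  forall w, cder F w (F1 w * Cexp w).
Proof.
  intros HP HF HF1 w. assert (H := pairing_cder P (fun w => Cexp w ^ j * F w)%C
    (fun w => Cexp w ^ Datatypes.S j * F1 w + RtoC (INR j) * (Cexp w ^ j * F w))%C HP HF).
  assert (H' : cder (fun w => Cexp (- (RtoC (INR j)) * w) * (Cexp w ^ j * F w))%C w (F1 w * Cexp w)).
  { eapply cder_eq.
    - apply cder_mult; [ | apply H ].
      + apply (cder_comp Cexp (fun w => - (RtoC (INR j)) * w)%C);
          [ apply cder_Cexp | apply cder_scal, cder_id ].
      + intros w'; generalize (pairing_plus _ _ _ _ (HF1 w') (pairing_scal (RtoC (INR j)) _ _ (HF w'))).
        apply pairing_ext; intros t; ring.
    - cbv beta; replace (- (RtoC (INR j)) * w)%C with (- (RtoC (INR j) * w))%C by ring.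
      rewrite Cexp_opp, Cexp_pow; simpl Cpow; field. rewrite <- Cexp_pow; apply Cexp_neq_0. }
  revert H'; apply cder_ext; intros y. replace (- (RtoC (INR j)) * y)%C with (- (RtoC (INR j) * y))%C by ring.
  rewrite Cexp_opp, Cexp_pow; field. rewrite <- Cexp_pow; apply Cexp_neq_0.
Qed.

End Pairing.

(** * Derivatives in the coordinate [z = exp w] *)

(** The quotient in the definition is the ratio of the Caratheodory quotients of [f] and of [Cexp],
    the latter nonzero at [w]. *)
Lemma cder_ddz (f : C -> C) (w l : C) : cder f w (l * Cexp w) -> is_ddz f w l.
Proof.
  intros H; apply cder_quotient in H; destruct H as [q [E [Hq Eq]]].
  destruct (proj1 (cder_quotient _ _ _) (cder_Cexp w)) as [r [E' [Hr Er]]].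
  assert (Ew := Cexp_neq_0 w); assert (Nr : r w <> 0%C) by (rewrite Er; auto).
  assert (Q := ccont_mult _ _ w Hq (ccont_inv r w Nr Hr)); cbv beta in Q.
  intros P HP; apply locally_Cmod in HP; destruct HP as [eps [He HP]]; destruct (Q eps He) as [d [Hd K]].
  unfold filtermap, locally', within; apply locally_Cmod; exists d; split; [ auto | intros y Hy Ny ].
  specialize (K y Hy); apply HP; rewrite E, E'. assert (N' : (y - w)%C <> 0%C).
  { intros E0; apply Ny; change (@eq C y w); replace y with (y - w + w)%C by ring; rewrite E0; ring. }
  rewrite Eq, Er in K; replace (l * Cexp w * / Cexp w)%C with l in K by (field; auto).
  replace (q y * (y - w) / (r y * (y - w)))%C with (q y * / r y)%C; [ exact K | ].
  unfold Cdiv; rewrite Cinv_mult; generalize (/ r y)%C; intros x; field; auto.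
Qed.

Lemma ddz_n_chain (k : nat) (F : nat -> C -> C) :
  (forall j w, (j < k)%nat -> is_ddz (F j) w (F (S j) w)) -> is_ddz_n k (F 0%nat) (F k).
Proof.
  induction k as [|k IH]; intros H; simpl; [ reflexivity | ].
  exists (F k); split; [ apply IH; intros; apply H; lia | intros w; apply H; lia ].
Qed.

Lemma firstn_app_le {A : Type} (m : nat) (l l' : list A) : (m <= length l)%nat -> firstn m (l ++ l') = firstn m l.
Proof.
  intros H; rewrite firstn_app; replace (m - length l)%nat with 0%nat by lia; apply app_nil_r.
Qed.

Lemma skipn_app_le {A : Type} (m : nat) (l l' : list A) :
  (m <= length l)%nat -> skipn m (l ++ l') = skipn m l ++ l'.
Proof. intros H; rewrite skipn_app; replace (m - length l)%nat with 0%nat by lia; reflexivity. Qed.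

Lemma is_ddz_ext (f g : C -> C) (w l : C) : (forall y, f y = g y) -> is_ddz f w l -> is_ddz g w l.
Proof.
  intros E; unfold is_ddz; apply filterlim_ext; intros y; rewrite !E; reflexivity.
Qed.

Lemma is_ddz_n_ext (k : nat) : forall f f' g g' : C -> C,
  (forall w, f w = f' w) -> (forall w, g w = g' w) -> is_ddz_n k f g -> is_ddz_n k f' g'.
Proof.
  induction k as [|k IH]; simpl; intros f f' g g' Hf Hg.
  - intros H w; rewrite <- Hf, <- Hg; apply H.
  - intros [h [H1 H2]]; exists h; split; [ apply (IH f f' h h); auto | intros w; rewrite <- Hg; apply H2 ].
Qed.

Lemma Cprod_cons (x : C) (l : list C) : Cprod (x :: l) = (x * Cprod l)%C.
Proof. reflexivity. Qed.

Lemma Cprod_nil : Cprod [] = 1%C.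
Proof. reflexivity. Qed.

(** * Ratios of [G] and the derivatives of [K] *)

Section Barnes.

Variables (tau c1 c2 : R) (G : C -> C).
Hypothesis Htau : 0 < tau.
Hypothesis HG : forall z, filterlim (barnes_partial tau c1 c2 z) eventually (locally (G z)).
Hypothesis HG2 : forall z, not_Gamma_pole z ->
  (G (z + RtoC tau) = RtoC (Rpower (2 * PI) ((tau - 1) / 2)) * Rcpow tau (RtoC (1 / 2) - z) * CGamma z * G z)%C.

Lemma G_shift_tau (z : C) : exists K0 : C, K0 <> 0%C /\ forall z, not_Gamma_pole z ->
  (G (z + RtoC tau) = K0 * Rcpow tau (- z) * CGamma z * G z)%C.
Proof.
  exists (RtoC (Rpower (2 * PI) ((tau - 1) / 2)) * Rcpow tau (RtoC (1 / 2)))%C; split.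
  - apply Cmult_neq_0; [ apply RtoC_neq_0, Rgt_not_eq, exp_pos | apply Rcpow_neq_0 ].
  - intros y Hy; rewrite HG2 by auto.
    replace (RtoC (1 / 2) - y)%C with (RtoC (1 / 2) + - y)%C by ring; rewrite Rcpow_plus; ring.
Qed.

Lemma G_neq_0_Re (z : C) : 0 < Re z -> G z <> 0%C.
Proof.
  intros Hz E; destruct (barnes_G_eq_0 tau c1 c2 G Htau HG z E) as [kl Ek].
  rewrite Ek in Hz; unfold lat in Hz; autorewrite with ReIm in Hz.
  generalize (pos_INR (fst kl)), (pos_INR (snd kl)); intros; nra.
Qed.

(** Off the poles of Gamma, two shifts by [tau] leave [Gamma (s + k) / Gamma s]. At [s = - j] with
    [j < k], both [G s] and the Pochhammer product vanish; with [j >= k], the point [s + k] would be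
    a zero of [G], against the first hypothesis. *)
Lemma G_ratio_poch (s : C) (k : nat) :
  G (RtoC (INR k) + s)%C <> 0%C -> G (RtoC tau + s)%C <> 0%C ->
  (G s * G (RtoC (tau + INR k) + s) / (G (RtoC (INR k) + s) * G (RtoC tau + s))
   = RtoC (/ tau ^ k) * poch s k)%C.
Proof.
  intros N1 N2. destruct (classic (not_Gamma_pole s)) as [Hs|Hs].
  - destruct (G_shift_tau s) as [K0 [HK0 HF]]. assert (Hsk : not_Gamma_pole (s + RtoC (INR k))).
    { intros j E; apply (Hs (j + k)%nat); rewrite plus_INR.
      replace s with (s + RtoC (INR k) - RtoC (INR k))%C by ring. rewrite E, !RtoC_opp, RtoC_plus; ring. }
    assert (E1 := HF s Hs). assert (E2 := HF _ Hsk).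
    replace (RtoC tau + s)%C with (s + RtoC tau)%C in * by ring.
    replace (RtoC (tau + INR k) + s)%C with (s + RtoC (INR k) + RtoC tau)%C by (rewrite RtoC_plus; ring).
    replace (RtoC (INR k) + s)%C with (s + RtoC (INR k))%C in * by ring.
    assert (N3 : G s <> 0%C) by (intros E; apply N2; rewrite E1, E; ring).
    rewrite E2, E1, CGamma_poch by auto.
    replace (- (s + RtoC (INR k)))%C with (- s + RtoC (- INR k))%C by (rewrite RtoC_opp; ring).
    rewrite Rcpow_plus. replace (Rcpow tau (RtoC (- INR k))) with (RtoC (/ tau ^ k)).
    2:{ rewrite Rcpow_R by auto; f_equal; rewrite Rpower_Ropp, Rpower_pow by auto; reflexivity. }
    assert (N4 := CGamma_neq_0 s Hs). assert (N5 := Rcpow_neq_0 tau (- s)%C). field; repeat split; auto.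
  - apply not_all_ex_not in Hs; destruct Hs as [j Hj]; apply NNPP in Hj.
    destruct (le_lt_dec k j) as [Hkj|Hkj].
    + exfalso; apply N1. assert (E := barnes_G_zero tau c1 c2 G Htau HG (0%nat, (j - k)%nat)).
      rewrite <- E; f_equal; unfold lat; cbn [fst snd]; rewrite Hj, minus_INR, INR_0 by auto.
      rewrite RtoC_opp, RtoC_plus, RtoC_minus, RtoC_mult; ring.
    + assert (E : G s = 0%C). { assert (E := barnes_G_zero tau c1 c2 G Htau HG (0%nat, j)).
        rewrite <- E; f_equal; unfold lat; cbn [fst snd]; rewrite Hj, INR_0.
        rewrite RtoC_opp, RtoC_plus, RtoC_mult; ring. }
      assert (E' : poch s k = 0%C).
      { unfold poch; apply Cprod_in_0, in_map_iff; exists j; split; [ rewrite Hj, RtoC_opp; ring | ].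
        apply in_seq; lia. }
      rewrite E, E'; unfold Cdiv; ring.
Qed.

(** Stated with [Beta] instead of a quotient of Gamma values, because truncated beta integrals are
    what the Euler transform converges from. *)
Lemma G_ratio_Gamma (x y : C) : 0 < Re x -> 0 < Re y ->
  (G (x + RtoC tau) * G (x + y) / (G x * G (x + y + RtoC tau)) = Rcpow tau y * (/ CGamma y * Beta x y))%C.
Proof.
  intros Hx Hy; destruct (G_shift_tau x) as [K0 [HK0 HF]].
  assert (Hxy : 0 < Re (x + y)) by (autorewrite with ReIm; lra).
  rewrite (HF x), (HF (x + y)%C) by (apply not_pole_Re; auto). assert (B := Beta_CGamma x y Hx Hy).
  assert (N2 := CGamma_neq_0 _ (not_pole_Re _ Hy)). assert (N3 := CGamma_neq_0 _ (not_pole_Re _ Hxy)).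
  assert (N4 := G_neq_0_Re _ Hx). assert (N5 := G_neq_0_Re _ Hxy).
  replace (- x)%C with (- (x + y) + y)%C by ring; rewrite Rcpow_plus.
  assert (N6 := Rcpow_neq_0 tau (- (x + y))%C).
  replace (Beta x y) with (CGamma x * CGamma y / CGamma (x + y))%C by (rewrite B; field; auto).
  field; repeat split; auto.
Qed.

Variables (m n : nat) (a b : list C) (alpha : C).
Hypotheses (Hm : (m <= length b)%nat) (Hn : (n <= length a)%nat)
  (HN : (order_N m n (length a) (length b) < 0)%Z).

Lemma pairing_K_unique (cls : contour_class) (sigma T : R) (w v : C) : admissible tau m n a b sigma T ->
  pairing (std_contour cls sigma T) (weight tau G m n a b alpha cls sigma T) (fun s => Cexp (- s * w)) v ->
  K G tau cls m n a b alpha w = v.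
Proof. intros H; exact (K_J tau c1 c2 G Htau HG m n a b alpha Hm Hn HN cls sigma T H w v). Qed.

Lemma pairing_weight (cls : contour_class) (sigma T : R) (m' n' : nat) (a' b' : list C) (rho Q : C -> C) (v : C) :
  (forall t, let s := std_contour cls sigma T t in
     kernel G tau m' n' a' b' alpha s = rho s * kernel G tau m n a b alpha s)%C ->
  pairing (std_contour cls sigma T) (weight tau G m' n' a' b' alpha cls sigma T) Q v ->
  pairing (std_contour cls sigma T) (weight tau G m n a b alpha cls sigma T) (fun s => rho s * Q s)%C v.
Proof.
  intros H; apply gen_int_ext; intros t; specialize (H t); cbv zeta in H.
  unfold weight; rewrite H; unfold Cdiv; ring.
Qed.

(** The new parameters enter only through two products of [G], so the two orders in which they are
    listed when [k = 1] are both instances. *)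
Lemma K_derivatives (cls : contour_class) (k : nat) (x y u v : C) :
  (forall s, G (RtoC (1 + tau) - x + s) * G (RtoC (1 + tau) - y + s) = G s * G (RtoC (tau + INR k) + s))%C ->
  (forall s, G (RtoC (1 + tau) - u + s) * G (RtoC (1 + tau) - v + s) = G (RtoC (INR k) + s) * G (RtoC tau + s))%C ->
  let a' := [x; y] ++ a in let b' := b ++ [u; v] in
  Rbar_lt (lambda_sharp tau m b') (lambda_flat (n + 2) a') ->
  is_ddz_n k (K G tau cls m n a b alpha)
    (fun w => RtoC ((- tau) ^ k) / Cexp w ^ k * K G tau cls m (n + 2) a' b' alpha w)%C.
Proof.
  intros Hxy Huv a' b' Hlam. assert (Sk : skipn m b' = skipn m b ++ [u; v]) by (apply skipn_app_le, Hm).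
  assert (Fk : firstn m b' = firstn m b) by (apply firstn_app_le, Hm).
  assert (Sn : skipn (n + 2) a' = skipn n a) by (rewrite Nat.add_comm; reflexivity).
  assert (Fn : firstn (n + 2) a' = x :: y :: firstn n a) by (rewrite Nat.add_comm; reflexivity).
  (* The abscissa is chosen for the enlarged set, whose poles include those of the original one; the
     same contour then serves both. *)
  destruct (Rbar_between _ _ Hlam) as [sigma [L1 L2]].
  destruct (admissible_exists tau m (n + 2) a' b' sigma Htau L1 L2) as [T HT].
  assert (Hadm' := HT T (Rle_refl T)); clear HT L1 L2 Hlam. assert (Hadm : admissible tau m n a b sigma T).
  { destruct Hadm' as [A1 [A2 A3]]; split; [ auto | split ].
    - intros s [aj [l [j [Hin E]]]]; apply A2; exists aj, l, j; rewrite Sn; auto.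
    - intros s [bj [l [j [Hin [H1 [H2 E]]]]]]; apply A3; exists bj, l, j; rewrite Sk.
      repeat split; auto; apply in_or_app; auto. }
  assert (Hm' : (m <= length b')%nat) by (unfold b'; rewrite length_app; lia).
  assert (Hn' : (n + 2 <= length a')%nat) by (unfold a'; rewrite length_app; simpl; lia).
  assert (HN' : (order_N m (n + 2) (length a') (length b') < 0)%Z).
  { unfold a', b'; rewrite !length_app; simpl length; revert HN; unfold order_N; lia. }
  set (sc := std_contour cls sigma T). set (wt := weight tau G m n a b alpha cls sigma T).
  assert (Hker : forall t, let s := sc t in kernel G tau m (n + 2) a' b' alpha s
    = (RtoC (/ tau ^ k) * poch s k * kernel G tau m n a b alpha s)%C).
  { intros t s. assert (Hnp : ~ Lambda_minus tau m b' s).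
    { intros Hp; apply (std_not_pole tau G m (n + 2) a' b' alpha cls sigma T Hadm' t); right; auto. }
    assert (Nu : G (RtoC (1 + tau) - u + s)%C <> 0%C)
      by (apply (G_plus_neq_0 tau c1 c2 G Htau HG m b'); [ rewrite Sk; apply in_or_app; simpl; auto | auto ]).
    assert (Nv : G (RtoC (1 + tau) - v + s)%C <> 0%C)
      by (apply (G_plus_neq_0 tau c1 c2 G Htau HG m b'); [ rewrite Sk; apply in_or_app; simpl; auto | auto ]).
    assert (Nuv := Cmult_neq_0 _ _ Nu Nv); rewrite Huv in Nuv.
    rewrite <- G_ratio_poch; [ | intros E; apply Nuv; rewrite E; ring | intros E; apply Nuv; rewrite E; ring ].
    rewrite <- Huv, <- Hxy; unfold kernel.
    rewrite Sk, Fk, Sn, Fn, map_app, Cprod_app; cbn [map]; rewrite !Cprod_cons, Cprod_nil, Cmult_1_r.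
    unfold Cdiv; rewrite !Cinv_mult; ring. }
  set (S := Rabs sigma + T).
  assert (Hgr : forall t, Cmod (sc t) <= S + Rabs t) by apply (std_contour_growth tau m n a b cls sigma T Hadm).
  assert (Hbd := J_bound tau c1 c2 G Htau HG m n a b alpha Hm Hn HN cls sigma T Hadm).
  (* [z^j] times the [j]-th derivative of [K] has the multiplier
     [(-1)^j s (s + 1) ... (s + j - 1)]. *)
  set (Q := fun (j : nat) (s : C) => (RtoC ((-1) ^ j) * poch s j)%C).
  assert (HQ : forall j, tempered sc (Q j)).
  { intros j; apply (tempered_mult sc); [ apply tempered_const | apply (tempered_poch sc S Hgr) ]. }
  set (Phi := fun (j : nat) (w : C) =>
    epsilon (inhabits (RtoC 0)) (pairing sc wt (fun s => Q j s * Cexp (- s * w))%C)).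
  assert (HPhi : forall j w, pairing sc wt (fun s => Q j s * Cexp (- s * w))%C (Phi j w)).
  { intros j w; unfold Phi; apply epsilon_spec.
    apply (tempered_pairing sc wt Hbd), (tempered_mult sc); [ apply HQ | apply (tempered_Cexp sc S Hgr) ]. }
  assert (Npow : forall w j, (Cexp w ^ j)%C <> 0%C) by (intros w j; rewrite <- Cexp_pow; apply Cexp_neq_0).
  set (F := fun (j : nat) (w : C) => (Phi j w / Cexp w ^ j)%C).
  assert (HF : forall j w, pairing sc wt (fun s => Q j s * Cexp (- s * w))%C (Cexp w ^ j * F j w)).
  { intros j w; replace (Cexp w ^ j * F j w)%C with (Phi j w) by (unfold F; field; apply Npow). apply HPhi. }
  apply (is_ddz_n_ext k (F 0%nat) _ (F k)).
  - intros w; symmetry; apply (pairing_K_unique cls sigma T w _ Hadm).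
    generalize (HF 0%nat w); simpl Cpow; rewrite Cmult_1_l.
    apply pairing_ext; intros t; unfold Q, poch; simpl; rewrite Cmult_1_r, Cmult_1_l; reflexivity.
  - intros w.
    assert (H1 := proj1 (proj2 (K_spec tau c1 c2 G Htau HG m (n + 2) a' b' alpha Hm' Hn' HN' cls sigma T Hadm' w))).
    assert (H2 := pairing_weight cls sigma T m (n + 2) a' b' (fun s => RtoC (/ tau ^ k) * poch s k)%C _ _ Hker H1).
    apply (pairing_scal sc wt (RtoC ((- tau) ^ k))) in H2.
    assert (E : (Cexp w ^ k * F k w = RtoC ((- tau) ^ k) * K G tau cls m (n + 2) a' b' alpha w)%C).
    { apply (pairing_unique sc wt _ _ _ (HF k w)); revert H2; apply pairing_ext; intros t; unfold Q.
      replace ((-1) ^ k) with ((- tau) ^ k * / tau ^ k); [ rewrite RtoC_mult; ring | ].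
      replace (- tau) with (-1 * tau) by ring; rewrite Rpow_mult_distr; field; apply pow_nonzero; lra. }
    replace (F k w) with (Cexp w ^ k * F k w / Cexp w ^ k)%C by (field; apply Npow).
    rewrite E; unfold Cdiv; ring.
  - apply ddz_n_chain; intros j w _; apply cder_ddz.
    apply (pairing_cder_shift sc wt S Hgr Hbd (Q j) (F j) (F (Datatypes.S j)) j (HQ j) (HF j)).
    intros w'; generalize (HF (Datatypes.S j) w'); apply pairing_ext; intros t; unfold Q.
    rewrite poch_S, <- tech_pow_Rmult, RtoC_mult. ring.
Qed.

End Barnes.

(** * The Euler transform *)

Definition ends_int (h : R -> C) (L : R) (v : C) : Prop :=
  forall eps, 0 < eps -> exists d, 0 < d /\ forall a b, 0 < a < d -> L - d < b < L ->
    exists w, is_CI h a b w /\ Cmod (w - v) < eps.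

Lemma ends_int_iff (h : R -> C) (L : R) (v : C) :
  is_RInt_gen (V := C_R_NormedModule) h (at_right 0) (at_left L) v <-> ends_int h L v.
Proof.
  split.
  - intros H eps He. assert (HP : locally (T := C_R_NormedModule) v (fun y => Cmod (y - v) < eps)).
    { apply locally_Cmod; exists eps; auto. } destruct (H _ HP) as [Q S [d1 HQ] [d2 HS] HQS].
    exists (Rmin d1 d2); split; [ apply Rmin_pos; apply cond_pos | intros a b Ha Hb ].
    assert (M1 := Rmin_l d1 d2). assert (M2 := Rmin_r d1 d2). destruct (HQS a b) as [w [Hw1 Hw2]].
    + apply HQ; [ | lra ].
      unfold ball; simpl; unfold AbsRing_ball, abs, minus, plus, opp; simpl; rewrite Rabs_pos_eq; lra.
    + apply HS; [ | lra ].
      unfold ball; simpl; unfold AbsRing_ball, abs, minus, plus, opp; simpl; rewrite Rabs_left; lra.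
    + exists w; split; auto.
  - intros H P HP; apply locally_Cmod in HP; destruct HP as [eps [He HP]]. destruct (H eps He) as [d [Hd HR]].
    apply (Filter_prod _ _ _ (fun a => 0 < a < d) (fun b => L - d < b < L)).
    + exists (mkposreal d Hd); intros y Hy H0.
      unfold ball in Hy; simpl in Hy; unfold AbsRing_ball, abs, minus, plus, opp in Hy; simpl in Hy.
      apply Rabs_lt_between in Hy; lra.
    + exists (mkposreal d Hd); intros y Hy H0.
      unfold ball in Hy; simpl in Hy; unfold AbsRing_ball, abs, minus, plus, opp in Hy; simpl in Hy.
      apply Rabs_lt_between in Hy; lra.
    + intros a b Ha Hb; destruct (HR a b Ha Hb) as [w [Hw1 Hw2]].
      exists w; split; [ exact Hw1 | apply HP, Hw2 ].
Qed.

Lemma Cmod_Rcpow_le (l t : R) (c : C) : 0 < l <= t -> t <= 1 -> Cmod (Rcpow t c) <= exp (Cmod c * - ln l).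
Proof.
  intros Hl Ht; rewrite Cmod_Rcpow; unfold Rpower; apply exp_le_compat.
  assert (H1 : ln l <= ln t) by (destruct (proj2 Hl) as [H| ->]; [ left; apply ln_increasing; lra | lra ]).
  assert (H2 : ln t <= 0) by (rewrite <- ln_1; destruct Ht as [H| ->]; [ left; apply ln_increasing; lra | lra ]).
  generalize (Re_le_Cmod c); intros H; apply Rabs_le_between in H; nra.
Qed.

Section BetaPart.

Variables (x y : C) (l : R).
Hypothesis Hl : 0 < l.

Let L := - ln l.
Let M := exp ((Cmod x + Cmod y + 3) * (1 + L)).

Lemma beta_fun_le (t : R) : l <= t <= 1 - l -> Cmod (beta_fun x y t) <= exp ((Cmod x + Cmod y + 2) * L).
Proof.
  intros Ht; unfold beta_fun; rewrite Cmod_mult.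
  eapply Rle_trans; [ apply Rmult_le_compat; try apply Cmod_ge_0; apply (Cmod_Rcpow_le l); lra | fold L ].
  rewrite <- exp_plus; apply exp_le_compat.
  assert (N1 := Cmod_triangle_minus x 1). assert (N2 := Cmod_triangle_minus y 1). rewrite Cmod_1 in N1, N2.
  assert (HL : 0 <= L).
  { unfold L; assert (ln l <= ln 1) by (left; apply ln_increasing; lra). rewrite ln_1 in *; lra. } nra.
Qed.

Lemma beta_fun_dR (t : R) : l <= t <= 1 - l -> exists v, dR (beta_fun x y) t v /\ Cmod v <= M.
Proof.
  intros Ht; eexists; split; [ apply dR_mult; [ apply dR_Rcpow | apply dR_Rcpow_1m ]; lra | ].
  assert (N1 := Cmod_triangle_minus x 1). assert (N2 := Cmod_triangle_minus y 1). rewrite Cmod_1 in N1, N2.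
  assert (N3 := Cmod_triangle_minus (x - 1) 1). assert (N4 := Cmod_triangle_minus (y - 1) 1).
  rewrite Cmod_1 in N3, N4. assert (HL : 0 <= L).
  { unfold L; assert (ln l <= ln 1) by (left; apply ln_increasing; lra). rewrite ln_1 in *; lra. }
  assert (B : forall c u k, l <= u <= 1 - l -> Cmod c <= k -> Cmod (Rcpow u c) <= exp (k * L)).
  { intros c u k Hu Hk; eapply Rle_trans; [ apply (Cmod_Rcpow_le l); lra | fold L; apply exp_le_compat; nra ]. }
  set (X := Cmod x) in *. set (Y := Cmod y) in *.
  apply Rle_trans with ((X + 1) * exp ((X + 2) * L) * exp ((Y + 1) * L)
    + exp ((X + 1) * L) * ((Y + 1) * exp ((Y + 2) * L))).
  - le_via Cmod_triangle; rewrite !Cmod_mult, Cmod_opp, Cmod_mult.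
    apply Rplus_le_compat; repeat apply Rmult_le_compat; try apply Rmult_le_pos; try apply Cmod_ge_0;
      try (apply B; lra); lra.
  - apply Rle_trans with ((X + Y + 3) * exp ((X + Y + 3) * L)).
    + replace (exp ((X + 1) * L) * ((Y + 1) * exp ((Y + 2) * L)))
        with ((Y + 1) * (exp ((X + 1) * L) * exp ((Y + 2) * L))) by ring.
      rewrite Rmult_assoc, <- !exp_plus. replace ((X + 2) * L + (Y + 1) * L) with ((X + Y + 3) * L) by ring.
      replace ((X + 1) * L + (Y + 2) * L) with ((X + Y + 3) * L) by ring.
      generalize (exp_pos ((X + Y + 3) * L)); nra.
    + unfold M; fold X Y; rewrite Rmult_plus_distr_l, exp_plus, Rmult_1_r. apply Rmult_le_compat_r; [ pos | ].
      generalize (exp_ge_1_plus (X + Y + 3)); lra.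
Qed.

Lemma beta_fun_lip (t u : R) : l <= t <= 1 - l -> l <= u <= 1 - l ->
  Cmod (beta_fun x y t - beta_fun x y u) <= M * Rabs (t - u).
Proof.
  intros Ht Hu.
  set (F' := fun t => epsilon (inhabits (RtoC 0)) (fun v => dR (beta_fun x y) t v /\ Cmod v <= M)).
  assert (HF : forall t, l <= t <= 1 - l -> dR (beta_fun x y) t (F' t) /\ Cmod (F' t) <= M).
  { intros r Hr; unfold F'; apply epsilon_spec, beta_fun_dR, Hr. } destruct (Rle_dec u t) as [H|H].
  - rewrite Rabs_pos_eq by lra; apply (mean_value_ineq (beta_fun x y) F'); [ auto | | ]; intros; apply HF; lra.
  - rewrite Rabs_left, Cmod_minus_sym by lra; replace (- (t - u)) with (u - t) by ring.
    apply (mean_value_ineq (beta_fun x y) F'); [ lra | | ]; intros; apply HF; lra.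
Qed.

Lemma beta_part_quadratic (a u v : R) : l <= a -> a <= u <= 1 - l -> a <= v <= 1 - l ->
  Cmod (beta_part x y a v - beta_part x y a u - RtoC (v - u) * beta_fun x y u) <= M * (Rabs (v - u) * Rabs (v - u)).
Proof.
  intros Ha Hu Hv. assert (PM : 0 < M) by pos.
  assert (Aux : forall p q r, l <= p -> p <= q -> q <= 1 - l -> l <= r <= 1 - l -> p <= r <= q ->
    Cmod (beta_part x y p q - RtoC (q - p) * beta_fun x y r) <= M * (q - p) * (q - p)).
  { intros p q r Hp Hpq Hq Hr Hrr.
    apply (is_CI_Cmod_le_const (fun t => beta_fun x y t - beta_fun x y r)%C); [ auto | | ].
    - intros t Ht; eapply Rle_trans; [ apply beta_fun_lip; lra | ].
      apply Rmult_le_compat_l; [ lra | apply Rabs_le; lra ].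
    - apply is_CI_minus; [ apply beta_part_correct; lra | apply is_CI_const ]. }
  destruct (Rle_dec u v) as [H|H].
  - rewrite (beta_part_Chasles x y a u v), Rabs_pos_eq by lra.
    replace (beta_part x y a u + beta_part x y u v - beta_part x y a u - RtoC (v - u) * beta_fun x y u)%C
      with (beta_part x y u v - RtoC (v - u) * beta_fun x y u)%C by ring.
    rewrite <- Rmult_assoc; apply Aux; lra.
  - rewrite (beta_part_Chasles x y a v u), Rabs_left by lra.
    replace (beta_part x y a v - (beta_part x y a v + beta_part x y v u) - RtoC (v - u) * beta_fun x y u)%C
      with (- (beta_part x y v u - RtoC (u - v) * beta_fun x y u))%C by (rewrite !RtoC_minus; ring).
    rewrite Cmod_opp, <- Rmult_assoc; replace (- (v - u)) with (u - v) by ring; apply Aux; lra.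
Qed.

Lemma beta_part_le (a b : R) : l <= a -> a <= b <= 1 - l ->
  Cmod (beta_part x y a b) <= exp ((Cmod x + Cmod y + 2) * L).
Proof.
  intros Ha Hb; apply Rle_trans with (exp ((Cmod x + Cmod y + 2) * L) * (b - a)).
  - apply (is_CI_Cmod_le_const (beta_fun x y)); [ lra | | apply beta_part_correct; lra ].
    intros t Ht; apply beta_fun_le; lra.
  - rewrite <- (Rmult_1_r (exp _)) at 2; apply Rmult_le_compat_l; [ pos | lra ].
Qed.

Lemma beta_part_ccont (a b : R) : l <= a -> a <= b <= 1 - l -> ccont (fun x => beta_part x y a b) x.
Proof.
  intros Ha Hb. assert (HL : 0 <= L).
  { unfold L; assert (ln l <= ln 1) by (left; apply ln_increasing; lra). rewrite ln_1 in *; lra. }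
  set (E := exp ((Cmod x + Cmod y + 2) * L) * (L * exp L)). assert (PE : 0 <= E) by (unfold E; pos).
  intros eps He; exists (Rmin 1 (eps / (E + 1))); split. { pos. } intros x' Hx'.
  assert (M1 := Rmin_l 1 (eps / (E + 1))). assert (M2 := Rmin_r 1 (eps / (E + 1))).
  set (h := (x' - x)%C) in *. assert (Nh := Cmod_ge_0 h). apply Rle_lt_trans with (E * Cmod h * (b - a)).
  - apply (is_CI_Cmod_le_const (fun t => beta_fun x' y t - beta_fun x y t)%C); [ lra | | ].
    2:{ apply is_CI_minus; apply beta_part_correct; lra. } intros t Ht.
    assert (Eq : (beta_fun x' y t - beta_fun x y t)%C = (beta_fun x y t * (Cexp (h * RtoC (ln t)) - 1))%C).
    { unfold beta_fun; replace (x' - 1)%C with ((x - 1) + h)%C by (unfold h; ring).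
      rewrite Rcpow_plus; unfold Rcpow at 2; ring. }
    rewrite Eq, Cmod_mult; unfold E. assert (Hln : Cmod (h * RtoC (ln t)) <= Cmod h * L).
    { rewrite Cmod_mult, Cmod_R; apply Rmult_le_compat_l; [ auto | ].
      assert (ln l <= ln t) by (destruct (proj1 Ht) as [H| <-]; [ left; apply ln_increasing; lra |
        destruct Ha as [H| ->]; [ left; apply ln_increasing; lra | lra ] ]).
      assert (ln t <= ln 1) by (left; apply ln_increasing; lra). rewrite ln_1 in *.
      unfold L; rewrite Rabs_left1; lra. }
    apply Rle_trans with (exp ((Cmod x + Cmod y + 2) * L) * (Cmod h * L * exp (Cmod h * L))).
    + apply Rmult_le_compat; try apply Cmod_ge_0; [ apply beta_fun_le; lra | ]. le_via Cexp_sub_1.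
      apply Rmult_le_compat; [ apply Cmod_ge_0 | pos | auto | apply exp_le_compat, Hln ].
    + rewrite (Rmult_assoc (exp ((Cmod x + Cmod y + 2) * L))); apply Rmult_le_compat_l; [ pos | ].
      replace (L * exp L * Cmod h) with (Cmod h * L * exp L) by ring.
      apply Rmult_le_compat_l; [ pos | apply exp_le_compat; nra ].
  - apply Rle_lt_trans with (E * Cmod h).
    + rewrite <- (Rmult_1_r (E * Cmod h)) at 2; apply Rmult_le_compat_l; [ pos | lra ].
    + assert (Q : eps / (E + 1) * (E + 1) = eps) by (field; lra). nra.
Qed.

End BetaPart.

Section PairingBeta.

Variables (sc wt : R -> C) (S : R).
Hypothesis sc_growth : forall t, Cmod (sc t) <= S + Rabs t.
Hypothesis pairing_bounded : forall B, exists D0, 0 < D0 /\ forall (Q : C -> C) (D : R),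
  (forall t, ccont Q (sc t)) -> (forall t, Cmod (Q (sc t)) <= D * exp (B * Rabs t)) ->
  (exists v, pairing sc wt Q v) /\ forall v, pairing sc wt Q v -> Cmod v <= D0 * D.

Variables (be ga : C).

Lemma tempered_beta_part (l a b : R) : 0 < l <= a -> a <= b <= 1 - l ->
  tempered sc (fun s => beta_part (be - s) ga a b).
Proof.
  intros Ha Hb; split.
  - intros t; apply (ccont_comp (fun x => beta_part x ga a b) (fun s => be - s)%C).
    + apply (beta_part_ccont _ _ l); lra.
    + apply an_ccont, an_minus; [ apply an_const | apply an_id ].
  - set (L := - ln l). assert (HL : 0 <= L).
    { unfold L; assert (ln l <= ln 1) by (left; apply ln_increasing; lra). rewrite ln_1 in *; lra. }
    exists (exp ((Cmod be + S + Cmod ga + 2) * L)), L. split; [ pos | split; [ auto | intros t ] ].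
    eapply Rle_trans; [ apply (beta_part_le _ _ l); lra | fold L; rewrite <- exp_plus; apply exp_le_compat ].
    assert (T := Cmod_triangle_minus be (sc t)). assert (G := sc_growth t). nra.
Qed.

(* Fubini: [x -> beta_part (be - s) ga a x] is a primitive of the integrand,
   uniformly to second order along the contour. *)
Lemma pairing_beta_part (Kf Kf1 : C -> C) (w : C) (a b : R) : 0 < a -> a <= b -> b < 1 ->
  (forall w, pairing sc wt (fun s => Cexp (- s * w)) (Kf w)) -> (forall w, cder Kf w (Kf1 w)) ->
  exists v, is_CI (fun t => Rcpow t (be - 1) * Rcpow (1 - t) (ga - 1) * Kf (w + RtoC (ln t))%C)%C a b v /\
    pairing sc wt (fun s => beta_part (be - s) ga a b * Cexp (- s * w))%C v.
Proof.
  intros Ha Hab Hb HK HK1.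
  set (f := fun t => (Rcpow t (be - 1) * Rcpow (1 - t) (ga - 1) * Kf (w + RtoC (ln t))%C)%C).
  set (l := Rmin (a / 2) ((1 - b) / 2)).
  assert (L1 : l <= a / 2) by apply Rmin_l. assert (L2 : l <= (1 - b) / 2) by apply Rmin_r.
  (* The base point [a / 2] and the bound [1 - l] leave room on both sides of [[a, b]], so that the
     primitive is differentiable at the end points as well. *)
  assert (L0 : 0 < l) by pos. set (x0 := a / 2).
  assert (Ht : forall y, x0 <= y <= 1 - l -> tempered sc (fun s => beta_part (be - s) ga x0 y * Cexp (- s * w))%C).
  { intros y Hy; apply (tempered_mult sc);
      [ apply (tempered_beta_part l); unfold x0 in *; lra | apply (tempered_Cexp sc S sc_growth) ]. }
  set (Psi := fun y => epsilon (inhabits (RtoC 0))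
    (pairing sc wt (fun s => beta_part (be - s) ga x0 y * Cexp (- s * w))%C)).
  assert (HPsi : forall y, x0 <= y <= 1 - l ->
    pairing sc wt (fun s => beta_part (be - s) ga x0 y * Cexp (- s * w))%C (Psi y)).
  { intros y Hy; unfold Psi; apply epsilon_spec, (tempered_pairing sc wt pairing_bounded), Ht, Hy. }
  assert (Hf : forall y, 0 < y -> pairing sc wt (fun s => beta_fun (be - s) ga y * Cexp (- s * w))%C (f y)).
  { intros y Hy; generalize (pairing_scal sc wt (Rcpow y (be - 1) * Rcpow (1 - y) (ga - 1)) _ _ (HK (w + RtoC (ln y))%C)).
    apply pairing_ext; intros t; unfold beta_fun.
    replace (be - sc t - 1)%C with (be - 1 + - sc t)%C by ring; rewrite Rcpow_plus.
    replace (- sc t * (w + RtoC (ln y)))%C with (- sc t * RtoC (ln y) + - sc t * w)%C by ring.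
    rewrite Cexp_plus; unfold Rcpow; ring. }
  exists (Psi b - Psi a)%C; split.
  - apply is_CI_dR; [ auto | | ].
    + intros y Hy; apply dR_eps; intros eps He. set (L := - ln l). assert (HL : 0 <= L).
      { unfold L; assert (ln l <= ln 1) by (left; apply ln_increasing; lra). rewrite ln_1 in *; lra. }
      destruct (pairing_bounded (1 + L + Cmod w)) as [D0 [PD0 HD]].
      set (D := exp ((Cmod be + S + Cmod ga + 3) * (1 + L) + Cmod w * S)). assert (PD : 0 < D) by pos.
      assert (PE : 0 < D0 * D) by pos. exists (Rmin (l / 2) (eps / (D0 * D))); split; [ pos | intros y' Hh ].
      rewrite <- RtoC_minus, Cmod_R; set (h := y' - y) in *; replace y' with (y + h) by (unfold h; ring).
      assert (M1 := Rmin_l (l / 2) (eps / (D0 * D))). assert (M2 := Rmin_r (l / 2) (eps / (D0 * D))).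
      assert (Hhb : Rabs h < l / 2) by lra. apply Rabs_lt_between in Hhb.
      assert (Hy1 : x0 <= y + h <= 1 - l) by (unfold x0; lra).
      assert (Hy2 : x0 <= y <= 1 - l) by (unfold x0; lra).
      assert (HP := pairing_minus sc wt _ _ _ _ (pairing_minus sc wt _ _ _ _ (HPsi _ Hy1) (HPsi _ Hy2))
        (pairing_scal sc wt (RtoC h) _ _ (Hf y ltac:(lra)))).
      apply Rle_trans with (D0 * (D * (Rabs h * Rabs h))).
      * rewrite (Cmult_comm (f y)); refine (proj2 (HD _ _ _ _) _ HP).
        -- intros t; apply ccont_minus; [ apply ccont_minus; apply Ht; auto | ].
           apply ccont_mult; [ apply ccont_const | apply ccont_mult; [ | apply (tempered_Cexp sc S sc_growth) ] ].
           unfold beta_fun, Rcpow; apply an_ccont, an_mult; [ | apply an_const ].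
           apply an_Cexp, an_mult; [ | apply an_const ].
           repeat apply an_minus; try apply an_const; apply an_id.
        -- intros t; assert (G := sc_growth t).
           replace (beta_part (be - sc t) ga x0 (y + h) * Cexp (- sc t * w) -
             beta_part (be - sc t) ga x0 y * Cexp (- sc t * w) -
             RtoC h * (beta_fun (be - sc t) ga y * Cexp (- sc t * w)))%C
             with ((beta_part (be - sc t) ga x0 (y + h) - beta_part (be - sc t) ga x0 y
               - RtoC (y + h - y) * beta_fun (be - sc t) ga y) * Cexp (- sc t * w))%C
             by (replace (y + h - y) with h by ring; ring).
           rewrite Cmod_mult.
           assert (B1 := beta_part_quadratic (be - sc t) ga l L0 x0 y (y + h) ltac:(unfold x0; lra) Hy2 Hy1).
           fold L in B1; replace (y + h - y) with h in B1 |- * by ring.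
           assert (B2 : Cmod (Cexp (- sc t * w)) <= exp (Cmod w * S + Cmod w * Rabs t)).
           { le_via Cmod_Cexp_le; apply exp_le_compat; generalize (Cmod_ge_0 w); nra. }
           eapply Rle_trans; [ apply Rmult_le_compat; [ apply Cmod_ge_0 | apply Cmod_ge_0 | apply B1 | apply B2 ] | ].
           rewrite Rmult_assoc, (Rmult_comm (Rabs h * Rabs h)), <- Rmult_assoc, <- exp_plus.
           replace (D * (Rabs h * Rabs h) * exp ((1 + L + Cmod w) * Rabs t))
             with (D * exp ((1 + L + Cmod w) * Rabs t) * (Rabs h * Rabs h)) by ring.
           apply Rmult_le_compat_r; [ generalize (Rabs_pos h); nra | unfold D; rewrite <- exp_plus; apply exp_le_compat ].
           assert (T := Cmod_triangle_minus be (sc t)). nra.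
      * rewrite <- !Rmult_assoc; apply Rmult_le_compat_r; [ apply Rabs_pos | ].
        assert (Q : eps / (D0 * D) * (D0 * D) = eps) by (field; split; lra).
        apply Rle_trans with (D0 * D * (eps / (D0 * D))); [ apply Rmult_le_compat_l; lra | lra ].
    + intros y Hy; unfold f; apply rcont_mult; [ apply (beta_fun_rcont be ga); lra | ].
      apply (rcont_comp Kf); [ eapply cder_ccont, HK1 | ].
      apply rcont_plus; [ apply rcont_const | eapply dR_rcont, dR_RtoC, is_derive_ln; lra ].
  - generalize (pairing_minus sc wt _ _ _ _ (HPsi b ltac:(unfold x0; lra)) (HPsi a ltac:(unfold x0; lra))).
    apply pairing_ext; intros t; rewrite (beta_part_Chasles _ _ x0 a b) by (unfold x0; lra); ring.
Qed.

End PairingBeta.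

Section EulerLimit.

Variables (sc wt : R -> C) (S : R).
Hypothesis sc_growth : forall t, Cmod (sc t) <= S + Rabs t.
Hypothesis pairing_bounded : forall B, exists D0, 0 < D0 /\ forall (Q : C -> C) (D : R),
  (forall t, ccont Q (sc t)) -> (forall t, Cmod (Q (sc t)) <= D * exp (B * Rabs t)) ->
  (exists v, pairing sc wt Q v) /\ forall v, pairing sc wt Q v -> Cmod v <= D0 * D.

Lemma pairing_differentiable (Kf : C -> C) :
  (forall w, pairing sc wt (fun s => Cexp (- s * w)) (Kf w)) -> exists Kf1 : C -> C, forall w, cder Kf w (Kf1 w).
Proof.
  intros HK.
  exists (fun w => epsilon (inhabits (RtoC 0)) (pairing sc wt (fun s => - s * 1 * Cexp (- s * w))%C)).
  apply (pairing_cder sc wt S sc_growth pairing_bounded (fun _ => 1%C)).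
  - apply tempered_const.
  - intros w; generalize (HK w); apply pairing_ext; intros t; ring.
  - intros w; apply epsilon_spec, (tempered_pairing sc wt pairing_bounded).
    apply (tempered_mult sc); [ | apply (tempered_Cexp sc S sc_growth) ].
    destruct (tempered_mult sc _ _ (tempered_const sc (- (1))) (tempered_id sc S sc_growth)) as [H1 [D [B [H2 [H3 H4]]]]].
    split.
    + intros t; apply an_ccont, an_mult; [ apply an_opp, an_id | apply an_const ].
    + exists D, B; repeat split; try assumption; intros t; specialize (H4 t).
      replace (- sc t * 1)%C with (- (1) * sc t)%C by ring; exact H4.
Qed.

(** On a left contour [Re s <= sigma0 < Re be], so [Re (be - s)] stays above [X] and the truncated
    beta integrals converge uniformly in [s]. This is where the bound on the real part along the
    contour enters. *)
Lemma pairing_beta (be ga : C) (sigma0 : R) (Kf rho : C -> C) (w V : C) :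
  (forall t, Re (sc t) <= sigma0) -> sigma0 < Re be -> 0 < Re ga ->
  (forall w, pairing sc wt (fun s => Cexp (- s * w)) (Kf w)) ->
  (forall t, ccont rho (sc t)) -> (forall t, rho (sc t) = Beta (be - sc t) ga) ->
  pairing sc wt (fun s => rho s * Cexp (- s * w))%C V ->
  is_beta_integral be ga (fun t => Kf (w + RtoC (ln t))%C) V.
Proof.
  intros Hsc Hbe Hga HK Hc Hrho HV; apply ends_int_iff; intros eps He.
  destruct (pairing_differentiable Kf HK) as [Kf1 HK1]. destruct (pairing_bounded (Cmod w)) as [D0 [PD0 HD]].
  set (E := D0 * exp (Cmod w * S)). assert (PE : 0 < E) by pos. assert (He' : 0 < eps / (2 * E)) by pos.
  set (X := Re be - sigma0). assert (PX : 0 < X) by (unfold X; lra).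
  destruct (Rpower_small X _ PX He') as [d1 [Pd1 [Hd1 H1]]].
  destruct (Rpower_small (Re ga) _ Hga He') as [d2 [Pd2 [Hd2 H2]]].
  exists (Rmin d1 d2); split; [ pos | intros a b Ha Hb ].
  assert (M1 := Rmin_l d1 d2). assert (M2 := Rmin_r d1 d2).
  destruct (pairing_beta_part sc wt S sc_growth pairing_bounded be ga Kf Kf1 w a b) as [v [Hv1 Hv2]]; try lra; auto.
  exists v; split; [ exact Hv1 | ]. specialize (H1 a ltac:(lra)). specialize (H2 (1 - b) ltac:(lra)).
  set (q := 2 / X * Rpower a X + 2 / Re ga * Rpower (1 - b) (Re ga)) in *.
  apply Rle_lt_trans with (D0 * (q * exp (Cmod w * S))).
  - assert (HP := pairing_minus sc wt _ _ _ _ Hv2 HV). refine (proj2 (HD _ _ _ _) _ HP).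
    + intros t; apply ccont_minus; (apply ccont_mult; [ | apply (tempered_Cexp sc S sc_growth) ]).
      * apply (tempered_beta_part sc S sc_growth be ga (Rmin a (1 - b)));
          generalize (Rmin_l a (1 - b)), (Rmin_r a (1 - b)), (Rmin_pos a (1 - b)); intros L1 L2 L3; [ split; [ apply L3 | ] | ]; lra.
      * apply Hc.
    + intros t; rewrite Hrho; specialize (Hsc t).
      replace (beta_part (be - sc t) ga a b * Cexp (- sc t * w) - Beta (be - sc t) ga * Cexp (- sc t * w))%C
        with ((beta_part (be - sc t) ga a b - Beta (be - sc t) ga) * Cexp (- sc t * w))%C by ring.
      rewrite Cmod_mult, Rmult_assoc, <- exp_plus. apply Rmult_le_compat; try apply Cmod_ge_0.
      * apply Beta_spec; autorewrite with ReIm; unfold X; lra.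
      * le_via Cmod_Cexp_le; apply exp_le_compat; generalize (sc_growth t), (Cmod_ge_0 w); nra.
  - replace (D0 * (q * exp (Cmod w * S))) with (E * q) by (unfold E; ring).
    assert (Q : eps / (2 * E) * (2 * E) = eps) by (field; lra).
    assert (q < 2 * (eps / (2 * E))) by (unfold q; lra). nra.
Qed.

End EulerLimit.

Lemma Re_std_contour_left (sigma T t : R) : 0 < T -> Re (std_contour K_left sigma T t) <= sigma.
Proof.
  intros HT; unfold std_contour; destruct (eps_trig _ pi8) as [S1 S2].
  destruct (Rle_dec t (- T)) as [A|A]; [ | destruct (Rle_dec T t) as [B|B] ].
  - rewrite std_left, Cexp_theta_minus by lra; unfold dirn, sgn_minus; autorewrite with ReIm; nra.
  - rewrite std_right, Cexp_theta_plus by lra; unfold dirn, sgn_plus; autorewrite with ReIm; nra.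
  - rewrite std_mid by lra; autorewrite with ReIm; lra.
Qed.

Section EulerTransform.

Variables (tau c1 c2 : R) (G : C -> C).
Hypothesis Htau : 0 < tau.
Hypothesis HG : forall z, filterlim (barnes_partial tau c1 c2 z) eventually (locally (G z)).
Hypothesis HG2 : forall z, not_Gamma_pole z ->
  (G (z + RtoC tau) = RtoC (Rpower (2 * PI) ((tau - 1) / 2)) * Rcpow tau (RtoC (1 / 2) - z) * CGamma z * G z)%C.
Variables (m n : nat) (a b : list C) (alpha : C) (sigma0 : R).
Hypotheses (Hm : (m <= length b)%nat) (Hn : (n <= length a)%nat)
  (HN : (order_N m n (length a) (length b) < 0)%Z)
  (Hsharp : Rbar_lt (lambda_sharp tau m b) (Finite sigma0))
  (Hflat : Rbar_lt (Finite sigma0) (lambda_flat n a)).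

Lemma K_left_beta (be ga w : C) : sigma0 < Re be -> 0 < Re ga ->
  let a' := a ++ [be; (be + ga + RtoC tau)%C] in
  let b' := [(be + RtoC tau)%C; (be + ga)%C] ++ b in
  is_beta_integral be ga (fun t => K G tau K_left m n a b alpha (w + RtoC (ln t)))
    (CGamma ga * Rcpow tau (- ga) * K G tau K_left (m + 2) n a' b' alpha w).
Proof.
  intros Hbe Hga a' b'. assert (Sk : skipn (m + 2) b' = skipn m b) by (rewrite Nat.add_comm; reflexivity).
  assert (Fk : firstn (m + 2) b' = (be + RtoC tau)%C :: (be + ga)%C :: firstn m b) by (rewrite Nat.add_comm; reflexivity).
  assert (Sn : skipn n a' = skipn n a ++ [be; (be + ga + RtoC tau)%C]) by (apply skipn_app_le, Hn).
  assert (Fn : firstn n a' = firstn n a) by (apply firstn_app_le, Hn).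
  assert (Hm' : (m + 2 <= length b')%nat) by (unfold b'; rewrite length_app; simpl; lia).
  assert (Hn' : (n <= length a')%nat) by (unfold a'; rewrite length_app; lia).
  assert (HN' : (order_N (m + 2) n (length a') (length b') < 0)%Z).
  { unfold a', b'; rewrite !length_app; simpl length; revert HN; unfold order_N; lia. }
  assert (Hsharp' : Rbar_lt (lambda_sharp tau (m + 2) b') (Finite sigma0)).
  { unfold lambda_sharp; rewrite Sk; exact Hsharp. }
  (* The new denominator-type parameters have real part at least [Re be > sigma0], and the new [b]'s
     are numerator-type, so [sigma0] stays admissible. *)
  assert (Hflat' : Rbar_lt (Finite sigma0) (lambda_flat n a')).
  { apply lambda_flat_gt; intros aj Hj; rewrite Sn in Hj; apply in_app_or in Hj.
    destruct Hj as [Hj|Hj]; [ revert aj Hj; apply lambda_flat_gt, Hflat | ].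
    destruct Hj as [<-|[<-|[]]]; autorewrite with ReIm; lra. }
  destruct (admissible_exists tau m n a b sigma0 Htau Hsharp Hflat) as [T1 HT1].
  destruct (admissible_exists tau (m + 2) n a' b' sigma0 Htau Hsharp' Hflat') as [T2 HT2].
  set (T := Rmax T1 T2). assert (Hadm := HT1 T (Rmax_l _ _)). assert (Hadm' := HT2 T (Rmax_r _ _)).
  set (sc := std_contour K_left sigma0 T). set (wt := weight tau G m n a b alpha K_left sigma0 T).
  assert (Hre : forall t, Re (sc t) <= sigma0) by (intros t; apply Re_std_contour_left, Hadm).
  assert (Hgr : forall t, Cmod (sc t) <= Rabs sigma0 + T + Rabs t)
    by apply (std_contour_growth tau m n a b K_left sigma0 T Hadm).
  assert (Hbd := J_bound tau c1 c2 G Htau HG m n a b alpha Hm Hn HN K_left sigma0 T Hadm).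
  set (rho := fun s => (G (be - s + RtoC tau) * G (be - s + ga) / (G (be - s) * G (be - s + ga + RtoC tau)))%C).
  assert (Hker : forall t, let s := sc t in kernel G tau (m + 2) n a' b' alpha s
    = (rho s * kernel G tau m n a b alpha s)%C).
  { intros t s; unfold rho, kernel.
    rewrite Sk, Fk, Sn, Fn, map_app, Cprod_app; cbn [map]; rewrite !Cprod_cons, Cprod_nil, Cmult_1_r.
    replace (be + RtoC tau - s)%C with (be - s + RtoC tau)%C by ring.
    replace (be + ga - s)%C with (be - s + ga)%C by ring.
    replace (be + ga + RtoC tau - s)%C with (be - s + ga + RtoC tau)%C by ring.
    unfold Cdiv; rewrite !Cinv_mult; ring. }
  set (k0 := (CGamma ga * Rcpow tau (- ga))%C).
  assert (HV := proj1 (proj2 (K_spec tau c1 c2 G Htau HG (m + 2) n a' b' alpha Hm' Hn' HN' K_left sigma0 T Hadm' w))).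
  assert (HV1 := pairing_weight tau G m n a b alpha K_left sigma0 T (m + 2) n a' b' rho _ _ Hker HV).
  apply (pairing_scal sc wt k0) in HV1.
  assert (Hpos : forall t, 0 < Re (be - sc t)) by (intros t; autorewrite with ReIm; specialize (Hre t); lra).
  apply (pairing_beta sc wt (Rabs sigma0 + T) Hgr Hbd be ga sigma0 _ (fun s => k0 * rho s)%C); try assumption.
  - intros w'; exact (proj1 (proj2 (K_spec tau c1 c2 G Htau HG m n a b alpha Hm Hn HN K_left sigma0 T Hadm w'))).
  - intros t; apply ccont_mult; [ apply ccont_const | ].
    assert (AG : forall c, ccont (fun s => G (be - s + c)%C) (sc t)).
    { intros c; apply (ccont_comp G (fun s => be - s + c)%C); [ apply an_ccont, (barnes_G_an tau c1 c2 G Htau HG) | ].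
      apply an_ccont, an_plus; [ apply an_minus; [ apply an_const | apply an_id ] | apply an_const ]. }
    unfold rho, Cdiv; apply ccont_mult; [ apply ccont_mult; apply AG | apply ccont_inv ].
    + apply Cmult_neq_0; apply (G_neq_0_Re tau c1 c2 G Htau HG); [ apply Hpos | ].
      specialize (Hpos t); autorewrite with ReIm in *; lra.
    + apply ccont_mult; [ | ].
      * apply (ccont_ext_near (fun s => G (be - s + 0)%C)); [ apply filter_forall; intros y; f_equal; ring | apply AG ].
      * apply (ccont_ext_near (fun s => G (be - s + (ga + RtoC tau))%C)); [ apply filter_forall; intros y; f_equal; ring | apply AG ].
  - intros t; unfold rho; rewrite (G_ratio_Gamma tau c1 c2 G Htau HG HG2) by auto.
    unfold k0; rewrite Rcpow_opp; field; split; [ apply CGamma_neq_0, not_pole_Re, Hga | apply Rcpow_neq_0 ].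
  - revert HV1; apply pairing_ext; intros t; ring.
Qed.

End EulerTransform.

(** * The inversion law *)

(** The values are changed at one point at a time. It serves at the corners of a contour, where
    [velocity] has no prescribed value. *)
Lemma is_CI_ext_off (l : list R) : forall (h k : R -> C) (a b : R) (v : C), a <= b ->
  (forall t, ~ In t l -> h t = k t) -> is_CI h a b v -> is_CI k a b v.
Proof.
  induction l as [|c l IH]; intros h k a b v Hab Hhk Hv.
  - revert Hv; apply is_CI_ext_all; intros t; apply Hhk; simpl; auto.
  - set (h' := fun t => if Req_EM_T t c then k t else h t). apply (IH h'); [ auto | | ].
    { intros t Ht; unfold h'; destruct (Req_EM_T t c) as [|N]; [ reflexivity | apply Hhk; intros [E|E]; auto ]. }
    assert (Hh' : forall t, t <> c -> h t = h' t).
    { intros t Ht; unfold h'; destruct (Req_EM_T t c); [ contradiction | reflexivity ]. }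
    destruct (Rle_dec a c) as [H1|H1]; [ destruct (Rle_dec c b) as [H2|H2] | ].
    + assert (E : ex_RInt (V := C_R_CompleteNormedModule) h a b) by (exists v; exact Hv).
      destruct (ex_RInt_Chasles_1 (V := C_R_CompleteNormedModule) h a c b (conj H1 H2) E) as [v1 E1].
      destruct (ex_RInt_Chasles_2 (V := C_R_CompleteNormedModule) h a c b (conj H1 H2) E) as [v2 E2].
      rewrite (is_CI_unique _ _ _ _ _ Hv (is_CI_Chasles _ _ _ _ _ _ E1 E2)).
      apply is_CI_Chasles with c; [ revert E1 | revert E2 ]; apply is_CI_ext; try assumption;
        intros t Ht; apply Hh'; lra.
    + revert Hv; apply is_CI_ext; [ auto | intros t Ht; apply Hh'; lra ].
    + revert Hv; apply is_CI_ext; [ auto | intros t Ht; apply Hh'; lra ].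
Qed.

Lemma gen_int_ext_off (l : list R) (h k : R -> C) (v : C) :
  (forall t, ~ In t l -> h t = k t) -> gen_int h v -> gen_int k v.
Proof.
  intros Hhk H eps He; destruct (H eps He) as [R0 HR]; exists (Rmax 0 R0); intros a b Ha Hb.
  assert (M1 := Rmax_l 0 R0). assert (M2 := Rmax_r 0 R0).
  destruct (HR a b) as [w [W1 W2]]; [ lra | lra | ]; exists w; split; [ | auto ].
  revert W1; apply (is_CI_ext_off l); [ lra | auto ].
Qed.

Lemma gen_int_reverse (h : R -> C) (v : C) : gen_int h v -> gen_int (fun t => h (- t)) v.
Proof.
  intros H eps He; destruct (H eps He) as [R0 HR]; exists R0; intros a b Ha Hb.
  destruct (HR (- b) (- a)) as [w [W1 W2]]; [ lra | lra | ]; exists w; split; [ | auto ].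
  apply is_CI_swap in W1.
  assert (E := is_CI_scal (- (1)) _ _ _ _ (is_RInt_comp_opp (V := C_R_NormedModule) h a b _ W1)).
  replace (- (1) * - w)%C with w in E by ring.
  revert E; apply is_CI_ext_all; intros t; change (- (1) * - h (- t)%R = h (- t)%R)%C; ring.
Qed.

Definition reflected (tau : R) : list C -> list C := map (fun x : C => RtoC (1 + tau) - x)%C.

Lemma kernel_reflected (tau : R) (G : C -> C) (m n : nat) (a b : list C) (alpha s : C) :
  kernel G tau n m (reflected tau b) (reflected tau a) alpha s = kernel G tau m n a b alpha (- s).
Proof.
  unfold kernel, reflected; rewrite !firstn_map, !skipn_map, !map_map.
  replace ((- s) ^ 2)%C with (s ^ 2)%C by ring.
  assert (E1 : forall l, map (fun x => G (RtoC (1 + tau) - x - s)%C) l = map (fun x => G (RtoC (1 + tau) - x + - s)%C) l)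
    by (intros l; apply map_ext; intros; f_equal; ring).
  assert (E2 : forall l, map (fun x => G (RtoC (1 + tau) - (RtoC (1 + tau) - x) + s)%C) l = map (fun x => G (x - - s)%C) l)
    by (intros l; apply map_ext; intros; f_equal; ring).
  rewrite (E1 (firstn n a)), (E1 (skipn m b)), !E2; unfold Cdiv; rewrite !Cinv_mult; ring.
Qed.

Lemma Rbar_max_opp (x : R) (y : Rbar) : Rbar_max (Finite (- x)) (Rbar_opp y) = Rbar_opp (Rbar_min (Finite x) y).
Proof.
  unfold Rbar_max; destruct y as [y| |]; simpl; destruct (Rbar_le_dec _ _) as [H|H]; simpl in *; try tauto.
  - f_equal; rewrite Rmin_right; lra.
  - f_equal; rewrite Rmin_left; lra.
Qed.

Lemma lambda_sharp_reflected (tau : R) (n : nat) (a : list C) :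
  lambda_sharp tau n (reflected tau a) = Rbar_opp (lambda_flat n a).
Proof.
  unfold lambda_sharp, lambda_flat, reflected; rewrite skipn_map.
  induction (skipn n a) as [|x l IH]; [ reflexivity | cbn [map fold_right] ].
  rewrite IH, <- Rbar_max_opp; do 2 f_equal; autorewrite with ReIm; ring.
Qed.

Lemma reflected_involutive (tau : R) (a : list C) : reflected tau (reflected tau a) = a.
Proof.
  unfold reflected; rewrite map_map; rewrite <- (map_id a) at 2; apply map_ext; intros; ring.
Qed.

Lemma lambda_flat_reflected (tau : R) (m : nat) (b : list C) :
  lambda_flat m (reflected tau b) = Rbar_opp (lambda_sharp tau m b).
Proof.
  rewrite <- (reflected_involutive tau b) at 2; rewrite lambda_sharp_reflected, Rbar_opp_involutive; reflexivity.
Qed.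

Lemma std_contour_reflected (sigma T t : R) : 0 < T ->
  std_contour K_left (- sigma) T t = (- std_contour K_right sigma T (- t)%R)%C.
Proof.
  intros HT; unfold std_contour. destruct (Rle_dec t (- T)) as [A|A]; [ | destruct (Rle_dec T t) as [B|B] ].
  - rewrite std_left, std_right, Cexp_theta_minus, Cexp_theta_plus by lra.
    unfold dirn, sgn_plus, sgn_minus; apply C_ext; autorewrite with ReIm; ring.
  - rewrite std_right, std_left, Cexp_theta_minus, Cexp_theta_plus by lra.
    unfold dirn, sgn_plus, sgn_minus; apply C_ext; autorewrite with ReIm; ring.
  - rewrite !std_mid by lra; apply C_ext; autorewrite with ReIm; ring.
Qed.

Lemma velocity_std_contour_reflected (sigma T t : R) : 0 < T -> t <> T -> t <> - T ->
  velocity (std_contour K_left (- sigma) T) t = velocity (std_contour K_right sigma T) (- t).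
Proof.
  intros HT N1 N2; unfold std_contour.
  destruct (Rle_dec t (- T)) as [A|A]; [ | destruct (Rle_dec T t) as [B|B] ].
  - rewrite velocity_std_left, velocity_std_right, Cexp_theta_minus, Cexp_theta_plus by lra.
    unfold dirn, sgn_plus, sgn_minus; apply C_ext; autorewrite with ReIm; ring.
  - rewrite velocity_std_right, velocity_std_left, Cexp_theta_minus, Cexp_theta_plus by lra.
    unfold dirn, sgn_plus, sgn_minus; apply C_ext; autorewrite with ReIm; ring.
  - rewrite !velocity_std_mid by lra; reflexivity.
Qed.

Lemma order_N_sym (m n p q : nat) : order_N n m q p = order_N m n p q.
Proof. unfold order_N; lia. Qed.

Section Inversion.

Variables (tau c1 c2 : R) (G : C -> C).
Hypothesis Htau : 0 < tau.
Hypothesis HG : forall z, filterlim (barnes_partial tau c1 c2 z) eventually (locally (G z)).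
Variables (m n : nat) (a b : list C) (alpha : C).
Hypotheses (Hm : (m <= length b)%nat) (Hn : (n <= length a)%nat)
  (HN : (order_N m n (length a) (length b) < 0)%Z)
  (Hlam : Rbar_lt (lambda_sharp tau m b) (lambda_flat n a)).

Lemma K_inversion (w : C) :
  K G tau K_right m n a b alpha w
  = K G tau K_left n m (reflected tau b) (reflected tau a) alpha (- w).
Proof.
  set (a' := reflected tau b). set (b' := reflected tau a).
  assert (Hm' : (n <= length b')%nat) by (unfold b', reflected; rewrite length_map; auto).
  assert (Hn' : (m <= length a')%nat) by (unfold a', reflected; rewrite length_map; auto).
  assert (HN' : (order_N n m (length a') (length b') < 0)%Z).
  { unfold a', b', reflected; rewrite !length_map, order_N_sym; auto. }
  destruct (Rbar_between _ _ Hlam) as [sigma [L1 L2]].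
  assert (L1' : Rbar_lt (lambda_sharp tau n b') (Finite (- sigma))).
  { unfold b'; rewrite lambda_sharp_reflected; apply Rbar_opp_lt; rewrite Rbar_opp_involutive; simpl Rbar_opp.
    rewrite Ropp_involutive; auto. }
  assert (L2' : Rbar_lt (Finite (- sigma)) (lambda_flat m a')).
  { unfold a'; rewrite lambda_flat_reflected; apply Rbar_opp_lt; rewrite Rbar_opp_involutive; simpl Rbar_opp.
    rewrite Ropp_involutive; auto. }
  destruct (admissible_exists tau m n a b sigma Htau L1 L2) as [T1 HT1].
  destruct (admissible_exists tau n m a' b' (- sigma) Htau L1' L2') as [T2 HT2]. set (T := Rmax T1 T2).
  assert (Hadm := HT1 T (Rmax_l _ _)). assert (Hadm' := HT2 T (Rmax_r _ _)).
  assert (HT : 0 < T) by apply Hadm.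
  symmetry; apply (K_J tau c1 c2 G Htau HG n m a' b' alpha Hm' Hn' HN' K_left (- sigma) T Hadm').
  assert (H := proj1 (proj2 (K_spec tau c1 c2 G Htau HG m n a b alpha Hm Hn HN K_right sigma T Hadm w))).
  apply gen_int_reverse in H; revert H; apply (gen_int_ext_off [T; - T]); intros t Ht; cbv beta.
  unfold weight; rewrite velocity_std_contour_reflected by (try assumption; intros E; apply Ht; rewrite E; simpl; auto).
  rewrite std_contour_reflected by auto; unfold a', b'; rewrite kernel_reflected.
  set (z := std_contour K_right sigma T (- t)).
  replace (- - z * - w)%C with (- z * w)%C by ring; replace (- - z)%C with z by ring; reflexivity.
Qed.

End Inversion.

(** * The shift law *)

(** Concatenation written as [f1 + f2 - q] with clamped parameters: at each time one of the two
    paths rests at [q], and continuity is that of a sum. *)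
Lemma same_side_trans (g : R -> C) (p q r : C) : same_side g p q -> same_side g q r -> same_side g p r.
Proof.
  intros H1 H2. destruct (same_side_path _ _ _ H1) as [f1 [C1 [A1 [B1 N1]]]].
  destruct (same_side_path _ _ _ H2) as [f2 [C2 [A2 [B2 N2]]]].
  set (f := fun u => (f1 (clamp 0 1 (2 * u)) + f2 (clamp 0 1 (2 * u - 1)) - q)%C).
  assert (Lo : forall u, u <= 1 / 2 -> f u = f1 (clamp 0 1 (2 * u))).
  { intros u Hu; unfold f; replace (clamp 0 1 (2 * u - 1)) with 0; [ rewrite A2; ring | ].
    unfold clamp, Rmax, Rmin; repeat destruct Rle_dec; lra. }
  assert (Hi : forall u, 1 / 2 <= u -> f u = f2 (clamp 0 1 (2 * u - 1))).
  { intros u Hu; unfold f; replace (clamp 0 1 (2 * u)) with 1; [ rewrite B1; ring | ].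
    unfold clamp, Rmax, Rmin; repeat destruct Rle_dec; lra. }
  assert (Aff : forall (h : R -> C) (k : R) u, (forall t, rcont h t) -> rcont (fun u => h (clamp 0 1 (2 * u - k))) u).
  { intros h k u Hh eps He.
    destruct (rcont_clamp h 0 1 (2 * u - k) ltac:(lra) (fun t _ => Hh t) eps He) as [d [Hd K]].
    exists (d / 2); split; [ lra | intros v Hv; apply K ].
    replace (2 * v - k - (2 * u - k)) with (2 * (v - u)) by ring.
    rewrite Rabs_mult, (Rabs_pos_eq 2) by lra; lra. }
  exists f; split; [ | split; [ | split ] ].
  - intros u; apply rcont_continuous.
    apply (rcont_ext (fun u => f1 (clamp 0 1 (2 * u - 0)) + f2 (clamp 0 1 (2 * u - 1)) + - q)%C).
    { intros v; unfold f; rewrite Rminus_0_r; reflexivity. }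
    apply rcont_plus; [ apply rcont_plus; apply Aff; auto | apply rcont_const ].
  - rewrite Lo, clamp_id by lra; replace (2 * 0) with 0 by ring; auto.
  - rewrite Hi, clamp_id by lra; replace (2 * 1 - 1) with 1 by ring; auto.
  - intros u t _ E; destruct (Rle_dec u (1 / 2)).
    + rewrite Lo in E by auto; apply (N1 (clamp 0 1 (2 * u)) t); auto.
    + rewrite Hi in E by lra; apply (N2 (clamp 0 1 (2 * u - 1)) t); auto.
Qed.

Section Translate.

Variables (g : R -> C) (c : C).
Let gc : R -> C := fun t => (g t - c)%C.

Lemma velocity_translate (t : R) : velocity gc t = velocity g t.
Proof.
  unfold velocity, Derive; f_equal; f_equal; apply Lim_ext; intros y; unfold gc; autorewrite with ReIm; f_equal; ring.
Qed.

Lemma piecewise_smooth_translate : piecewise_smooth g -> piecewise_smooth gc.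
Proof.
  intros [H1 [l [H2 H3]]]; split; [ | exists l; split ].
  - intros t; apply rcont_continuous, (rcont_plus g (fun _ => - c)%C); [ apply rcont_continuous, H1 | apply rcont_const ].
  - intros t Ht; destruct (H2 t Ht) as [D1 [D2 [D3 D4]]]; split; [ | split; [ | split ] ].
    + apply (ex_derive_minus (V := R_NormedModule)); [ auto | apply ex_derive_const ].
    + apply (ex_derive_minus (V := R_NormedModule)); [ auto | apply ex_derive_const ].
    + apply (continuous_ext (velocity g)); [ intros u; symmetry; apply velocity_translate | auto ].
    + rewrite velocity_translate; auto.
  - intros t Ht; destruct (H3 t Ht) as [vl [vr [D1 [D2 [D3 D4]]]]]; exists vl, vr.
    split; [ auto | split; [ auto | split ] ];
      (apply (filterlim_ext (velocity g)); [ intros u; symmetry; apply velocity_translate | auto ]).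
Qed.

Lemma same_side_translate (p q : C) : same_side g p q -> same_side gc (p - c) (q - c).
Proof.
  intros H; destruct (same_side_path _ _ _ H) as [f [F1 [F2 [F3 F4]]]].
  exists (fun u => f u - c)%C; split; [ | split; [ | split ] ].
  - intros u; apply rcont_continuous, (rcont_plus f (fun _ => - c)%C); [ apply F1 | apply rcont_const ].
  - rewrite F2; reflexivity.
  - rewrite F3; reflexivity.
  - intros u t _ E; apply (F4 u t); unfold gc in E.
    replace (g t) with (g t - c + c)%C by ring; rewrite <- E; ring.
Qed.

(** Translation carries far real points [x] to [x - c], which are no longer real; they have to be
    joined back to [x] off the translated curve. *)
Lemma is_contour_translate (thm thp : R) (Lp Lm Lp' Lm' : C -> Prop) : sin thm < 0 -> 0 < sin thp ->
  (forall s, Lp' s -> Lp (s + c)%C) -> (forall s, Lm' s -> Lm (s + c)%C) ->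
  is_contour thm thp Lp Lm g -> is_contour thm thp Lp' Lm' gc.
Proof.
  intros Hthm Hthp HLp HLm H. assert (Hinf := contour_inf _ _ _ _ _ Hthm Hthp H (Cmod c)).
  destruct Hinf as [R0 HR0].
  (* For large [|x|] the segment from [x - c] to [x] misses the curve: the part with [|t| <= |R0|]
     is bounded, and for other [t] the imaginary part of [g t] exceeds [Cmod c] in absolute
     value. *)
  assert (Hb : exists M, forall (x u : R) t, M <= Rabs x -> 0 <= u <= 1 -> (RtoC x - RtoC u * c)%C <> gc t).
  { destruct (rcont_bounded g (- Rabs R0) (Rabs R0)) as [M [PM HM]]. { generalize (Rabs_pos R0); lra. }
    { intros t _; apply (contour_curve _ _ _ _ _ H). }
    exists (M + Cmod c + 1); intros x u t Hx Hu E; unfold gc in E.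
    assert (E' : g t = (RtoC x + RtoC (1 - u) * c)%C).
    { replace (g t) with (g t - c + c)%C by ring; rewrite <- E, RtoC_minus; ring. }
    assert (Nc : Cmod (RtoC (1 - u) * c) <= Cmod c).
    { rewrite Cmod_mult, Cmod_R, Rabs_pos_eq by lra; generalize (Cmod_ge_0 c); nra. }
    destruct (Rle_dec (Rabs t) (Rabs R0)) as [Ht|Ht].
    - specialize (HM t (proj1 (Rabs_le_between _ _) Ht)); rewrite E' in HM.
      assert (T := Cmod_minus_ge (RtoC x) (- (RtoC (1 - u) * c))). rewrite Cmod_opp, Cmod_R in T.
      replace (RtoC x - - (RtoC (1 - u) * c))%C with (RtoC x + RtoC (1 - u) * c)%C in T by ring. lra.
    - assert (I : Rabs (Im (g t)) <= Cmod c). { rewrite E'; autorewrite with ReIm.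
        replace (0 + ((1 - u) * Im c + 0 * Re c)) with ((1 - u) * Im c) by ring.
        rewrite Rabs_mult, (Rabs_pos_eq (1 - u)) by lra. generalize (Im_le_Cmod c), (Rabs_pos (Im c)); nra. }
      apply Rabs_le_between in I. assert (A := Rle_abs R0). destruct (Rcase_abs t) as [Hneg|Hpos].
      + rewrite (Rabs_left t) in Ht by auto.
        destruct (HR0 (- t) ltac:(lra)) as [_ L]; rewrite Ropp_involutive in L; unfold lower in L; lra.
      + rewrite (Rabs_right t) in Ht by auto. destruct (HR0 t ltac:(lra)) as [L _]; unfold upper in L; lra. }
  destruct Hb as [M HM]. assert (Slide : forall x, M <= Rabs x -> same_side gc (RtoC x - c) (RtoC x)).
  { intros x Hx; exists (fun u => (RtoC x - c) + RtoC u * c)%C; split; [ | split; [ | split ] ].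
    - intros u; apply rcont_continuous, rcont_line.
    - ring.
    - ring.
    - intros u t Hu E; apply (HM x (1 - u) t Hx ltac:(lra)); rewrite <- E, RtoC_minus; ring. }
  split.
  - intros t t' E; apply (contour_simple _ _ _ _ _ H); unfold gc in E.
    replace (g t) with (g t - c + c)%C by ring; rewrite E; ring.
  - apply piecewise_smooth_translate, (contour_smooth _ _ _ _ _ H).
  - destruct (contour_ends _ _ _ _ _ H) as [T [sm [sp [E1 E2]]]].
    exists T, (sm - c)%C, (sp - c)%C; split; intros t Ht; unfold gc; [ rewrite E1 | rewrite E2 ]; try assumption; ring.
  - intros t; destruct (contour_avoids _ _ _ _ _ H t) as [N1 N2]; unfold gc; split; intros K;
      [ apply N1 | apply N2 ]; [ apply HLp in K | apply HLm in K ];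
      replace (g t) with (g t - c + c)%C by ring; auto.
  - intros s Hs; destruct (contour_right _ _ _ _ _ H _ (HLp s Hs)) as [M1 HM1].
    exists (Rmax M1 M); intros x Hx.
    assert (X1 := Rmax_l M1 M). assert (X2 := Rmax_r M1 M). assert (X3 := Rle_abs x).
    apply same_side_trans with (RtoC x - c)%C; [ | apply Slide; lra ].
    replace s with (s + c - c)%C by ring; apply same_side_translate, HM1; lra.
  - intros s Hs; destruct (contour_left _ _ _ _ _ H _ (HLm s Hs)) as [M1 HM1].
    exists (Rmax M1 M); intros x Hx.
    assert (X1 := Rmax_l M1 M). assert (X2 := Rmax_r M1 M). assert (X3 := Rle_abs x).
    apply same_side_trans with (RtoC (- x) - c)%C; [ | apply Slide; rewrite Rabs_Ropp; lra ].
    replace s with (s + c - c)%C by ring; apply same_side_translate, HM1; lra.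
Qed.

End Translate.

Section Shift.

Variables (tau c1 c2 : R) (G : C -> C).
Hypothesis Htau : 0 < tau.
Hypothesis HG : forall z, filterlim (barnes_partial tau c1 c2 z) eventually (locally (G z)).
Variables (m n : nat) (a b : list C) (alpha : C).
Hypotheses (Hm : (m <= length b)%nat) (Hn : (n <= length a)%nat)
  (HN : (order_N m n (length a) (length b) < 0)%Z)
  (Hlam : Rbar_lt (lambda_sharp tau m b) (lambda_flat n a)).

Lemma kernel_shift (c s : C) :
  kernel G tau m n (map (Cplus c) a) (map (Cplus c) b) alpha (s + c)
  = (Cexp (RtoC PI * alpha * c ^ 2 / RtoC tau) * Cexp (s * (RtoC (2 * PI) * alpha * c / RtoC tau))
     * kernel G tau m n a b alpha s)%C.
Proof.
  unfold kernel; rewrite !firstn_map, !skipn_map, !map_map.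
  assert (E1 : forall l, map (fun x => G (c + x - (s + c))%C) l = map (fun x => G (x - s)%C) l)
    by (intros l; apply map_ext; intros; f_equal; ring).
  assert (E2 : forall l, map (fun x => G (RtoC (1 + tau) - (c + x) + (s + c))%C) l
    = map (fun x => G (RtoC (1 + tau) - x + s)%C) l) by (intros l; apply map_ext; intros; f_equal; ring).
  rewrite (E1 (firstn m b)), (E1 (skipn n a)), (E2 (firstn n a)), (E2 (skipn m b)).
  replace (RtoC PI * alpha * (s + c) ^ 2 / RtoC tau)%C with
    (RtoC PI * alpha * c ^ 2 / RtoC tau + s * (RtoC (2 * PI) * alpha * c / RtoC tau)
     + RtoC PI * alpha * s ^ 2 / RtoC tau)%C by (rewrite RtoC_mult; field; apply RtoC_neq_0; lra).
  rewrite !Cexp_plus; ring.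
Qed.

(** For complex [c] the translate of a standard contour need not be standard. The law is therefore
    checked on an arbitrary contour of the shifted parameters, translated back by [c]; standard
    contours only provide existence and uniqueness. *)
Lemma K_shift (cls : contour_class) (c w : C) :
  K G tau cls m n (map (Cplus c) a) (map (Cplus c) b) alpha w
  = (Cexp (RtoC PI * alpha * c ^ 2 / RtoC tau) * Cexp (- c * w)
     * K G tau cls m n a b alpha (w - RtoC (2 * PI) * alpha * c / RtoC tau))%C.
Proof.
  set (a' := map (Cplus c) a). set (b' := map (Cplus c) b).
  assert (Hm' : (m <= length b')%nat) by (unfold b'; rewrite length_map; auto).
  assert (Hn' : (n <= length a')%nat) by (unfold a'; rewrite length_map; auto).
  assert (HN' : (order_N m n (length a') (length b') < 0)%Z) by (unfold a', b'; rewrite !length_map; auto).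
  destruct (Rbar_between _ _ Hlam) as [sigma [L1 L2]].
  destruct (admissible_exists tau m n a b sigma Htau L1 L2) as [T1 HT1].
  assert (Hadm := HT1 T1 (Rle_refl _)); clear HT1.
  destruct (admissible_exists tau m n a' b' (sigma + Re c) Htau) as [T2 HT2].
  { apply lambda_sharp_lt; intros y Hy; unfold b' in Hy; rewrite skipn_map in Hy.
    apply in_map_iff in Hy; destruct Hy as [x [<- Hx]].
    assert (H := proj1 (lambda_sharp_lt tau m b sigma) L1 x Hx); autorewrite with ReIm; lra. }
  { apply lambda_flat_gt; intros y Hy; unfold a' in Hy; rewrite skipn_map in Hy.
    apply in_map_iff in Hy; destruct Hy as [x [<- Hx]].
    assert (H := proj1 (lambda_flat_gt n a sigma) L2 x Hx); autorewrite with ReIm; lra. }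
  assert (Hadm' := HT2 T2 (Rle_refl _)); clear HT2. set (w' := (w - RtoC (2 * PI) * alpha * c / RtoC tau)%C).
  apply (proj2 (proj2 (K_spec tau c1 c2 G Htau HG m n a' b' alpha Hm' Hn' HN' cls (sigma + Re c) T2 Hadm' w))).
  intros eps g He Hg.
  assert (Hgc : is_contour (theta_minus cls eps) (theta_plus cls eps) (Lambda_plus tau n a) (Lambda_minus tau m b)
    (fun t => g t - c)%C).
  { destruct (sin_theta cls eps) as [S1 S2]. destruct (eps_trig _ He) as [S3 _].
    apply (is_contour_translate g c _ _ (Lambda_plus tau n a') (Lambda_minus tau m b')); try lra; [ | | auto ].
    - intros s [aj [l [k [Hin ->]]]]; exists (c + aj)%C, l, k; split; [ | ring ].
      unfold a'; rewrite skipn_map; apply in_map, Hin.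
    - intros s [bj [l [k [Hin [H1 [H2 ->]]]]]]; exists (c + bj)%C, l, k; repeat split; try assumption; [ | ring ].
      unfold b'; rewrite skipn_map; apply in_map, Hin. }
  assert (H := proj1 (K_spec tau c1 c2 G Htau HG m n a b alpha Hm Hn HN cls sigma T1 Hadm w') eps _ He Hgc).
  apply (proj1 (gen_int_iff _ _)) in H; apply (proj2 (gen_int_iff _ _)).
  apply (gen_int_scal (Cexp (RtoC PI * alpha * c ^ 2 / RtoC tau) * Cexp (- c * w))) in H.
  revert H; apply gen_int_ext; intros t; cbv beta; rewrite velocity_translate.
  set (s := (g t - c)%C). replace (g t) with (s + c)%C by (unfold s; ring).
  unfold a', b'; rewrite kernel_shift. replace (- (s + c) * w)%C with (- c * w + - s * w)%C by ring.
  unfold w'. replace (- s * (w - RtoC (2 * PI) * alpha * c / RtoC tau))%C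
    with (- s * w + s * (RtoC (2 * PI) * alpha * c / RtoC tau))%C by ring.
  rewrite !Cexp_plus; unfold Cdiv; ring.
Qed.

End Shift.

(** * Fractional integrals *)

Lemma ends_int_ext (g h : R -> C) (L : R) (v : C) : 0 < L ->
  (forall t, 0 < t < L -> g t = h t) -> ends_int g L v -> ends_int h L v.
Proof.
  intros HL E H eps He; destruct (H eps He) as [d [Hd K]].
  exists (Rmin d (L / 2)); split; [ pos | intros a b Ha Hb ].
  assert (M1 := Rmin_l d (L / 2)). assert (M2 := Rmin_r d (L / 2)).
  destruct (K a b) as [w [W1 W2]]; [ lra | lra | exists w; split; [ | auto ] ].
  revert W1; apply is_CI_ext; [ lra | intros t Ht; apply E; lra ].
Qed.

Lemma ends_int_scal (c : C) (h : R -> C) (L : R) (v : C) :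
  ends_int h L v -> ends_int (fun t => c * h t)%C L (c * v).
Proof.
  intros H eps He; destruct (scal_eps c eps He) as [e [He' Ke]]; destruct (H e He') as [d [Hd K]].
  exists d; split; [ auto | intros a b Ha Hb; destruct (K a b Ha Hb) as [w [W1 W2]] ].
  exists (c * w)%C; split; [ apply is_CI_scal, W1 | auto ].
Qed.

Lemma ends_int_dilate (k L : R) (g : R -> C) (v : C) : 0 < k ->
  ends_int g (k * L) v -> ends_int (fun t => RtoC k * g (k * t)%R)%C L v.
Proof.
  intros Hk H eps He; destruct (H eps He) as [d [Hd K]]. exists (d / k); split; [ pos | intros a b Ha Hb ].
  assert (E : d / k * k = d) by (field; lra).
  destruct (K (k * a) (k * b)) as [w [W1 W2]]; [ split; nra | split; nra | ]. exists w; split; [ | auto ].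
  replace (k * a) with (k * a + 0) in W1 by ring. replace (k * b) with (k * b + 0) in W1 by ring.
  generalize (is_RInt_comp_lin (V := C_R_NormedModule) g k 0 a b w W1).
  apply is_CI_ext_all; intros t; rewrite Rplus_0_r.
  apply C_ext; simpl; unfold scal; simpl; unfold mult; simpl; ring.
Qed.

(** Substitution [r = |z| t] along the ray. The factor [Cexp w] splits into the modulus, which
    belongs to [dr], and the phase, the last factor of the Riemann-Liouville integrand. *)
Lemma Erdelyi_Kober_Riemann_Liouville (de : C) (f : C -> C) (w v : C) : 0 < Re de ->
  is_Erdelyi_Kober 0 de f w v <-> is_Riemann_Liouville de f w (Cexp (de * w) * v).
Proof.
  set (k := exp (Re w)). assert (Hk : 0 < k) by pos.
  set (h := fun t => (Rcpow (1 - t) (de - RtoC 1) * Rcpow t (RtoC 0) * f (w + RtoC (ln t))%C)%C).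
  set (g := fun r => (Cexp ((de - RtoC 1) * (ln (k - r), Im w)) * f (ln r, Im w) * Cexp (Ci * RtoC (Im w)))%C).
  assert (Hgh : forall t, 0 < t < 1 -> (RtoC k * g (k * t)%R)%C = (Cexp (de * w) * h t)%C).
  { intros t Ht; unfold g, h; rewrite Rcpow_0. replace (k - k * t) with (k * (1 - t)) by ring.
    rewrite !ln_mult by lra; unfold k at 2 3; rewrite ln_exp.
    replace (Re w + ln t, Im w)%R with (w + RtoC (ln t))%C by (C_eq; ring).
    replace (Re w + ln (1 - t), Im w)%R with (w + RtoC (ln (1 - t)))%C by (C_eq; ring).
    replace ((de - 1) * (w + RtoC (ln (1 - t))))%C with ((de - 1) * RtoC (ln (1 - t)) + de * w - w)%C by ring.
    rewrite Cexp_minus, Cexp_plus; unfold Rcpow. replace (RtoC k) with (Cexp w / Cexp (Ci * RtoC (Im w)))%C.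
    - field; split; apply Cexp_neq_0.
    - rewrite <- Cexp_minus; unfold k; rewrite <- Cexp_R; f_equal; C_eq; ring. }
  assert (Ew := Cexp_neq_0 (de * w)). unfold is_Erdelyi_Kober, is_Riemann_Liouville; cbv zeta; split.
  - intros [I [HI ->]]; exists (Cexp (de * w) * I)%C; split; [ | unfold Cdiv; ring ].
    apply ends_int_iff in HI; apply ends_int_iff. apply (ends_int_scal (Cexp (de * w))) in HI.
    assert (HI' : ends_int (fun t => RtoC k * g (k * t)%R)%C (/ k * k) (Cexp (de * w) * I)).
    { rewrite Rinv_l by lra; revert HI; apply ends_int_ext; [ lra | intros t Ht; symmetry; apply Hgh, Ht ]. }
    apply ends_int_dilate in HI'; [ | pos ]. revert HI'; apply ends_int_ext; [ auto | intros r Hr ].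
    replace (k * (/ k * r)) with r by (field; lra).
    rewrite Cmult_assoc, <- RtoC_mult, Rinv_l, Cmult_1_l by lra; reflexivity.
  - intros [I [HI E]]; exists (/ Cexp (de * w) * I)%C; split.
    + apply ends_int_iff in HI; apply ends_int_iff.
      assert (HI' : ends_int g (k * 1) I) by (rewrite Rmult_1_r; exact HI).
      apply ends_int_dilate in HI'; [ | auto ]. apply (ends_int_scal (/ Cexp (de * w))) in HI'.
      revert HI'; apply ends_int_ext; [ lra | intros t Ht ]; rewrite Hgh by auto; fold (h t). field; auto.
    + replace v with (/ Cexp (de * w) * (Cexp (de * w) * v))%C by (field; auto). rewrite E; unfold Cdiv; ring.
Qed.

Lemma is_beta_integral_ext (be ga : C) (g h : R -> C) (v : C) : (forall t, g t = h t) ->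
  is_beta_integral be ga g v -> is_beta_integral be ga h v.
Proof.
  intros E H; apply ends_int_iff; apply ends_int_iff in H; revert H.
  apply ends_int_ext; [ lra | intros t _; rewrite E; reflexivity ].
Qed.

Lemma is_Erdelyi_Kober_beta (ga de : C) (f : C -> C) (w v : C) : 0 < Re de ->
  is_beta_integral (ga + 1) de (fun t => f (w + RtoC (ln t))%C) (CGamma de * v) ->
  is_Erdelyi_Kober ga de f w v.
Proof.
  intros Hde H; exists (CGamma de * v)%C; split.
  - apply ends_int_iff; apply ends_int_iff in H; revert H; apply ends_int_ext; [ lra | intros t _ ].
    replace (ga + 1 - RtoC 1)%C with ga by ring; ring.
  - field; apply CGamma_neq_0, not_pole_Re, Hde.
Qed.

(** * Orders of kernels *)

Lemma locally'_near (z : C) (P : C -> Prop) : near z (fun y => y <> z -> P y) -> locally' z P.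
Proof. intros H; unfold locally', within; apply locally_Cmod; exact H. Qed.

Lemma has_kernel_order_eq (G : C -> C) (tau : R) (psi : C -> C) (m n p q : nat) (alpha C0 loglam : C) (a b : list C) :
  (m <= q)%nat -> (n <= p)%nat -> length a = p -> length b = q -> C0 <> 0%C ->
  (forall s, psi s = C0 * Cexp (- s * loglam) * kernel G tau m n a b alpha s)%C ->
  has_kernel_order G tau psi m n p q alpha.
Proof.
  intros Hm Hn Ha Hb H0 H; split; [ auto | split; [ auto | ] ].
  exists a, b, C0, loglam; split; [ auto | split; [ auto | split; [ auto | ] ] ].
  intros s0; apply locally'_near, filter_forall; intros y _; apply H.
Qed.

(** The reflected kernel is shifted by 1; the Gaussian factor turns this shift into the factor
    [C lambda^(-s)] with [log lambda = 2 PI alpha / tau]. *)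
Lemma kernel_order_reflection (G : C -> C) (tau : R) (m n p q : nat) (a b : list C) (alpha : C) :
  0 < tau -> (m <= q)%nat -> (n <= p)%nat -> length a = p -> length b = q ->
  has_kernel_order G tau (fun s => kernel G tau m n a b alpha (RtoC 1 - s)%C) n m q p alpha.
Proof.
  intros Ht Hm Hn Ha Hb. set (mu := (RtoC (2 * PI) * alpha * 1 / RtoC tau)%C).
  apply (has_kernel_order_eq G tau _ n m q p alpha (Cexp (- (RtoC PI * alpha * 1 ^ 2 / RtoC tau)) * Cexp mu) mu
    (map (Cplus 1) (reflected tau b)) (map (Cplus 1) (reflected tau a))); try assumption.
  - unfold reflected; rewrite !length_map; auto.
  - unfold reflected; rewrite !length_map; auto.
  - apply Cmult_neq_0; apply Cexp_neq_0.
  - intros s. assert (H := kernel_shift tau G Ht n m (reflected tau b) (reflected tau a) alpha 1 (s - 1)).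
    replace (s - 1 + 1)%C with s in H by ring; rewrite H, kernel_reflected; fold mu.
    replace (- (s - 1))%C with (1 - s)%C by ring. replace ((s - 1) * mu)%C with (s * mu - mu)%C by ring.
    replace (- s * mu)%C with (- (s * mu))%C by ring.
    rewrite Cexp_minus, !Cexp_opp; field; repeat split; apply Cexp_neq_0.
Qed.

Lemma kernel_order_product (G : C -> C) (tau : R) (m n p q m2 n2 p2 q2 : nat) (a b a2 b2 : list C) (alpha alpha2 : C) :
  (m <= q)%nat -> (n <= p)%nat -> length a = p -> length b = q ->
  (m2 <= q2)%nat -> (n2 <= p2)%nat -> length a2 = p2 -> length b2 = q2 ->
  has_kernel_order G tau (fun s => kernel G tau m n a b alpha s * kernel G tau m2 n2 a2 b2 alpha2 s)%C
    (m + m2) (n + n2) (p + p2) (q + q2) (alpha + alpha2).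
Proof.
  intros Hm Hn Ha Hb Hm2 Hn2 Ha2 Hb2.
  (* The lists cannot just be concatenated: the numerator-type entries of both kernels have to come
     first. *)
  set (mix := fun (k k2 : nat) (l l2 : list C) => (firstn k l ++ firstn k2 l2) ++ (skipn k l ++ skipn k2 l2)).
  assert (Lmix : forall k k2 l l2, (k <= length l)%nat -> (k2 <= length l2)%nat ->
    length (mix k k2 l l2) = (length l + length l2)%nat /\
    firstn (k + k2) (mix k k2 l l2) = firstn k l ++ firstn k2 l2 /\
    skipn (k + k2) (mix k k2 l l2) = skipn k l ++ skipn k2 l2).
  { intros k k2 l l2 Hk Hk2.
    assert (Len : length (firstn k l ++ firstn k2 l2) = (k + k2)%nat) by (rewrite length_app, !firstn_length_le; lia).
    unfold mix; split; [ rewrite length_app, Len, length_app, !length_skipn; lia | split ].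
    - rewrite <- Len at 1; rewrite firstn_app, firstn_all, Nat.sub_diag; apply app_nil_r.
    - rewrite <- Len at 1; rewrite skipn_app, skipn_all, Nat.sub_diag; reflexivity. }
  destruct (Lmix n n2 a a2 ltac:(lia) ltac:(lia)) as [A1 [A2 A3]].
  destruct (Lmix m m2 b b2 ltac:(lia) ltac:(lia)) as [B1 [B2 B3]].
  apply (has_kernel_order_eq G tau _ _ _ _ _ _ 1 0 (mix n n2 a a2) (mix m m2 b b2)); try lia.
  - apply RtoC_neq_0; lra.
  - intros s; unfold kernel; rewrite A2, A3, B2, B3, !map_app, !Cprod_app.
    replace (RtoC PI * (alpha + alpha2) * s ^ 2 / RtoC tau)%C
      with (RtoC PI * alpha * s ^ 2 / RtoC tau + RtoC PI * alpha2 * s ^ 2 / RtoC tau)%C by (unfold Cdiv; ring).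
    replace (- s * RtoC 0)%C with (RtoC 0) by ring.
    rewrite Cexp_0, Cexp_plus; unfold Cdiv; rewrite !Cinv_mult; ring.
Qed.

Section GammaFactor.

Variables (tau c1 c2 : R) (G : C -> C).
Hypothesis Htau : 0 < tau.
Hypothesis HG : forall z, filterlim (barnes_partial tau c1 c2 z) eventually (locally (G z)).
Hypothesis HG2 : forall z, not_Gamma_pole z ->
  (G (z + RtoC tau) = RtoC (Rpower (2 * PI) ((tau - 1) / 2)) * Rcpow tau (RtoC (1 / 2) - z) * CGamma z * G z)%C.

(** Near [s0] the zeros of [G] are those of finitely many linear factors, hence isolated. *)
Lemma G_neq_0_punctured (s0 : C) : near s0 (fun s => s <> s0 -> G s <> 0%C).
Proof.
  destruct (barnes_factorization tau c1 c2 G Htau HG (Cmod s0 + 1)) as [ks [E HE]].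
  assert (Hks : near s0 (fun s => s <> s0 -> Cprod (map (fun kl => s + RtoC (lat tau kl))%C ks) <> 0%C)).
  { clear HE; induction ks as [|kl ks IH].
    - apply filter_forall; intros s _; cbn [map]; rewrite Cprod_nil; apply RtoC_neq_0; lra.
    - assert (H1 : near s0 (fun s => s <> s0 -> (s + RtoC (lat tau kl))%C <> 0%C)).
      { destruct (classic (s0 + RtoC (lat tau kl) = 0)%C) as [Z|Z].
        - apply filter_forall; intros s Hs Z'; apply Hs.
          replace s with (s + RtoC (lat tau kl) - RtoC (lat tau kl))%C by ring; rewrite Z', <- Z; ring.
        - assert (H := ccont_neq_0 (fun s => s + RtoC (lat tau kl))%C s0
            (an_ccont _ _ (an_plus _ _ _ (an_id _) (an_const _ _))) Z).
          revert H; apply filter_imp; auto. }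
      generalize (filter_and _ _ H1 IH); apply filter_imp; intros s [N1 N2] Hs; cbn [map]; rewrite Cprod_cons.
      apply Cmult_neq_0; auto. }
  assert (Hball : near s0 (fun s => Cmod s < Cmod s0 + 1)). { exists 1; split; [ lra | intros y Hy ].
    generalize (Cmod_dist_triangle y s0 0); replace (y - 0)%C with y by ring; replace (s0 - 0)%C with s0 by ring; lra. }
  generalize (filter_and _ _ Hks Hball); apply filter_imp; intros s [N1 N2] Hs.
  destruct (HE s N2) as [_ [E1 ->]]; apply Cmult_neq_0; auto.
Qed.

(* Since the poles of [CGamma] are zeros of [G], the functional equation
   expresses [CGamma s] as [G (s + tau) / G s] up to an exponential factor. *)
Lemma kernel_order_Gamma (psi : C -> C) (m n p q : nat) (alpha : C) :
  has_kernel_order G tau psi m n p q alpha ->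
  has_kernel_order G tau (fun s => CGamma s * psi s)%C m (n + 1) (p + 1) (q + 1) alpha.
Proof.
  intros [Hm [Hn [a [b [C0 [loglam [Ha [Hb [H0 H]]]]]]]]]. split; [ lia | split; [ lia | ] ].
  destruct (G_shift_tau tau G HG2 0) as [K0 [HK0 HF]].
  (* The new parameters 1 and [1 + tau] put [G (s + tau)] in the numerator and [G s] in the
     denominator; the factor [tau^(-s)] of the functional equation goes into [loglam], and its
     constant into [C0 / K0]. *)
  exists (RtoC 1 :: a), (b ++ [RtoC (1 + tau)]), (C0 / K0)%C, (loglam - RtoC (ln tau))%C.
  split; [ simpl; lia | split; [ rewrite length_app; simpl; lia | split ] ].
  { apply Cmult_neq_0; [ auto | intros E; apply (RtoC_neq_0 1); [ lra | ] ].
    rewrite <- (Cinv_r K0) by auto; rewrite E; ring. }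
  intros s0; apply locally'_near.
  assert (H1 : near s0 (fun s => s <> s0 -> psi s = (C0 * Cexp (- s * loglam) * kernel G tau m n a b alpha s)%C)).
  { apply locally_Cmod; exact (H s0). }
  generalize (filter_and _ _ H1 (G_neq_0_punctured s0)); apply filter_imp; intros s [E1 E2] Hs.
  specialize (E1 Hs); specialize (E2 Hs). assert (Np : not_Gamma_pole s). { intros k Ek; apply E2; rewrite Ek.
    assert (Z := barnes_G_zero tau c1 c2 G Htau HG (0%nat, k)); rewrite <- Z; f_equal.
    unfold lat; cbn [fst snd]; rewrite INR_0, RtoC_opp, RtoC_plus, RtoC_mult; ring. }
  assert (EF := HF s Np).
  assert (EG : CGamma s = (G (s + RtoC tau) * / G s * / K0 * Cexp (s * RtoC (ln tau)))%C).
  { rewrite EF; unfold Rcpow; replace (- s * RtoC (ln tau))%C with (- (s * RtoC (ln tau)))%C by ring.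
    rewrite Cexp_opp; field; repeat split; try assumption; apply Cexp_neq_0. }
  rewrite E1, EG; unfold kernel.
  replace (n + 1)%nat with (S n) by lia; cbn [firstn skipn map]; rewrite Cprod_cons.
  rewrite firstn_app_le, skipn_app_le by lia; rewrite map_app, Cprod_app; cbn [map]; rewrite Cprod_cons, Cprod_nil.
  replace (RtoC (1 + tau) - RtoC 1 + s)%C with (s + RtoC tau)%C by (rewrite RtoC_plus; ring).
  replace (RtoC (1 + tau) - RtoC (1 + tau) + s)%C with s by ring.
  replace (- s * (loglam - RtoC (ln tau)))%C with (- s * loglam + s * RtoC (ln tau))%C by ring.
  rewrite Cexp_plus, Cmult_1_r; unfold Cdiv; rewrite !Cinv_mult; ring.
Qed.

End GammaFactor.

Open Scope C_scope.

Theorem theorem10p3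
  (tau : R) (G : C -> C) (m n p q : nat) (a b : list C) (alpha : C) (sigma0 : R)
  (Htau : (0 < tau)%R) (HG : is_barnes_G tau G)
  (Hp : length a = p) (Hq : length b = q)
  (Hm : (m <= q)%nat) (Hn : (n <= p)%nat)
  (HN : (order_N m n p q < 0)%Z)
  (Hlam : Rbar_lt (lambda_sharp tau m b) (lambda_flat n a))
  (Hsig1 : Rbar_lt (lambda_sharp tau m b) (Finite sigma0))
  (Hsig2 : Rbar_lt (Finite sigma0) (lambda_flat n a)) :
  let refl := map (fun x : C => RtoC (1 + tau) - x) in
  (* (i) *)
  ((forall be ga : C, (sigma0 < Re be)%R -> (0 < Re ga)%R ->
      let a' := a ++ [be; be + ga + RtoC tau] in
      let b' := [be + RtoC tau; be + ga] ++ b in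
      Rbar_lt (lambda_sharp tau (m + 2) b') (lambda_flat n a') ->
      forall w : C,
        is_beta_integral be ga
          (fun t => K G tau K_left m n a b alpha (w + RtoC (ln t)))
          (CGamma ga * Rcpow tau (- ga)
             * K G tau K_left (m + 2) n a' b' alpha w))
   /\
   (forall w : C,
      K G tau K_right m n a b alpha w
      = K G tau K_left n m (refl b) (refl a) alpha (- w))
   /\
   (lambda_sharp tau n (refl a) = Rbar_opp (lambda_flat n a)
    /\ lambda_flat m (refl b) = Rbar_opp (lambda_sharp tau m b))
   /\
   (forall (be ga : C) (sigma0' : R),
      Rbar_lt (Rbar_opp (lambda_flat n a)) (Finite sigma0') ->
      Rbar_lt (Finite sigma0') (Rbar_opp (lambda_sharp tau m b)) ->
      (sigma0' < Re be)%R -> (0 < Re ga)%R ->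
      let a' := refl b ++ [be; be + ga + RtoC tau] in
      let b' := [be + RtoC tau; be + ga] ++ refl a in
      Rbar_lt (lambda_sharp tau (n + 2) b') (lambda_flat m a') ->
      forall w : C,
        is_beta_integral be ga
          (fun t => K G tau K_right m n a b alpha (w - RtoC (ln t)))
          (CGamma ga * Rcpow tau (- ga)
             * K G tau K_left (n + 2) m a' b' alpha (- w))))
  /\
  (* (ii) *)
  ((forall ga de : C, (sigma0 < Re (ga + RtoC 1))%R -> (0 < Re de)%R ->
      let a' := a ++ [ga + RtoC 1; ga + de + RtoC (1 + tau)] in
      let b' := [ga + RtoC (1 + tau); ga + de + RtoC 1] ++ b in
      Rbar_lt (lambda_sharp tau (m + 2) b') (lambda_flat n a') ->
      forall w : C,
        is_Erdelyi_Kober ga de (K G tau K_left m n a b alpha) w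
          (Rcpow tau (- de) * K G tau K_left (m + 2) n a' b' alpha w))
   /\
   (forall (de : C) (f : C -> C) (w v : C), (0 < Re de)%R ->
      is_Erdelyi_Kober (RtoC 0) de f w v <->
      is_Riemann_Liouville de f w (Cexp (de * w) * v))
   /\
   (forall (cls : contour_class) (c w : C),
      K G tau cls m n (map (Cplus c) a) (map (Cplus c) b) alpha w
      = Cexp (RtoC PI * alpha * c ^ 2 / RtoC tau) * Cexp (- c * w)
        * K G tau cls m n a b alpha (w - RtoC (2 * PI) * alpha * c / RtoC tau))
   /\
   (forall de : C, (sigma0 < 1)%R -> (0 < Re de)%R ->
      let a' := a ++ [RtoC 1; de + RtoC (1 + tau)] in
      let b' := [RtoC (1 + tau); de + RtoC 1] ++ b in
      Rbar_lt (lambda_sharp tau (m + 2) b') (lambda_flat n a') ->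
      forall w : C,
        is_Riemann_Liouville de (K G tau K_left m n a b alpha) w
          (Rcpow tau (- de) * Cexp (RtoC PI * alpha * de ^ 2 / RtoC tau)
           * K G tau K_left (m + 2) n
               (map (Cplus (- de)) a') (map (Cplus (- de)) b') alpha
               (w - RtoC (2 * PI) * alpha * de / RtoC tau))))
  /\
  (* (iii) *)
  (forall cls : contour_class,
     (forall k : nat, (1 <= k)%nat ->
        let a' := [RtoC (1 + tau); RtoC (1 - INR k)] ++ a in
        let b' := b ++ [RtoC (1 + tau - INR k); RtoC 1] in
        Rbar_lt (lambda_sharp tau m b') (lambda_flat (n + 2) a') ->
        is_ddz_n k (K G tau cls m n a b alpha)
          (fun w => RtoC ((- tau) ^ k) / Cexp w ^ k
                      * K G tau cls m (n + 2) a' b' alpha w))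
     /\
     (let a' := [RtoC 0; RtoC (1 + tau)] ++ a in
      let b' := b ++ [RtoC tau; RtoC 1] in
      Rbar_lt (lambda_sharp tau m b') (lambda_flat (n + 2) a') ->
      forall w : C,
        is_ddz (K G tau cls m n a b alpha) w
          (- (RtoC tau / Cexp w * K G tau cls m (n + 2) a' b' alpha w))))
  /\
  (* (iv) *)
  (let phi := kernel G tau m n a b alpha in
   has_kernel_order G tau (fun s => phi (RtoC 1 - s)) n m q p alpha
   /\
   (forall (ms ns ps qs : nat) (alphas : C),
      has_kernel_order G tau (fun s => phi (RtoC 1 - s)) ms ns ps qs alphas ->
      has_kernel_order G tau (fun s => CGamma s * phi (RtoC 1 - s))
        ms (ns + 1) (ps + 1) (qs + 1) alphas)
   /\
   (forall (m2 n2 p2 q2 : nat) (a2 b2 : list C) (alpha2 : C),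
      length a2 = p2 -> length b2 = q2 -> (m2 <= q2)%nat -> (n2 <= p2)%nat ->
      has_kernel_order G tau
        (fun s => phi s * kernel G tau m2 n2 a2 b2 alpha2 s)
        (m + m2) (n + n2) (p + p2) (q + q2) (alpha + alpha2))).
Proof.
  destruct HG as [c1 [c2 [HG0 [_ HG2]]]].
  subst p q; intros refl.
  split; [ split; [ | split; [ | split; [ split | ] ] ]
         | split; [ split; [ | split; [ | split ] ] | split; [ | split; [ | split ] ] ] ].
  - intros be ga Hbe Hga a' b' _ w.
    exact (K_left_beta tau c1 c2 G Htau HG0 HG2 m n a b alpha sigma0 Hm Hn HN Hsig1 Hsig2 be ga w Hbe Hga).
  - exact (K_inversion tau c1 c2 G Htau HG0 m n a b alpha Hm Hn HN Hlam).
  - exact (lambda_sharp_reflected tau n a).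
  - exact (lambda_flat_reflected tau m b).
  - intros be ga sigma0' L1 L2 Hbe Hga a' b' _ w.
    assert (Hm' : (n <= length (refl a))%nat) by (unfold refl; rewrite length_map; assumption).
    assert (Hn' : (m <= length (refl b))%nat) by (unfold refl; rewrite length_map; assumption).
    assert (HN' : (order_N n m (length (refl b)) (length (refl a)) < 0)%Z)
      by (unfold refl; rewrite !length_map, order_N_sym; assumption).
    rewrite <- (lambda_sharp_reflected tau n a) in L1. rewrite <- (lambda_flat_reflected tau m b) in L2.
    generalize (K_left_beta tau c1 c2 G Htau HG0 HG2 n m (refl b) (refl a) alpha sigma0' Hm' Hn' HN' L1 L2
      be ga (- w) Hbe Hga).
    apply is_beta_integral_ext; intros t.
    rewrite (K_inversion tau c1 c2 G Htau HG0 m n a b alpha Hm Hn HN Hlam).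
    replace (- (w - RtoC (ln t))) with (- w + RtoC (ln t)) by ring; reflexivity.
  - intros ga de Hga Hde a' b' _ w; apply is_Erdelyi_Kober_beta; [ assumption | ].
    assert (H := K_left_beta tau c1 c2 G Htau HG0 HG2 m n a b alpha sigma0 Hm Hn HN Hsig1 Hsig2
      (ga + RtoC 1) de w Hga Hde).
    rewrite Cmult_assoc; unfold a', b'.
    replace (ga + de + RtoC (1 + tau)) with (ga + RtoC 1 + de + RtoC tau) by (rewrite RtoC_plus; ring).
    replace (ga + RtoC (1 + tau)) with (ga + RtoC 1 + RtoC tau) by (rewrite RtoC_plus; ring).
    replace (ga + de + RtoC 1) with (ga + RtoC 1 + de) by ring.
    exact H.
  - intros de f w v Hde; exact (Erdelyi_Kober_Riemann_Liouville de f w v Hde).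
  - intros cls c w; exact (K_shift tau c1 c2 G Htau HG0 m n a b alpha Hm Hn HN Hlam cls c w).
  - intros de Hs Hde a' b' Hlam' w.
    assert (Hm' : (m + 2 <= length b')%nat) by (unfold b'; rewrite length_app; simpl; lia).
    assert (Hn' : (n <= length a')%nat) by (unfold a'; rewrite length_app; lia).
    assert (HN' : (order_N (m + 2) n (length a') (length b') < 0)%Z).
    { unfold a', b'; rewrite !length_app; simpl length; revert HN; unfold order_N; lia. }
    rewrite (K_shift tau c1 c2 G Htau HG0 (m + 2) n a' b' alpha Hm' Hn' HN' Hlam').
    (* Shifting the parameters by [- de] moves the argument back by [mu] and leaves
       [Cexp (de * (w - mu))]. As [de * mu = 2 PI alpha de^2 / tau], the two Gaussian constants
       cancel [Cexp (- de * mu)], and [z^de] remains. *)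
    set (mu := RtoC (2 * PI) * alpha * de / RtoC tau).
    replace (RtoC (2 * PI) * alpha * - de / RtoC tau) with (- mu) by (unfold mu, Cdiv; ring).
    replace (w - mu - - mu) with w by ring.
    assert (E : Cexp (RtoC PI * alpha * de ^ 2 / RtoC tau)
      * (Cexp (RtoC PI * alpha * (- de) ^ 2 / RtoC tau) * Cexp (- - de * (w - mu))) = Cexp (de * w)).
    { rewrite <- !Cexp_plus; f_equal; unfold mu; rewrite RtoC_mult; field; apply RtoC_neq_0; lra. }
    replace (Rcpow tau (- de) * Cexp (RtoC PI * alpha * de ^ 2 / RtoC tau)
      * (Cexp (RtoC PI * alpha * (- de) ^ 2 / RtoC tau) * Cexp (- - de * (w - mu)) * K G tau K_left (m + 2) n a' b' alpha w))
      with (Cexp (de * w) * (Rcpow tau (- de) * K G tau K_left (m + 2) n a' b' alpha w)) by (rewrite <- E; ring).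
    apply (proj1 (Erdelyi_Kober_Riemann_Liouville de (K G tau K_left m n a b alpha) w
      (Rcpow tau (- de) * K G tau K_left (m + 2) n a' b' alpha w) Hde)).
    apply is_Erdelyi_Kober_beta; [ assumption | rewrite Cmult_assoc ].
    replace (RtoC 0 + RtoC 1) with (RtoC 1) by ring.
    assert (H := K_left_beta tau c1 c2 G Htau HG0 HG2 m n a b alpha sigma0 Hm Hn HN Hsig1 Hsig2 (RtoC 1) de w Hs Hde).
    unfold a', b'.
    replace (de + RtoC (1 + tau)) with (RtoC 1 + de + RtoC tau) by (rewrite RtoC_plus; ring).
    replace (RtoC (1 + tau)) with (RtoC 1 + RtoC tau) by (rewrite RtoC_plus; ring).
    replace (de + RtoC 1) with (RtoC 1 + de) by ring.
    exact H.
  - intros cls; split.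
    + intros k _ a' b' Hlam'.
      apply (K_derivatives tau c1 c2 G Htau HG0 HG2 m n a b alpha Hm Hn HN cls k); try assumption; intros s;
        f_equal; f_equal; rewrite ?RtoC_minus, ?RtoC_plus; ring.
    + intros a' b' Hlam' w.
      destruct (K_derivatives tau c1 c2 G Htau HG0 HG2 m n a b alpha Hm Hn HN cls 1 (RtoC 0) (RtoC (1 + tau))
        (RtoC tau) (RtoC 1)) as [h [H1 H2]]; try assumption.
      * intros s; rewrite Cmult_comm; f_equal; f_equal; rewrite ?RtoC_minus, ?RtoC_plus; simpl INR; ring.
      * intros s; f_equal; f_equal; rewrite ?RtoC_minus, ?RtoC_plus; simpl INR; ring.
      * replace (- (RtoC tau / Cexp w * K G tau cls m (n + 2) a' b' alpha w))
          with (RtoC ((- tau) ^ 1) / Cexp w ^ 1 * K G tau cls m (n + 2) a' b' alpha w)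
          by (rewrite pow_1, RtoC_opp; field; apply Cexp_neq_0).
        apply (is_ddz_ext h); [ intros y; symmetry; apply H1 | apply H2 ].
  - apply kernel_order_reflection; auto.
  - intros ms ns ps qs alphas; apply (kernel_order_Gamma tau c1 c2 G Htau HG0 HG2).
  - intros m2 n2 p2 q2 a2 b2 alpha2 H1 H2 H3 H4; apply kernel_order_product; auto.
Qed.
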